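(* Let $\Omega$, $F$, $\lambda_1^\pm(F,\Omega)$ be as in the context, let $p>n$, and let $f\in C(\Omega)\cap L^p(\Omega)$ with $f\not\equiv0$. For $\lambda\in\mathbb{R}$ consider the Dirichlet problem $$F(D^2u,Du,u,x)=\lambda u+f\ \text{ in }\Omega,\qquad u=0\ \text{ on }\partial\Omega. \qquad (\ast)$$ (i) If $f\ge0$, then there exists a constant $\eta=\eta(f)>0$ such that if $\lambda_1^+(F,\Omega)\le\lambda_1^-(F,\Omega)<\lambda\le\lambda_1^-(F,\Omega)+\eta$, then every viscosity solution $u\in C(\bar\Omega)$ of $(\ast)$ satisfies $u<0$ in $\Omega$. (ii) If $f\le0$, then there exists a constant $\eta=\eta(f)>0$ such that if $\lambda_1^-(F,\Omega)\le\lambda_1^+(F,\Omega)<\lambda\le\lambda_1^+(F,\Omega)+\eta$, then every viscosity solution $u\in C(\bar\Omega)$ of $(\ast)$ satisfies $u>0$ in $\Omega$.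
   Context: $\Omega\subseteq\mathbb{R}^n$ is a bounded, smooth, connected open set; $\mathbb{S}^n$ denotes the real symmetric $n\times n$ matrices. For $0<\gamma\le\Gamma$ and $M\in\mathbb{S}^n$ the Pucci operators are $\mathcal{P}^+_{\gamma,\Gamma}(M)=\sup_A[-\mathrm{tr}(AM)]$ and $\mathcal{P}^-_{\gamma,\Gamma}(M)=\inf_A[-\mathrm{tr}(AM)]$, with $A$ ranging over symmetric matrices whose eigenvalues lie in $[\gamma,\Gamma]$. The nonlinearity $F:\mathbb{S}^n\times\mathbb{R}^n\times\mathbb{R}\times\Omega\to\mathbb{R}$ satisfies: (F1) for each $K>0$ there are an increasing continuous $\omega_K:[0,\infty)\to[0,\infty)$ with $\omega_K(0)=0$ and $\nu\in(1/2,1]$ such that $|F(M,p,z,x)-F(M,p,z,y)|\le\omega_K(|x-y|^\nu(|M|+1))$ whenever $|p|,|z|\le K$; (F2) there are constants $\delta_1,\delta_0\ge0$, $0<\gamma\le\Gamma$ with $\mathcal{P}^-_{\gamma,\Gamma}(M-N)-\delta_1|p-q|-\delta_0|z-w|\le F(M,p,z,x)-F(N,q,w,x)\le\mathcal{P}^+_{\gamma,\Gamma}(M-N)+\delta_1|p-q|+\delta_0|z-w|$ for all arguments; (F3) $F(tM,tp,tz,x)=tF(M,p,z,x)$ for all $t\ge0$. All differential (in)equalities are meant in the viscosity sense: for $f\in C(\Omega)$, $u\in C(\Omega)$ is a subsolution (supersolution) of $F(D^2u,Du,u,x)=f$ if whenever $\varphi\in C^2(\Omega)$ and $u-\varphi$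 has a local maximum (minimum) at $x_0$, then $F(D^2\varphi(x_0),D\varphi(x_0),u(x_0),x_0)\le f(x_0)$ (resp. $\ge$); a solution is both. Define $\lambda_1^+(F,\Omega)=\sup\{\rho:\exists v\in C(\Omega),\ v>0,\ F(D^2v,Dv,v,x)\ge\rho v\text{ in }\Omega\}$ and $\lambda_1^-(F,\Omega)=\sup\{\rho:\exists v\in C(\Omega),\ v<0,\ F(D^2v,Dv,v,x)\le\rho v\text{ in }\Omega\}$. *)

(* Defs.v *)
From HB Require Import structures.
From mathcomp Require Import all_boot all_order all_algebra.
From mathcomp Require Import all_classical all_reals all_analysis.
Set Implicit Arguments. Unset Strict Implicit. Unset Printing Implicit Defensive.
Import Order.TTheory GRing.Theory Num.Theory.
Import numFieldNormedType.Exports.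
Local Open Scope classical_set_scope.
Local Open Scope ring_scope.

Section Defs.
Variables (R : realType) (n : nat).
Notation E := 'rV[R]_n.

Definition pd (i : 'I_n) (f : E -> R) (x : E) : R := 'D_(delta_mx 0 i) f x.

Fixpoint Ck_on (A : set E) (k : nat) (f : E -> R) : Prop :=
  match k with
  | 0 => forall x, A x -> {for x, continuous f}
  | k'.+1 => (forall x, A x -> {for x, continuous f}) /\
             (forall x, A x -> differentiable f x) /\
             (forall i, Ck_on A k' (pd i f))
  end.

Definition Cinf (f : E -> R) : Prop := forall k, Ck_on setT k f.

Definition grad (f : E -> R) (x : E) : 'rV[R]_n := \row_i pd i f x.
Definition hess (f : E -> R) (x : E) : 'M[R]_n := \matrix_(i, j) pd i (pd j f) x.

Definition symmetric (M : 'M[R]_n) : Prop := M^T = M.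

Definition smooth_domain (O : set E) : Prop :=
  open O /\ connected O /\ O !=set0 /\ bounded_set O /\
  exists rho : E -> R, Cinf rho /\ O = [set x | rho x < 0] /\
    (forall x, rho x = 0 -> exists i, pd i rho x != 0).

Definition pucci_set (ga Ga : R) : set 'M[R]_n :=
  [set A | symmetric A /\ forall a, eigenvalue A a -> ga <= a <= Ga].

Definition pucci_plus (ga Ga : R) (M : 'M[R]_n) : R :=
  sup [set - \tr (A *m M) | A in pucci_set ga Ga].
Definition pucci_minus (ga Ga : R) (M : 'M[R]_n) : R :=
  inf [set - \tr (A *m M) | A in pucci_set ga Ga].

Definition op_type := 'M[R]_n -> 'rV[R]_n -> R -> E -> R.

Definition F1 (O : set E) (F : op_type) : Prop :=
  forall K : R, 0 < K -> exists (om : R -> R) (nu : R),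
    {in `[0, +oo[ &, {homo om : s t / s <= t}} /\
    {within `[0, +oo[, continuous om} /\ om 0 = 0 /\
    (forall t, 0 <= t -> 0 <= om t) /\
    2^-1 < nu <= 1 /\
    forall M p z x y, symmetric M -> `|p| <= K -> `|z| <= K -> O x -> O y ->
      `|F M p z x - F M p z y| <= om ((`|x - y| `^ nu) * (`|M| + 1)).

Definition F2 (O : set E) (F : op_type) : Prop :=
  exists d1 d0 ga Ga : R, 0 <= d1 /\ 0 <= d0 /\ 0 < ga /\ ga <= Ga /\
    forall M N p q z w x, symmetric M -> symmetric N -> O x ->
      pucci_minus ga Ga (M - N) - d1 * `|p - q| - d0 * `|z - w|
        <= F M p z x - F N q w x /\
      F M p z x - F N q w x
        <= pucci_plus ga Ga (M - N) + d1 * `|p - q| + d0 * `|z - w|.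

Definition F3 (O : set E) (F : op_type) : Prop :=
  forall (t : R) M p z x, 0 <= t -> symmetric M -> O x ->
    F (t *: M) (t *: p) (t * z) x = t * F M p z x.

Definition cont_on (O : set E) (u : E -> R) : Prop :=
  forall x, O x -> {for x, continuous u}.

Definition visc_sub (O : set E) (F : op_type) (g u : E -> R) : Prop :=
  cont_on O u /\
  forall (phi : E -> R) (x0 : E), Ck_on O 2 phi -> O x0 ->
    (\forall x \near x0, u x - phi x <= u x0 - phi x0) ->
    F (hess phi x0) (grad phi x0) (u x0) x0 <= g x0.

Definition visc_super (O : set E) (F : op_type) (g u : E -> R) : Prop :=
  cont_on O u /\
  forall (phi : E -> R) (x0 : E), Ck_on O 2 phi -> O x0 ->
    (\forall x \near x0, u x0 - phi x0 <= u x - phi x) ->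
    g x0 <= F (hess phi x0) (grad phi x0) (u x0) x0.

Definition visc_sol (O : set E) (F : op_type) (g u : E -> R) : Prop :=
  visc_sub O F g u /\ visc_super O F g u.

Definition lambda1_plus (O : set E) (F : op_type) : \bar R :=
  ereal_sup [set rho%:E | rho in [set rho : R | exists v : E -> R,
     cont_on O v /\ (forall x, O x -> 0 < v x) /\
     visc_super O F (fun x => rho * v x) v]].

Definition lambda1_minus (O : set E) (F : op_type) : \bar R :=
  ereal_sup [set rho%:E | rho in [set rho : R | exists v : E -> R,
     cont_on O v /\ (forall x, O x -> v x < 0) /\
     visc_sub O F (fun x => rho * v x) v]].
End Defs.

(* Lebesgue integral over R^n of a nonnegative function, computed as an
   iterated one-dimensional Lebesgue integral (equal to the n-dimensional
   Lebesgue integral for nonnegative Borel functions, by Tonelli). *)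
Definition cons_row (R : realType) (m : nat) (t : R) (y : 'rV[R]_m) : 'rV[R]_m.+1 :=
  \row_(i < m.+1) (if unlift ord0 i is Some j then y 0 j else t).

Fixpoint lebint_n (R : realType) (n : nat) : ('rV[R]_n -> \bar R) -> \bar R :=
  match n return ('rV[R]_n -> \bar R) -> \bar R with
  | 0 => fun g => g 0
  | n'.+1 => fun g =>
      (\int[@lebesgue_measure R]_(t in [set: R])
         lebint_n (fun y => g (cons_row t y)))%E
  end.

Definition Lp_on (R : realType) (n : nat) (p : R) (O : set 'rV[R]_n)
  (f : 'rV[R]_n -> R) : Prop :=
  (lebint_n (fun x => ((\1_O x) * (`|f x| `^ p))%:E) < +oo)%E.

(* Main.v *)
Require Import Defs.
From HB Require Import structures.
From mathcomp Require Import all_boot all_order all_algebra.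
From mathcomp Require Import all_classical all_reals all_analysis.
From mathcomp Require Import measurable_realfun.
From mathcomp Require Import ring lra.
Set Implicit Arguments. Unset Strict Implicit. Unset Printing Implicit Defensive.
Import Order.TTheory GRing.Theory Num.Theory.
Import numFieldNormedType.Exports.
Local Open Scope classical_set_scope.
Local Open Scope ring_scope.

(** Write [l] for the eigenvalue [lambda1_minus], take [v < 0] with [F(v) <= r v] and [r] slightly
    below [l], and put [eps = lambda - r], [m = - min u].  Let [t] be the maximum of [u / v] over the
    set [K] of the points where the defining function [d] of the domain is at least a small [s].
    Then [z = u - t v] vanishes somewhere on [K], and [- z] is a subsolution of the extremal
    inequality with right-hand side [C |z| + eps m - f].  The maximum principle in the strip [d < s]
    gives [z >= - eps m].  As [f > 0] somewhere, quantitative propagation of positivity bounds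
    [eps m] from below, so that [m] is large when [eps] is small; it also gives [max u <= C m] and
    [u <= - theta m] on [K].  In the strip, adding the barrier [alpha (d + k d^2)] with [alpha]
    proportional to [m] beats the bound [C d] that [f] contributes through the
    Alexandrov-Bakelman-Pucci estimate, so [u < 0].  The second case is the first one for the
    operator [- F (- M) (- p) (- z) x].

    Differences of sub- and supersolutions are handled by the theorem on sums.  The part played
    there by the Alexandrov and Jensen theorems is taken by a finite argument: the gradients at the
    points touched by planes extend to a Lipschitz map, and by an energy argument over nested cubes
    this map is almost affine at some scale on a cube rich in such points.  The
    Alexandrov-Bakelman-Pucci estimate is obtained likewise, by counting lattice slopes cube by
    cube, which only involves lower Riemann sums and the iterated Lebesgue integral. *)

(** * Euclidean vectors and quadratic forms *)

(** No eigenfunction is at hand, only negative subsolutions [v] for some [r] close to the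
    eigenvalue, with no information at the boundary. Hence [u / v] is maximised over an interior
    compact set only, and the estimates carry errors proportional to [eps m]. The order between the
    two eigenvalues enters once, to exclude a positive [u], which would be admissible for
    [lambda1_plus].

    The exponent [nu > 1/2] is decisive twice. In the doubling of variables, Lipschitz regularity
    brings the doubled points within [O(ep)], and the error due to (F1) is then of order
    [ep ^ (2 nu - 1)]. In the Lipschitz estimate, a concave modulus gains a term of order
    [L rho ^ (-1/2)] against an error of order [L rho ^ (nu - 1)].

    At the boundary, rescaling the bound on [f] to a cube of size comparable to the depth [d] costs
    a factor [d ^ (- n / p)]. As [p > n], the profile [d - d ^ (1 + 1 / (m + 2))] with [m] large
    compensates this and still gives a bound linear in [d]. *)

Section Euclid.
Context {R : realType}.

(** The library norm of a row vector is the sup norm. Euclidean quantities go through [dot] and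
    [sq], and many of the later factors [n%:R] come from comparing the two norms. *)
Definition dot {n} (x y : 'rV[R]_n) : R := \sum_i x 0 i * y 0 i.
Definition sq {n} (x : 'rV[R]_n) : R := dot x x.
Definition qf {n} (M : 'M[R]_n) (x : 'rV[R]_n) : R := dot (x *m M) x.

Section Fixn.
Variable n : nat.
Implicit Types (x y z : 'rV[R]_n) (M N : 'M[R]_n) (a : R).

Lemma dotC x y : dot x y = dot y x.
Proof. by apply: eq_bigr => i _; rewrite mulrC. Qed.
Lemma dotDl x y z : dot (x + y) z = dot x z + dot y z.
Proof. by rewrite -big_split; apply: eq_bigr => i _; rewrite mxE mulrDl. Qed.
Lemma dotDr x y z : dot z (x + y) = dot z x + dot z y.
Proof. by rewrite !(dotC z) dotDl. Qed.
Lemma dotZl a x y : dot (a *: x) y = a * dot x y.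
Proof. by rewrite mulr_sumr; apply: eq_bigr => i _; rewrite mxE mulrA. Qed.
Lemma dotZr a x y : dot x (a *: y) = a * dot x y.
Proof. by rewrite dotC dotZl dotC. Qed.
Lemma dotNl x y : dot (- x) y = - dot x y.
Proof. by rewrite -scaleN1r dotZl mulN1r. Qed.
Lemma dotNr x y : dot x (- y) = - dot x y.
Proof. by rewrite dotC dotNl dotC. Qed.
Lemma dotBl x y z : dot (x - y) z = dot x z - dot y z.
Proof. by rewrite dotDl dotNl. Qed.
Lemma dotBr x y z : dot z (x - y) = dot z x - dot z y.
Proof. by rewrite dotDr dotNr. Qed.
Lemma dot0l x : dot 0 x = 0.
Proof. by rewrite -(scale0r x) dotZl mul0r. Qed.
Lemma dot0r x : dot x 0 = 0.
Proof. by rewrite dotC dot0l. Qed.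
Definition dotE := (dotDl, dotDr, dotNl, dotNr, dotZl, dotZr, dot0l, dot0r).

Lemma sq_ge0 x : 0 <= sq x.
Proof. by apply: sumr_ge0 => i _; rewrite -expr2 sqr_ge0. Qed.
Lemma sq0 : sq (0 : 'rV[R]_n) = 0.
Proof. by rewrite /sq dot0l. Qed.
Lemma sqZ a x : sq (a *: x) = a ^+ 2 * sq x.
Proof. by rewrite /sq !dotE mulrA. Qed.
Lemma sqN x : sq (- x) = sq x.
Proof. by rewrite /sq !dotE opprK. Qed.
Lemma sqD x y : sq (x + y) = sq x + 2 * dot x y + sq y.
Proof. rewrite /sq !dotE (dotC y x); ring. Qed.
Lemma sqB x y : sq (x - y) = sq x - 2 * dot x y + sq y.
Proof. rewrite sqD sqN dotNr; ring. Qed.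
Lemma sqBC x y : sq (x - y) = sq (y - x).
Proof. by rewrite -sqN opprB. Qed.

Lemma normv_coord x i : `|x 0 i| <= `|x|.
Proof.
have -> : `|x| = mx_norm x by [].
by rewrite mx_normrE; apply: (le_bigmax _ (fun ij => `|x ij.1 ij.2|) (0, i)).
Qed.
Lemma normv_le x a : 0 <= a -> (forall i, `|x 0 i| <= a) -> `|x| <= a.
Proof.
move=> a0 H; have -> : `|x| = mx_norm x by [].
by rewrite mx_normrE; apply: bigmax_le => // -[i j] _ /=; rewrite ord1.
Qed.
Lemma normv_lt x a : 0 < a -> (forall i, `|x 0 i| < a) -> `|x| < a.
Proof.
move=> a0 H; have -> : `|x| = mx_norm x by [].
by rewrite mx_normrE; apply: bigmax_lt => // -[i j] _ /=; rewrite ord1.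
Qed.

Lemma normv_sq x : `|x| ^+ 2 <= sq x.
Proof.
have H i : x 0 i ^+ 2 <= sq x.
  rewrite /sq /dot (bigD1 i) //= -expr2 lerDl sumr_ge0 // => j _.
  by rewrite -expr2 sqr_ge0.
rewrite -[leRHS]sqr_sqrtr ?sq_ge0 //; apply: lerXn2r; rewrite ?nnegrE ?sqrtr_ge0 //.
apply: normv_le; first exact: sqrtr_ge0.
by move=> i; rewrite -sqrtr_sqr ler_wsqrtr.
Qed.
Lemma sq_normv x : sq x <= n%:R * `|x| ^+ 2.
Proof.
rewrite -[n in n%:R]card_ord mulr_natl -sumr_const.
apply: ler_sum => i _; rewrite -expr2 -real_normK ?num_real //.
by apply: lerXn2r; rewrite ?nnegrE ?normr_ge0 // normv_coord.
Qed.
Lemma dot_normv x y : `|dot x y| <= n%:R * (`|x| * `|y|).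
Proof.
rewrite -[n in n%:R]card_ord mulr_natl -sumr_const.
apply: le_trans (ler_norm_sum _ _ _) _; apply: ler_sum => i _.
by rewrite normrM ler_pM ?normr_ge0 ?normv_coord.
Qed.
Lemma sq_eq0 x : sq x = 0 -> x = 0.
Proof.
move=> x0; have := normv_sq x; rewrite x0 => H.
apply/eqP; rewrite -normr_eq0 -sqrf_eq0; rewrite eq_le H sqr_ge0 //.
Qed.
Lemma sq_gt0 x : x != 0 -> 0 < sq x.
Proof. by move=> x0; rewrite lt_def sq_ge0 andbT; apply: contra x0 => /eqP/sq_eq0/eqP. Qed.
Lemma cauchy_schwarz x y : dot x y ^+ 2 <= sq x * sq y.
Proof.
have [->|y0] := eqVneq y 0; first by rewrite dot0r sq0 mulr0 expr0n.
have := sq_ge0 (sq y *: x - dot x y *: y); have yp := sq_gt0 y0.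
rewrite sqB !sqZ !dotE => H.
have : 0 <= sq y * (sq x * sq y - dot x y ^+ 2) by nra.
by rewrite pmulr_rge0 // subr_ge0.
Qed.
Lemma dot_amgm x y a : 0 < a -> 2 * dot x y <= a * sq x + a^-1 * sq y.
Proof.
move=> a0; have := sq_ge0 (a *: x - y); rewrite sqB sqZ dotZl => H.
have : 0 <= a^-1 * (a ^+ 2 * sq x - 2 * (a * dot x y) + sq y) by rewrite mulr_ge0 // invr_ge0 ltW.
have -> : a^-1 * (a ^+ 2 * sq x - 2 * (a * dot x y) + sq y) = a * sq x - 2 * dot x y + a^-1 * sq y.
  by field; rewrite gt_eqF.
lra.
Qed.
Lemma sqD_le x y : sq (x + y) <= 2 * sq x + 2 * sq y.
Proof. have := sq_ge0 (x - y); rewrite sqB sqD; lra. Qed.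
Lemma sqB_le x y : sq (x - y) <= 2 * sq x + 2 * sq y.
Proof. by have := sqD_le x (- y); rewrite sqN. Qed.

Lemma dot_delta x i : dot x (delta_mx 0 i) = x 0 i.
Proof.
rewrite /dot (bigD1 i) //= mxE !eqxx mulr1 big1 ?addr0 // => j ji.
by rewrite mxE eqxx (negbTE ji) mulr0.
Qed.

Lemma sq_delta i : sq (delta_mx 0 i : 'rV[R]_n) = 1.
Proof. by rewrite /sq dot_delta mxE !eqxx. Qed.

Lemma qfDm M N x : qf (M + N) x = qf M x + qf N x.
Proof. by rewrite /qf mulmxDr dotDl. Qed.
Lemma qfNm M x : qf (- M) x = - qf M x.
Proof. by rewrite /qf mulmxN dotNl. Qed.
Lemma qfBm M N x : qf (M - N) x = qf M x - qf N x.
Proof. by rewrite qfDm qfNm. Qed.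
Lemma qfZm a M x : qf (a *: M) x = a * qf M x.
Proof. by rewrite /qf -scalemxAr dotZl. Qed.
Lemma qf_scalar a x : qf (a%:M) x = a * sq x.
Proof. by rewrite /qf mul_mx_scalar dotZl. Qed.
Lemma qf0m x : qf 0 x = 0.
Proof. by rewrite /qf mulmx0 dot0l. Qed.
Lemma qfZ M a x : qf M (a *: x) = a ^+ 2 * qf M x.
Proof. by rewrite /qf -scalemxAl !dotE mulrA. Qed.
Lemma qfN M x : qf M (- x) = qf M x.
Proof. by rewrite /qf mulNmx !dotE opprK. Qed.
Lemma qf0 M : qf M 0 = 0.
Proof. by rewrite /qf mul0mx dot0l. Qed.
Lemma dot_mulmx M x y : dot (x *m M) y = \sum_i \sum_j M i j * (x 0 i * y 0 j).
Proof.
rewrite /dot exchange_big; apply: eq_bigr => j _ /=.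
by rewrite mxE mulr_suml; apply: eq_bigr => i _; ring.
Qed.
Lemma dot_trmx M x y : dot (x *m M) y = dot x (y *m M^T).
Proof.
rewrite [RHS]dotC !dot_mulmx exchange_big; apply: eq_bigr => i _; apply: eq_bigr => j _.
by rewrite mxE [x _ _ * _]mulrC.
Qed.
Lemma dot_sym M x y : Defs.symmetric M -> dot (x *m M) y = dot (y *m M) x.
Proof. by move=> sM; rewrite dot_trmx sM dotC. Qed.
Lemma qfD M x y : Defs.symmetric M -> qf M (x + y) = qf M x + 2 * dot (x *m M) y + qf M y.
Proof. by move=> sM; rewrite /qf mulmxDl !dotE (dot_sym y x sM); ring. Qed.
Lemma qfB M x y : Defs.symmetric M -> qf M (x - y) = qf M x - 2 * dot (x *m M) y + qf M y.
Proof. by move=> sM; rewrite qfD // qfN dotNr; ring. Qed.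

End Fixn.
End Euclid.

(** * Compactness and continuity *)

Section Topo.
Context {R : realType} {n : nat}.
Notation E := 'rV[R]_n.

Lemma nearP_eps (P : E -> Prop) (x : E) :
  (\forall y \near x, P y) <-> exists2 d : R, 0 < d & forall y, `|y - x| < d -> P y.
Proof.
split.
  move=> /nbhs_ballP[d /= d0 H]; exists d => // y yx; apply: H.
  by rewrite -ball_normE /= distrC.
case=> d d0 H; apply/nbhs_ballP; exists d => //= y; rewrite -ball_normE /= distrC; exact: H.
Qed.

Lemma contP_eps (f : E -> R) (x : E) :
  {for x, continuous f} <->
  forall e : R, 0 < e -> exists2 d : R, 0 < d & forall y, `|y - x| < d -> `|f y - f x| < e.
Proof.
split.
  move=> H e e0; apply/nearP_eps; have /cvgrPdist_lt/(_ e e0) := H.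
  by apply: filterS => y; rewrite distrC.
move=> H; have : f y @[y --> x] --> f x; last by [].
apply: (iffRL (@cvgrPdist_lt R R _ (nbhs x) (nbhs_filter x) f (f x))) => e e0.
apply/nearP_eps; have [d d0 K] := H e e0.
by exists d => // y /K; rewrite distrC.
Qed.

Lemma cont_dot (p : E) (x : E) : {for x, continuous (fun y : E => dot p y)}.
Proof.
apply/contP_eps => e e0; have c0 : 0 < n%:R * `|p| + 1.
  by rewrite ltr_wpDl // mulr_ge0 // ler0n.
exists (e / (n%:R * `|p| + 1)); first by rewrite divr_gt0.
move=> y; rewrite ltr_pdivlMr // => H; rewrite -dotBr.
apply: le_lt_trans (dot_normv _ _) _; apply: le_lt_trans H; rewrite mulrA.
by have := normr_ge0 (y - x); nra.
Qed.

Lemma cont_sum (I : Type) (r : seq I) (f : I -> E -> R) (x : E) :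
  (forall i, {for x, continuous (f i)}) ->
  {for x, continuous (fun y => \sum_(i <- r) f i y)}.
Proof.
move=> H; elim: r => [|i r IH].
  have -> : (fun y => \sum_(i <- [::]) f i y) = (fun=> 0).
    by apply/funext => y; rewrite big_nil.
  exact: cst_continuous.
have -> : (fun y => \sum_(i0 <- i :: r) f i0 y) = (fun y => f i y + \sum_(j <- r) f j y).
  by apply/funext => y; rewrite big_cons.
exact: continuousD.
Qed.

Lemma cont_sq (c x : E) : {for x, continuous (fun y : E => sq (y - c))}.
Proof.
have -> : (fun y : E => sq (y - c)) = (fun y => \sum_i (y 0 i - c 0 i) * (y 0 i - c 0 i)).
  by apply/funext => y; apply: eq_bigr => i _; rewrite !mxE.
by apply: cont_sum => i; apply: continuousM; apply: continuousB;
   (exact: coord_continuous || exact: cst_continuous).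
Qed.

Lemma cont_qf M (x : E) : {for x, continuous (fun y : E => qf M y)}.
Proof.
have -> : (fun y : E => qf M y) = (fun y => \sum_i \sum_j M i j * (y 0 i * y 0 j)).
  by apply/funext => y; rewrite /qf dot_mulmx.
apply: cont_sum => i; apply: cont_sum => j.
apply: continuousM; first exact: cst_continuous.
by apply: continuousM; exact: coord_continuous.
Qed.

Lemma evt_max (f : E -> R) (A : set E) : A !=set0 -> compact A ->
  (forall x, A x -> {for x, continuous f}) ->
  exists2 c, A c & forall y, A y -> f y <= f c.
Proof.
move=> A0 cA fA.
have [|c cA' H] := @compact_EVT_max _ R f A A0 cA.
  by apply: continuous_in_subspaceT => x; rewrite inE => /fA.
by exists c; [rewrite inE in cA' | move=> y yA; apply: H; rewrite inE].
Qed.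

Lemma evt_min (f : E -> R) (A : set E) : A !=set0 -> compact A ->
  (forall x, A x -> {for x, continuous f}) ->
  exists2 c, A c & forall y, A y -> f c <= f y.
Proof.
move=> A0 cA fA; have [|c Ac H] := @evt_max (fun x => - f x) A A0 cA.
  by move=> x Ax; apply: continuousN; exact: fA.
by exists c => // y Ay; have := H y Ay; rewrite lerN2.
Qed.

Lemma cubeE (x0 : E) r : 0 < r -> [set x : E | `|x - x0| <= r] = closed_ball x0 r.
Proof.
move=> r0; rewrite closed_ballE // /closed_ball_.
by apply/seteqP; split => x /=; rewrite distrC.
Qed.

Lemma compact_cube (x0 : E) r : 0 < r -> compact [set x : E | `|x - x0| <= r].
Proof.
move=> r0; rewrite cubeE //; apply: bounded_closed_compact; last exact: closed_ball_closed.
exists (`|x0| + r); split; first exact: num_real.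
move=> M HM x; rewrite -cubeE //= => H; apply/ltW; apply: le_lt_trans HM.
by rewrite -(subrK x0 x) addrC; apply: le_trans (ler_normD _ _) _; rewrite lerD2l.
Qed.

Lemma closedP_eps (A : set E) :
  (forall x, ~ A x -> exists2 d : R, 0 < d & forall y, `|y - x| < d -> ~ A y) -> closed A.
Proof.
move=> H; rewrite -openC openE => x /= nA; rewrite /interior; apply/nearP_eps; exact: H.
Qed.

Lemma openP_eps (A : set E) : open A <->
  (forall x, A x -> exists2 d : R, 0 < d & forall y, `|y - x| < d -> A y).
Proof.
split; first by move=> oA x Ax; apply/nearP_eps; exact: open_nbhs_nbhs.
by move=> H; rewrite openE => x Ax; apply/nearP_eps; exact: H.
Qed.

(* Lebesgue-number form of compactness *)
Lemma compact_unif (A : set E) (P : E -> R -> Prop) : compact A ->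
  (forall x d d', A x -> P x d -> 0 < d' -> d' <= d -> P x d') ->
  (forall x, A x -> exists2 d, 0 < d & forall y, A y -> `|y - x| < d -> P y d) ->
  exists2 d, 0 < d & forall x, A x -> P x d.
Proof.
move=> cA Pm H.
have /compact_near_coveringP/near_covering_withinP nc := cA.
have := nc R (0^'+) (fun d x => P x d) _.
have H2 : forall x, A x -> \forall x' \near x & i \near 0^'+, A x' -> P x' i.
  move=> x Ax; have [d d0 Hd] := H x Ax.
  exists ([set y | `|y - x| < d], [set e : R | 0 < e <= d]) => /=.
    split; first by apply/nearP_eps; exists d.
    near=> e; apply/andP; split => //; near: e; exact: nbhs_right_le.
  case=> y e /= [yx /andP[e0 ed]] Ay; apply: (Pm _ d) => //; exact: Hd.
move=> /(_ _ H2) => H3.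
have : \forall e \near 0^'+, 0 < e /\ forall x, A x -> P x e.
  by near=> e; split => //; near: e.
move=> /filter_ex[e [e0 He]]; by exists e.
Unshelve. all: by end_near.
Qed.

Lemma unif_cont (f : E -> R) (A : set E) : compact A ->
  (forall x, A x -> {for x, continuous f}) ->
  forall e, 0 < e -> exists2 d : R, 0 < d & forall x y, A x -> `|y - x| < d -> `|f y - f x| < e.
Proof.
move=> cA fA e e0.
have [||d d0 H] := @compact_unif A (fun x d => forall y, `|y - x| < d -> `|f y - f x| < e) cA.
- by move=> x d d' Ax H d'0 dd y yd; apply: H; exact: lt_le_trans dd.
- move=> x Ax; have /contP_eps/(_ (e / 2)) := fA x Ax.
  case=> [|d d0 H]; first by rewrite divr_gt0.
  exists (d / 2); rewrite ?divr_gt0 // => y Ay yx z zy.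
  have h1 : `|f z - f x| < e / 2.
    apply: H; rewrite -(subrKA y) (splitr d); apply: le_lt_trans (ler_normD _ _) _.
    exact: ltrD.
  have h2 : `|f x - f y| < e / 2 by rewrite distrC; apply: H; apply: lt_trans yx _; lra.
  rewrite -(subrKA (f x)) (splitr e); apply: le_lt_trans (ler_normD _ _) _; exact: ltrD.
- by exists d => // x y Ax; exact: H.
Qed.

End Topo.

(** * Positive semidefinite and uniformly elliptic matrices *)

Section Psd.
Context {R : realType} {n : nat}.
Notation E := 'rV[R]_n.
Implicit Types (x y : E) (A B M N X Y : 'M[R]_n).

Definition outer x : 'M[R]_n := \matrix_(i, j) (x 0 i * x 0 j).

Lemma outer_sym x : Defs.symmetric (outer x).
Proof. by apply/matrixP => i j; rewrite !mxE mulrC. Qed.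
Lemma mul_outer x y : y *m outer x = dot x y *: x.
Proof.
apply/rowP => j; rewrite !mxE mulr_suml; apply: eq_bigr => i _.
by rewrite mxE; ring.
Qed.
Lemma qf_outer x y : qf (outer x) y = dot x y ^+ 2.
Proof. by rewrite /qf mul_outer dotZl expr2. Qed.
Lemma tr_mul_outer A x : \tr (A *m outer x) = qf A x.
Proof.
rewrite /qf dot_mulmx /mxtrace; apply: eq_bigr => i _; rewrite mxE.
by apply: eq_bigr => j _; rewrite mxE; ring.
Qed.

Lemma symD A B : Defs.symmetric A -> Defs.symmetric B -> Defs.symmetric (A + B).
Proof. by move=> sA sB; rewrite /Defs.symmetric linearD /= sA sB. Qed.
Lemma symN A : Defs.symmetric A -> Defs.symmetric (- A).
Proof. by move=> sA; rewrite /Defs.symmetric linearN /= sA. Qed.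
Lemma symB A B : Defs.symmetric A -> Defs.symmetric B -> Defs.symmetric (A - B).
Proof. by move=> sA sB; apply: symD => //; exact: symN. Qed.
Lemma symZ a A : Defs.symmetric A -> Defs.symmetric (a *: A).
Proof. by move=> sA; rewrite /Defs.symmetric linearZ /= sA. Qed.
Lemma sym_scalar a : Defs.symmetric (a%:M : 'M[R]_n).
Proof. exact: tr_scalar_mx. Qed.
Lemma sym0 : Defs.symmetric (0 : 'M[R]_n).
Proof. exact: trmx0. Qed.

Lemma qf_delta M i : qf M (delta_mx 0 i) = M i i.
Proof. by rewrite /qf dot_delta -rowE mxE. Qed.

(** Off-diagonal entries are recovered by polarisation at [delta_mx 0 i + delta_mx 0 j], whose
    square length is 2; this is where the factor 2 comes from. *)
Lemma qf_entry_bound M c : 0 <= c -> Defs.symmetric M -> (forall x, `|qf M x| <= c * sq x) -> `|M| <= 2 * c.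
Proof.
move=> c0 sM H.
have Hii i : `|M i i| <= c by have := H (delta_mx 0 i); rewrite qf_delta sq_delta mulr1.
have bnd i j : `|M i j| <= 2 * c.
  have [->|ij] := eqVneq i j; first by apply: le_trans (Hii j) _; lra.
  have dij : dot (delta_mx 0 i : E) (delta_mx 0 j) = 0.
    by rewrite dot_delta mxE eqxx eq_sym (negbTE ij).
  have := H (delta_mx 0 i + delta_mx 0 j); rewrite qfD // !qf_delta sqD dij !sq_delta.
  rewrite -rowE dot_delta mxE; have := Hii i; have := Hii j.
  by rewrite !ler_norml => /andP[? ?] /andP[? ?] /andP[? ?]; apply/andP; split; lra.
have -> : `|M| = mx_norm M by [].
rewrite mx_normrE; apply: bigmax_le => [|[i j] _]; last exact: bnd.
by rewrite mulr_ge0.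
Qed.

(** Elimination takes the place of diagonalisation. A zero on the diagonal of a semidefinite matrix
    forces its whole row to vanish, and the Schur complement of a positive entry [B i i] is again
    semidefinite with one more zero on its diagonal. The induction runs on the number of nonzero
    diagonal entries. *)
Lemma psd_decomp B : Defs.symmetric B -> (forall x, 0 <= qf B x) ->
  exists s : seq E, B = \sum_(x <- s) outer x.
Proof.
have [k] := ubnP #|[set i | B i i != 0]%SET|; elim: k B => // k IH B.
rewrite ltnS => Bk sB pB.
have Bd i : 0 <= B i i by have := pB (delta_mx 0 i); rewrite qf_delta.
have key i j : B i i = 0 -> B i j = 0.
  move=> Bii; apply/eqP/negPn/negP => Bij.
  (* The coefficient is chosen so that the form takes the value [- 1] at this vector. *)
  have := pB (- ((B j j + 1) / (2 * B i j)) *: delta_mx 0 i + delta_mx 0 j).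
  rewrite qfD // qfZ !qf_delta Bii mulr0 -scalemxAl dotZl -rowE dot_delta mxE.
  have -> : 2 * (- ((B j j + 1) / (2 * B i j)) * B i j) = - (B j j + 1) by field.
  by lra.
have [i /negPf Bi|H] := pickP (fun i => B i i != 0); last first.
  exists [::]; rewrite big_nil; apply/matrixP => i j; rewrite mxE; apply: key.
  by have /negbFE/eqP := H i.
have Bip : 0 < B i i by rewrite lt_def Bi Bd.
pose r := row i B; pose B' := B - (B i i)^-1 *: outer r.
have sB' : Defs.symmetric B' by apply: symB => //; apply: symZ; exact: outer_sym.
have rE x : dot (delta_mx 0 i *m B) x = dot r x by rewrite -rowE.
have pB' x : 0 <= qf B' x.
  have := pB (x - (dot r x / B i i) *: delta_mx 0 i).
  rewrite qfB // qfZ qf_delta dotZr dot_sym // rE.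
  rewrite qfBm qfZm qf_outer; congr (_ <= _); field; exact/negbT.
have B'd j : 0 <= B' j j by have := pB' (delta_mx 0 j); rewrite qf_delta.
have [|s Es] := IH B' _ sB' pB'.
  apply: leq_trans Bk; apply: proper_card; apply/properP; split.
    apply/fintype.subsetP => j; rewrite !inE; apply: contra => /eqP Bj.
    rewrite /B' !mxE Bj (_ : B i j = 0) ?mulr0 ?subr0 //.
    by rewrite -[B]sB mxE key.
  exists i; first by rewrite inE Bi.
  by rewrite inE negbK /B' !mxE; apply/eqP; field; exact/negbT.
exists ((Num.sqrt (B i i))^-1 *: r :: s); rewrite big_cons -Es /B' addrC -[LHS](subrK ((B i i)^-1 *: outer r)).
congr (_ + _); apply/matrixP => a b; rewrite !mxE.
have -> : (B i i)^-1 = (Num.sqrt (B i i))^-1 * (Num.sqrt (B i i))^-1.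
  by rewrite -invfM -expr2 sqr_sqrtr // ltW.
ring.
Qed.

Lemma tr_psd_ge0 A B : (forall x, 0 <= qf A x) ->
  Defs.symmetric B -> (forall x, 0 <= qf B x) -> 0 <= \tr (A *m B).
Proof.
move=> pA sB pB; have [s ->] := psd_decomp sB pB.
rewrite mulmx_sumr linear_sum /=; apply: sumr_ge0 => x _.
by rewrite tr_mul_outer.
Qed.

(** Moving from [x] a little way against [y = x *m A] would make the form negative at first order
    unless [y] vanishes. *)
Lemma psd_kernel A x : Defs.symmetric A -> (forall y, 0 <= qf A y) -> qf A x = 0 -> x *m A = 0.
Proof.
move=> sA pA Ax; apply: sq_eq0; set y := x *m A; apply/eqP; rewrite eq_le sq_ge0 andbT.
rewrite leNgt; apply/negP => y0.
have c0 : 0 <= qf A y by [].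
pose t := sq y / (qf A y + 1).
have := pA (x - t *: y); rewrite qfB // Ax qfZ dotZr -/y -/(sq y).
have ht : t * (qf A y + 1) = sq y by rewrite /t mulfVK // gt_eqF // ltr_wpDl.
have t0 : 0 < t by rewrite /t divr_gt0 // ltr_wpDl.
have : t * (qf A y) < sq y by nra.
rewrite expr2 => h1 h2; have : t * sq y > 0 by rewrite mulr_gt0.
have : t * (t * qf A y) < t * sq y by rewrite ltr_pM2l.
by lra.
Qed.

(** The minimum [a] of the form on the unit sphere makes [A - a%:M] semidefinite and null at the
    minimiser, which is then an eigenvector by [psd_kernel]. This turns the eigenvalue condition of
    [pucci_set] into a bound on the quadratic form. *)
Lemma rayleigh_min A : (0 < n)%N -> Defs.symmetric A ->
  exists2 a, eigenvalue A a & forall x, a * sq x <= qf A x.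
Proof.
move=> n0 sA.
pose K : set E := [set x | sq x = 1].
have K0 : K !=set0 by exists (delta_mx 0 (Ordinal n0)); rewrite /K /= sq_delta.
have cK : compact K.
  apply: bounded_closed_compact.
    exists 1; split; first exact: num_real.
    move=> M M1 x; rewrite /K /= => x1; apply: le_trans (ltW M1).
    by rewrite -(@expr_le1 _ 2) // -x1 normv_sq.
  apply: closedP_eps => x nx.
  have /contP_eps := @cont_sq R n 0 x; rewrite subr0 => /(_ `|sq x - 1|).
  case=> [|d d0 H]; first by rewrite normr_gt0 subr_eq0; apply/eqP.
  exists d => // y yx y1; have := H y yx.
  by rewrite subr0 [sq y]y1 distrC ltxx.
have [x0 Kx0 H] := evt_min K0 cK (fun x _ => @cont_qf R n A x).
have Hall x : qf A x0 * sq x <= qf A x.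
  have [->|x1] := eqVneq x 0; first by rewrite sq0 qf0 mulr0.
  have sp := sq_gt0 x1.
  have q1 : (Num.sqrt (sq x))^-1 ^+ 2 = (sq x)^-1 by rewrite exprVn sqr_sqrtr // ltW.
  have := H ((Num.sqrt (sq x))^-1 *: x); rewrite qfZ q1.
  rewrite ler_pdivlMl // mulrC; apply.
  by rewrite /K /= sqZ q1 mulVf // gt_eqF.
exists (qf A x0) => //; apply/eigenvalueP; exists x0; last first.
  apply/eqP => x00; move: Kx0; rewrite /K /= x00 sq0 => /eqP; by rewrite eq_sym oner_eq0.
apply/eqP; rewrite -subr_eq0 -mul_mx_scalar -mulmxBr; apply/eqP.
apply: psd_kernel.
- by apply: symB => //; exact: sym_scalar.
- by move=> y; rewrite qfBm qf_scalar subr_ge0.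
- by rewrite qfBm qf_scalar [sq x0]Kx0 mulr1 subrr.
Qed.

Definition ell (ga Ga : R) A := Defs.symmetric A /\ forall x, ga * sq x <= qf A x <= Ga * sq x.

Lemma pucci_set_ell ga Ga A : (0 < n)%N -> pucci_set ga Ga A -> ell ga Ga A.
Proof.
move=> n0 [sA H]; split=> // x; apply/andP; split.
  have [a ea Ha] := rayleigh_min n0 sA; apply: le_trans (Ha x).
  by rewrite ler_wpM2r ?sq_ge0 //; case/andP: (H a ea).
have [a ea Ha] := rayleigh_min n0 (symN sA).
have ea' : eigenvalue A (- a).
  case/eigenvalueP: ea => v va v0; apply/eigenvalueP; exists v => //.
  by rewrite scaleNr -va mulmxN opprK.
have := Ha x; rewrite qfNm => h; case/andP: (H _ ea') => _ h2.
have := sq_ge0 x; nra.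
Qed.

Lemma pucci_set_scalar ga Ga : (0 < n)%N -> ga <= Ga -> pucci_set ga Ga (ga%:M : 'M[R]_n).
Proof.
move=> n0 gG; split; first exact: sym_scalar.
move=> a /eigenvalueP[v]; rewrite mul_mx_scalar => /eqP; rewrite -subr_eq0 -scalerBl.
rewrite scaler_eq0 => /orP[|/eqP -> /eqP //]; rewrite subr_eq0 => /eqP <- _.
by rewrite lexx gG.
Qed.

Lemma ell_scalar_tr ga Ga A : (0 <= Ga) -> ell ga Ga A -> n%:R * ga <= \tr A <= n%:R * Ga.
Proof.
move=> G0 [sA H].
have b i : ga <= A i i <= Ga by have := H (delta_mx 0 i); rewrite qf_delta sq_delta !mulr1.
rewrite -[n in n%:R]card_ord !mulr_natl -!sumr_const /mxtrace; apply/andP.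
by split; apply: ler_sum => i _; case/andP: (b i).
Qed.

Lemma ell_tr_psd ga Ga A B : ell ga Ga A -> Defs.symmetric B ->
  (forall x, 0 <= qf B x) -> ga * \tr B <= \tr (A *m B) <= Ga * \tr B.
Proof.
move=> [sA H] sB pB.
have h1 : 0 <= \tr ((A - ga%:M) *m B).
  by apply: tr_psd_ge0 => // x; rewrite qfBm qf_scalar subr_ge0; case/andP: (H x).
have h2 : 0 <= \tr ((Ga%:M - A) *m B).
  by apply: tr_psd_ge0 => // x; rewrite qfBm qf_scalar subr_ge0; case/andP: (H x).
move: h1 h2; rewrite !mulmxBl !mul_scalar_mx !raddfB /= !mxtraceZ !subr_ge0 => h1 h2.
by rewrite h1 h2.
Qed.

(** For a unit vector, [1%:M - outer x] is semidefinite by Cauchy-Schwarz, so its trace against [B]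
    is nonnegative. *)
Lemma tr_psd_lb B x : Defs.symmetric B -> (forall x, 0 <= qf B x) -> sq x = 1 -> qf B x <= \tr B.
Proof.
move=> sB pB x1.
have H y : 0 <= qf (1%:M - outer x) y.
  rewrite qfBm qf_scalar mul1r qf_outer subr_ge0; apply: le_trans (cauchy_schwarz _ _) _.
  by rewrite x1 mul1r.
have := tr_psd_ge0 H sB pB.
by rewrite mulmxBl mul1mx linearB /= mxtrace_mulC tr_mul_outer subr_ge0.
Qed.

End Psd.

(** * Second-order jets *)

Section Jets.
Context {R : realType} {n : nat}.
Notation E := 'rV[R]_n.
Implicit Types (x y p : E) (A B M N X Y : 'M[R]_n) (u v w : E -> R).

(** The touching quadratic is exact, with no second-order remainder: it is itself a [C^2] test
    function, so viscosity inequalities apply to such jets directly. *)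
Definition ujet u x p M := exists2 d : R, 0 < d & forall y, `|y - x| < d ->
  u y <= u x + dot p (y - x) + 2^-1 * qf M (y - x).
Definition ljet u x p M := exists2 d : R, 0 < d & forall y, `|y - x| < d ->
  u x + dot p (y - x) + 2^-1 * qf M (y - x) <= u y.

Definition quad (c : R) p M x0 : E -> R := fun y => c + dot p (y - x0) + 2^-1 * qf M (y - x0).

Lemma quad_differentiable c p M x0 x : differentiable (quad c p M x0) x.
Proof.
have dc i : differentiable (fun y : E => (y - x0) 0 i) x.
  have -> : (fun y : E => (y - x0) 0 i) = (fun y : E => y 0 i) - cst (x0 0 i).
    by apply/funext => y; rewrite !mxE.
  by apply: differentiableB; [exact: differentiable_coord | exact: differentiable_cst].
have -> : quad c p M x0 = cst c + (\sum_i (p 0 i *: (fun y : E => (y - x0) 0 i))) +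
   2^-1 *: (\sum_i \sum_j (M i j *: ((fun y : E => (y - x0) 0 i) * (fun y : E => (y - x0) 0 j)))).
  apply/funext => y; rewrite /quad /qf dot_mulmx /dot.
  rewrite !fctE !fct_sumE; congr (_ + _ + _ * _).
  by apply: eq_bigr => i _; rewrite fct_sumE.
apply: differentiableD; last first.
  apply: differentiableZ; apply: differentiable_sum => i; apply: differentiable_sum => j.
  by apply: differentiableZ; apply: differentiableM.
apply: differentiableD; first exact: differentiable_cst.
by apply: differentiable_sum => i; apply: differentiableZ.
Qed.

Lemma derive_poly2 (f : E -> R) (x v : E) (a b : R) :
  (forall h : R, f (h *: v + x) - f x = h * a + h ^+ 2 * b) -> 'D_v f x = a.
Proof.
move=> H; apply: cvg_lim => //.
have : (fun h : R => a + h * b) @ 0^' --> a.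
  suff : (fun h : R => a + h * b) @ 0^' --> a + 0 * b by rewrite mul0r addr0.
  apply: cvgD; first exact: cvg_cst.
  apply: cvgM; last exact: cvg_cst.
  exact: (@cvg_within _ (nbhs (0:R))).
apply: cvg_trans; apply: near_eq_cvg; near=> h.
have h0 : h != 0 by near: h; exact: nbhs_dnbhs_neq.
by rewrite /= H /GRing.scale /=; field.
Unshelve. all: by end_near. Qed.

Lemma pd_quad c p M x0 i : Defs.symmetric M ->
  pd i (quad c p M x0) = quad (p 0 i) (row i M) 0 x0.
Proof.
move=> sM; apply/funext => x; apply: (derive_poly2 (b := 2^-1 * M i i)) => h.
have e : (h *: delta_mx 0 i + x) - x0 = (x - x0) + h *: delta_mx 0 i by rewrite -addrA addrC.
rewrite /quad e; move: (x - x0) => y; rewrite qfD // qfZ qf_delta !dotE qf0m !dot_delta.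
rewrite -(dot_delta (y *m M)) dot_sym // -rowE; by field.
Qed.

Lemma Ck_quad (O : set E) k c p M x0 : Defs.symmetric M -> Ck_on O k (quad c p M x0).
Proof.
elim: k c p M => [|k IH] c p M sM /=.
  by move=> x _; apply: differentiable_continuous; exact: quad_differentiable.
split; first by move=> x _; apply: differentiable_continuous; exact: quad_differentiable.
split; first by move=> x _; exact: quad_differentiable.
by move=> i; rewrite pd_quad //; apply: IH; exact: sym0.
Qed.

Lemma quad_center c p M x0 : quad c p M x0 x0 = c.
Proof. by rewrite /quad subrr dot0r qf0 mulr0 !addr0. Qed.

Lemma grad_quad c p M x0 : Defs.symmetric M -> grad (quad c p M x0) x0 = p.
Proof. by move=> sM; apply/rowP => i; rewrite mxE pd_quad // quad_center. Qed.

Lemma hess_quad c p M x0 : Defs.symmetric M -> hess (quad c p M x0) x0 = M.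
Proof.
move=> sM; apply/matrixP => i j; rewrite mxE pd_quad // pd_quad ?quad_center; last exact: sym0.
by rewrite mxE -[in RHS]sM mxE.
Qed.

Definition Fsub (O : set E) (F : op_type R n) (g u : E -> R) := forall x p M,
  O x -> Defs.symmetric M -> ujet u x p M -> F M p (u x) x <= g x.
Definition Fsup (O : set E) (F : op_type R n) (g u : E -> R) := forall x p M,
  O x -> Defs.symmetric M -> ljet u x p M -> g x <= F M p (u x) x.

Lemma visc_sub_Fsub O F g u : visc_sub O F g u -> Fsub O F g u.
Proof.
move=> [_ H] x p M Ox sM [d d0 J].
have := H (quad (u x) p M x) x (Ck_quad _ _ _ _ _ sM) Ox.
rewrite grad_quad // hess_quad //; apply; apply/nearP_eps; exists d => // y yx.
by rewrite quad_center subrr subr_le0 /quad; exact: J.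
Qed.

Lemma visc_super_Fsup O F g u : visc_super O F g u -> Fsup O F g u.
Proof.
move=> [_ H] x p M Ox sM [d d0 J].
have := H (quad (u x) p M x) x (Ck_quad _ _ _ _ _ sM) Ox.
rewrite grad_quad // hess_quad //; apply; apply/nearP_eps; exists d => // y yx.
by rewrite quad_center subrr subr_ge0 /quad; exact: J.
Qed.

(** Viscosity form of [P^-(D^2 w) <= d1 |Dw| + g], the infimum over the class [ell] being replaced
    by an arbitrary lower bound [c], so that it never has to be computed. *)
Definition Psub (ga Ga d1 : R) (D : set E) (g w : E -> R) := forall x p M c,
  D x -> Defs.symmetric M -> ujet w x p M ->
  (forall A, ell ga Ga A -> c <= - \tr (A *m M)) -> c <= d1 * `|p| + g x.

Lemma ujetN u x p M : ujet (fun y => - u y) x p M -> ljet u x (- p) (- M).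
Proof.
by move=> [d d0 H]; exists d => // y /H; rewrite dotNl qfNm => h; lra.
Qed.
Lemma ljetN u x p M : ljet (fun y => - u y) x p M -> ujet u x (- p) (- M).
Proof.
by move=> [d d0 H]; exists d => // y /H; rewrite dotNl qfNm => h; lra.
Qed.

Lemma ujetZ t u x p M : 0 < t -> ujet (fun y => t * u y) x p M -> ujet u x (t^-1 *: p) (t^-1 *: M).
Proof.
move=> t0 [d d0 H]; exists d => // y /H; rewrite dotZl qfZm.
rewrite -(ler_pM2l (x := t^-1)) ?invr_gt0 // mulKf ?gt_eqF // => /le_trans; apply.
by rewrite !mulrDr mulKf ?gt_eqF // (mulrCA t^-1 2^-1).
Qed.

End Jets.

Section Operator.
Context {R : realType} {n : nat}.
Notation E := 'rV[R]_n.
Variables (O : set E) (F : op_type R n).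
Implicit Types (x y p : E) (A B M N X Y : 'M[R]_n).
Hypothesis n0 : (0 < n)%N.

(* The lower bound of (F2) with the infimum unfolded; exchanging the arguments gives the upper one *)
Definition F2low (d1 d0 ga Ga : R) := forall M N p q z w x c,
  Defs.symmetric M -> Defs.symmetric N -> O x ->
  (forall A, ell ga Ga A -> c <= - \tr (A *m (M - N))) ->
  c - d1 * `|p - q| - d0 * `|z - w| <= F M p z x - F N q w x.

Lemma F2_F2low : F2 O F -> exists d1 d0 ga Ga,
  [/\ 0 <= d1, 0 <= d0, 0 < ga, ga <= Ga & F2low d1 d0 ga Ga].
Proof.
move=> [d1 [d0 [ga [Ga [d10 [d00 [ga0 [gG H]]]]]]]].
exists d1, d0, ga, Ga; split=> // M N p q z w x c sM sN Ox Hc.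
have [h _] := H M N p q z w x sM sN Ox; apply: le_trans h; rewrite !lerD2r.
apply: lb_le_inf.
  by exists (- \tr (ga%:M *m (M - N))), ga%:M => //; exact: pucci_set_scalar.
by move=> _ [A pA <-]; apply: Hc; exact: pucci_set_ell.
Qed.

(** By homogeneity the arguments may be shrunk by a factor [t] before (F1) is used with [K = 1], and
    the result divided by [t]. Choosing [t] so that the argument of the modulus stays below [s0]
    turns an arbitrary modulus into a small multiple of [1 + |p| + |z|] plus a term linear in
    [|M|]. *)
Lemma F1_modulus : F1 O F -> F3 O F -> exists2 nu : R, 2^-1 < nu <= 1 &
  forall th, 0 < th -> exists r C : R, [/\ 0 < r, r <= 1, 0 <= C &
  forall M p z x y, Defs.symmetric M -> O x -> O y -> `|x - y| <= r ->
  `|F M p z x - F M p z y| <= th * (1 + `|p| + `|z|) + C * (`|x - y| `^ nu * `|M|)].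
Proof.
move=> /(_ 1 ltr01)[om [nu [mono [omc [om0 [_ [nuh H]]]]]]] h3.
exists nu => // th th0.
have [s0 s0p Hs] : exists2 s0, 0 < s0 & forall t, 0 <= t -> t <= s0 -> om t <= th.
  move: omc => /continuous_within_itvcyP[_ /cvgrPdist_lt/(_ th th0)].
  move=> [e /= e0 He]; exists (e / 2); first by rewrite divr_gt0.
  move=> t; rewrite le_eqVlt => /orP[/eqP <- _|t0 te]; first by rewrite om0 ltW.
  have /= := He t; rewrite om0 sub0r normrN sub0r normrN gtr0_norm // => /(_ _ t0).
  by move=> h; apply: le_trans (ler_norm _) (ltW (h _)); lra.
(* Since [nu > 1/2] and [|x - y| <= 1], a distance of at most [(s0 / 2) ^+ 2] makes [|x - y| ^ nu]
   at most [s0 / 2]. *)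
pose r := Num.min 1 ((s0 / 2) ^+ 2); have r0 : 0 < r by rewrite lt_min ltr01 exprn_gt0 // divr_gt0.
exists r, (2 * th / s0); split => //.
- by rewrite ge_min lexx.
- by rewrite divr_ge0 ?mulr_ge0 // ltW.
move=> M p z x y sM Ox Oy xyr; set D := `|x - y| `^ nu.
have D0 : 0 <= D by exact: powR_ge0.
have Ds : D <= s0 / 2.
  have [xy0|xy0] := eqVneq `|x - y| 0.
    rewrite /D xy0 powR0; last by case/andP: nuh => h _; rewrite gt_eqF //; apply: lt_trans h; rewrite invr_gt0.
    by rewrite divr_ge0 // ltW.
  have xyp : 0 < `|x - y| by rewrite lt_def xy0 normr_ge0.
  have xy1 : `|x - y| <= 1 by apply: le_trans xyr _; rewrite ge_min lexx.
  apply: (@le_trans _ _ (`|x - y| `^ 2^-1)).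
    by apply: ger_powR; [rewrite xyp xy1 | case/andP: nuh => /ltW].
  rewrite powR12_sqrt // -[leRHS]gtr0_norm ?divr_gt0 // -sqrtr_sqr ler_wsqrtr //.
  by apply: le_trans xyr _; rewrite ge_min lexx orbT.
pose a := (1 + `|p| + `|z|)^-1.
have w0 : 0 < 1 + `|p| + `|z| by have := normr_ge0 p; have := normr_ge0 z; lra.
have a0 : 0 < a by rewrite invr_gt0.
have key t : 0 < t -> t <= a -> D * (t * `|M| + 1) <= s0 ->
  `|F M p z x - F M p z y| <= t^-1 * th.
  move=> t0 ta Hts; rewrite mulrC ler_pdivlMr // mulrC -{1}(gtr0_norm t0) -normrM mulrBr -!h3 ?(ltW t0) //.
  have small (q : R) : 0 <= q -> q <= 1 + `|p| + `|z| -> t * q <= 1.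
    move=> q0 qw; apply: (@le_trans _ _ (a * q)); first by rewrite ler_wpM2r.
    by rewrite mulrC ler_pdivrMr // mul1r.
  apply: le_trans (H _ _ _ _ _ _ _ _ Ox Oy) _.
  - exact: symZ.
  - by rewrite normrZ gtr0_norm //; apply: small => //; have := normr_ge0 z; lra.
  - by rewrite normrM gtr0_norm //; apply: small => //; have := normr_ge0 p; lra.
  apply: Hs; first by rewrite mulr_ge0 // addr_ge0.
  by rewrite normrZ (gtr0_norm t0).
have [hs|hs] := leP (D * (a * `|M|)) (s0 / 2).
  apply: le_trans (key a a0 (lexx _) _) _; first by rewrite mulrDr mulr1; lra.
  rewrite invrK mulrC lerDl !mulr_ge0 // ?invr_ge0 ?ltW //.
have [s Es] : exists s, s = D * (a * `|M|) by eexists.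
rewrite -Es in hs.
have sp : 0 < s by apply: lt_trans hs; rewrite divr_gt0.
(* For large [|M|] the factor is reduced until [D * (t * |M|)] equals [s0 / 2]; dividing by [t] then
   costs a multiple of [D * |M|]. *)
pose t := a * (s0 / (2 * s)).
have t0 : 0 < t by rewrite mulr_gt0 // divr_gt0 // mulr_gt0.
apply: le_trans (key t t0 _ _) _.
- rewrite /t ger_pMr // ler_pdivrMr ?mulr_gt0 //; lra.
- have -> : D * (t * `|M| + 1) = s * (s0 / (2 * s)) + D.
    by rewrite /t; move: (s0 / _) => q; rewrite Es; ring.
  have -> : s * (s0 / (2 * s)) = s0 / 2 by field; rewrite gt_eqF.
  lra.
have -> : t^-1 * th = 2 * th / s0 * (D * `|M|).
  have -> : t^-1 * th = 2 * th / s0 * (s / a) by rewrite /t; field; rewrite !gt_eqF.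
  by congr (_ * _); rewrite Es; field; rewrite gt_eqF.
by rewrite lerDr mulr_ge0 // ltW.
Qed.

End Operator.

(** * Averaged slopes over nested cubes *)

Section Cells.
Context {R : realType} {m b' : nat}.
Notation E := 'rV[R]_m.
Notation b := b'.+1.
Notation idx := {ffun 'I_m -> 'I_b}.
Variables (h L : R) (G : E -> E) (K : set E).
Hypotheses (h0 : 0 < h) (L0 : 0 <= L) (GL : forall x y, `|G x - G y| <= L * `|x - y|).
Implicit Types (x y z : E) (j : nat) (c : idx).

Definition cvec c : E := \row_i (c i)%:R.
Definition side j : R := h * b%:R ^+ j.
Definition cell j x : set E := [set z | forall i, x 0 i <= z 0 i < x 0 i + side j].
Definition sub_corner j x c : E := x + side j *: cvec c.
Definition nb : R := #|{: idx}|%:R.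
Definition fr2 (M : 'M[R]_m) : R := \sum_i \sum_k M i k ^+ 2.

(** A discrete mean of the Jacobian of [G] over a cell: difference quotients at mesh [h], averaged
    over the sub-cells at each level. [energy] averages their squares in the same way, so that
    [energy] minus [fr2] of [slope] is a variance. *)
Fixpoint slope j x : 'M[R]_m := match j with
  | 0 => \matrix_(i, k) (h^-1 * (G (x + h *: delta_mx 0 i) - G x) 0 k)
  | j.+1 => nb^-1 *: \sum_c slope j (sub_corner j x c) end.
Fixpoint energy j x : R := match j with
  | 0 => fr2 (slope 0 x)
  | j.+1 => nb^-1 * \sum_c energy j (sub_corner j x c) end.
Definition hit j x : bool := `[< exists2 z, K z & cell j x z >].
Fixpoint hitfrac j x : R := match j with
  | 0 => (hit 0 x)%:R
  | j.+1 => nb^-1 * \sum_c hitfrac j (sub_corner j x c) end.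

Lemma side_gt0 j : 0 < side j.
Proof. by rewrite mulr_gt0 // exprn_gt0 // ltr0n. Qed.
Lemma sideS j : side j.+1 = b%:R * side j.
Proof. by rewrite /side exprS; ring. Qed.
Lemma nb_gt0 : 0 < nb.
Proof. by rewrite /nb card_ffun !card_ord ltr0n expn_gt0. Qed.
Lemma nbE : nb = b%:R ^+ m.
Proof. by rewrite /nb card_ffun !card_ord natrX. Qed.

Lemma fr2_ge0 M : 0 <= fr2 M.
Proof. by apply: sumr_ge0 => i _; apply: sumr_ge0 => k _; exact: sqr_ge0. Qed.

Lemma avg_fr2 (B : idx -> 'M[R]_m) (A := nb^-1 *: \sum_c B c) :
  nb^-1 * \sum_c fr2 (B c) - fr2 A = nb^-1 * \sum_c fr2 (B c - A).
Proof.
have sumB i k : \sum_c B c i k = nb * A i k.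
  by rewrite /A mxE summxE mulVKf // gt_eqF // nb_gt0.
have -> : \sum_c fr2 (B c - A) = \sum_i \sum_k \sum_c (B c i k ^+ 2 - 2 * A i k * B c i k + A i k ^+ 2).
  rewrite exchange_big; apply: eq_bigr => i _; rewrite exchange_big; apply: eq_bigr => k _.
  by apply: eq_bigr => c _; rewrite !mxE; ring.
have -> : \sum_c fr2 (B c) = \sum_i \sum_k \sum_c B c i k ^+ 2.
  by rewrite exchange_big; apply: eq_bigr => i _; rewrite exchange_big.
rewrite /fr2 !mulr_sumr -sumrB; apply: eq_bigr => i _; rewrite !mulr_sumr -sumrB.
apply: eq_bigr => k _.
rewrite big_split sumrB /= -mulr_sumr sumB sumr_const -/nb -mulr_natl -/nb.
by field; rewrite gt_eqF // nb_gt0.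
Qed.

Lemma sub_cell j x c z : cell j (sub_corner j x c) z -> cell j.+1 x z.
Proof.
move=> H i; have /andP[] := H i; rewrite !mxE => h1 h2.
have s0 := side_gt0 j; apply/andP; split.
  by apply: le_trans h1; rewrite lerDl mulr_ge0 // ltW.
apply: lt_le_trans h2 _; rewrite sideS -addrA lerD2l.
have : (c i)%:R + 1 <= b%:R :> R by rewrite natr1 ler_nat.
by nra.
Qed.

Lemma cell_split j x z : cell j.+1 x z -> exists c, cell j (sub_corner j x c) z.
Proof.
move=> H; have s0 := side_gt0 j.
have q i : 0 <= (z 0 i - x 0 i) / side j < b%:R.
  have /andP[h1 h2] := H i; rewrite divr_ge0 ?subr_ge0 ?(ltW s0) //=.
  by rewrite ltr_pdivrMr // -sideS; lra.
have t (i : 'I_m) : (Num.truncn ((z 0 i - x 0 i) / side j)%R < b)%N.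
  have /andP[h1 h2] := q i; rewrite -(ltr_nat R); apply: le_lt_trans h2.
  by have /andP[] := truncn_itv h1.
exists [ffun i => Ordinal (t i)] => i; rewrite !mxE ffunE /=.
have /andP[h1 _] := q i; have /andP[h3 h4] := truncn_itv h1.
move: h3 h4; rewrite ler_pdivlMr // ltr_pdivrMr // -natr1 => h3 h4.
by apply/andP; split; nra.
Qed.

Lemma hit_sub j x c : hit j (sub_corner j x c) -> hit j.+1 x.
Proof. by move=> /asboolP[z Kz /sub_cell cz]; apply/asboolP; exists z. Qed.

Lemma frac_ge0 j x : 0 <= hitfrac j x.
Proof.
elim: j x => [|j IH] x /=; first by rewrite ler0n.
by rewrite mulr_ge0 ?invr_ge0 ?(ltW nb_gt0) // sumr_ge0.
Qed.

Lemma avg_le (f : idx -> R) a : (forall c, f c <= a) -> nb^-1 * \sum_c f c <= a.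
Proof.
move=> H; rewrite ler_pdivrMl ?nb_gt0 // /nb mulr_natl -sumr_const.
exact: ler_sum.
Qed.
Lemma avg_ge (f : idx -> R) a : (forall c, a <= f c) -> a <= nb^-1 * \sum_c f c.
Proof.
move=> H; rewrite ler_pdivlMl ?nb_gt0 // /nb mulr_natl -sumr_const.
exact: ler_sum.
Qed.
Lemma avg_ge1 (f : idx -> R) c a : (forall c, 0 <= f c) -> a <= f c -> nb^-1 * a <= nb^-1 * \sum_c f c.
Proof.
move=> H fc; rewrite ler_pM2l ?invr_gt0 ?nb_gt0 // (bigD1 c) //= -[leLHS]addr0.
by apply: lerD => //; apply: sumr_ge0.
Qed.

Lemma frac_le_hit j x : hitfrac j x <= (hit j x)%:R.
Proof.
elim: j x => [|j IH] x //=; apply: avg_le => c; apply: le_trans (IH _) _.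
by rewrite ler_nat; case: (boolP (hit j _)) => // /hit_sub ->.
Qed.

(** [K] is present at the scale of the sub-cells, and the mean Jacobian hardly changes from one
    sub-cell to another. Both are needed to expand a function along points of [K] with a nearly
    affine gradient. *)
Definition good th j x := [/\ hit j.+1 x, forall c, hit j (sub_corner j x c) &
  forall c, fr2 (slope j (sub_corner j x c) - slope j.+1 x) <= th].

(* [slope] averages the slopes of the sub-cells, so a cell that is hit without being good raises the energy
   by a definite amount; as the energy is bounded, good cells exist. *)
Lemma energy_growth th be J : 0 <= be -> be <= nb^-1 -> be <= nb^-1 * th ->
  (forall j x, (j < J)%N -> ~ good th j x) -> forall j x, (j <= J)%N ->
  j%:R * be * hitfrac j x <= energy j x - fr2 (slope j x) - hitfrac j x + (hit j x)%:R.
Proof.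
move=> be0 be1 be2 ng; elim=> [|j IH] x jJ /=; first by rewrite !mul0r; lra.
set A := nb^-1 *: _; set T := \sum_c hitfrac _ _.
pose B c := slope j (sub_corner j x c).
have ev := avg_fr2 B; rewrite -/A in ev.
have step : nb^-1 * \sum_c (j%:R * be * hitfrac j (sub_corner j x c)) <=
   nb^-1 * \sum_c (energy j (sub_corner j x c) - fr2 (B c) - hitfrac j (sub_corner j x c)
     + (hit j (sub_corner j x c))%:R).
  by rewrite ler_pM2l ?invr_gt0 ?nb_gt0 //; apply: ler_sum => c _; apply: IH; exact: ltnW.
move: step; rewrite -mulr_sumr -/T big_split sumrB sumrB /= -/T.
set En := \sum_c energy _ _; set Fr := \sum_c fr2 (B c); set H := \sum_c _%:R => step.
have fB : nb^-1 * \sum_c fr2 (B c - A) >= 0.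
  by apply: avg_ge => c; exact: fr2_ge0.
have HH : nb^-1 * H <= (hit j.+1 x)%:R.
  apply: avg_le => c; rewrite ler_nat.
  by case: (boolP (hit j _)) => // /hit_sub ->.
have T0 : 0 <= nb^-1 * T <= (hit j.+1 x)%:R.
  by apply/andP; split; [exact: (frac_ge0 j.+1 x) | exact: (frac_le_hit j.+1 x)].
(* A hit cell that is not good has a sub-cell that is not hit, which lowers the average of [hit] by
   at least [nb^-1], or a sub-cell whose slope deviates, which adds at least [nb^-1 * th] to the
   variance. Both are at least [be]. In a cell that is not hit the fraction is zero. *)
have gain : be * (nb^-1 * T) <= nb^-1 * \sum_c fr2 (B c - A) + ((hit j.+1 x)%:R - nb^-1 * H).
  case: (boolP (hit j.+1 x)) => [hx|hx]; last first.
    rewrite (negbTE hx) /= ?mulr0n in T0 HH *; case/andP: T0 => t1 t2.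
    by have -> : nb^-1 * T = 0; [apply/eqP; rewrite eq_le t1 t2 | lra].
  rewrite hx /= in HH T0 *.
  suff : be <= nb^-1 * \sum_c fr2 (B c - A) + (1 - nb^-1 * H) by case/andP: T0 => ? ?; nra.
  have := ng j x jJ; have [allh|/existsNP[c /negP nh]] := pselect (forall c, hit j (sub_corner j x c)).
    move=> ngx; have [H1|/existsNP[c /negP]] := pselect (forall c, fr2 (B c - A) <= th).
      by exfalso; apply: ngx; split.
    rewrite -ltNge => /ltW thc.
    have := @avg_ge1 (fun c => fr2 (B c - A)) c th (fun c => fr2_ge0 _) thc; lra.
  move=> _; have : nb^-1 * 1 <= nb^-1 * \sum_c (1 - (hit j (sub_corner j x c))%:R).
    apply: (avg_ge1 (c := c)) => [c'|]; last by rewrite (negbTE nh) subr0.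
    by case: (hit j _); rewrite ?subrr ?subr0.
  rewrite sumrB sumr_const -/nb -/H mulrBr mulVf ?gt_eqF ?nb_gt0 //; lra.
rewrite -natr1; move: ev step gain => ev step gain.
have e1 : nb^-1 * (j%:R * be * T) = j%:R * be * (nb^-1 * T) by ring.
have e2 : nb^-1 * (En - Fr - T + H) = nb^-1 * En - nb^-1 * Fr - nb^-1 * T + nb^-1 * H by ring.
have e3 : (j%:R + 1) * be * (nb^-1 * T) = j%:R * be * (nb^-1 * T) + be * (nb^-1 * T) by ring.
have ev' : nb^-1 * Fr - fr2 A = nb^-1 * \sum_c fr2 (B c - A) := ev.
rewrite e1 e2 in step; rewrite e3; lra.
Qed.

Lemma slope_bound j x i k : `|slope j x i k| <= L.
Proof.
elim: j x => [|j IH] x.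
  rewrite /= mxE normrM gtr0_norm ?invr_gt0 // ler_pdivrMl //.
  apply: le_trans (normv_coord _ _) _; apply: le_trans (GL _ _) _.
  rewrite addrAC subrr add0r normrZ gtr0_norm // mulrC ler_wpM2r //.
  by rewrite ger_pMr //; apply: normv_le => // l; rewrite mxE eqxx /=; case: (l == i); rewrite ?normr1 ?normr0.
rewrite /= mxE normrM gtr0_norm ?invr_gt0 ?nb_gt0 // summxE.
apply: (@le_trans _ _ (nb^-1 * \sum_c `|slope j (sub_corner j x c) i k|)).
  by rewrite ler_pM2l ?invr_gt0 ?nb_gt0 // ler_norm_sum.
by apply: avg_le => c; exact: IH.
Qed.

Lemma energy_le j x : energy j x <= m%:R * (m%:R * L ^+ 2).
Proof.
elim: j x => [|j IH] x; last by rewrite /=; apply: avg_le => c; exact: IH.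
rewrite /energy /fr2 -[m in leRHS]card_ord !mulr_natl -!sumr_const.
apply: ler_sum => i _; apply: ler_sum => k _.
rewrite -real_normK ?num_real //; apply: lerXn2r; rewrite ?nnegrE //.
exact: (slope_bound 0).
Qed.

(** Points at mutual distance at least [h] lie in distinct smallest cells, of which a cell of level
    [j] contains [nb ^+ j]. *)
Lemma frac_count (I : finType) (zz : I -> E) : (forall i, K (zz i)) ->
  (forall i i', i != i' -> h <= `|zz i - zz i'|) -> forall j x,
  (\sum_(i | `[< cell j x (zz i) >]) 1 : R) <= nb ^+ j * hitfrac j x.
Proof.
move=> Kz sep; elim=> [|j IH] x.
  rewrite expr0 mul1r /=; have [i /asboolP ci|H] := pickP (fun i => `[< cell 0 x (zz i) >]).
    have -> : hit 0 x by apply/asboolP; exists (zz i).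
    rewrite (bigD1 i) /=; last exact/asboolP.
    rewrite big1 ?addr0 // => i' /andP[/asboolP ci' ii'].
    have := sep _ _ ii'; rewrite leNgt => /negP; case.
    apply: normv_lt => // k; have /andP[] := ci k; have /andP[] := ci' k.
    rewrite !mxE /side expr0 mulr1 ltr_norml => *; apply/andP; split; lra.
  by rewrite big_pred0 // ler0n.
rewrite exprSr /= -mulrA mulVKf ?gt_eqF ?nb_gt0 // mulr_sumr.
apply: (@le_trans _ _ (\sum_c \sum_(i | `[< cell j (sub_corner j x c) (zz i) >]) 1)); last first.
  by apply: ler_sum => c _; exact: IH.
rewrite (exchange_big_dep xpredT) //= [leLHS]big_mkcond; apply: ler_sum => i _.
case: asboolP => [/cell_split[c cc]|_]; last by apply: sumr_ge0.
by rewrite (bigD1 c) /= ?lerDl ?sumr_ge0 //; exact/asboolP.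
Qed.

Definition upd c i k : idx := [ffun l => if l == i then k else c l].

Lemma sum_upd (V : nmodType) (f : idx -> V) i :
  \sum_c f c = \sum_(c : idx | c i == ord0) \sum_k f (upd c i k).
Proof.
rewrite (partition_big (fun c => upd c i ord0) (fun c => c i == ord0)) /=; last first.
  by move=> c _; rewrite ffunE eqxx.
apply: eq_bigr => c /eqP c0.
rewrite (reindex_onto (fun k => upd c i k) (fun c => c i)) /=; last first.
  by move=> c' /eqP <-; apply/ffunP => l; rewrite !ffunE; case: eqP => [->|].
apply: eq_bigl => k; rewrite !ffunE eqxx eqxx andbT.
by apply/eqP/ffunP => l; rewrite !ffunE; case: eqP => [->|//]; rewrite c0.
Qed.

Definition nf i : R := #|[pred c : idx | c i == ord0]|%:R.
Lemma nbnf i : nb = b%:R * nf i.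
Proof.
have := @sum_upd R (fun=> 1) i; rewrite sumr_const -/nb => ->.
rewrite (eq_bigr (fun=> b%:R)); last by move=> c _; rewrite sumr_const card_ord.
by rewrite sumr_const; exact/esym/mulr_natr.
Qed.
Lemma nf_gt0 i : 0 < nf i.
Proof. by have := nb_gt0; rewrite (nbnf i) pmulr_rgt0 // ltr0n. Qed.

(** Mean of [G] over the lattice points on the lower face of the cell orthogonal to the [i]-th
    axis. *)
Fixpoint face i j x : E := match j with
  | 0 => G x
  | j.+1 => (nf i)^-1 *: \sum_(c : idx | c i == ord0) face i j (sub_corner j x c) end.

(** The difference quotients telescope along the [i]-th axis, so the mean Jacobian is a difference
    of means over opposite faces: a discrete divergence theorem. *)
Lemma slope_face i j x :
  row i (slope j x) = (side j)^-1 *: (face i j (x + side j *: delta_mx 0 i) - face i j x).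
Proof.
elim: j x => [|j IH] x.
  by apply/rowP => k; rewrite /= !mxE /side expr0 mulr1.
rewrite /= linearZ linear_sum /=.
under eq_bigr do rewrite IH.
rewrite (sum_upd _ i) -[(nf i)^-1 *: _ - _]scalerBr -sumrB !scaler_sumr.
apply: eq_bigr => c /eqP ci; rewrite -scaler_sumr.
pose g k := face i j (sub_corner j x c + (side j * k%:R) *: delta_mx 0 i).
have e k : sub_corner j x (upd c i k) = sub_corner j x c + (side j * k%:R) *: delta_mx 0 i.
  apply/rowP => l; rewrite !mxE ffunE eqxx /=; case: (eqVneq l i) => [->|_]; rewrite ?ci /=; ring.
under eq_bigr => k _.
  rewrite e (_ : _ + side j *: _ = sub_corner j x c + (side j * k.+1%:R) *: delta_mx 0 i); last first.
    by rewrite -addrA -scalerDl -natr1 mulrDr mulr1.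
  over.
rewrite -(big_mkord xpredT (fun k => g k.+1 - g k)) telescope_sumr // /g mulr0 scale0r addr0.
have -> : sub_corner j (x + side j.+1 *: delta_mx 0 i) c = sub_corner j x c + (side j * b%:R) *: delta_mx 0 i.
  by rewrite /sub_corner sideS (mulrC b%:R) addrAC.
rewrite !scalerA; congr (_ *: _).
rewrite sideS (nbnf i); field.
by rewrite !gt_eqF ?nf_gt0 ?side_gt0 ?ltr0n.
Qed.

Lemma cvec_norm c : `|cvec c| <= b%:R - 1.
Proof.
apply: normv_le => [|i]; first by rewrite subr_ge0 ler1n.
by rewrite mxE ger0_norm ?ler0n // lerBrDr natr1 ler_nat.
Qed.

Lemma face_close i j x : `|face i j x - G x| <= L * side j.
Proof.
elim: j x => [|j IH] x; first by rewrite /= subrr normr0 mulr_ge0 // ltW // side_gt0.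
have -> : face i j.+1 x - G x =
   (nf i)^-1 *: \sum_(c : idx | c i == ord0) (face i j (sub_corner j x c) - G x).
  rewrite sumrB scalerBr; congr (_ - _).
  by rewrite sumr_const -scaler_nat -/(nf i) scalerA mulVf ?scale1r // gt_eqF // nf_gt0.
rewrite normrZ gtr0_norm ?invr_gt0 ?nf_gt0 // ler_pdivrMl ?nf_gt0 //.
apply: le_trans (ler_norm_sum _ _ _) _; rewrite /nf mulr_natl -sumr_const.
apply: ler_sum => c _; rewrite -(subrKA (G (sub_corner j x c))).
apply: le_trans (ler_normD _ _) _.
have h2 : `|G (sub_corner j x c) - G x| <= L * (side j * (b%:R - 1)).
  apply: le_trans (GL _ _) _; rewrite ler_wpM2l // addrAC subrr add0r normrZ.
  by rewrite gtr0_norm ?side_gt0 // ler_pM2l ?side_gt0 // cvec_norm.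
apply: le_trans (lerD (IH _) h2) _; rewrite sideS le_eqVlt; apply/orP; left; apply/eqP; ring.
Qed.

Lemma fr2_entry M th i k : fr2 M <= th ^+ 2 -> 0 <= th -> `|M i k| <= th.
Proof.
move=> H th0; have : M i k ^+ 2 <= th ^+ 2.
  apply: le_trans H; rewrite /fr2 (bigD1 i) //= (bigD1 k) //= -addrA lerDl.
  by apply: addr_ge0; [apply: sumr_ge0 => l _; exact: sqr_ge0|
    apply: sumr_ge0 => l _; apply: sumr_ge0 => l' _; exact: sqr_ge0].
by rewrite -[M i k ^+ 2]real_normK ?num_real // ler_pXn2r // ?nnegrE.
Qed.

(** At each step along the axis the face means of a good cell move by [side j] times the common
    slope, up to [side j * th]. Passing from face means to point values costs [L * side j] at either
    end. Relative to [side j.+1] the total is of order [L / b + th], small for large [b]. *)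
Lemma good_row th j x i c k : 0 <= th -> good (th ^+ 2) j x -> c i = ord0 -> (k <= b)%N ->
  `|G (sub_corner j x c + (side j * k%:R) *: delta_mx 0 i) - G (sub_corner j x c)
    - (side j * k%:R) *: row i (slope j.+1 x)| <= side j * (2 * L + b%:R * th).
Proof.
move=> th0 [_ _ gd] ci kb; have s0 := side_gt0 j.
set y := sub_corner j x c; set A := slope j.+1 x.
pose g k := face i j (y + (side j * k%:R) *: delta_mx 0 i).
have stepk l : (l < k)%N -> `|g l.+1 - g l - side j *: row i A| <= side j * th.
  move=> lk; have lb : (l < b)%N by exact: leq_trans kb.
  have e : y + (side j * l%:R) *: delta_mx 0 i = sub_corner j x (upd c i (Ordinal lb)).
    rewrite /y; apply/rowP => l'; rewrite !mxE ffunE eqxx /=.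
    by case: (eqVneq l' i) => [->|_]; rewrite ?ci /=; ring.
  have e2 : y + (side j * l.+1%:R) *: delta_mx 0 i = sub_corner j x (upd c i (Ordinal lb)) + side j *: delta_mx 0 i.
    by rewrite -e; apply/rowP => l'; rewrite !mxE -natr1; ring.
  have := slope_face i j (sub_corner j x (upd c i (Ordinal lb))).
  rewrite -e2 -e -/(g l) -/(g l.+1) => /(congr1 (fun v => side j *: v)).
  rewrite scalerA mulfV ?gt_eqF // scale1r => <-; rewrite -scalerBr normrZ gtr0_norm // ler_pM2l //.
  apply: normv_le => // k'; rewrite !mxE.
  by have := fr2_entry i k' (gd (upd c i (Ordinal lb))) th0; rewrite -e !mxE.
have tele : `|g k - g 0%N - (side j * k%:R) *: row i A| <= k%:R * (side j * th).
  elim: {kb} k stepk => [|k IH] st; first by rewrite subrr mulr0 scale0r subrr normr0 mul0r.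
  have -> : g k.+1 - g 0%N - (side j * k.+1%:R) *: row i A =
     (g k - g 0%N - (side j * k%:R) *: row i A) + (g k.+1 - g k - side j *: row i A).
    by rewrite -natr1 mulrDr mulr1 scalerDl; apply/rowP => l; rewrite !mxE; ring.
  apply: le_trans (ler_normD _ _) _; rewrite -natr1 mulrDl mul1r; apply: lerD; last exact: st.
  by apply: IH => l lk; apply: st; exact: ltnW.
set v := (side j * k%:R) *: row i A in tele *.
have g0 : g 0%N = face i j y by rewrite /g mulr0 scale0r addr0.
have -> : G (y + (side j * k%:R) *: delta_mx 0 i) - G y - v =
  (g k - g 0%N - v) + (G (y + (side j * k%:R) *: delta_mx 0 i) - g k) + (g 0%N - G y).
  by apply/rowP => l; rewrite !mxE; ring.
apply: le_trans (ler_normD _ _) _; apply: le_trans (lerD (ler_normD _ _) (lexx _)) _.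
have h1 : `|G (y + (side j * k%:R) *: delta_mx 0 i) - g k| <= L * side j.
  by rewrite distrC; exact: face_close.
have h2 : `|g 0%N - G y| <= L * side j by rewrite g0; exact: face_close.
have h3 : k%:R * (side j * th) <= b%:R * (side j * th).
  by rewrite ler_wpM2r ?ler_nat // mulr_ge0 // ltW.
lra.
Qed.

(** The corner is reached one coordinate at a time, through intermediate corners, each leg being
    covered by [good_row]. *)
Lemma good_affine th j x c : 0 <= th -> good (th ^+ 2) j x ->
  `|G (sub_corner j x c) - G x - (side j *: cvec c) *m slope j.+1 x| <=
  m%:R * (side j * (2 * L + b%:R * th)).
Proof.
move=> th0 gd; set A := slope _ _; have s0 := side_gt0 j.
pose pre (l : nat) : idx := [ffun i : 'I_m => if (i < l)%N then c i else ord0].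
have main l : (l <= m)%N -> `|G (sub_corner j x (pre l)) - G x - (side j *: cvec (pre l)) *m A|
   <= l%:R * (side j * (2 * L + b%:R * th)).
  elim: l => [|l IH] lm.
    have -> : cvec (pre 0%N) = 0 by apply/rowP => i; rewrite !mxE ffunE.
    rewrite /sub_corner (_ : cvec _ = 0); last by apply/rowP => i; rewrite !mxE ffunE.
    by rewrite scaler0 addr0 subrr mul0mx subrr normr0 mul0r.
  pose i := Ordinal lm.
  have e : sub_corner j x (pre l.+1) = sub_corner j x (pre l) + (side j * (c i)%:R) *: delta_mx 0 i.
    apply/rowP => i'; rewrite !mxE !ffunE eqxx /= ltnS.
    case: (ltngtP i' l) => il.
    - have -> : (i' == i) = false by apply/negP => /eqP ei; rewrite ei /= ltnn in il.
      by rewrite /=; ring.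
    - have -> : (i' == i) = false by apply/negP => /eqP ei; rewrite ei /= ltnn in il.
      by rewrite /=; ring.
    - have -> : i' = i by apply/val_inj.
      by rewrite eqxx /=; ring.
  have e2 : (side j *: cvec (pre l.+1)) *m A = (side j *: cvec (pre l)) *m A + (side j * (c i)%:R) *: row i A.
    rewrite rowE scalemxAl -mulmxDl; congr (_ *m _).
    by move: e; rewrite /sub_corner -addrA => /addrI.
  have pi : pre l i = ord0 by rewrite ffunE /= ltnn.
  have := good_row th0 gd pi (ltnW (ltn_ord (c i))).
  rewrite -e -/A => h1.
  have -> : G (sub_corner j x (pre l.+1)) - G x - (side j *: cvec (pre l.+1)) *m A =
    (G (sub_corner j x (pre l.+1)) - G (sub_corner j x (pre l)) - (side j * (c i)%:R) *: row i A) +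
    (G (sub_corner j x (pre l)) - G x - (side j *: cvec (pre l)) *m A).
    by rewrite e2; apply/rowP => l'; rewrite !mxE; ring.
  apply: le_trans (ler_normD _ _) _; rewrite -natr1 mulrDl mul1r addrC.
  by apply: lerD => //; apply: IH; exact: ltnW.
have := main m (leqnn _).
have -> : pre m = c by apply/ffunP => i; rewrite ffunE ltn_ord.
by [].
Qed.

Lemma good_affine_pt th j x y : 0 <= th -> good (th ^+ 2) j x -> cell j.+1 x y ->
  `|G y - G x - (y - x) *m slope j.+1 x| <=
  (3 * m%:R + 1) * (side j.+1 * (L / b%:R + th)).
Proof.
move=> th0 gd cy; have [c cc] := cell_split cy; have s0 := side_gt0 j.
set A := slope _ _; set z := sub_corner j x c.
have yz : `|y - z| <= side j.
  apply: normv_le; first exact: ltW.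
  by move=> i; have /andP[h1 h2] := cc i; rewrite !mxE ler_norml; move: h1 h2; rewrite !mxE => *; apply/andP; split; lra.
have zx : side j *: cvec c = z - x by rewrite /z /sub_corner addrAC subrr add0r.
have := good_affine c th0 gd; rewrite zx -/z -/A => h1.
have h2 : `|G y - G z| <= L * side j by apply: le_trans (GL _ _) _; rewrite ler_wpM2l.
have h3 : `|(y - z) *m A| <= m%:R * (side j * L).
  apply: normv_le => [|k]; first by rewrite !mulr_ge0 // ltW.
  rewrite mxE; apply: le_trans (ler_norm_sum _ _ _) _.
  rewrite -[m in leRHS]card_ord mulr_natl -sumr_const; apply: ler_sum => i _.
  rewrite normrM ler_pM //; first by apply: le_trans yz; exact: normv_coord.
  exact: slope_bound.
have -> : G y - G x - (y - x) *m A = (G z - G x - (z - x) *m A) + (G y - G z) - (y - z) *m A.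
  by rewrite !mulmxBl; apply/rowP => k; rewrite !mxE; ring.
apply: le_trans (ler_normB _ _) _; apply: le_trans (lerD (ler_normD _ _) (lexx _)) _.
apply: le_trans (lerD (lerD h1 h2) h3) _.
have -> : (3 * m%:R + 1) * (side j.+1 * (L / b%:R + th)) =
  (3 * m%:R + 1) * (side j * (L + b%:R * th)).
  have : (b%:R : R) != 0 by rewrite pnatr_eq0.
  by rewrite sideS; move: (b%:R : R) => B B0; congr (_ * _); field.
have q1 : 0 <= side j * L by rewrite mulr_ge0 // ltW.
have q2 : 0 <= side j * (b%:R * th) by rewrite !mulr_ge0 // ?ltW.
have q3 : 0 <= m%:R * (side j * (b%:R * th)) by rewrite mulr_ge0.
nra.
Qed.

End Cells.

(** * Lipschitz extension of partial maps *)

Section Mcshane.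
Context {R : realType} {m : nat}.
Notation E := 'rV[R]_m.

(** The extension is the infimum of the cones [a + L * |x - z|] over the graph [T]; the Lipschitz
    condition makes this relation single-valued. *)
Lemma mcshane (T : E -> R -> Prop) (L : R) : 0 <= L -> (exists z a, T z a) ->
  (forall z1 a1 z2 a2, T z1 a1 -> T z2 a2 -> `|a1 - a2| <= L * `|z1 - z2|) ->
  exists g : E -> R, (forall z a, T z a -> g z = a) /\
    (forall x y, `|g x - g y| <= L * `|x - y|).
Proof.
move=> L0 [z0 [a0 T0]] H.
pose V x : set R := [set r | exists z a, T z a /\ r = a + L * `|x - z|].
have Vne x : V x !=set0 by exists (a0 + L * `|x - z0|), z0, a0.
have lbV x : lbound (V x) (a0 - L * `|x - z0|).
  move=> _ [z [a [Ta ->]]]; have := H _ _ _ _ T0 Ta; rewrite ler_norml => /andP[_ h].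
  have : `|z0 - z| <= `|x - z0| + `|x - z| by rewrite (distrC x) -[z0 - z](subrKA x) ler_normD.
  move=> h2; have h3 : L * `|z0 - z| <= L * (`|x - z0| + `|x - z|) by rewrite ler_wpM2l.
  lra.
have hV x : has_inf (V x) by split=> //; exists (a0 - L * `|x - z0|); exact: lbV.
exists (fun x => inf (V x)); split.
  move=> z a Ta; apply/eqP; rewrite eq_le; apply/andP; split.
    by apply: (ge_inf (hV z).2); exists z, a; rewrite subrr normr0 mulr0 addr0.
  apply: lb_le_inf => // _ [z' [a' [Ta' ->]]].
  by have := H _ _ _ _ Ta Ta'; rewrite ler_norml => /andP[_ h]; lra.
have half x y : inf (V x) - inf (V y) <= L * `|x - y|.
  rewrite lerBlDl -lerBlDr; apply: lb_le_inf => // _ [z [a [Ta ->]]].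
  rewrite lerBlDr; apply: (@le_trans _ _ (a + L * `|x - z|)).
    by apply: (ge_inf (hV x).2); exists z, a.
  rewrite -addrA lerD2l -mulrDr ler_wpM2l // -(subrKA y) addrC.
  by apply: le_trans (ler_normD _ _) _; rewrite addrC.
by move=> x y; rewrite ler_norml half andbT lerNl opprB (distrC x); exact: half.
Qed.

(** Each coordinate is extended separately; the constant is preserved because the norm is the sup
    norm. *)
Lemma mcshane_vec (T : E -> E -> Prop) (L : R) : 0 <= L -> (exists z a, T z a) ->
  (forall z1 a1 z2 a2, T z1 a1 -> T z2 a2 -> `|a1 - a2| <= L * `|z1 - z2|) ->
  exists g : E -> E, (forall z a, T z a -> g z = a) /\
    (forall x y, `|g x - g y| <= L * `|x - y|).
Proof.
move=> L0 [z0 [a0 T0]] H.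
have /choice[g Hg] (i : 'I_m) : exists g : E -> R, (forall z a, T z a -> g z = a 0 i) /\
    (forall x y, `|g x - g y| <= L * `|x - y|).
  have [| |g [g1 g2]] := @mcshane (fun z r => exists2 a, T z a & r = a 0 i) L L0.
  - by exists z0, (a0 0 i), a0.
  - move=> z1 _ z2 _ [a1 t1 ->] [a2 t2 ->]; apply: le_trans (H _ _ _ _ t1 t2).
    by have := normv_coord (a1 - a2) i; rewrite !mxE.
  - by exists g; split=> // z a Ta; apply: g1; exists a.
exists (fun x => \row_i g i x); split.
  by move=> z a Ta; apply/rowP => i; rewrite mxE; exact: (Hg i).1.
move=> x y; apply: normv_le => [|i]; first by rewrite mulr_ge0.
by rewrite !mxE; exact: (Hg i).2.
Qed.

End Mcshane.

Lemma natr_dist_ge1 (R : realDomainType) (a b : nat) : a != b -> 1 <= `|a%:R - b%:R : R|.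
Proof.
wlog ab : a b / (a < b)%N => [H nab|_].
  have [ab|ba|e] := ltngtP a b; first exact: H.
    by rewrite distrC; apply: H => //; rewrite eq_sym.
  by rewrite e eqxx in nab.
rewrite distrC; apply: le_trans (ler_norm _).
by rewrite -natrB ?(ltnW ab) // ler1n subn_gt0.
Qed.

(** * Existence of a scale at which a Lipschitz map is nearly affine *)

Section GoodScale.
Context {R : realType} {m : nat}.
Notation E := 'rV[R]_m.

(** Without a good cell below level [J], [energy_growth] bounds [J * be] times the hit fraction
    independently of [J]. But the values of [G] on [K] cover a cube of slopes, which keeps the hit
    fraction above [(r / (L * S)) ^+ m]; a large [J] is contradictory. *)
Lemma exists_good_scale (b' : nat) (G : E -> E) (K : set E) (L S r th : R) (x0 : E) :
  (0 < m)%N -> (0 < b')%N -> 0 < L -> 0 < S -> 0 < r -> 0 < th ->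
  (forall x y, `|G x - G y| <= L * `|x - y|) ->
  (forall z, K z -> forall i, x0 0 i <= z 0 i < x0 0 i + S) ->
  (forall p : E, (forall i, 0 <= p 0 i <= r) -> exists2 z, K z & G z = p) ->
  exists (x : E) (s : R) (A : 'M[R]_m), [/\ 0 < s, s <= S, (forall i k, `|A i k| <= L),
   (forall y : E, (forall i, x 0 i <= y 0 i < x 0 i + s) ->
      exists z, [/\ K z, forall i, x 0 i <= z 0 i < x 0 i + s & `|z - y| <= s / b'.+1%:R]) &
   (forall y : E, (forall i, x 0 i <= y 0 i < x 0 i + s) ->
     `|G y - G x - (y - x) *m A| <= (3 * m%:R + 1) * (s * (L / b'.+1%:R + th)))].
Proof.
move=> m0 b0 L0 S0 r0 th0 GL KS Ksurj.
set b := b'.+1; set B : R := b%:R; have B0 : 0 < B by rewrite ltr0n.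
pose N : R := nb (m := m) (b' := b').
have N0 : 0 < N by exact: nb_gt0.
have NE : N = B ^+ m by exact: nbE.
pose be := N^-1 * Num.min 1 (th ^+ 2).
have be0 : 0 < be by rewrite mulr_gt0 ?invr_gt0 // lt_min ltr01 exprn_gt0.
pose cst := (r / (L * S)) ^+ m; have c0 : 0 < cst by rewrite exprn_gt0 // divr_gt0 // mulr_gt0.
pose Q := m%:R * (m%:R * L ^+ 2) + 2.
pose J := (Num.truncn (Q / (be * cst))).+1.
have JQ : Q < J%:R * (be * cst).
  have Q0 : 0 <= Q / (be * cst).
    rewrite divr_ge0 //; last by rewrite mulr_ge0 // ltW.
    by rewrite /Q addr_ge0 // !mulr_ge0 // ltW.
  have /andP[_ h1] := truncn_itv Q0.
  by rewrite -(ltr_pdivrMr _ _ (mulr_gt0 be0 c0)); exact: h1.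
pose h := S / B ^+ J; have h0 : 0 < h by rewrite divr_gt0 // exprn_gt0.
have hS : side (b' := b') h J = S by rewrite /side /h mulfVK // gt_eqF // exprn_gt0.
have sideM j : (j <= J)%N -> side (b' := b') h j <= S.
  move=> jJ; rewrite -hS /side ler_pM2l //; apply: ler_weXn2l => //.
  by rewrite ler1n.
have [[j [x [jJ gd]]]|ng] := pselect (exists j x, (j < J)%N /\ good (b' := b') h G K (th ^+ 2) j x).
  exists x, (side (b' := b') h j.+1), (slope (b' := b') h G j.+1 x); split.
  - exact: side_gt0.
  - exact: sideM.
  - by move=> i k; apply: slope_bound => //; exact: ltW.
  - move=> y cy; have [c cc] := cell_split h0 (b' := b') cy.
    case: gd => _ hc _; have /asboolP[z Kz cz] := hc c.
    exists z; split=> //; first exact: (sub_cell h0 cz).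
    have s0 := side_gt0 (b' := b') h0 j.
    rewrite sideS mulrC mulKf ?pnatr_eq0 //; apply: normv_le => [|i]; first exact: ltW.
    by have /andP[? ?] := cc i; have /andP[? ?] := cz i; rewrite !mxE ler_norml; apply/andP; split; lra.
  - by move=> y cy; apply: (good_affine_pt (K := K)) => //; exact: ltW.
exfalso.
have H := energy_growth (b' := b') (G := G) (K := K) h0 (ltW be0) (th := th ^+ 2) (J := J).
have := H _ _ _ J x0 (leqnn _).
have -> : be <= nb (m := m) (b' := b') ^-1.
  by rewrite /be -[leRHS]mulr1 ler_pM2l ?invr_gt0 // ge_min lexx.
have -> : be <= nb (m := m) (b' := b') ^-1 * th ^+ 2.
  by rewrite ler_pM2l ?invr_gt0 // ge_min lexx orbT.
move=> /(_ isT isT) H1; have {}H1 := H1 _.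
set fr := hitfrac _ _ _ _ in H1.
have fr1 : cst <= fr.
  (* Slopes on a lattice of spacing [L * h] have preimages at mutual distance at least [h], the
     separation that [frac_count] asks for. *)
  pose t := L * h; have t0 : 0 < t by rewrite mulr_gt0.
  pose a' := Num.truncn (r / t); pose a := a'.+1.
  have ra : a'%:R * t <= r /\ r / t < a%:R.
    have /truncn_itv/andP[h1 h2] : 0 <= r / t by rewrite divr_ge0 // ltW.
    by split=> //; rewrite -ler_pdivlMr.
  pose pt (c : {ffun 'I_m -> 'I_a}) : E := \row_i ((c i)%:R * t).
  have ptr c i : 0 <= pt c 0 i <= r.
    rewrite mxE mulr_ge0 ?ler0n ?(ltW t0) //=; apply: le_trans ra.1.
    by rewrite ler_pM2r // ler_nat -ltnS ltn_ord.
  have /choice[zz Hzz] c : exists z, K z /\ G z = pt c.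
    by have [z Kz Gz] := Ksurj _ (ptr c); exists z.
  have sep c c' : c != c' -> h <= `|zz c - zz c'|.
    move=> cc'; rewrite -(ler_pM2l L0) -/t; apply: le_trans (GL _ _).
    rewrite (Hzz c).2 (Hzz c').2.
    have [i ci] : exists i, c i != c' i.
      by apply/existsP; rewrite -negb_forall; apply: contra cc' => /forallP e; apply/eqP/ffunP => i; exact/eqP.
    apply: le_trans (normv_coord _ i); rewrite !mxE -mulrBl normrM (gtr0_norm t0).
    by rewrite ler_pMl //; exact: natr_dist_ge1.
  have := frac_count (b' := b') h0 (fun c => (Hzz c).1) sep J x0.
  rewrite -/fr (eq_bigl xpredT) => [|c]; last first.
    by apply/asboolP => i; rewrite hS; apply: KS; exact: (Hzz c).1.
  rewrite sumr_const card_ffun !card_ord natrX -/N NE -exprM mulnC exprM => h1.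
  have BJ : 0 < (B ^+ J) ^+ m by rewrite !exprn_gt0.
  have : (a%:R / B ^+ J) ^+ m <= fr by rewrite expr_div_n ler_pdivrMr // mulrC.
  apply: le_trans; apply: lerXn2r; rewrite ?nnegrE ?divr_ge0 ?ler0n ?(ltW r0) ?mulr_ge0 ?(ltW L0) ?(ltW S0) ?exprn_ge0 //.
  apply: (@le_trans _ _ ((r / t) / B ^+ J)); last by rewrite ler_pM2r ?invr_gt0 ?exprn_gt0 // ltW // ra.2.
  have BJ1 : B ^+ J != 0 by rewrite gt_eqF // exprn_gt0.
  rewrite /t /h; move: (B ^+ J) BJ1 => P P0.
  have -> : r / (L * (S / P)) / P = r / (L * S) by field; rewrite P0 !gt_eqF.
  by [].
have ng' : forall j x, (j < J)%N -> ~ good (b' := b') h G K (th ^+ 2) j x.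
  by move=> j x jJ gd; apply: ng; exists j, x.
have {}H1 := H1 ng'.
have e1 : energy (b' := b') h G J x0 <= m%:R * (m%:R * L ^+ 2) by apply: energy_le => //; exact: ltW.
have e2 := fr2_ge0 (slope (b' := b') h G J x0).
have e3 : 0 <= fr by exact: frac_ge0.
have e4 : (hit (b' := b') h K J x0)%:R <= 1 :> R by case: hit.
have e5 : J%:R * (be * cst) <= J%:R * be * fr.
  by rewrite -mulrA ler_wpM2l // ler_pM2l.
rewrite /Q in JQ; lra.
Qed.

End GoodScale.

(** * Scales at which a function is almost quadratic *)

Lemma conv_itv (R : realDomainType) (lo hi a a' t : R) :
  lo <= a < hi -> lo <= a' < hi -> 0 <= t <= 1 -> lo <= a' + t * (a - a') < hi.
Proof.
move=> /andP[? ?] /andP[? ?] /andP[t0 t1]; have [aa|aa] := leP a' a.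
  have : t * (a - a') <= 1 * (a - a') by rewrite ler_wpM2r // subr_ge0.
  have : 0 <= t * (a - a') by rewrite mulr_ge0 // subr_ge0.
  by move=> *; apply/andP; split; lra.
have : t * (a' - a) <= 1 * (a' - a) by rewrite ler_wpM2r // subr_ge0 ltW.
have : 0 <= t * (a' - a) by rewrite mulr_ge0 // subr_ge0 ltW.
by move=> *; apply/andP; split; lra.
Qed.

Section QuadraticScale.
Context {R : realType} {m : nat}.
Notation E := 'rV[R]_m.
Implicit Types (x y z g p : E) (W : E -> R).

Lemma mulmx_norm (y : E) (A : 'M[R]_m) L : 0 <= L -> (forall i k, `|A i k| <= L) ->
  `|y *m A| <= m%:R * (`|y| * L).
Proof.
move=> L0 AL; apply: normv_le => [|k]; first by rewrite !mulr_ge0.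
rewrite mxE; apply: le_trans (ler_norm_sum _ _ _) _.
have -> : m%:R * (`|y| * L) = \sum_(i < m) (`|y| * L) by rewrite sumr_const card_ord mulr_natl.
apply: ler_sum => i _; by rewrite normrM ler_pM // normv_coord.
Qed.

Lemma sum_ratio (b : nat) : (0 < b)%N ->
  \sum_(k < b) ((k%:R / b%:R) * b%:R^-1) = 2^-1 - (2 * b%:R)^-1 :> R.
Proof.
move=> b0; have bn : (b%:R : R) != 0 by rewrite pnatr_eq0 -lt0n.
have H c : \sum_(k < c) (k%:R : R) = c%:R * (c%:R - 1) / 2.
  elim: c => [|c IH]; first by rewrite big_ord0 mul0r mul0r.
  by rewrite big_ord_recr /= IH -natr1; field.
rewrite -!mulr_suml H; move: (b%:R : R) bn => B B0; by field.
Qed.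

Lemma qf_half_sum (A : 'M[R]_m) y : qf (2^-1 *: (A + A^T)) y = qf A y.
Proof. by rewrite qfZm qfDm /qf [dot (y *m A^T) y]dotC -dot_trmx; field. Qed.

(* Adding up first-order expansions of [W] at points of [K] along a segment, where the
   gradient is almost affine, yields a second-order expansion *)
Lemma chain_expansion (b' : nat) W (G : E -> E) (K : set E) (C L th s : R) x (A : 'M[R]_m) z0 z :
  let b := b'.+1 in let B : R := b%:R in
  0 <= C -> 0 <= L -> 0 <= th -> 0 < s -> (forall i k, `|A i k| <= L) ->
  (forall x y, `|G x - G y| <= L * `|x - y|) ->
  let cl := [set y : E | forall i, x 0 i <= y 0 i < x 0 i + s] in
  K z0 -> cl z0 -> cl z ->
  (forall w y, K w -> cl y -> `|W y - W w - dot (G w) (y - w)| <= C / 2 * sq (y - w)) ->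
  (forall y, cl y -> exists w, [/\ K w, cl w & `|w - y| <= s / B]) ->
  (forall y, cl y -> `|G y - G x - (y - x) *m A| <= (3 * m%:R + 1) * (s * (L / B + th))) ->
  `|W z - W z0 - dot (G z0) (z - z0) - 2^-1 * qf A (z - z0)| <=
   (3 * C * m%:R + m%:R * ((6 * m%:R + 3) * (L + 1)) + m%:R * (m%:R * L)) * (s ^+ 2 * (B^-1 + th)).
Proof.
move=> b B C0 L0 th0 s0 AL GL cl Kz0 clz0 clz WK hitK Gaff.
have B0 : 0 < B by rewrite ltr0n.
have B1 : 1 <= B by rewrite ler1n.
set D := z - z0.
have Ds : `|D| <= s.
  apply: normv_le => [|i]; first exact: ltW.
  have /andP[? ?] := clz i; have /andP[? ?] := clz0 i.
  by rewrite !mxE ler_norml; apply/andP; split; lra.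
pose xi (k : nat) : E := z0 + (k%:R / B) *: D.
have clxi k : (k <= b)%N -> cl (xi k).
  move=> kb i; rewrite !mxE.
  apply: conv_itv; [exact: clz | exact: clz0 |].
  by rewrite divr_ge0 ?ler0n ?(ltW B0) //= ler_pdivrMr // mul1r ler_nat.
have xiS k : xi k.+1 - xi k = B^-1 *: D.
  by rewrite /xi -natr1; apply/rowP => i; rewrite !mxE; field; rewrite gt_eqF.
have xi0 k : xi k - z0 = (k%:R / B) *: D by rewrite /xi addrAC subrr add0r.
pose e0 := s * (L / B + th).
have e00 : 0 <= e0 by rewrite mulr_ge0 ?(ltW s0) // addr_ge0 // divr_ge0 // ltW.
have sB0 : 0 <= s / B by rewrite divr_ge0 // ltW.
pose e1 := (6 * m%:R + 3) * e0.
have stepW k : (k < b)%N ->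
  `|W (xi k.+1) - W (xi k) - B^-1 * dot (G z0) D - k%:R / B * B^-1 * qf A D| <=
   3 * C * m%:R * (s / B) ^+ 2 + m%:R * (e1 * (s / B)).
  move=> kb; have c1 := clxi k (ltnW kb); have c2 := clxi k.+1 kb.
  (* Both ends of the short segment are expanded at the same nearby point [w] of [K], and the
     gradient at [w] is then compared with the affine approximation. *)
  have [w [Kw clw wx]] := hitK _ c1.
  have d1 : `|xi k - w| <= s / B by rewrite distrC.
  have d2 : `|xi k.+1 - w| <= 2 * (s / B).
    rewrite -(subrKA (xi k)); apply: le_trans (ler_normD _ _) _.
    rewrite xiS normrZ gtr0_norm ?invr_gt0 // mulr_natl mulr2n lerD //.
    by rewrite mulrC ler_pM2r ?invr_gt0.
  have q1 : C / 2 * sq (xi k - w) <= C / 2 * (m%:R * (s / B) ^+ 2).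
    rewrite ler_wpM2l ?divr_ge0 //; apply: le_trans (sq_normv _) _.
    by rewrite ler_wpM2l // lerXn2r ?nnegrE.
  have q2 : C / 2 * sq (xi k.+1 - w) <= C / 2 * (m%:R * (2 * (s / B)) ^+ 2).
    rewrite ler_wpM2l ?divr_ge0 //; apply: le_trans (sq_normv _) _.
    by rewrite ler_wpM2l // lerXn2r ?nnegrE // mulr_ge0.
  have w1 := le_trans (WK _ _ Kw c1) q1; have w2 := le_trans (WK _ _ Kw c2) q2.
  pose gerr := G w - G z0 - (xi k - z0) *m A.
  have gerrE : `|gerr| <= e1.
    have h1 : `|G w - G (xi k)| <= L * (s / B).
      by apply: le_trans (GL _ _) _; rewrite ler_wpM2l.
    have h2 := Gaff _ c1; have h3 := Gaff _ clz0.
    have -> : gerr = (G w - G (xi k)) + (G (xi k) - G x - (xi k - x) *m A) - (G z0 - G x - (z0 - x) *m A).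
      by rewrite /gerr !mulmxBl; apply/rowP => i; rewrite !mxE; ring.
    apply: le_trans (ler_normB _ _) _; apply: le_trans (lerD (ler_normD _ _) (lexx _)) _.
    apply: le_trans (lerD (lerD h1 h2) h3) _.
    have : L * (s / B) <= e0.
      by rewrite mulrCA ler_pM2l // lerDl.
    rewrite /e1 -/e0; have : 0 <= m%:R * e0 by rewrite mulr_ge0. nra.
  have dg : `|B^-1 * dot gerr D| <= m%:R * (e1 * (s / B)).
    rewrite normrM gtr0_norm ?invr_gt0 //.
    have -> : m%:R * (e1 * (s / B)) = B^-1 * (m%:R * (e1 * s)) by ring.
    rewrite ler_pM2l ?invr_gt0 //; apply: le_trans (dot_normv _ _) _.
    by rewrite ler_wpM2l // ler_pM.
  have -> : W (xi k.+1) - W (xi k) - B^-1 * dot (G z0) D - k%:R / B * B^-1 * qf A D =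
    (W (xi k.+1) - W w - dot (G w) (xi k.+1 - w)) - (W (xi k) - W w - dot (G w) (xi k - w))
     + B^-1 * dot gerr D.
    have -> : dot (G w) (xi k.+1 - w) = dot (G w) (xi k - w) + B^-1 * dot (G w) D.
      by rewrite -dotZr -(xiS k) -dotDr; congr dot; apply/rowP => l; rewrite !mxE; ring.
    by rewrite /gerr xi0 -scalemxAl !dotBl dotZl /qf; ring.
  apply: le_trans (ler_normD _ _) _; apply: lerD => //.
  apply: le_trans (ler_normB _ _) _; apply: le_trans (lerD w2 w1) _.
  have : 0 <= C * m%:R * (s / B) ^+ 2 by apply: mulr_ge0; [exact: mulr_ge0 | exact: sqr_ge0].
  rewrite expr2; set u := s / B; nra.
have tele : W z - W z0 = \sum_(k < b) (W (xi k.+1) - W (xi k)).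
  rewrite -(big_mkord xpredT (fun k => W (xi k.+1) - W (xi k))) telescope_sumr //.
  by rewrite /xi divff ?gt_eqF // mul0r scale0r addr0 scale1r; congr (W _ - _); rewrite /D addrC subrK.
have B0' : B != 0 by rewrite gt_eqF.
have sumB : \sum_(k < b) B^-1 = 1 by rewrite sumr_const card_ord -mulr_natr mulVf.
have main : `|W z - W z0 - dot (G z0) D - (2^-1 - (2 * B)^-1) * qf A D| <=
   B * (3 * C * m%:R * (s / B) ^+ 2 + m%:R * (e1 * (s / B))).
  have -> : W z - W z0 - dot (G z0) D - (2^-1 - (2 * B)^-1) * qf A D =
     \sum_(k < b) (W (xi k.+1) - W (xi k) - B^-1 * dot (G z0) D - k%:R / B * B^-1 * qf A D).
    by rewrite sumrB sumrB -tele -mulr_suml sumB mul1r -mulr_suml sum_ratio.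
  apply: le_trans (ler_norm_sum _ _ _) _.
  have H (c : R) : B * c = \sum_(k < b) c by rewrite sumr_const card_ord mulr_natl.
  by rewrite H; apply: ler_sum => k _; exact: stepW.
have qA : `|qf A D| <= m%:R * (m%:R * L) * s ^+ 2.
  apply: le_trans (dot_normv _ _) _.
  have -> : m%:R * (m%:R * L) * s ^+ 2 = m%:R * (m%:R * (s * L) * s) by ring.
  rewrite ler_wpM2l // ler_pM //; apply: le_trans (mulmx_norm _ L0 AL) _.
  by rewrite ler_wpM2l // ler_wpM2r.
have -> : W z - W z0 - dot (G z0) D - 2^-1 * qf A D =
  (W z - W z0 - dot (G z0) D - (2^-1 - (2 * B)^-1) * qf A D) - (2 * B)^-1 * qf A D by ring.
apply: le_trans (ler_normB _ _) _; apply: le_trans (lerD main (lexx _)) _.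
rewrite normrM gtr0_norm ?invr_gt0 ?mulr_gt0 //.
have : (2 * B)^-1 * `|qf A D| <= B^-1 * (m%:R * (m%:R * L) * s ^+ 2).
  by apply: ler_pM; rewrite ?invr_ge0 ?mulr_ge0 ?(ltW B0) // lef_pV2 ?posrE ?mulr_gt0 //; lra.
have -> : B * (3 * C * m%:R * (s / B) ^+ 2 + m%:R * (e1 * (s / B))) =
   3 * C * m%:R * s ^+ 2 * B^-1 + m%:R * (6 * m%:R + 3) * s ^+ 2 * (L * B^-1 + th).
  by rewrite /e1 /e0; field.
have iB : 0 <= B^-1 by rewrite invr_ge0 ltW.
move: (B^-1) iB => iB iB0 => h.
have s2 : 0 <= s ^+ 2 by rewrite exprn_ge0 // ltW.
move: h s2; move: (s ^+ 2) (_^-1 * `|_|) => S2 Q h s2.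
have t1 : 0 <= 3 * C * m%:R * S2 * th by rewrite !mulr_ge0.
have t2 : m%:R * (6 * m%:R + 3) * S2 * (L * iB + th) <=
  m%:R * (6 * m%:R + 3) * S2 * ((L + 1) * (iB + th)).
  rewrite ler_wpM2l ?mulr_ge0 ?addr_ge0 ?mulr_ge0 //.
  by have : 0 <= L * th + iB; [rewrite addr_ge0 // mulr_ge0 | (clear -R m; lra)].
have t3 : 0 <= m%:R * (m%:R * L) * S2 * th by rewrite !mulr_ge0.
(clear -R m t3 t2 t1 h; lra).
Qed.

(** Points where a plane of small slope touches [W] from above form [K], and the strict maximum
    makes all these slopes occur near the origin. At such points semiconvexity pinches [W] between a
    plane and a paraboloid, so the slope is a Lipschitz function of the point. Its extension is
    nearly affine on some cube, and summation along segments gives the expansion. *)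
Lemma quadratic_scale W (r0 C k : R) : (0 < m)%N -> 0 < r0 -> 0 <= C -> 0 < k ->
  (forall z, `|z| <= r0 -> {for z, continuous W}) ->
  (forall z0, `|z0| <= r0 -> exists g, forall z, `|z| <= r0 ->
     W z0 + dot g (z - z0) - C / 2 * sq (z - z0) <= W z) ->
  (forall z, `|z| <= r0 -> W z <= W 0 - k * sq z) ->
  forall eta, 0 < eta -> exists z0 s g (A : 'M[R]_m), [/\ 0 < s, s < eta, `|z0| < eta, `|g| < eta &
   [/\ Defs.symmetric A, forall y, qf A y <= eta * sq y &
   forall z, `|z - z0| <= s -> `|z| <= r0 /\
     `|W z - W z0 - dot g (z - z0) - 2^-1 * qf A (z - z0)| <= eta * s ^+ 2]].
Proof.
move=> m0 r00 C0 k0 Wc Wlow Wmax eta eta0.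
pose rho := Num.min eta r0 / 8.
have rho0 : 0 < rho by rewrite divr_gt0 // lt_min eta0.
have rhoe : 8 * rho <= eta by rewrite /rho mulrC divfK // ge_min lexx.
have rhor : 8 * rho <= r0 by rewrite /rho mulrC divfK // ge_min lexx orbT.
have m1 : 1 <= m%:R :> R by rewrite ler1n.
(* A plane of slope below [k * rho / m%:R] cannot touch farther than [rho] from the origin, where
   [W] has dropped by at least [k * sq z]. *)
pose r := Num.min (k * rho / m%:R) (eta / 2).
have mp : 0 < m%:R :> R by lra.
have r0' : 0 < r by rewrite lt_min; apply/andP; split; rewrite divr_gt0 // mulr_gt0.
have rk : m%:R * r <= k * rho.
  rewrite mulrC -ler_pdivlMr; last lra; by rewrite /r ge_min lexx.
have re : r < eta by apply: (@le_lt_trans _ _ (eta / 2)); [rewrite /r ge_min lexx orbT | lra].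
pose T z p := `|z| <= rho /\ forall y, `|y| <= r0 -> W y <= W z + dot p (y - z).
pose L := C * (1 + m%:R) + 1.
have L0 : 0 < L by rewrite ltr_wpDl // mulr_ge0.
have Tex p : (forall i, 0 <= p 0 i <= r) -> exists z, T z p.
  move=> pr.
  have pn : `|p| <= r.
    by apply: normv_le => [|i]; [exact: ltW | have /andP[? ?] := pr i; rewrite ger0_norm].
  have [|||z zr Hz] := @evt_max R m (fun y => W y - dot p y) [set y | `|y - 0| <= r0].
  - by exists 0; rewrite /= subrr normr0 ltW.
  - exact: compact_cube.
  - by move=> y; rewrite /= subr0 => yr; apply: continuousB; [exact: Wc | exact: cont_dot].
  move: zr; rewrite /= subr0 => zr.
  have Hz' y : `|y| <= r0 -> W y <= W z + dot p (y - z).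
    by move=> yr; have := Hz y; rewrite /= subr0 => /(_ yr); rewrite dotBr; lra.
  exists z; split=> //.
  have h1 := Hz' 0; rewrite normr0 sub0r dotNr in h1; have {}h1 := h1 (ltW r00).
  have h2 := Wmax z zr; have h3 := dot_normv p z; have h4 := ler_norm (- dot p z); rewrite normrN in h4.
  have h5 : k * `|z| ^+ 2 <= k * sq z by rewrite ler_pM2l // normv_sq.
  have h6 : m%:R * (`|p| * `|z|) <= m%:R * (r * `|z|) by rewrite ler_wpM2l // ler_wpM2r.
  have [->|z0] := eqVneq `|z| 0; first exact: ltW.
  have zp : 0 < `|z| by rewrite lt_def z0 normr_ge0.
  have h7 : k * `|z| <= k * rho.
    apply: le_trans rk; rewrite -(ler_pM2r zp); rewrite expr2 in h5; (clear -R m h5 h6 h4 h3 h2 h1; lra).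
  by rewrite ler_pM2l in h7.
(* The touching slope must agree with the slope [g] given by semiconvexity: otherwise a short move
   against [p - g] would put the lower paraboloid above the touching plane. *)
have Tlow z p y : T z p -> `|y| <= r0 -> W z + dot p (y - z) - C / 2 * sq (y - z) <= W y.
  move=> [zr Hz] yr; have zr0 : `|z| <= r0 by lra.
  have [g Hg] := Wlow z zr0; suff : p = g by move=> ->; exact: Hg.
  apply/eqP; rewrite -subr_eq0; apply/eqP; apply: sq_eq0; set d := p - g.
  apply/eqP; rewrite eq_le sq_ge0 andbT leNgt; apply/negP => d0.
  pose t := Num.min (rho / (`|d| + 1)) (1 / (C + 1)).
  have dp : 0 < `|d| + 1 by rewrite ltr_wpDl.
  have Cp : 0 < C + 1 by rewrite ltr_wpDl.
  have t0 : 0 < t by rewrite lt_min; apply/andP; split; rewrite divr_gt0.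
  have t1 : t * `|d| <= rho.
    apply: (@le_trans _ _ (t * (`|d| + 1))); first by rewrite ler_pM2l // lerDl.
    by rewrite -ler_pdivlMr // /t ge_min lexx.
  have t2 : t * (C + 1) <= 1 by rewrite -ler_pdivlMr // /t ge_min lexx orbT.
  have yr1 : `|z - t *: d| <= r0.
    by apply: le_trans (ler_normB _ _) _; rewrite normrZ (gtr0_norm t0); lra.
  have := Hz _ yr1; have := Hg _ yr1.
  have -> : z - t *: d - z = - (t *: d) by rewrite addrAC subrr add0r.
  rewrite sqN sqZ !dotNr !dotZr => h1 h2.
  have e : sq d = dot p d - dot g d by rewrite -dotBl.
  have : t * sq d <= t * (C / 2 * t * sq d) by rewrite [X in t * X <= _]e; (clear -R m h2 h1; lra).
  rewrite ler_pM2l // => h3; have : C * t < 2 by nra.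
  by nra.
have TLip z1 p1 z2 p2 : T z1 p1 -> T z2 p2 -> `|p1 - p2| <= L * `|z1 - z2|.
  move=> T1 T2; have [z1r U1] := T1; have [z2r U2] := T2; set t := `|z1 - z2|.
  have t2r : t <= 2 * rho by apply: le_trans (ler_normB _ _) _; lra.
  have [t0|t0] := eqVneq t 0.
    have z12 : z1 = z2 by apply/eqP; rewrite -subr_eq0 -normr_eq0; exact/eqP.
    suff -> : p1 = p2 by rewrite subrr normr0 t0 mulr0.
    subst z2; apply/eqP; rewrite -subr_eq0; apply/eqP/sq_eq0/eqP; rewrite eq_le sq_ge0 andbT leNgt.
    apply/negP => d0; set d := p1 - p2 in d0.
    have dp : 0 < `|d| + 1 by rewrite ltr_wpDl.
    pose u := Num.min (rho / (`|d| + 1)) (1 / (C + 1)).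
    have Cp : 0 < C + 1 by rewrite ltr_wpDl.
    have u0 : 0 < u by rewrite lt_min; apply/andP; split; rewrite divr_gt0.
    have u1 : u * `|d| <= rho.
      apply: (@le_trans _ _ (u * (`|d| + 1))); first by rewrite ler_pM2l // lerDl.
      by rewrite -ler_pdivlMr // /u ge_min lexx.
    have u2 : u * (C + 1) <= 1 by rewrite -ler_pdivlMr // /u ge_min lexx orbT.
    have yr1 : `|z1 - u *: d| <= r0.
      by apply: le_trans (ler_normB _ _) _; rewrite normrZ (gtr0_norm u0); lra.
    have h1 := U1 _ yr1; have h2 := Tlow _ _ _ T2 yr1; move: h1 h2.
    have -> : z1 - u *: d - z1 = - (u *: d) by rewrite addrAC subrr add0r.
    rewrite sqN sqZ !dotNr !dotZr => h1 h2.
    have e : sq d = dot p1 d - dot p2 d by rewrite -dotBl.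
    have : u * sq d <= u * (C / 2 * u * sq d) by rewrite [X in u * X <= _]e; (clear -R m h2 h1; lra).
    rewrite ler_pM2l // => h3; have h4 : C * u < 2 by nra.
    by nra.
  have tp : 0 < t by rewrite lt_def t0 normr_ge0.
  apply: normv_le => [|i]; first by rewrite mulr_ge0 ?(ltW L0) // ltW.
  (* The plane touching at [z1] lies above the paraboloid at [z2]. Evaluating both at [z2 - v], with
     [v] of length [|z1 - z2|] along an axis, bounds one coordinate of [p1 - p2]. *)
  have Hs (e : R) : e ^+ 2 = 1 -> e * (p1 - p2) 0 i <= L * t.
    move=> e1; pose v : E := (e * t) *: delta_mx 0 i.
    have vt : `|v| <= t.
      apply: normv_le => [|l]; first exact: ltW.
      rewrite !mxE eqxx /= normrM normrM (gtr0_norm tp).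
      have -> : `|e| = 1 by apply/eqP; rewrite -(@eqrXn2 _ 2) // real_normK ?num_real // e1 expr1n.
      by rewrite mul1r; case: (l == i); rewrite ?normr1 ?normr0 ?mulr1 ?mulr0 // ltW.
    have yr1 : `|z2 - v| <= r0 by apply: le_trans (ler_normB _ _) _; lra.
    have z2r0 : `|z2| <= r0 by lra.
    have h1 := U1 _ yr1; have h2 := Tlow _ _ _ T2 yr1; have h3 := Tlow _ _ _ T1 z2r0.
    have e2 : z2 - v - z2 = - v by rewrite addrAC subrr add0r.
    have e3 : z2 - v - z1 = (z2 - z1) - v by rewrite addrAC.
    rewrite e2 sqN dotNr in h2; rewrite e3 dotBr in h1.
    have q1 : sq v = t ^+ 2 by rewrite sqZ sq_delta exprMn e1; ring.
    have q2 : sq (z2 - z1) <= m%:R * t ^+ 2 by rewrite sqBC; exact: sq_normv.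
    have q3 : C / 2 * sq (z2 - z1) <= C / 2 * (m%:R * t ^+ 2) by rewrite ler_wpM2l // divr_ge0.
    have q4 : dot (p1 - p2) v = t * (e * (p1 - p2) 0 i) by rewrite dotZr dot_delta; ring.
    have h4 : t * (e * (p1 - p2) 0 i) <= t * (C / 2 * (1 + m%:R) * t).
      rewrite -q4 dotBl; rewrite q1 in h2; rewrite expr2 in q3 h2; (clear -R m h2 q3 h1 h3; lra).
    rewrite ler_pM2l // in h4; apply: le_trans h4 _; rewrite ler_wpM2r ?(ltW tp) // /L.
    have : 0 <= C * (1 + m%:R) by rewrite mulr_ge0.
    (clear -R m; lra).
  rewrite ler_norml; apply/andP; split.
    by have := Hs (-1); rewrite sqrrN expr1n mulN1r => /(_ erefl); lra.
  by have := Hs 1; rewrite expr1n mul1r => /(_ erefl).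
have [|G [GT GL]] := @mcshane_vec R m T L (ltW L0) _ TLip.
  by have [|z Tz] := Tex 0; [move=> i; rewrite mxE lexx ltW | exists z, 0].
pose K z := exists p, T z p /\ (forall i, 0 <= p 0 i <= r).
pose cst := 3 * C * m%:R + m%:R * ((6 * m%:R + 3) * (L + 1)) + m%:R * (m%:R * L).
have cst0 : 0 < cst.
  rewrite /cst; have a1 : 0 <= C * m%:R by rewrite mulr_ge0.
  have a2 : 0 < m%:R * ((6 * m%:R + 3) * (L + 1)) by rewrite !mulr_gt0; (clear -R m L0 m1; lra).
  have a3 : 0 <= m%:R * (m%:R * L) by rewrite !mulr_ge0 // ltW.
  lra.
pose th := eta / (128 * cst); have th0 : 0 < th by rewrite divr_gt0 // mulr_gt0.
pose b' := (Num.truncn th^-1 + 3)%N.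
have bth : b'.+1%:R^-1 <= th.
  rewrite -[th]invrK lef_pV2 ?posrE ?ltr0n ?invr_gt0 //.
  have /truncn_itv/andP[_ h] : 0 <= th^-1 by rewrite invr_ge0 ltW.
  by apply: ltW; apply: lt_le_trans h _; rewrite ler_nat /b' ltnS leq_addr.
pose x0 : E := const_mx (- rho).
have [||||x [s [A [s0 sS AL hitK Gaff]]]] :=
    @exists_good_scale R m b' G K L (3 * rho) r th x0 m0 _ L0 _ r0' th0 GL.
- by rewrite /b' addnC.
- by rewrite mulr_gt0.
- move=> z [p [[zr _] _]] i; rewrite mxE; have := normv_coord z i.
  by move=> h; have := le_trans h zr; rewrite ler_norml => /andP[? ?]; apply/andP; split; lra.
- move=> p pr; have [z Tz] := Tex p pr; exists z; first by exists p.
  exact: GT.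
pose cl := [set y : E | forall i, x 0 i <= y 0 i < x 0 i + s].
have b4 : 4 <= b'.+1%:R :> R by rewrite (ler_nat _ 4) /b' -addnS leq_addl.
have [|z0 [Kz0 clz0 z0c]] := hitK (\row_i (x 0 i + s / 2)).
  by move=> i; rewrite mxE; apply/andP; split; (clear -R m s0; lra).
have sb : s / b'.+1%:R <= s / 4.
  by rewrite ler_pM2l // lef_pV2 ?posrE ?ltr0n.
have [p0 [Tz0 p0r]] := Kz0; have [z0r U0] := Tz0.
have G0 : G z0 = p0 by exact: GT.
have near_cl z : `|z - z0| <= s / 5 -> cl z.
  move=> h i; have h1 := le_trans (normv_coord _ i) h; have h2 := le_trans (le_trans (normv_coord _ i) z0c) sb.
  move: h1 h2; rewrite !mxE !ler_norml => /andP[? ?] /andP[? ?]; apply/andP; split; lra.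
have clr z : cl z -> `|z| <= r0.
  move=> cz; have : `|z - z0| <= s.
    apply: normv_le => [|i]; first exact: ltW.
    have /andP[? ?] := cz i; have /andP[? ?] := clz0 i.
    by rewrite !mxE ler_norml; apply/andP; split; lra.
  have := ler_normD (z - z0) z0; rewrite subrK; (clear -R m z0r sS rhor rho0; lra).
have exp z : `|z - z0| <= s / 5 ->
    `|W z - W z0 - dot p0 (z - z0) - 2^-1 * qf A (z - z0)| <= eta / 64 * s ^+ 2.
  move=> h; rewrite -G0.
  have := @chain_expansion b' W G K C L th s x A z0 z C0 (ltW L0) (ltW th0) s0 AL GL Kz0 clz0 (near_cl _ h).
  rewrite -/cst => /(_ _ _ _)/le_trans; apply.
  - move=> w y [p [Tw pr]] cy; rewrite (GT _ _ Tw); have yr := clr _ cy.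
    have := Tlow _ _ _ Tw yr; have := Tw.2 _ yr; have : 0 <= C / 2 * sq (y - w).
      by rewrite mulr_ge0 ?divr_ge0 ?sq_ge0.
    by rewrite ler_norml => *; apply/andP; split; lra.
  - by move=> y /hitK.
  - by move=> y /Gaff.
  have -> : eta / 64 * s ^+ 2 = cst * (s ^+ 2 * (th + th)) by rewrite /th; field; rewrite gt_eqF.
  by rewrite ler_pM2l // ler_wpM2l ?sqr_ge0 // lerD2r.
exists z0, (s / 5), p0, (2^-1 *: (A + A^T)); split.
- by rewrite divr_gt0.
- by (clear -R m sS rhoe rho0; lra).
- by (clear -R m z0r rhoe rho0; lra).
- apply: le_lt_trans re; apply: normv_le => [|i]; first exact: ltW.
  by have /andP[? ?] := p0r i; rewrite ger0_norm.
have s2 : 0 < s ^+ 2 by rewrite exprn_gt0.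
split.
- by rewrite /Defs.symmetric linearZ linearD /= trmxK addrC.
(* The plane touching at [z0] stays above [W], so the expansion on the boundary of the small cube
   bounds the form from above; homogeneity extends this to all [y]. *)
- move=> y; rewrite qf_half_sum; have [->|y0] := eqVneq y 0; first by rewrite qf0 sq0 mulr0.
  have yp : 0 < `|y| by rewrite normr_gt0.
  pose a := s / 5 / `|y|; have a0 : 0 < a by rewrite !divr_gt0.
  have e : z0 + a *: y - z0 = a *: y by rewrite addrAC subrr add0r.
  have an : `|z0 + a *: y - z0| <= s / 5.
    by rewrite e normrZ (gtr0_norm a0) /a divfK // gt_eqF.
  have := exp _ an; rewrite ler_norml => /andP[h1 _].
  have := U0 _ (clr _ (near_cl _ an)); rewrite e in h1 *; rewrite qfZ in h1 => h2.
  have h3 : a ^+ 2 * qf A y <= eta / 32 * s ^+ 2 by (clear -R m h2 h1; lra).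
  have h4 : s ^+ 2 = 25 * a ^+ 2 * `|y| ^+ 2 by rewrite /a; field; rewrite gt_eqF.
  have h5 := normv_sq y.
  have h6 : a ^+ 2 * qf A y <= a ^+ 2 * (eta / 32 * 25 * `|y| ^+ 2) by rewrite h4 in h3; (clear -R m h3; lra).
  rewrite ler_pM2l ?exprn_gt0 // in h6; have h7 : eta * `|y| ^+ 2 <= eta * sq y by rewrite ler_pM2l.
  have h8 : 0 <= eta * `|y| ^+ 2 by rewrite mulr_ge0 ?(ltW eta0) // exprn_ge0.
  (clear -R m h8 h7 h6; lra).
- move=> z h; split; first exact: clr (near_cl _ h).
  rewrite qf_half_sum; apply: le_trans (exp _ h) _.
  have -> : (s / 5) ^+ 2 = s ^+ 2 / 25 by field.
  have : 0 < eta * s ^+ 2 by rewrite mulr_gt0.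
  (clear -R m; lra).
Qed.

End QuadraticScale.

(** * The theorem on sums *)

Section SupConv.
Context {R : realType} {n : nat}.
Notation E := 'rV[R]_n.
Implicit Types (x y z g p h : E) (u v : E -> R) (M X Y Z : 'M[R]_n).

Lemma lin_ge_quad (d : E) (C de : R) : 0 < de ->
  (forall h, `|h| < de -> 0 <= dot d h + C * sq h) -> d = 0.
Proof.
move=> de0 H; apply: sq_eq0; apply/eqP; rewrite eq_le sq_ge0 andbT leNgt; apply/negP => d0.
have dp : 0 < `|d| + 1 by rewrite ltr_wpDl.
have Cp : 0 < `|C| + 1 by rewrite ltr_wpDl.
pose t := Num.min (de / (2 * (`|d| + 1))) (1 / (2 * (`|C| + 1))).
have t0 : 0 < t by rewrite lt_min; apply/andP; split; rewrite divr_gt0 // mulr_gt0.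
have t1 : t * (2 * (`|d| + 1)) <= de by rewrite -ler_pdivlMr ?mulr_gt0 // /t ge_min lexx.
have t2 : t * (2 * (`|C| + 1)) <= 1 by rewrite -ler_pdivlMr ?mulr_gt0 // /t ge_min lexx orbT.
have := H (- (t *: d)); rewrite normrN normrZ (gtr0_norm t0) dotNr dotZr sqN sqZ -/(sq d).
have -> : t * `|d| < de by have := normr_ge0 d; nra.
move=> /(_ isT); have -> : - (t * sq d) + C * (t ^+ 2 * sq d) = (t * sq d) * (C * t - 1) by ring.
rewrite pmulr_rge0 ?mulr_gt0 // => h; have := ler_norm C; have : `|C| * t <= 2^-1 by lra.
move=> h1 h2; have : C * t <= `|C| * t by rewrite ler_pM2r.
lra.
Qed.

(* [U] is the sup-convolution and [m xi] a point where the supremum is attained *)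
Lemma sup_convolution u (r lam : R) : 0 < r -> 0 < lam ->
  (forall x, `|x| <= r -> {for x, continuous u}) ->
  exists (U : E -> R) (m : E -> E), [/\ forall xi, `|m xi| <= r,
    forall xi, U xi = u (m xi) - lam / 2 * sq (m xi - xi),
    forall xi y, `|y| <= r -> u y - lam / 2 * sq (y - xi) <= U xi,
    forall xi xi', U xi + lam * dot (m xi - xi) (xi' - xi) - lam / 2 * sq (xi' - xi) <= U xi' &
    forall xi, {for xi, continuous U}].
Proof.
move=> r0 l0 uc.
have /choice[m Hm] (xi : E) : exists x, `|x| <= r /\
    forall y, `|y| <= r -> u y - lam / 2 * sq (y - xi) <= u x - lam / 2 * sq (x - xi).
  have [|||x xr Hx] := @evt_max R n (fun y => u y - lam / 2 * sq (y - xi)) [set y | `|y - 0| <= r].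
  - by exists 0; rewrite /= subrr normr0 ltW.
  - exact: compact_cube.
  - move=> y; rewrite /= subr0 => yr; apply: continuousB; first exact: uc.
    by apply: continuousM; [exact: cst_continuous | exact: cont_sq].
  by move: xr; rewrite /= subr0 => xr; exists x; split=> // y yr; apply: Hx; rewrite /= subr0.
pose U xi := u (m xi) - lam / 2 * sq (m xi - xi).
have Ua xi y : `|y| <= r -> u y - lam / 2 * sq (y - xi) <= U xi by exact: (Hm xi).2.
have Ub xi xi' : U xi + lam * dot (m xi - xi) (xi' - xi) - lam / 2 * sq (xi' - xi) <= U xi'.
  apply: le_trans (Ua xi' (m xi) (Hm xi).1); rewrite /U.
  have -> : m xi - xi' = (m xi - xi) - (xi' - xi) by apply/rowP => i; rewrite !mxE; ring.
  rewrite [sq (_ - _ - _)]sqB; lra.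
exists U, m; split=> //; first by move=> xi; exact: (Hm xi).1.
move=> xi; apply/contP_eps => e e0.
pose B := n%:R * (r + `|xi| + 1) + n%:R + 1; have B0 : 0 < B.
  by rewrite ltr_wpDl // addr_ge0 // mulr_ge0 // !addr_ge0 // ltW.
pose d := Num.min 1 (e / (2 * lam * B)).
have d0 : 0 < d by rewrite lt_min ltr01 divr_gt0 // !mulr_gt0.
have dB : d * (2 * lam * B) <= e by rewrite -ler_pdivlMr ?mulr_gt0 // /d ge_min lexx orbT.
exists d => // y yd.
have y1 : `|y - xi| <= 1 by apply: ltW; apply: lt_le_trans yd _; rewrite /d ge_min lexx.
have half a c : `|a| <= `|xi| + 1 -> `|c - a| < d -> `|c - a| <= 1 -> U a - U c < e.
  move=> ha hd h1; have := Ub a c; have hm := (Hm a).1.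
  have h2 := dot_normv (m a - a) (c - a); have h3 := sq_normv (c - a).
  have h4 : `|m a - a| <= r + `|xi| + 1 by apply: le_trans (ler_normB _ _) _; lra.
  have h5 : `|m a - a| * `|c - a| <= (r + `|xi| + 1) * `|c - a| by rewrite ler_wpM2r.
  have h6 : n%:R * (`|m a - a| * `|c - a|) <= n%:R * ((r + `|xi| + 1) * `|c - a|) by rewrite ler_wpM2l.
  have h7 : n%:R * `|c - a| ^+ 2 <= n%:R * `|c - a|.
    by rewrite ler_wpM2l // expr2 ler_piMr.
  have h8 : - dot (m a - a) (c - a) <= `|dot (m a - a) (c - a)| by rewrite -normrN ler_norm.
  move=> hU.
  have h9 : lam * (- dot (m a - a) (c - a) + 2^-1 * sq (c - a)) <= lam * (B * `|c - a|).
    rewrite ler_pM2l //; clear -h2 h3 h6 h7 h8 h1; rewrite /B; have := normr_ge0 (c - a).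
    have : 0 <= n%:R * `|c - a| by rewrite mulr_ge0.
    nra.
  have h10 : lam * (B * `|c - a|) <= lam * (B * d).
    by rewrite ler_pM2l // ler_pM2l // ltW.
  clear -hU h9 h10 dB e0; lra.
rewrite ltr_norml; apply/andP; split.
  rewrite ltrNl opprB; apply: half => //; lra.
apply: half; last by rewrite distrC.
  by have := ler_normD (y - xi) xi; rewrite subrK; lra.
by rewrite distrC.
Qed.

(** When the centre is translated together with the competitor, the penalty does not change; so a
    quadratic touching [U] at [xi] also touches [u] at [m xi]. The concave paraboloid lying below
    [U] determines [p] and bounds [X] from below. *)
Lemma ujet_supconv u (U : E -> R) (m : E -> E) (r lam : R) xi p X :
  (forall xi, U xi = u (m xi) - lam / 2 * sq (m xi - xi)) ->
  (forall xi y, `|y| <= r -> u y - lam / 2 * sq (y - xi) <= U xi) ->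
  (forall xi xi', U xi + lam * dot (m xi - xi) (xi' - xi) - lam / 2 * sq (xi' - xi) <= U xi') ->
  `|m xi| < r -> ujet U xi p X ->
  [/\ ujet u (m xi) p X, p = lam *: (m xi - xi) & forall a, - lam * sq a <= qf X a].
Proof.
move=> UE Ua Ub mr [d d0 J].
have lowup h : `|h| < d -> lam * dot (m xi - xi) h - lam / 2 * sq h <= dot p h + 2^-1 * qf X h.
  move=> hd; have := Ub xi (xi + h); have := J (xi + h).
  have -> : xi + h - xi = h by rewrite addrAC subrr add0r.
  by move=> /(_ hd); lra.
have CX : exists C, forall h, `|qf X h| <= C * sq h.
  exists (n%:R * (n%:R * `|X|)) => h; apply: le_trans (dot_normv _ _) _.
  have h1 : `|h *m X| <= n%:R * (`|h| * `|X|).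
    apply: mulmx_norm => // i k; have -> : `|X| = mx_norm X by [].
    by rewrite mx_normrE; apply: (le_bigmax _ (fun ij => `|X ij.1 ij.2|) (i, k)).
  have h2 := normv_sq h.
  apply: (@le_trans _ _ (n%:R * (n%:R * (`|h| * `|X|) * `|h|))).
    by rewrite ler_wpM2l // ler_wpM2r.
  have -> : n%:R * (n%:R * (`|h| * `|X|) * `|h|) = n%:R * (n%:R * `|X|) * `|h| ^+ 2 :> R by ring.
  by rewrite ler_wpM2l // !mulr_ge0.
have pE : p = lam *: (m xi - xi).
  have [C HC] := CX; apply/eqP; rewrite -subr_eq0; apply/eqP.
  apply: (@lin_ge_quad _ (C / 2 + lam / 2) d d0) => h /lowup; rewrite (dotBl p) dotZl.
  by have := ler_norm (qf X h); have := HC h; lra.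
split=> //.
- exists (Num.min d (r - `|m xi|)); first by rewrite lt_min d0 subr_gt0.
  move=> y; rewrite lt_min => /andP[yd yr].
  have yr' : `|y| <= r by have := ler_normD (y - m xi) (m xi); rewrite subrK; lra.
  have := Ua (xi + (y - m xi)) y yr'; have := J (xi + (y - m xi)).
  have -> : xi + (y - m xi) - xi = y - m xi by rewrite addrAC subrr add0r.
  have -> : y - (xi + (y - m xi)) = m xi - xi by apply/rowP => i; rewrite !mxE; ring.
  by move=> /(_ yd); rewrite (UE xi); lra.
- move=> a; have ap : 0 < `|a| + 1 by rewrite ltr_wpDl.
  pose t := d / (2 * (`|a| + 1)); have t0 : 0 < t by rewrite divr_gt0 // mulr_gt0.
  have := lowup (t *: a); rewrite normrZ (gtr0_norm t0) => H.
  have hd : t * `|a| < d.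
    have : t * (2 * (`|a| + 1)) = d by rewrite /t divfK // gt_eqF // mulr_gt0.
    by have := normr_ge0 a; nra.
  have := H hd; rewrite pE dotZl sqZ qfZ => h.
  have : t ^+ 2 * (- lam * sq a) <= t ^+ 2 * qf X a by lra.
  by rewrite ler_pM2l // exprn_gt0.
Qed.

(** With [2 * e * sq] added to the quadratic, the maximum of the difference lies in the open cube:
    on the boundary the added term is at least [2 * e * s ^+ 2], more than the error [e * s ^+ 2].
    At that maximum the bound is exact. *)
Lemma approx_ujet (U : E -> R) xi0 p X (e s : R) : 0 < e -> 0 < s -> Defs.symmetric X ->
  (forall xi, {for xi, continuous U}) ->
  (forall h, `|h| <= s -> U (xi0 + h) <= U xi0 + dot p h + 2^-1 * qf X h + e * s ^+ 2) ->
  exists xi1 q, `|xi1 - xi0| < s /\ ujet U xi1 q (X + (4 * e)%:M).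
Proof.
move=> e0 s0 sX Uc H.
pose f y := U y - (dot p (y - xi0) + 2^-1 * qf X (y - xi0) + 2 * e * sq (y - xi0)).
have fc y : {for y, continuous f}.
  apply: continuousB; first exact: Uc.
  have -> : (fun y : E => dot p (y - xi0) + 2^-1 * qf X (y - xi0) + 2 * e * sq (y - xi0)) =
     (fun y => quad 0 p X xi0 y + 2 * e * sq (y - xi0)).
    by apply/funext => z; rewrite /quad add0r.
  apply: continuousD; first by apply: differentiable_continuous; exact: quad_differentiable.
  by apply: continuousM; [exact: cst_continuous | exact: cont_sq].
have [|||x1 xr Hx] := @evt_max R n f [set y | `|y - xi0| <= s].
- by exists xi0; rewrite /= subrr normr0 ltW.
- exact: compact_cube.
- by move=> y _; exact: fc.
rewrite /= in xr; set h1 := x1 - xi0 in xr.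
have x1E : x1 = xi0 + h1 by rewrite /h1 addrC subrK.
have lt1 : `|h1| < s.
  rewrite lt_def xr andbT; apply/negP => /eqP hs.
  have := Hx xi0; rewrite /= subrr normr0 (ltW s0) => /(_ isT).
  rewrite /f subrr dot0r qf0 sq0 -/h1 => h2; have := H _ xr; rewrite -x1E => h3.
  have h4 := normv_sq h1; rewrite -hs in h4.
  have : 0 < e * s ^+ 2 by rewrite mulr_gt0 // exprn_gt0.
  have : e * s ^+ 2 <= e * sq h1 by rewrite ler_pM2l.
  clear -h2 h3; lra.
exists x1, (p + h1 *m X + (4 * e) *: h1); split=> //.
exists (s - `|h1|); first by rewrite subr_gt0.
move=> y yd; pose k := y - x1.
have yE : y - xi0 = h1 + k by apply/rowP => i; rewrite !mxE; ring.
have := Hx y; rewrite /= yE /f yE -/h1.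
have -> : `|h1 + k| <= s by apply: le_trans (ler_normD _ _) _; rewrite /k; lra.
move=> /(_ isT); rewrite -/k qfD // sqD qfDm qf_scalar (dotDl (p + _)) (dotDl p) dotDr !dotZl; lra.
Qed.

Lemma dot_row_mx (a b c d : E) : dot (row_mx a b) (row_mx c d) = dot a c + dot b d.
Proof.
rewrite /dot big_split_ord /=.
by congr (_ + _); apply: eq_bigr => i _; rewrite ?row_mxEl ?row_mxEr.
Qed.
Lemma sq_row_mx (a b : E) : sq (row_mx a b) = sq a + sq b.
Proof. exact: dot_row_mx. Qed.

Lemma qf_ulsub (A : 'M[R]_(n + n)) (a : E) : qf A (row_mx a 0) = qf (ulsubmx A) a.
Proof.
by rewrite -{1}(submxK A) /qf mul_row_block !mul0mx !addr0 dot_row_mx dot0r addr0.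
Qed.

Lemma qf_drsub (A : 'M[R]_(n + n)) (a : E) : qf A (row_mx 0 a) = qf (drsubmx A) a.
Proof.
by rewrite -{1}(submxK A) /qf mul_row_block !mul0mx !add0r dot_row_mx dot0r add0r.
Qed.

Lemma normv_row_mx (a b : E) c : 0 <= c -> `|a| <= c -> `|b| <= c -> `|row_mx a b| <= c.
Proof.
move=> c0 ac bc; apply: normv_le => // i; rewrite mxE; case: splitP => j _.
  exact: le_trans (normv_coord _ _) ac.
exact: le_trans (normv_coord _ _) bc.
Qed.

Lemma normv_row_mxl (a b : E) : `|a| <= `|row_mx a b|.
Proof. by apply: normv_le => // i; rewrite -(row_mxEl a b) normv_coord. Qed.
Lemma normv_row_mxr (a b : E) : `|b| <= `|row_mx a b|.
Proof. by apply: normv_le => // i; rewrite -(row_mxEr a b) normv_coord. Qed.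

Lemma qf_bound M : exists2 C, 0 <= C & forall h : E, `|qf M h| <= C * sq h.
Proof.
exists (n%:R * (n%:R * `|M|)) => [|h]; first by rewrite !mulr_ge0.
apply: le_trans (dot_normv _ _) _.
have h1 : `|h *m M| <= n%:R * (`|h| * `|M|).
  apply: mulmx_norm => // i k; have -> : `|M| = mx_norm M by [].
  by rewrite mx_normrE; apply: (le_bigmax _ (fun ij => `|M ij.1 ij.2|) (i, k)).
have h2 := normv_sq h.
apply: (@le_trans _ _ (n%:R * (n%:R * (`|h| * `|M|) * `|h|))).
  by rewrite ler_wpM2l // ler_wpM2r.
have -> : n%:R * (n%:R * (`|h| * `|M|) * `|h|) = n%:R * (n%:R * `|M|) * `|h| ^+ 2 :> R by ring.
by rewrite ler_wpM2l // !mulr_ge0.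
Qed.

Lemma cont_lsubmx (z : 'rV[R]_(n + n)) (U : E -> R) :
  {for lsubmx z, continuous U} -> {for z, continuous (fun z : 'rV[R]_(n + n) => U (lsubmx z))}.
Proof.
move=> Uc; apply/contP_eps => e e0; have /contP_eps/(_ e e0)[d d0 H] := Uc.
exists d => // y yz; apply: H; apply: le_lt_trans yz.
by rewrite -linearB -{2}(hsubmxK (y - z)); exact: normv_row_mxl.
Qed.
Lemma cont_rsubmx (z : 'rV[R]_(n + n)) (U : E -> R) :
  {for rsubmx z, continuous U} -> {for z, continuous (fun z : 'rV[R]_(n + n) => U (rsubmx z))}.
Proof.
move=> Uc; apply/contP_eps => e e0; have /contP_eps/(_ e e0)[d d0 H] := Uc.
exists d => // y yz; apply: H; apply: le_lt_trans yz.
by rewrite -linearB -{2}(hsubmxK (y - z)); exact: normv_row_mxr.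
Qed.

(* Completing the doubling argument: at a good scale for the sum of the two sup-convolutions
   the mixed second-order terms are exactly those of [Z'], so that the two separate
   quadratic expansions satisfy the joint matrix inequality. *)
Lemma sums_good_scale (U V : E -> R) Z' (lam eta : R) : (0 < n)%N -> 0 < lam -> 0 < eta ->
  Defs.symmetric Z' ->
  (forall x, {for x, continuous U}) -> (forall x, {for x, continuous V}) ->
  (forall x, exists g, forall y, U x + dot g (y - x) - lam / 2 * sq (y - x) <= U y) ->
  (forall x, exists g, forall y, V x + dot g (y - x) - lam / 2 * sq (y - x) <= V y) ->
  (forall x y, U x + V y <= U 0 + V 0 + 2^-1 * qf Z' (x - y)) ->
  exists x1 y1 p q X Y, [/\ `|x1| < eta, `|y1| < eta, Defs.symmetric X, Defs.symmetric Y &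
   [/\ ujet U x1 p X, ujet V y1 q Y &
    forall a b, qf X a + qf Y b <= qf Z' (a - b) + eta * (sq a + sq b)]].
Proof.
move=> n0 l0 eta0 sZ Uc Vc Ul Vl UV.
have [CZ CZ0 HCZ] := qf_bound Z'.
(* Subtracting [ka * sq z] makes the maximum at the origin strict, as [quadratic_scale] requires. *)
pose ka := eta / 16; have ka0 : 0 < ka by rewrite divr_gt0.
pose W (z : 'rV[R]_(n + n)) := U (lsubmx z) + V (rsubmx z)
   - 2^-1 * qf Z' (lsubmx z - rsubmx z) - ka * sq z.
have WE x y : W (row_mx x y) = U x + V y - 2^-1 * qf Z' (x - y) - ka * (sq x + sq y).
  by rewrite /W row_mxKl row_mxKr sq_row_mx.
pose C := 2 * (lam / 2 + CZ + ka).
have C0 : 0 <= C by rewrite /C; lra.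
have W0 : W 0 = U 0 + V 0.
  by rewrite -(@row_mx0 _ 1 n n) WE subrr qf0 sq0; ring.
pose ep := eta / 64; have ep0 : 0 < ep by rewrite divr_gt0.
have [||||z0 [s [g [A [s0 se z0e ge [sA Aup exp]]]]]] :=
   @quadratic_scale R (n + n) W 1 C ka _ ltr01 C0 ka0 _ _ _ ep ep0.
- by rewrite addn_gt0 n0.
- move=> z _; have -> : W = (fun z : 'rV[R]_(n + n) => U (lsubmx z) + V (rsubmx z)
     - 2^-1 * qf (block_mx Z' (- Z') (- Z') Z') z - ka * sq (z - 0)).
    apply/funext => y; rewrite /W subr0; congr (_ - _ * _ - _).
    rewrite -[in RHS](hsubmxK y) /qf mul_row_block dot_row_mx.
    by rewrite !mulmxN mulmxBl !dotE; ring.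
  apply: continuousB; last by apply: continuousM; [exact: cst_continuous | exact: cont_sq].
  apply: continuousB; last by apply: continuousM; [exact: cst_continuous | exact: cont_qf].
  by apply: continuousD; [apply: cont_lsubmx; exact: Uc | apply: cont_rsubmx; exact: Vc].
- move=> z0 _; rewrite -(hsubmxK z0); set x0 := lsubmx z0; set y0 := rsubmx z0.
  have [g1 H1] := Ul x0; have [g2 H2] := Vl y0; set d := x0 - y0.
  exists (row_mx (g1 - d *m Z' - (2 * ka) *: x0) (g2 + d *m Z' - (2 * ka) *: y0)) => z _.
  rewrite -(hsubmxK z); set x := lsubmx z; set y := rsubmx z.
  rewrite opp_row_mx add_row_mx dot_row_mx sq_row_mx !WE.
  have {}H1 := H1 x; have {}H2 := H2 y.
  have : x = x0 + (x - x0) /\ y = y0 + (y - y0) by rewrite !(addrC _ (_ - _)) !subrK.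
  move: H1 H2; move: (x - x0) (y - y0) => h k H1 H2 [xE yE].
  have -> : x - y = d + (h - k) by rewrite xE yE /d; apply/rowP => i; rewrite !mxE; ring.
  rewrite -/d xE yE in H1 H2 *.
  rewrite (qfD d) // !sqD dotBr (dotBl (g1 - _)) (dotBl g1) (dotBl (g2 + _)) (dotDl g2) !dotZl.
  have h1 := HCZ (h - k); have h2 := sqB_le h k; have h3 := ler_norm (qf Z' (h - k)).
  have h4 : CZ * sq (h - k) <= CZ * (2 * sq h + 2 * sq k) by rewrite ler_wpM2l.
  rewrite /C; clear -H1 H2 h1 h3 h4; lra.
- move=> z _; rewrite -(hsubmxK z) W0 WE sq_row_mx.
  by have := UV (lsubmx z) (rsubmx z); lra.
move: z0e ge exp; rewrite -(hsubmxK z0) -(hsubmxK g).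
set x0 := lsubmx z0; set y0 := rsubmx z0; set g1 := lsubmx g; set g2 := rsubmx g.
move=> z0e ge exp; set d := x0 - y0.
have x0e : `|x0| < ep := le_lt_trans (normv_row_mxl _ _) z0e.
have y0e : `|y0| < ep := le_lt_trans (normv_row_mxr _ _) z0e.
have e3 h k : `|h| <= s -> `|k| <= s ->
   `|W (row_mx (x0 + h) (y0 + k)) - W (row_mx x0 y0) - (dot g1 h + dot g2 k)
      - 2^-1 * qf A (row_mx h k)| <= ep * s ^+ 2.
  move=> hs ks; have := exp (row_mx (x0 + h) (y0 + k)).
  have -> : row_mx (x0 + h) (y0 + k) - row_mx x0 y0 = row_mx h k.
    by rewrite opp_row_mx add_row_mx; congr row_mx; rewrite addrAC subrr add0r.
  rewrite dot_row_mx.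
  by case; first exact: normv_row_mx (ltW s0) hs ks.
have ns0 : `|0 : E| <= s by rewrite normr0 ltW.
pose X0 := ulsubmx A + Z' + (2 * ka)%:M; pose Y0 := drsubmx A + Z' + (2 * ka)%:M.
have [sAu sAd] : Defs.symmetric (ulsubmx A) /\ Defs.symmetric (drsubmx A).
  by rewrite /Defs.symmetric trmx_ulsub trmx_drsub sA.
have sX0 : Defs.symmetric X0 by apply: symD; [exact: symD | exact: sym_scalar].
have sY0 : Defs.symmetric Y0 by apply: symD; [exact: symD | exact: sym_scalar].
have [|x1 [p [x1s jx]]] := @approx_ujet U x0 (g1 + d *m Z' + (2 * ka) *: x0) X0 ep s ep0 s0 sX0 Uc.
  move=> h hs; have := e3 h 0 hs ns0; rewrite ler_norml => /andP[_].
  rewrite addr0 !WE qf_ulsub dot0r -/d.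
  have -> : x0 + h - y0 = d + h by rewrite addrAC.
  rewrite qfD // sqD /X0 !qfDm qf_scalar (dotDl (g1 + _)) (dotDl g1) dotZl.
  clear; lra.
have [|y1 [q [y1s jy]]] := @approx_ujet V y0 (g2 - d *m Z' + (2 * ka) *: y0) Y0 ep s ep0 s0 sY0 Vc.
  move=> k ks; have := e3 0 k ns0 ks; rewrite ler_norml => /andP[_].
  rewrite addr0 !WE qf_drsub dot0r -/d.
  have -> : x0 - (y0 + k) = d - k by rewrite opprD addrA.
  rewrite qfB // sqD /Y0 !qfDm qf_scalar (dotDl (g2 - _)) (dotBl g2) dotZl.
  clear; lra.
exists x1, y1, p, q, (X0 + (4 * ep)%:M), (Y0 + (4 * ep)%:M); split.
- have := ler_normD (x1 - x0) x0; rewrite subrK /ep in x0e se *; clear -x1s x0e se eta0; lra.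
- have := ler_normD (y1 - y0) y0; rewrite subrK /ep in y0e se *; clear -y1s y0e se eta0; lra.
- by apply: symD => //; exact: sym_scalar.
- by apply: symD => //; exact: sym_scalar.
split=> // a b.
(* In the mixed second difference of [W] only the coupling through [Z'] survives. This identifies
   the off-diagonal part of [A] up to the error of the expansion, and the upper bound on [A]
   concludes. *)
suff H : qf A (row_mx a 0) + qf A (row_mx 0 b) + 2 * dot (a *m Z') b <= 7 * ep * (sq a + sq b).
  move: H; rewrite qf_ulsub qf_drsub qfB // /X0 /Y0 !qfDm !qf_scalar /ka /ep.
  have := sq_ge0 a; have := sq_ge0 b.
  have := mulr_ge0 (ltW eta0) (sq_ge0 a); have := mulr_ge0 (ltW eta0) (sq_ge0 b); clear; lra.
have [ab0|ab0] := eqVneq `|row_mx a b| 0.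
  have [-> ->] : a = 0 /\ b = 0.
    by split; apply/eqP; rewrite -normr_eq0 eq_le normr_ge0 andbT -ab0 (normv_row_mxl, normv_row_mxr).
  by rewrite row_mx0 mul0mx dot0l qf0 sq0; lra.
set N := `|row_mx a b| in ab0; have N0 : 0 < N by rewrite lt_def ab0 normr_ge0.
pose t := s / N; have t0 : 0 < t by rewrite divr_gt0.
have tn (c : E) : `|c| <= N -> `|t *: c| <= s.
  move=> cN; rewrite normrZ (gtr0_norm t0); apply: (@le_trans _ _ (t * N)); first by rewrite ler_pM2l.
  by rewrite /t divfK.
have as' := tn _ (normv_row_mxl a b); have bs' := tn _ (normv_row_mxr a b).
have := e3 _ _ as' bs'; have := e3 _ _ as' ns0; have := e3 _ _ ns0 bs'.
have up := Aup (row_mx (t *: a) (t *: b)).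
rewrite !ler_norml !WE !addr0 -/d => /andP[i1 i2] /andP[i3 i4] /andP[i5 i6].
have : t ^+ 2 * (qf A (row_mx a 0) + qf A (row_mx 0 b) + 2 * dot (a *m Z') b) <=
       t ^+ 2 * (7 * ep * (sq a + sq b)).
  move: i1 i2 i3 i4 i5 i6 up; rewrite !dot0r.
  have -> : x0 + t *: a - (y0 + t *: b) = (d + t *: a) - t *: b by rewrite opprD addrA (addrAC x0).
  have -> : x0 + t *: a - y0 = d + t *: a by rewrite addrAC.
  have -> : x0 - (y0 + t *: b) = d - t *: b by rewrite opprD addrA.
  have -> : row_mx (t *: a) (0 : E) = t *: row_mx a 0 by rewrite scale_row_mx scaler0.
  have -> : row_mx (0 : E) (t *: b) = t *: row_mx 0 b by rewrite scale_row_mx scaler0.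
  rewrite (qfB (d + _)) // (qfB d) // (mulmxDl d) (dotDl (d *m _)) sq_row_mx !qfZ !sqZ.
  rewrite -scalemxAl !(dotZl, dotZr) => i1 i2 i3 i4 i5 i6 up.
  have n1 : N ^+ 2 <= sq a + sq b by rewrite -sq_row_mx normv_sq.
  have st : s ^+ 2 = t ^+ 2 * N ^+ 2 by rewrite /t; field.
  have n2 : ep * s ^+ 2 <= ep * (t ^+ 2 * (sq a + sq b)).
    by rewrite st ler_pM2l // ler_pM2l // exprn_gt0.
  clear -i1 i2 i3 i4 i5 i6 up n2; lra.
by rewrite ler_pM2l // exprn_gt0.
Qed.

(** Comparison with the competitor [0]: the growth bound uses only half of the penalty coefficient.
    The points to which jets are carried back thus stay close to the centre. *)
Lemma supconv_argmax (w : E -> R) (r lam : R) m U : (0 < n)%N -> 0 < r -> 0 < lam ->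
  (forall xi, `|m xi| <= r) ->
  (forall xi, U xi = w (m xi) - lam / 2 * sq (m xi - xi)) ->
  (forall xi y, `|y| <= r -> w y - lam / 2 * sq (y - xi) <= U xi) ->
  (forall h, `|h| <= r -> w h <= w 0 + lam / 4 * sq h) ->
  forall xi, `|m xi| <= 4 * n%:R * `|xi|.
Proof.
move=> n0 r0 l0 mr UE Ua wmax xi.
have h1 := Ua xi 0; rewrite normr0 sub0r sqN UE in h1; have {}h1 := h1 (ltW r0).
have h2 := wmax _ (mr xi); have h3 : lam * sq (m xi - xi) <= lam * (2^-1 * sq (m xi) + sq xi) by lra.
rewrite ler_pM2l // sqB in h3.
have h4 : 2 * dot (m xi) xi <= 4^-1 * sq (m xi) + 4 * sq xi.
  by have := @dot_amgm R n (m xi) xi 4^-1; rewrite invrK => /(_ _)->.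
have h5 : sq (m xi) <= 16 * sq xi by lra.
have h6 := normv_sq (m xi); have h7 := sq_normv xi.
have n1 : 1 <= n%:R :> R by rewrite ler1n.
have h8 : `|m xi| ^+ 2 <= (4 * n%:R * `|xi|) ^+ 2.
  have -> : (4 * n%:R * `|xi|) ^+ 2 = 16 * (n%:R * (n%:R * `|xi| ^+ 2)) by ring.
  have : n%:R * `|xi| ^+ 2 <= n%:R * (n%:R * `|xi| ^+ 2).
    by rewrite ler_peMl // mulr_ge0 // sqr_ge0.
  lra.
by rewrite ler_pXn2r // ?nnegrE ?mulr_ge0 // in h8.
Qed.

(** Sup-convolution makes both functions semiconvex and replaces the coupling [Z] by [Z'], which is
    what the hypothesis relating the two forms expresses. [sums_good_scale] provides jets of the
    convolutions and [ujet_supconv] carries them back. The jets are exact, at points within [eta] of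
    the maximum. *)
Lemma theorem_on_sums u v xh yh (r lam : R) p Z Z' : (0 < n)%N -> 0 < r -> 0 < lam ->
  Defs.symmetric Z' ->
  (forall x, `|x - xh| <= r -> {for x, continuous u}) ->
  (forall y, `|y - yh| <= r -> {for y, continuous v}) ->
  (forall a b, qf Z a <= qf Z' b + lam / 2 * sq (a - b)) ->
  (forall x y, `|x - xh| <= r -> `|y - yh| <= r ->
     u x - v y <= u xh - v yh + dot p ((x - xh) - (y - yh)) + 2^-1 * qf Z ((x - xh) - (y - yh))) ->
  forall eta, 0 < eta -> exists x1 y1 p1 p2 X Y,
   [/\ `|x1 - xh| < eta, `|y1 - yh| < eta, `|p1 - p| < eta, `|p2 - p| < eta &
   [/\ Defs.symmetric X, Defs.symmetric Y, ujet u x1 p1 X, ljet v y1 p2 Y &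
   [/\ forall a b, qf X a - qf Y b <= qf Z' (a - b) + eta * (sq a + sq b),
     forall a, - lam * sq a <= qf X a & forall b, qf Y b <= lam * sq b]]].
Proof.
move=> n0 r0 l0 sZ' uc vc HZ Hmax eta eta0.
pose ut h := u (xh + h) - dot p h; pose wt h := dot p h - v (yh + h).
have shift (f : E -> R) (c : E) h : {for c + h, continuous f} -> {for h, continuous (fun h => f (c + h))}.
  move=> /contP_eps fc; apply/contP_eps => e e0; have [d d0 H] := fc e e0.
  exists d => // y yh'; apply: H; by rewrite opprD addrACA subrr add0r.
have utc h : `|h| <= r -> {for h, continuous ut}.
  move=> hr; apply: continuousB; last exact: cont_dot.
  by apply: shift; apply: uc; rewrite addrAC subrr add0r.
have wtc h : `|h| <= r -> {for h, continuous wt}.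
  move=> hr; apply: continuousB; first exact: cont_dot.
  by apply: shift; apply: vc; rewrite addrAC subrr add0r.
have HM h k : `|h| <= r -> `|k| <= r -> ut h + wt k <= ut 0 + wt 0 + 2^-1 * qf Z (h - k).
  move=> hr kr; have := Hmax (xh + h) (yh + k).
  have e (c g : E) : c + g - c = g by rewrite addrAC subrr add0r.
  by rewrite !e /ut /wt !addr0 !dot0r => /(_ hr kr); rewrite dotBr; lra.
have HZ0 h : qf Z h <= lam / 2 * sq h by have := HZ h 0; rewrite qf0 subr0 add0r.
have utmax h : `|h| <= r -> ut h <= ut 0 + lam / 4 * sq h.
  by move=> hr; have := HM h 0 hr; rewrite normr0 subr0 => /(_ (ltW r0)); have := HZ0 h; lra.
have wtmax h : `|h| <= r -> wt h <= wt 0 + lam / 4 * sq h.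
  by move=> hr; have := HM 0 h; rewrite normr0 sub0r qfN => /(_ (ltW r0) hr); have := HZ0 h; lra.
have [U [m [mr UE Ua Ub Uc]]] := sup_convolution r0 l0 utc.
have [V [m' [mr' VE Va Vb Vc]]] := sup_convolution r0 l0 wtc.
have mU := supconv_argmax n0 r0 l0 mr UE Ua utmax.
have mV := supconv_argmax n0 r0 l0 mr' VE Va wtmax.
pose et := Num.min eta r / ((4 * n%:R + 1) * (1 + lam)).
have l1 : 0 < 1 + lam by rewrite ltr_wpDl.
have n1 : 0 < 4 * n%:R + 1 :> R by rewrite ltr_wpDl // mulr_ge0.
have et0 : 0 < et by rewrite divr_gt0 ?mulr_gt0 // lt_min eta0.
have ete : et * ((4 * n%:R + 1) * (1 + lam)) = Num.min eta r by rewrite divfK // gt_eqF // mulr_gt0.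
have bnd (mm : E -> E) x : (forall xi, `|mm xi| <= 4 * n%:R * `|xi|) -> `|x| < et ->
   [/\ `|mm x| < r, `|mm x| < eta & `|lam *: (mm x - x)| < eta].
  move=> mb xe; have h1 := mb x; have h2 := normr_ge0 x.
  have h3 : (4 * n%:R + 1) * `|x| < (4 * n%:R + 1) * et by rewrite ltr_pM2l.
  have h4 : (4 * n%:R + 1) * `|x| * (1 + lam) < Num.min eta r.
    by rewrite -ete mulrA (mulrC et) ltr_pM2r.
  have [ge gr] : Num.min eta r <= eta /\ Num.min eta r <= r by rewrite !ge_min !lexx orbT.
  have h5 : 0 <= (4 * n%:R + 1) * `|x| * lam by rewrite mulr_ge0 ?(ltW l0) // mulr_ge0 // ltW.
  have h6 : `|mm x - x| <= (4 * n%:R + 1) * `|x| by apply: le_trans (ler_normB _ _) _; (clear -R n m h1; lra).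
  split; [(clear -R n m h5 gr h4 h2 h1; lra) | (clear -R n m h5 ge h4 h2 h1; lra) |].
  rewrite normrZ (gtr0_norm l0); have : lam * `|mm x - x| <= lam * ((4 * n%:R + 1) * `|x|) by rewrite ler_pM2l.
  have : 0 <= (4 * n%:R + 1) * `|x| by rewrite mulr_ge0 // ltW.
  (clear -R n m ge h4; lra).
have [|||x1 [y1 [q1 [q2 [X [Y [x1e y1e sX sY [jU jV XY]]]]]]]] :=
    @sums_good_scale U V Z' lam et n0 l0 et0 sZ' Uc Vc.
- by move=> x; exists (lam *: (m x - x)) => y; rewrite dotZl.
- by move=> x; exists (lam *: (m' x - x)) => y; rewrite dotZl.
- move=> x y; have hU := Ua 0 0; have hV := Va 0 0.
  rewrite normr0 subr0 sq0 mulr0 !subr0 in hU hV; have {}hU := hU (ltW r0); have {}hV := hV (ltW r0).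
  have hM := HM _ _ (mr x) (mr' y); rewrite UE VE.
  have := HZ (m x - m' y) (x - y).
  have -> : m x - m' y - (x - y) = (m x - x) - (m' y - y) by apply/rowP => i; rewrite !mxE; ring.
  have h1 := sqB_le (m x - x) (m' y - y).
  have : lam * sq ((m x - x) - (m' y - y)) <= lam * (2 * sq (m x - x) + 2 * sq (m' y - y)) by rewrite ler_pM2l.
  clear -hU hV hM; lra.
have [b1 b2 b3] := bnd m x1 mU x1e; have [c1 c2 c3] := bnd m' y1 mV y1e.
have [ju qE Xl] := ujet_supconv UE Ua Ub b1 jU.
have [jw q'E Yl] := ujet_supconv VE Va Vb c1 jV.
have ett : et <= eta.
  have h : Num.min eta r <= eta by rewrite ge_min lexx.
  rewrite -ete in h; apply: le_trans h; rewrite ler_pMr //.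
  have : 0 <= n%:R * (1 + lam) by rewrite mulr_ge0 // ltW.
  (clear -R n m l0; lra).
exists (xh + m x1), (yh + m' y1), (p + q1), (p - q2), X, (- Y).
have e (c g : E) : c + g - c = g by rewrite addrAC subrr add0r.
rewrite !e -qE -q'E normrN in b3 c3 *; split=> //; split=> //.
- exact: symN.
- have [d d0 J] := ju; exists d => // y yd; have := J (y - xh).
  have e2 : y - xh - m x1 = y - (xh + m x1) by rewrite opprD addrA.
  rewrite e2 => /(_ yd); rewrite /ut (addrC xh (y - xh)) subrK dotDl.
  have -> : dot p (y - xh) = dot p (m x1) + dot p (y - (xh + m x1)).
    by rewrite -dotDr -e2; congr dot; rewrite [RHS]addrC subrK.
  clear; lra.
- have [d d0 J] := jw; exists d => // y yd; have := J (y - yh).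
  have e2 : y - yh - m' y1 = y - (yh + m' y1) by rewrite opprD addrA.
  rewrite e2 => /(_ yd); rewrite /wt (addrC yh (y - yh)) subrK dotBl qfNm.
  have -> : dot p (y - yh) = dot p (m' y1) + dot p (y - (yh + m' y1)).
    by rewrite -dotDr -e2; congr dot; rewrite [RHS]addrC subrK.
  clear; lra.
- split=> // [a b|b]; last by rewrite qfNm; have := Yl b; (clear -R n m; lra).
  rewrite qfNm opprK; apply: le_trans (XY a b) _; rewrite lerD2l ler_wpM2r //.
  by rewrite addr_ge0 ?sq_ge0.
Qed.

End SupConv.

(** * Interior Lipschitz estimate *)

Section Radial.
Context {R : realType} {n : nat}.
Notation E := 'rV[R]_n.
Implicit Types (x y e h : E) (L t : R).

Definition nrm2 (x : E) : R := Num.sqrt (sq x).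
(** The Ishii-Lions modulus [2 L t - L t^(3/2)]: on the unit interval it is increasing and at least
    [L t], while its second derivative, of order [- L t^(-1/2)], is unbounded at [0]. *)
Definition radm L t : R := 2 * L * t - L * (t * Num.sqrt t).
Definition radm' L t : R := 2 * L - 3 / 2 * L * Num.sqrt t.

Lemma nrm2_ge0 x : 0 <= nrm2 x. Proof. exact: sqrtr_ge0. Qed.
Lemma nrm2K x : nrm2 x ^+ 2 = sq x. Proof. by rewrite sqr_sqrtr ?sq_ge0. Qed.
Lemma nrm2_gt0 x : x != 0 -> 0 < nrm2 x.
Proof. by move=> x0; rewrite sqrtr_gt0 sq_gt0. Qed.
Lemma dot_nrm2 x y : `|dot x y| <= nrm2 x * nrm2 y.
Proof.
rewrite -(@ler_pXn2r _ 2) ?nnegrE ?mulr_ge0 ?nrm2_ge0 //.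
by rewrite real_normK ?num_real // exprMn !nrm2K cauchy_schwarz.
Qed.
Lemma nrm2_le x r : 0 <= r -> sq x <= r ^+ 2 -> nrm2 x <= r.
Proof. by move=> r0 H; rewrite -(ger0_norm r0) -sqrtr_sqr ler_wsqrtr. Qed.
Lemma normv_nrm2 x : `|x| <= nrm2 x.
Proof. by rewrite -(@ler_pXn2r _ 2) ?nnegrE ?nrm2_ge0 // nrm2K normv_sq. Qed.
Lemma nrm2_normv x : (0 < n)%N -> nrm2 x <= n%:R * `|x|.
Proof.
move=> n0; apply: nrm2_le; first by rewrite mulr_ge0.
apply: le_trans (sq_normv x) _; rewrite exprMn ler_wpM2r ?sqr_ge0 //.
by rewrite expr2 ler_peMl // ler1n.
Qed.

Lemma rad_expansion L r s : 0 <= L -> 0 < r -> `|s| <= r / 2 ->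
  radm L (r + s) <= radm L r + radm' L r * s - L / (4 * Num.sqrt r) * s ^+ 2.
Proof.
move=> L0 r0; rewrite ler_norml => /andP[s1 s2].
have rs0 : 0 <= r + s by lra.
rewrite /radm /radm'; set a := Num.sqrt r; set b := Num.sqrt (r + s).
have a0 : 0 < a by rewrite sqrtr_gt0.
have b0 : 0 <= b by exact: sqrtr_ge0.
have ar : r = a ^+ 2 by rewrite sqr_sqrtr // ltW.
have br : r + s = b ^+ 2 by rewrite sqr_sqrtr.
have b2a : b <= 2 * a.
  rewrite -(@ler_pXn2r _ 2) ?nnegrE ?mulr_ge0 ?(ltW a0) //.
  by rewrite -br exprMn -ar; lra.
have sE : s = b ^+ 2 - a ^+ 2 by rewrite -br ar; ring.
(* In the square roots [a] and [b] the claim is polynomial; the difference is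
   [(b - a)^2 (a^2 + 2 a b - b^2) / (4 a)], nonnegative because [b <= 2 a]. *)
have key : a ^+ 3 + 3 / 2 * a * (b ^+ 2 - a ^+ 2) + (b ^+ 2 - a ^+ 2) ^+ 2 / (4 * a) <= b ^+ 3.
  rewrite -subr_ge0.
  have -> : b ^+ 3 - (a ^+ 3 + 3 / 2 * a * (b ^+ 2 - a ^+ 2) + (b ^+ 2 - a ^+ 2) ^+ 2 / (4 * a)) =
     (b - a) ^+ 2 * (a ^+ 2 + 2 * a * b - b ^+ 2) / (4 * a) by field; rewrite gt_eqF.
  apply: divr_ge0; last by rewrite mulr_ge0 // ltW.
  apply: mulr_ge0; first exact: sqr_ge0.
  have : 0 <= b * (2 * a - b) by rewrite mulr_ge0 // subr_ge0.
  have : 0 <= a ^+ 2 by exact: sqr_ge0.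
  lra.
have := ler_wpM2l L0 key; rewrite br sE ar; move: (a0) => /gt_eqF/negbT an.
have -> : L / (4 * a) * (b ^+ 2 - a ^+ 2) ^+ 2 = L * ((b ^+ 2 - a ^+ 2) ^+ 2 / (4 * a)) by field.
move: ((b ^+ 2 - a ^+ 2) ^+ 2 / (4 * a)) => q; clear; lra.
Qed.

Lemma rad_mono L t t' : 0 <= L -> 0 <= t -> t <= t' -> t' <= 1 -> radm L t <= radm L t'.
Proof.
move=> L0 t0 tt t1; rewrite /radm; set a := Num.sqrt t; set b := Num.sqrt t'.
have a0 : 0 <= a by exact: sqrtr_ge0.
have ab : a <= b by exact: ler_wsqrtr.
have b1 : b <= 1 by rewrite -sqrtr1 ler_wsqrtr.
have ta : t = a ^+ 2 by rewrite sqr_sqrtr.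
have tb : t' = b ^+ 2 by rewrite sqr_sqrtr //; lra.
rewrite ta tb; suff : 0 <= L * ((b - a) * (2 * (a + b) - (a ^+ 2 + a * b + b ^+ 2))) by lra.
rewrite mulr_ge0 // mulr_ge0 ?subr_ge0 //; nra.
Qed.

Lemma rad_lb L t : 0 <= L -> 0 <= t -> t <= 1 -> L * t <= radm L t.
Proof.
move=> L0 t0 t1; rewrite /radm.
have : L * (t * Num.sqrt t) <= L * (t * 1).
  by rewrite ler_wpM2l // ler_wpM2l // -sqrtr1 ler_wsqrtr.
lra.
Qed.

Lemma radm'_bounds L t : 0 <= L -> 0 <= t -> t <= 1 -> L / 2 <= radm' L t <= 2 * L.
Proof.
move=> L0 t0 t1; rewrite /radm'.
have h1 : Num.sqrt t <= 1 by rewrite -sqrtr1 ler_wsqrtr.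
have h2 : 0 <= Num.sqrt t by exact: sqrtr_ge0.
have : 0 <= L * Num.sqrt t by rewrite mulr_ge0.
have : L * Num.sqrt t <= L * 1 by rewrite ler_wpM2l.
by move=> *; apply/andP; split; lra.
Qed.

(** Here [t] is the component of [h] along [e]; only the orthogonal part [sq h - t ^+ 2] lengthens
    the vector beyond [r + t]. *)
Lemma nrm2_expansion e h : e != 0 -> let r := nrm2 e in let t := dot e h / r in
  nrm2 h <= r / 2 ->
  [/\ `|t| <= nrm2 h, t ^+ 2 <= sq h & nrm2 (e + h) <= r + t + (sq h - t ^+ 2) / (2 * (r + t))].
Proof.
move=> e0 r t hr; have r0 : 0 < r by exact: nrm2_gt0.
have th : `|t| <= nrm2 h.
  by rewrite normrM normfV (gtr0_norm r0) ler_pdivrMr // mulrC dot_nrm2.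
have t2 : t ^+ 2 <= sq h.
  by rewrite -nrm2K -real_normK ?num_real // lerXn2r ?nnegrE ?nrm2_ge0.
split=> //; have rt : 0 < r + t by move: th; rewrite ler_norml => /andP[h1 h2]; lra.
have k0 : 0 <= (sq h - t ^+ 2) / (2 * (r + t)).
  by rewrite divr_ge0 ?subr_ge0 // mulr_ge0 // ltW.
apply: nrm2_le; first by rewrite addr_ge0 // ltW.
rewrite sqD -(nrm2K e) -/r.
have -> : dot e h = t * r by rewrite /t divfK // gt_eqF.
set k := _ / _ in k0 *.
have -> : sq h = t ^+ 2 + 2 * (r + t) * k by rewrite /k; field; rewrite gt_eqF.
have := sqr_ge0 k; clear; lra.
Qed.

(* The negative eigenvalue in the radial direction is what makes the Ishii-Lions argument work. *)
Lemma radial_jet L e : 0 < L -> e != 0 -> nrm2 e <= 2^-1 ->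
  let r := nrm2 e in let m := L / (8 * Num.sqrt r) in let al := radm' L r / r + m in
  exists2 de, 0 < de & forall h, `|h| < de ->
   radm L (nrm2 (e + h)) <= radm L r + dot ((radm' L r / r) *: e) h
     + 2^-1 * qf (al%:M - ((al + m) / r ^+ 2) *: outer e) h.
Proof.
move=> L0 e0 r12 r m al; have r0 : 0 < r by exact: nrm2_gt0.
have r12' : r <= 2^-1 by [].
set q := Num.sqrt r in m al *; have q0 : 0 < q by rewrite sqrtr_gt0.
pose ds := Num.min (r / 4) (r ^+ 2 / (64 * q)).
have ds0 : 0 < ds by rewrite lt_min !divr_gt0 ?mulr_gt0 ?exprn_gt0.
have n1 : 0 < n%:R + 1 :> R by rewrite ltr_wpDl.
exists (ds / (n%:R + 1)); first by rewrite divr_gt0.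
move=> h; rewrite ltr_pdivlMr // => hd.
have hH : nrm2 h <= ds.
  apply: nrm2_le; first exact: ltW.
  apply: le_trans (sq_normv h) _; have h1 : (`|h| * (n%:R + 1)) ^+ 2 <= ds ^+ 2.
    by rewrite lerXn2r ?nnegrE ?mulr_ge0 // ltW.
  apply: le_trans h1; rewrite exprMn mulrC ler_wpM2l ?sqr_ge0 // expr2.
  have : 0 <= n%:R :> R by [].
  nra.
have hH1 : nrm2 h <= r / 4 by apply: le_trans hH _; rewrite ge_min lexx.
have hH2 : nrm2 h <= r ^+ 2 / (64 * q) by apply: le_trans hH _; rewrite ge_min lexx orbT.
have [|th t2 N] := @nrm2_expansion e h e0; first by rewrite -/r; lra.
rewrite -/r in th t2 N; set t := dot e h / r in th t2 N.
have tE : dot e h = t * r by rewrite /t divfK // gt_eqF.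
set k := (sq h - t ^+ 2) / (2 * (r + t)) in N.
have th' : `|t| <= r / 4 by lra.
have rt : 3 / 4 * r <= r + t by move: th'; rewrite ler_norml => /andP[? ?]; lra.
have rt0 : 0 < r + t by lra.
have u0 : 0 <= sq h - t ^+ 2 by rewrite subr_ge0.
have k0 : 0 <= k by rewrite divr_ge0 // mulr_ge0 // ltW.
have H0 := nrm2_ge0 h.
have kE : k * (2 * (r + t)) = sq h - t ^+ 2 by rewrite /k divfK // gt_eqF // mulr_gt0.
have k1 : k * r <= sq h.
  have : k * (3 / 4 * r) <= k * (r + t) by rewrite ler_wpM2l.
  have := sqr_ge0 t; have : 0 <= k * r by rewrite mulr_ge0 // ltW.
  lra.
have kr : k <= r / 4.
  rewrite -(ler_pM2r r0); apply: le_trans k1 _; rewrite -nrm2K expr2.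
  have : nrm2 h * nrm2 h <= (r / 4) * (r / 4) by rewrite ler_pM.
  have : 0 < r * r by rewrite mulr_gt0.
  lra.
have sb : `|t + k| <= r / 2.
  by apply: le_trans (ler_normD _ _) _; rewrite (ger0_norm k0); lra.
have s1 : r + (t + k) <= 1.
  by have := ler_norm (t + k); lra.
have Nm : radm L (nrm2 (e + h)) <= radm L (r + (t + k)).
  by apply: rad_mono; rewrite ?nrm2_ge0 ?(ltW L0) //; rewrite addrA.
apply: le_trans Nm _; apply: le_trans (rad_expansion (ltW L0) r0 sb) _.
rewrite -/q qfBm qf_scalar qfZm qf_outer dotZl tE.
have -> : L / (4 * q) = 2 * m by rewrite /m; field; rewrite gt_eqF.
have m0 : 0 < m by rewrite divr_gt0 // mulr_gt0.
have /andP[R1 R2] : L / 2 <= radm' L r <= 2 * L by apply: radm'_bounds; rewrite ?(ltW L0) //; (clear -R n r12' r0; lra).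
have -> : radm' L r / r * (t * r) = radm' L r * t by field; rewrite gt_eqF.
have -> : (al + m) / r ^+ 2 * (t * r) ^+ 2 = (al + m) * t ^+ 2 by field; rewrite gt_eqF.
set P := radm' L r in R1 R2 al *.
have alE : al = P / r + m by [].
(* k is (sq h - t^2) / (2 r) up to a cubic error *)
have kk : k * (2 * r) <= (sq h - t ^+ 2) + 2 * (k * `|t|).
  have : - t <= `|t| by rewrite -normrN ler_norm.
  move=> h1; have : k * - t <= k * `|t| by rewrite ler_wpM2l.
  (clear -R n kE; lra).
have Pr : 0 <= P / r by rewrite divr_ge0 ?(ltW r0) //; (clear -R n R2 R1; lra).
have e1 : P * k <= 2^-1 * (P / r) * (sq h - t ^+ 2) + P / r * (k * `|t|).
  have := ler_wpM2l Pr kk.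
  have -> : P / r * (k * (2 * r)) = 2 * (P * k) by field; rewrite gt_eqF.
  (clear -R n; lra).
have e2 : P / r * (k * `|t|) <= m / 4 * sq h.
  have h1 : k * `|t| <= (sq h / r) * (r ^+ 2 / (64 * q)).
    rewrite ler_pM //; last by (clear -R n th hH2; lra).
    by rewrite ler_pdivlMr.
  have h2 : P / r <= 2 * L / r by rewrite ler_pM2r ?invr_gt0.
  have h3 : P / r * (k * `|t|) <= 2 * L / r * ((sq h / r) * (r ^+ 2 / (64 * q))).
    by apply: ler_pM => //; exact: mulr_ge0.
  apply: le_trans h3 _; rewrite le_eqVlt; apply/orP; left; apply/eqP.
  by rewrite /m; field; rewrite !gt_eqF.
have e3 : k ^+ 2 <= sq h / 16.
  have h1 : k * (3 / 2 * r) <= nrm2 h * (r / 4).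
    have h3 : nrm2 h * nrm2 h <= nrm2 h * (r / 4) by rewrite ler_wpM2l.
    have h4 : k * (3 / 4 * r) <= k * (r + t) by rewrite ler_wpM2l.
    have := sqr_ge0 t; rewrite -expr2 nrm2K in h3; (clear -R n h3 h4 kE; lra).
  have h2 : k <= nrm2 h / 4.
    by rewrite -(ler_pM2r r0); have : 0 <= k * r; [rewrite mulr_ge0 // ltW | (clear -R n h1; lra)].
  have : k ^+ 2 <= (nrm2 h / 4) ^+ 2 by rewrite lerXn2r ?nnegrE // divr_ge0.
  have -> : (nrm2 h / 4) ^+ 2 = sq h / 16 by rewrite -nrm2K; field.
  by [].
have e4 : (t + k) ^+ 2 >= t ^+ 2 / 2 - k ^+ 2 by have := sqr_ge0 (t + 2 * k); (clear -R n; lra).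
have e5 : 2 * m * (t ^+ 2 / 2 - k ^+ 2) <= 2 * m * (t + k) ^+ 2 by rewrite ler_pM2l // mulr_gt0.
have e6 : m * k ^+ 2 <= m * (sq h / 16) by rewrite ler_pM2l.
have e7 : 0 <= m * sq h by rewrite mulr_ge0 ?sq_ge0 // ltW.
rewrite alE; clear -e1 e2 e5 e6 e7; lra.
Qed.

End Radial.

Section PairMaximum.
Context {R : realType} {n : nat}.
Notation E := 'rV[R]_n.

Lemma evt_pair (u v G : E -> R) (a0 b0 : E) (r : R) : 0 < r ->
  (forall x, `|x - a0| <= r -> {for x, continuous u}) ->
  (forall y, `|y - b0| <= r -> {for y, continuous v}) ->
  (forall z, {for z, continuous G}) ->
  exists a b, [/\ `|a - a0| <= r, `|b - b0| <= r &
    forall x y, `|x - a0| <= r -> `|y - b0| <= r -> u x - v y - G (x - y) <= u a - v b - G (a - b)].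
Proof.
move=> r0 uc vc Gc.
have cubeE2 (z : 'rV[R]_(n + n)) : `|z - row_mx a0 b0| <= r ->
    `|lsubmx z - a0| <= r /\ `|rsubmx z - b0| <= r.
  move=> h; have e : z - row_mx a0 b0 = row_mx (lsubmx z - a0) (rsubmx z - b0).
    by rewrite -{1}(hsubmxK z) opp_row_mx add_row_mx.
  by rewrite e in h; split; apply: le_trans h; [exact: normv_row_mxl | exact: normv_row_mxr].
have [|||z zr H] := @evt_max R (n + n) (fun z => u (lsubmx z) - v (rsubmx z) - G (lsubmx z - rsubmx z))
    [set z | `|z - row_mx a0 b0| <= r].
- by exists (row_mx a0 b0); rewrite /= subrr normr0 ltW.
- exact: compact_cube.
- move=> z /cubeE2[za zb]; apply: continuousB; last first.
    apply/contP_eps => e e0; have /contP_eps/(_ e e0)[d d0 H] := Gc (lsubmx z - rsubmx z).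
    exists (d / 2); first by rewrite divr_gt0.
    move=> y yz; apply: H; have -> : lsubmx y - rsubmx y - (lsubmx z - rsubmx z) = lsubmx (y - z) - rsubmx (y - z).
      by rewrite !linearB; apply/rowP => i; rewrite !mxE; ring.
    have h1 := normv_row_mxl (lsubmx (y - z)) (rsubmx (y - z)).
    have h2 := normv_row_mxr (lsubmx (y - z)) (rsubmx (y - z)).
    rewrite hsubmxK in h1 h2; apply: le_lt_trans (ler_normB _ _) _; lra.
  by apply: continuousB; [apply: cont_lsubmx; exact: uc | apply: cont_rsubmx; exact: vc].
have [za zb] := cubeE2 z zr.
exists (lsubmx z), (rsubmx z); split=> // x y xa yb.
have := H (row_mx x y); rewrite /= row_mxKl row_mxKr; apply.
rewrite opp_row_mx add_row_mx; apply: normv_row_mx => //; exact: ltW.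
Qed.

End PairMaximum.

Section Scaling.
Context {R : realType} {n : nat}.
Notation E := 'rV[R]_n.
Variables (O : set E) (F : op_type R n).

Lemma Fsub_scale t g u : F3 O F -> 0 < t -> Fsub O F g u -> Fsub O F (fun x => t * g x) (fun x => t * u x).
Proof.
move=> h3 t0 H x p M Ox sM J; have J' := ujetZ t0 J.
have sM' : Defs.symmetric (t^-1 *: M) by exact: symZ.
have := H x _ _ Ox sM' J'; rewrite -(ler_pM2l t0) -h3 ?(ltW t0) // !scalerA divff ?gt_eqF // !scale1r.
by [].
Qed.

Lemma ljetZ t (u : E -> R) x p M : 0 < t -> ljet (fun y => t * u y) x p M -> ljet u x (t^-1 *: p) (t^-1 *: M).
Proof.
move=> t0 J; have := @ujetN R n u x (- (t^-1 *: p)) (- (t^-1 *: M)); rewrite !opprK; apply.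
rewrite -!scalerN; apply: (ujetZ t0); have := @ujetN R n.
have [d d0 H] := J; exists d => // y /H; rewrite dotNl qfNm; lra.
Qed.

Lemma Fsup_scale t g u : F3 O F -> 0 < t -> Fsup O F g u -> Fsup O F (fun x => t * g x) (fun x => t * u x).
Proof.
move=> h3 t0 H x p M Ox sM J; have J' := ljetZ t0 J.
have sM' : Defs.symmetric (t^-1 *: M) by exact: symZ.
have := H x _ _ Ox sM' J'; rewrite -(ler_pM2l t0) -h3 ?(ltW t0) // !scalerA divff ?gt_eqF // !scale1r.
by [].
Qed.

Lemma ujet_add_quad (u : E -> R) (q : E) (B : 'M[R]_n) c x1 x p M :  Defs.symmetric B ->
  ujet (fun y => u y - (c + dot q (y - x1) + 2^-1 * qf B (y - x1))) x p M ->
  ujet u x (p + q + (x - x1) *m B) (M + B).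
Proof.
move=> sB [d d0 H]; exists d => // y /H.
have e : y - x1 = (x - x1) + (y - x) by apply/rowP => i; rewrite !mxE; ring.
rewrite e; move: (x - x1) (y - x) => a b; rewrite qfD // qfDm dotDr !dotDl; lra.
Qed.

Definition F1mod (nu : R) := forall th, 0 < th -> exists r C : R, [/\ 0 < r, r <= 1, 0 <= C &
  forall M p z x y, Defs.symmetric M -> O x -> O y -> `|x - y| <= r ->
  `|F M p z x - F M p z y| <= th * (1 + `|p| + `|z|) + C * (`|x - y| `^ nu * `|M|)].

End Scaling.

Section Lipschitz.
Context {R : realType} {n : nat}.
Notation E := 'rV[R]_n.
Variables (O : set E) (F : op_type R n) (d1 d0 ga Ga nu : R).
Hypotheses (n0 : (0 < n)%N) (d10 : 0 <= d1) (d00 : 0 <= d0) (ga0 : 0 < ga) (gG : ga <= Ga).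
Hypotheses (nuh : 2^-1 < nu <= 1) (F2h : F2low O F d1 d0 ga Ga) (F1h : F1mod O F nu) (F3h : F3 O F).

(** The square root is to be matched with the [rho^(-1/2)] of the radial second derivative; for
    [nu > 1/2] the other factor tends to [0]. *)
Lemma powR_split t : 0 < t -> t `^ nu = t `^ (nu - 2^-1) * Num.sqrt t.
Proof.
move=> t0; rewrite -powR12_sqrt ?(ltW t0) // -powRD ?subrK //.
by rewrite (gt_eqF t0) implybT.
Qed.

Lemma powR_small th : 0 < th -> exists2 t1 : R, 0 < t1 & forall t : R, 0 < t -> t <= t1 ->
  t `^ (nu - 2^-1) <= th.
Proof.
have /andP[nu1 _] := nuh; have nu0 : 0 < nu - 2^-1 by rewrite subr_gt0.
move=> th0; exists (th `^ (nu - 2^-1)^-1); first exact: powR_gt0.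
move=> t t0 tt; have -> : th = (th `^ (nu - 2^-1)^-1) `^ (nu - 2^-1).
  by rewrite -powRrM mulVf ?gt_eqF // powRr1 // ltW.
by apply: ge0_ler_powR; rewrite ?nnegrE ?(ltW nu0) ?(ltW t0) ?powR_ge0.
Qed.

(** The matrix [Y - X + s%:M] is semidefinite and at least [T] at the unit vector [e], so its trace
    is at least [T], and ellipticity converts this into a gain [ga * T]. *)
Lemma jets_gap (X Y : 'M[R]_n) (e : E) T s A : Defs.symmetric X -> Defs.symmetric Y ->
  (forall a, qf X a - qf Y a <= s * sq a) -> sq e = 1 -> qf X e - qf Y e <= - T -> 0 <= s ->
  ell ga Ga A -> ga * T - n%:R * Ga * s <= - \tr (A *m (X - Y)).
Proof.
move=> sX sY H e1 HT s0 hA.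
have Ga0 : 0 <= Ga by rewrite ltW // (lt_le_trans ga0).
have sD : Defs.symmetric (Y - X + s%:M) by apply: symD; [exact: symB | exact: sym_scalar].
have pD a : 0 <= qf (Y - X + s%:M) a by rewrite qfDm qfBm qf_scalar; have := H a; lra.
have /andP[h1 _] := ell_tr_psd hA sD pD.
have h2 := tr_psd_lb sD pD e1; rewrite qfDm qfBm qf_scalar e1 mulr1 in h2.
have /andP[_ h3] := ell_scalar_tr Ga0 hA.
have h4 : ga * T <= ga * \tr (Y - X + s%:M) by rewrite ler_pM2l //; lra.
have h5 : s * \tr A <= s * (n%:R * Ga) by rewrite ler_wpM2l.
have -> : \tr (A *m (X - Y)) = s * \tr A - \tr (A *m (Y - X + s%:M)).
  by rewrite !mulmxDr !mulmxN mul_mx_scalar !mxtraceD !raddfN /= mxtraceZ; ring.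
lra.
Qed.

End Lipschitz.

Section Lipschitz.
Context {R : realType} {n : nat}.
Notation E := 'rV[R]_n.
Variables (O : set E) (F : op_type R n) (d1 d0 ga Ga nu : R).
Hypotheses (n0 : (0 < n)%N) (d10 : 0 <= d1) (d00 : 0 <= d0) (ga0 : 0 < ga) (gG : ga <= Ga).
Hypotheses (nuh : 2^-1 < nu <= 1) (F2h : F2low O F d1 d0 ga Ga) (F1h : F1mod O F nu) (F3h : F3 O F).

(** The two viscosity inequalities are subtracted at the jets given by the theorem on sums. The
    negative radial eigenvalue produces [2 * ga * m], and the right side collects the terms that it
    must be shown to dominate. *)
Lemma lipschitz_tail (u g : E -> R) x0 x1 y1 p1 p2 p X Y e (r K m L eta C1 W rm : R) :
  (forall M p z x y, Defs.symmetric M -> O x -> O y -> `|x - y| <= rm ->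
  `|F M p z x - F M p z y| <= 1 * (1 + `|p| + `|z|) + C1 * (`|x - y| `^ nu * `|M|)) ->
  Fsub O F g u -> Fsup O F g u -> O x1 -> O y1 -> `|x1 - x0| <= r ->
  `|u x1| <= 1 -> `|u y1| <= 1 -> `|g x1| <= 1 -> `|g y1| <= 1 ->
  Defs.symmetric X -> Defs.symmetric Y ->
  ujet (fun x => u x - K * sq (x - x0)) x1 p1 X -> ljet u y1 p2 Y ->
  `|p1 - p| <= eta -> `|p2 - p| <= eta -> 0 < eta -> eta <= 1 -> `|p| <= 2 * L ->
  0 <= K -> sq e = 1 -> 0 <= C1 ->
  (forall a, qf X a - qf Y a <= 2 * eta * sq a) -> qf X e - qf Y e <= - (2 * m) + 2 * eta ->
  `|x1 - y1| <= rm -> `|x1 - y1| `^ nu * `|Y| <= W ->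
  2 * ga * m <= ((2 + 2 * K) * (ga + n%:R * Ga) + d1 * (2 + 2 * K * r) + 2 * d0 + 5) + 2 * L + C1 * W.
Proof.
move=> F1m Fu Fv Ox1 Oy1 x1r ux uy gx gy sX sY jX jY p1p p2p eta0 eta1 pL K0 e1 C10 Hs HT xyr HW.
have Ga0 : 0 <= Ga by rewrite ltW // (lt_le_trans ga0).
have sX' : Defs.symmetric (X + (2 * K)%:M) by apply: symD => //; exact: sym_scalar.
have jX' : ujet u x1 (p1 + 0 + (x1 - x0) *m (2 * K)%:M) (X + (2 * K)%:M).
  apply: (@ujet_add_quad R n u 0 (2 * K)%:M 0); first exact: sym_scalar.
  have -> // : (fun y => u y - (0 + dot 0 (y - x0) + 2^-1 * qf (2 * K)%:M (y - x0)))
    = (fun x => u x - K * sq (x - x0)).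
  by apply/funext => y; rewrite dot0l qf_scalar; field.
rewrite addr0 mul_mx_scalar in jX'.
have hA := Fu _ _ _ Ox1 sX' jX'; have hB := Fv _ _ _ Oy1 sY jY.
set p1' := p1 + (2 * K) *: (x1 - x0) in hA.
have s0 : 0 <= 2 * eta + 2 * K by lra.
pose T := 2 * m - 2 * eta - 2 * K; pose s := 2 * eta + 2 * K.
have Hc A : ell ga Ga A -> ga * T - n%:R * Ga * s <= - \tr (A *m (X + (2 * K)%:M - Y)).
  apply: (@jets_gap R n ga Ga ga0 gG _ Y e) => //.
  - by move=> a; rewrite qfDm qf_scalar /s; have := Hs a; lra.
  - by rewrite qfDm qf_scalar e1 /T; lra.
have h1 := @F2h _ _ p1' p2 (u x1) (u y1) _ _ sX' sY Ox1 Hc.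
have h2 := F1m Y p2 (u y1) x1 y1 sY Ox1 Oy1 xyr.
have pp : `|p1' - p2| <= 2 * eta + 2 * K * r.
  have -> : p1' - p2 = (p1 - p) + (p - p2) + (2 * K) *: (x1 - x0) by rewrite /p1'; apply/rowP => i; rewrite !mxE; ring.
  apply: le_trans (ler_normD _ _) _; apply: lerD.
    by apply: le_trans (ler_normD _ _) _; rewrite (distrC p p2); (clear -e1 K0 eta0 p2p p1p jY; lra).
  by rewrite normrZ ger0_norm ?mulr_ge0 // ler_wpM2l ?mulr_ge0.
have pu : `|u x1 - u y1| <= 2 by apply: le_trans (ler_normB _ _) _; (clear -sX gx uy ux x1r Oy1 Ox1; lra).
have pp2 : `|p2| <= 2 * L + 1.
  have -> : p2 = p + (p2 - p) by apply/rowP => i; rewrite !mxE; ring.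
  by apply: le_trans (ler_normD _ _) _; (clear -HT C10 pL eta1 eta0 p2p; lra).
have h3 : d1 * `|p1' - p2| <= d1 * (2 + 2 * K * r) by rewrite ler_wpM2l //; (clear -pp h2 eta1; lra).
have h4 : d0 * `|u x1 - u y1| <= d0 * 2 by rewrite ler_wpM2l.
have h5 : C1 * (`|x1 - y1| `^ nu * `|Y|) <= C1 * W by rewrite ler_wpM2l.
have h6 := ler_norm (- (F Y p2 (u y1) x1 - F Y p2 (u y1) y1)); rewrite normrN in h6.
move: gx gy; rewrite !ler_norml => /andP[_ gx] /andP[gy _].
have nG : 0 <= n%:R * Ga by rewrite mulr_ge0.
have h7 : (ga + n%:R * Ga) * s <= (ga + n%:R * Ga) * (2 + 2 * K).
  have ss : s <= 2 + 2 * K by rewrite /s; (clear -pL eta1 eta0 p2p p1p jY; lra).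
  by apply: ler_wpM2l => //; rewrite addr_ge0 // ltW.
have h8 : ga * T - n%:R * Ga * s = 2 * ga * m - (ga + n%:R * Ga) * s by rewrite /T /s; ring.
rewrite h8 in h1; clear -h1 h2 h3 h4 h5 h6 h7 hA hB gx gy uy pp2; lra.
Qed.

End Lipschitz.

(* Normalized form at small scales: Ishii-Lions doubling with the concave modulus [radm] *)
Lemma lipschitz_small (R : realType) (n : nat) (O : set 'rV[R]_n) (F : op_type R n)
  (d1 d0 ga Ga nu : R) : (0 < n)%N -> 0 <= d1 -> 0 <= d0 -> 0 < ga -> ga <= Ga -> 2^-1 < nu <= 1 ->
  F2low O F d1 d0 ga Ga -> F1mod O F nu -> exists2 r1 : R, 0 < r1 & forall r : R, 0 < r -> r <= r1 ->
  exists2 L : R, 0 < L & forall (u g : 'rV[R]_n -> R) (x0 : 'rV[R]_n),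
   (forall x : 'rV[R]_n, `|x - x0| <= r -> O x /\ {for x, continuous u}) ->
   Fsub O F g u -> Fsup O F g u ->
   (forall x : 'rV[R]_n, `|x - x0| <= r -> `|u x| <= 1 /\ `|g x| <= 1) ->
   forall y : 'rV[R]_n, `|y - x0| <= r -> u x0 - u y <= radm L (nrm2 (x0 - y)).
Proof.
move=> n0 d10 d00 ga0 gG nuh F2h F1h.
have [rm [C1 [rm0 rm1 C10 F1m]]] := F1h _ ltr01.
have C11 : 0 < C1 + 1 by exact: ltr_wpDl.
have c64 : 0 < ga / (32 * (32 * (C1 + 1))) by rewrite divr_gt0 // !mulr_gt0.
have [t2 t20 Ht2] := powR_small nuh c64.
(* The four bounds serve, in this order, the range of (F1), the interval where [radm] is controlled,
   the smallness of [t ^ (nu - 1/2)], and [sqrt rho <= ga / 64]. *)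
pose t1 := Num.min (Num.min (rm / 2) 2^-1) (Num.min (t2 / 2) ((ga / 64) ^+ 2)).
have t10 : 0 < t1 by rewrite !lt_min !divr_gt0 // exprn_gt0 ?divr_gt0 // invr_gt0 // ltr0n.
have [ta [tb [tc td]]] : t1 <= rm / 2 /\ (t1 <= 2^-1 /\ (t1 <= t2 / 2 /\ t1 <= (ga / 64) ^+ 2)).
  by rewrite /t1 !ge_min !lexx !orbT.
have np : 0 < n%:R :> R by rewrite ltr0n.
exists (t1 / (2 * n%:R)); first by rewrite divr_gt0 // mulr_gt0.
move=> r r0; rewrite ler_pdivlMr ?mulr_gt0 // => rt1.
(* As [|u| <= 1], the localising term is below 2 at a positive maximum, so this [K] keeps [a] within
   [r / 2] of [x0]. *)
have [K KE] : {K | K = 12 / r ^+ 2} by eexists.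
have K0 : 0 < K by rewrite KE divr_gt0 // exprn_gt0.
have [CK CKE] : {CK | CK = (2 + 2 * K) * (ga + n%:R * Ga) + d1 * (2 + 2 * K * r) + 2 * d0 + 5} by eexists.
have Ga0 : 0 < Ga by exact: lt_le_trans gG.
have CK0 : 0 < CK.
  have h1 : 0 <= (2 + 2 * K) * (ga + n%:R * Ga) by apply: mulr_ge0; apply: addr_ge0; rewrite ?(ltW ga0) //; apply: mulr_ge0 => //; exact: ltW.
  have h2 : 0 <= d1 * (2 + 2 * K * r) by apply: mulr_ge0 => //; apply: addr_ge0 => //; apply: mulr_ge0; [apply: mulr_ge0 => //|]; exact: ltW.
  by rewrite CKE; apply: ltr_wpDl => //; rewrite !addr_ge0 // mulr_ge0.
(* The first term forces [|a - b| < r / 3]; the second lets [ga * m] dominate [CK] at the end. *)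
have [L LE] : {L | L = 6 / r + 64 * CK / ga} by eexists.
have L0 : 0 < L by rewrite LE addr_gt0 // divr_gt0 // mulr_gt0.
exists L => // u g x0 uO Fu Fv ug.
have G0 : radm L (nrm2 (0 : 'rV[R]_n)) = 0 by rewrite /radm /nrm2 sq0 sqrtr0 !mul0r !mulr0 subrr.
pose G (z : 'rV[R]_n) := radm L (nrm2 z).
have Gc z : {for z, continuous G}.
  have c1 : {for z, continuous (nrm2 : 'rV[R]_n -> R)}.
    have -> : (nrm2 : 'rV[R]_n -> R) = (fun y => Num.sqrt (sq (y - 0))) by apply/funext => y; rewrite subr0.
    apply: (@continuous_comp _ _ _ (fun y : 'rV[R]_n => sq (y - 0)) Num.sqrt); first exact: cont_sq.
    exact: sqrt_continuous.
  apply: continuousB.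
    by apply: continuousM; [exact: cst_continuous | exact: c1].
  apply: continuousM; first exact: cst_continuous.
  apply: continuousM; first exact: c1.
  by apply: (@continuous_comp _ _ _ (nrm2 : 'rV[R]_n -> R) Num.sqrt); [exact: c1 | exact: sqrt_continuous].
pose u1 x := u x - K * sq (x - x0).
have x0r : `|x0 - x0| <= r by rewrite subrr normr0 ltW.
have u1c x : `|x - x0| <= r -> {for x, continuous u1}.
  move=> /uO[_ uc]; apply: continuousB => //.
  by apply: continuousM; [exact: cst_continuous | exact: cont_sq].
have [a [b [ar br ab]]] := @evt_pair R n u1 u G x0 x0 r r0 u1c (fun x xr => (uO x xr).2) Gc.
suff Hm : u1 a - u b - G (a - b) <= 0.
  move=> y yr; have := le_trans (ab x0 y x0r yr) Hm; rewrite /u1 subrr sq0 mulr0 subr0 /G; (clear; lra).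
rewrite leNgt; apply/negP => pos.
have [ua _] := ug a ar; have [ub _] := ug b br.
move: ua ub; rewrite !ler_norml => /andP[ua1 ua2] /andP[ub1 ub2].
set e := a - b in pos.
have e0 : e != 0.
  apply/eqP => e0; move: pos; rewrite e0 /G G0 /u1.
  have ab' : a = b by apply/eqP; rewrite -subr_eq0; apply/eqP.
  have : 0 <= K * sq (a - x0) by rewrite mulr_ge0 ?sq_ge0 // ltW.
  by rewrite ab'; (clear; lra).
set rho := nrm2 e; have rho0 : 0 < rho by exact: nrm2_gt0.
have rhot1 : rho <= t1.
  apply: le_trans (nrm2_normv e n0) _; apply: le_trans rt1.
  have : `|e| <= 2 * r.
    have -> : e = (a - x0) - (b - x0) by rewrite opprB addrA subrK.
    by apply: le_trans (ler_normB _ _) _; (clear -br ar; lra).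
  by rewrite -(ler_pM2l np) mulrA (mulrC r) (mulrC 2).
have rho12 : rho <= 2^-1 by exact: le_trans tb.
have GL : L * rho <= G e by apply: rad_lb; rewrite ?(ltW L0) ?(ltW rho0) //; (clear -rho12; lra).
have Ksq : 0 <= K * sq (a - x0) by rewrite mulr_ge0 ?sq_ge0 // ltW.
have Lrho : L * rho < 2 by rewrite /u1 in pos; (clear -pos Ksq GL ub1 ua2; lra).
have er : `|e| < r / 3.
  apply: le_lt_trans (normv_nrm2 e) _; rewrite -/rho.
  have : 6 / r * rho < 2.
    apply: le_lt_trans Lrho; rewrite ler_pM2r // LE lerDl divr_ge0 ?mulr_ge0 ?(ltW CK0) //; exact: ltW.
  by rewrite mulrAC ltr_pdivrMr // => h; (clear -h; lra).
have ar2 : `|a - x0| < r / 2.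
  have h1 : K * sq (a - x0) < 2.
    have : 0 <= L * rho by rewrite mulr_ge0 // ltW.
    by rewrite /u1 in pos; (clear -pos GL ub1 ua2; lra).
  rewrite -(@ltr_pXn2r _ 2) ?nnegrE ?divr_ge0 ?(ltW r0) //.
  apply: le_lt_trans (normv_sq _) _; rewrite -(ltr_pM2l K0); apply: lt_le_trans h1 _.
  by rewrite KE; have -> : 12 / r ^+ 2 * (r / 2) ^+ 2 = 3 by [field; rewrite gt_eqF]; (clear; lra).
have br2 : `|b - x0| < 5 / 6 * r.
  have -> : b - x0 = (a - x0) - e by rewrite /e; apply/rowP => i; rewrite !mxE; ring.
  by apply: le_lt_trans (ler_normB _ _) _; (clear -ar2 er; lra).
set q := Num.sqrt rho; have q0 : 0 < q by rewrite sqrtr_gt0.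
have q2 : q ^+ 2 = rho by rewrite sqr_sqrtr // ltW.
have [de de0 jet] := @radial_jet R n L e L0 e0 rho12.
move: jet; rewrite -/rho -/q; set m := L / (8 * q); set al := radm' L rho / rho + m.
set p := (radm' L rho / rho) *: e; set Z := _ - _ => jet.
have m0 : 0 < m by rewrite divr_gt0 // mulr_gt0.
have /andP[R1 R2] : L / 2 <= radm' L rho <= 2 * L by apply: radm'_bounds; rewrite ?(ltW L0) ?(ltW rho0) //; (clear -rho12; lra).
have Rr0 : 0 < radm' L rho / rho by rewrite divr_gt0 //; (clear -R1 L0; lra).
have al0 : 0 < al by rewrite addr_gt0.
have mLr : m <= L / rho.
  have q1 : q <= 1 by rewrite -sqrtr1 ler_wsqrtr //; (clear -rho12; lra).
  rewrite /m ler_pdivrMr ?mulr_gt0 // -q2 expr2.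
  have -> : L / (q * q) * (8 * q) = 8 * L / q by field; rewrite gt_eqF.
  rewrite ler_pdivlMr //; have : L * q <= L * 1 by rewrite ler_pM2l.
  (clear -R2 R1; lra).
have alr : al <= 3 * L / rho.
  have : radm' L rho / rho <= 2 * L / rho by rewrite ler_pM2r ?invr_gt0.
  by rewrite /al -!mulrA in mLr *; (clear -mLr; lra).
(* Passing from [Z] to [Z'] pays for the sup-convolution: the tangential eigenvalue doubles, and
   half of the negative radial one survives. *)
pose Z' : 'M[R]_n := (2 * al)%:M - ((2 * al + m / 2) / rho ^+ 2) *: outer e.
have sZ' : Defs.symmetric Z' by apply: symB; [exact: sym_scalar | apply: symZ; exact: outer_sym].
pose lam := 4 * al + 2 * m; have lam0 : 0 < lam by rewrite addr_gt0 // mulr_gt0.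
have qZ' c : qf Z' c = 2 * al * sq c - (2 * al + m / 2) * (dot e c / rho) ^+ 2.
  by rewrite qfBm qf_scalar qfZm qf_outer; field; rewrite gt_eqF.
have HZ c c' : qf Z c <= qf Z' c' + lam / 2 * sq (c - c').
  rewrite qZ' /Z qfBm qf_scalar qfZm qf_outer.
  have -> : (al + m) / rho ^+ 2 * dot e c ^+ 2 = (al + m) * (dot e c / rho) ^+ 2 by field; rewrite gt_eqF.
  pose tt (c : 'rV[R]_n) := dot e c / rho.
  have ttD c1 c2 : tt (c1 - c2) = tt c1 - tt c2 by rewrite /tt dotBr mulrBl.
  have perp c1 : tt c1 ^+ 2 <= sq c1.
    rewrite /tt expr_div_n ler_pdivrMr ?exprn_gt0 // /rho nrm2K mulrC; exact: cauchy_schwarz.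
  (* split each vector into its component along [e] and the rest *)
  pose N c1 := sq c1 - tt c1 ^+ 2.
  have par c1 c2 : N (c1 + c2) <= 2 * N c1 + 2 * N c2.
    have e1 : tt (c1 + c2) = tt c1 + tt c2 by have := ttD (c1 + c2) c2; rewrite addrK; (clear; lra).
    have e2 : sq (c1 - c2) = sq c1 - 2 * dot c1 c2 + sq c2 by rewrite sqB.
    have := perp (c1 - c2); rewrite /N e1 ttD e2 sqD; (clear; lra).
  have Npar : N c <= 2 * N c' + 2 * N (c - c').
    by have := par c' (c - c'); rewrite addrC subrK.
  have h1 := perp (c - c'); rewrite ttD in h1.
  have h2 : al * N c <= al * (2 * N c' + 2 * N (c - c')) by rewrite ler_pM2l.
  have h3 : m * (tt c' ^+ 2 / 2) <= m * (tt c ^+ 2 + (tt c - tt c') ^+ 2).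
    by rewrite ler_pM2l //; have := sqr_ge0 (2 * tt c - tt c'); (clear; lra).
  have h4 : m * (tt c - tt c') ^+ 2 <= m * sq (c - c') by rewrite ler_pM2l.
  have h5 : al * N (c - c') <= al * sq (c - c') by rewrite ler_pM2l // /N gerBl sqr_ge0.
  have h6 : 0 <= al * tt (c - c') ^+ 2 by rewrite mulr_ge0 ?sqr_ge0 // ltW.
  rewrite ttD in h6; move: h1 h2 h3 h4 h5 h6; rewrite -/(tt c) -/(tt c') /N ttD /lam.
  move: (tt c) (tt c') (sq c) (sq c') (sq (c - c')) => t1' t2' s1 s2 s3 h1 h2 h3 h4 h5 h6.
  clear -h1 h2 h3 h4 h5 h6; lra.
have small : exists2 rs, 0 < rs & forall x y, `|x - a| <= rs -> `|y - b| <= rs ->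
   [/\ `|x - x0| <= r, `|y - x0| <= r & `|(x - a) - (y - b)| < de].
  exists (Num.min (r / 6) (de / 4)); first by rewrite lt_min !divr_gt0.
  have [h1 h2] : Num.min (r / 6) (de / 4) <= r / 6 /\ Num.min (r / 6) (de / 4) <= de / 4 by rewrite !ge_min !lexx orbT.
  move=> x y xa yb; split.
  - have k := ler_normD (x - a) (a - x0); rewrite subrKA in k; clear -k h1 xa ar2 r0; lra.
  - have k := ler_normD (y - b) (b - x0); rewrite subrKA in k; clear -k h1 yb br2 r0; lra.
  - apply: le_lt_trans (ler_normB _ _) _; clear -h2 xa yb de0; lra.
have [rs rs0 Hrs] := small.
have aa : `|a - a| <= rs by rewrite subrr normr0 ltW.
have bb : `|b - b| <= rs by rewrite subrr normr0 ltW.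
have eta0 : 0 < Num.min (Num.min 1 (rho / 2)) rs by rewrite !lt_min ltr01 rs0 divr_gt0.
set eta := Num.min _ _ in eta0.
have [eta1 [eta2 eta3]] : eta <= 1 /\ eta <= rho / 2 /\ eta <= rs by rewrite /eta !ge_min !lexx !orbT.
have [|||x1 [y1 [p1 [p2 [X [Y [[x1a y1b p1p p2p] [[sX sY jX jY] [Hs HX HY]]]]]]]]] := @theorem_on_sums R n u1 u a b rs lam p Z Z' n0 rs0 lam0 sZ' _ _ HZ _ eta eta0.
- by move=> x xa; apply: u1c; have [] := Hrs x b xa bb.
- by move=> y yb; have [] := Hrs a y aa yb => _ yr _; exact: (uO y yr).2.
- move=> x y xa yb; have [xr yr hd] := Hrs x y xa yb.
  have := ab x y xr yr; have := jet _ hd.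
  have -> : e + (x - a - (y - b)) = x - y by rewrite /e; apply/rowP => i; rewrite !mxE; ring.
  by rewrite -/e /G => k1 k2; clear -k1 k2; lra.
have [x1r y1r _] := Hrs x1 y1 (le_trans (ltW x1a) eta3) (le_trans (ltW y1b) eta3).
have xy : `|x1 - y1| <= 2 * rho.
  have -> : x1 - y1 = e + (x1 - a) - (y1 - b) by rewrite /e; apply/rowP => i; rewrite !mxE; ring.
  apply: le_trans (ler_normB _ _) _; have k1 := ler_normD e (x1 - a); have k2 := normv_nrm2 e.
  rewrite -/rho in k2; clear -k1 k2 x1a y1b eta2; lra.
have Hs0 c : qf X c - qf Y c <= 2 * eta * sq c.
  have k := Hs c c; rewrite subrr qf0 in k; clear -k; lra.
pose eh := rho^-1 *: e.
have sqe : sq e = rho ^+ 2 by rewrite -nrm2K.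
have eh1 : sq eh = 1 by rewrite sqZ sqe -exprMn mulVf ?gt_eqF // expr1n.
(* Opposite vectors see the radial eigenvalue [- m / 2] of [Z'] four times: the form at [2 eh] is
   [- 2 m]. *)
have HT : qf X eh - qf Y eh <= - (2 * m) + 2 * eta.
  have := Hs eh (- eh); rewrite qfN sqN eh1 opprK; congr (_ <= _).
  rewrite -[eh + eh]/(eh *+ 2) -scaler_nat qfZ qZ' eh1 dotZr -/(sq e) sqe.
  by field; rewrite gt_eqF.
have L1 : 2 * eta <= 2 * (L / rho).
  rewrite ler_pM2l //; apply: le_trans eta1 _; rewrite ler_pdivlMr // mul1r.
  have n1 : 1 <= n%:R :> R by rewrite ler1n.
  have k1 : 0 <= 64 * CK / ga by rewrite divr_ge0 ?mulr_ge0 // ltW.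
  have k2 : 1 <= 6 / r.
    rewrite ler_pdivlMr // mul1r.
    have k3 : r * 1 <= r * (2 * n%:R) by rewrite ler_pM2l //; clear -n1; lra.
    clear -k3 rt1 tb; lra.
  rewrite LE; clear -k1 k2 rho12; lra.
have lamb : lam <= 14 * (L / rho) by rewrite /lam; rewrite -mulrA in alr; clear -alr mLr; lra.
have normY : `|Y| <= 32 * (L / rho).
  have -> : 32 * (L / rho) = 2 * (16 * (L / rho)) by ring.
  have Lr0 : 0 < L / rho by rewrite divr_gt0.
  apply: qf_entry_bound => //; first by rewrite mulr_ge0 // ltW.
  move=> c; have := HX c; have := HY c; have := Hs0 c; rewrite ler_norml.
  have h : lam * sq c + 2 * eta * sq c <= 16 * (L / rho) * sq c by rewrite -mulrDl ler_wpM2r ?sq_ge0 //; clear -lamb L1; lra.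
  have := sq_ge0 c; have h2 : 0 <= 2 * eta * sq c by rewrite !mulr_ge0 ?sq_ge0 // ltW.
  by move=> k1 k2 k3 k4; clear -k1 k2 k3 k4 h h2; apply/andP; split; lra.
have xyrm : `|x1 - y1| <= rm by clear -xy rhot1 ta; lra.
have pL : `|p| <= 2 * L.
  rewrite normrZ gtr0_norm // mulrAC ler_pdivrMr //; apply: ler_pM => //; first by clear -R1 L0; lra.
  exact: normv_nrm2.
have [th thE] : {x | x = ga / (32 * (32 * (C1 + 1)))} by eexists.
rewrite -thE in c64 Ht2.
(* The first factor is at most [2 * th * sqrt rho] because [nu > 1/2], the second is of order
   [L / rho]; their product is of order [th * m], with [th] at free choice. *)
have HW : `|x1 - y1| `^ nu * `|Y| <= th * 512 * m.
  have h1 : `|x1 - y1| `^ nu <= th * (2 * q).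
    apply: (@le_trans _ _ ((2 * rho) `^ nu)).
      apply: ge0_ler_powR; rewrite ?nnegrE ?mulr_ge0 ?(ltW rho0) //.
      by have /andP[nu1 _] := nuh; apply: le_trans (ltW nu1); rewrite invr_ge0.
    rewrite (powR_split nu) ?mulr_gt0 //; apply: ler_pM; rewrite ?powR_ge0 ?sqrtr_ge0 //.
      by apply: Ht2; rewrite ?mulr_gt0 //; clear -rhot1 tc; lra.
    rewrite -[leRHS]ger0_norm ?mulr_ge0 ?(ltW q0) // -sqrtr_sqr ler_wsqrtr // exprMn q2 ler_wpM2r ?(ltW rho0) //; clear; lra.
  apply: le_trans (ler_pM (powR_ge0 _ _) (normr_ge0 _) h1 normY) _.
  by rewrite /m -q2 le_eqVlt; apply/orP; left; apply/eqP; clear -q0; field; rewrite gt_eqF.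
have Hsup := @lipschitz_tail R n O F d1 d0 ga Ga nu d10 d00 ga0 gG F2h u g x0 x1 y1 p1 p2 p X Y eh r K m L eta C1 _ rm F1m Fu Fv
  (uO _ x1r).1 (uO _ y1r).1 x1r (ug _ x1r).1 (ug _ y1r).1 (ug _ x1r).2 (ug _ y1r).2 sX sY jX jY
  (ltW p1p) (ltW p2p) eta0 eta1 pL (ltW K0) eh1 C10 Hs0 HT xyrm HW.
rewrite -CKE in Hsup.
have thD : th * 32 * (32 * (C1 + 1)) = ga.
  by rewrite thE; field; rewrite gt_eqF.
have th0 : 0 < th by exact: c64.
have C1th : C1 * (th * 512 * m) <= ga / 2 * m.
  have h1 : 0 <= th * m by rewrite mulr_ge0 // ltW.
  clear -thD h1; move: thD h1; generalize th => t <- h1; lra.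
have q64 : q <= ga / 64.
  by rewrite -(@ler_pXn2r _ 2) ?nnegrE ?(ltW q0) ?divr_ge0 ?(ltW ga0) // q2; clear -rhot1 td; lra.
have Lm : 2 * L <= ga / 4 * m.
  have -> : 2 * L = 16 * q * m by rewrite /m; field; rewrite gt_eqF.
  by rewrite ler_pM2r //; clear -q64; lra.
have Lm8 : L <= 8 * m.
  have -> : 8 * m = L / q by rewrite /m; field; rewrite gt_eqF.
  rewrite ler_pdivlMr // ler_piMr ?(ltW L0) // -sqrtr1 ler_wsqrtr //; clear -rho12; lra.
have LCK : 64 * CK <= L * ga.
  rewrite -ler_pdivrMr // LE lerDr divr_ge0 // ltW //.
have k := ler_wpM2r (ltW ga0) Lm8; have gm0 : 0 < ga * m by rewrite mulr_gt0.
clear -k Hsup C1th Lm LCK CK0 gm0; lra.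
Qed.

(** * Differences of sub- and supersolutions *)

Section Comparison.
Context {R : realType} {n : nat}.
Notation E := 'rV[R]_n.
Variables (O : set E) (F : op_type R n) (d1 d0 ga Ga nu : R).
Hypotheses (n0 : (0 < n)%N) (d10 : 0 <= d1) (d00 : 0 <= d0) (ga0 : 0 < ga) (gG : ga <= Ga).
Hypotheses (nuh : 2^-1 < nu <= 1) (F2h : F2low O F d1 d0 ga Ga) (F1h : F1mod O F nu).

Lemma normm_entry (M : 'M[R]_n) i j : `|M i j| <= `|M|.
Proof.
have -> : `|M| = mx_norm M by [].
by rewrite mx_normrE; exact: (le_bigmax _ (fun ij => `|M ij.1 ij.2|) (i, j)).
Qed.

Lemma mulmx_norm_le (x : E) (M : 'M[R]_n) : `|x *m M| <= n%:R * (`|x| * `|M|).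
Proof. by apply: mulmx_norm => // i k; exact: normm_entry. Qed.

(* One step of the doubling: [b] in the Hessian inequality is evaluated at
   multiples [1 + s] and [1 - s] of a vector to bound [Y] through the gap [T]. *)
Lemma gap_bound (X Y : 'M[R]_n) (T ep eta tau : R) :
  0 < ep -> 0 < eta -> 0 < tau -> tau <= 1 -> eta <= tau -> 0 <= T ->
  (forall a b, qf X a - qf Y b <= 2 / ep * sq (a - b) + eta * (sq a + sq b)) ->
  (forall a, qf Y a - qf X a <= T * sq a) ->
  forall b, `|qf Y b| <= (2 * T / tau + 2 * tau / ep + 3) * sq b.
Proof.
move=> ep0 eta0 tau0 tau1 etat T0 H HT b.
have h1 := H ((1 + tau) *: b) b; have h2 := H ((1 - tau) *: b) b.
have e1 : (1 + tau) *: b - b = tau *: b by apply/rowP => i; rewrite !mxE; ring.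
have e2 : (1 - tau) *: b - b = (- tau) *: b by apply/rowP => i; rewrite !mxE; ring.
move: h1 h2; rewrite e1 e2 !qfZ !sqZ sqrrN; move: (HT b); move: (qf X b) (qf Y b) (sq_ge0 b) => x y.
move: (sq b) => s s0 hT h1 h2.
pose B := 2 * T / tau + 2 * tau / ep + 3.
have tB : tau * B = 2 * T + 2 / ep * tau ^+ 2 + 3 * tau by rewrite /B; field; rewrite !gt_eqF.
have k1 : (1 + tau) ^+ 2 * (y - T * s) <= (1 + tau) ^+ 2 * x by apply: ler_wpM2l; [exact: sqr_ge0 | lra].
have k2 : (1 - tau) ^+ 2 * (y - T * s) <= (1 - tau) ^+ 2 * x by apply: ler_wpM2l; [exact: sqr_ge0 | lra].
have Ts : 0 <= T * s by exact: mulr_ge0.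
have es : 0 <= eta * s by rewrite mulr_ge0 // ltW.
have ets : eta * s <= tau * s by rewrite ler_wpM2r.
have t2 : tau ^+ 2 <= tau by rewrite expr2 ler_piMr // ltW.
have t2T : tau ^+ 2 * (T * s) <= tau * (T * s) by rewrite ler_wpM2r.
have t1T : tau * (T * s) <= 1 * (T * s) by rewrite ler_wpM2r.
have t2e : tau ^+ 2 * (eta * s) <= tau * (eta * s) by rewrite ler_wpM2r.
have t1e : tau * (eta * s) <= 1 * (eta * s) by rewrite ler_wpM2r.
have tp : 0 <= tau * (T * s) by rewrite mulr_ge0 // ltW.
have tp2 : 0 <= tau ^+ 2 * (T * s) by rewrite mulr_ge0 // sqr_ge0.
have tq : 0 <= tau * (eta * s) by rewrite mulr_ge0 // ltW.
have E0 : 0 <= 2 / ep * tau ^+ 2 * s by apply: mulr_ge0 => //; apply: mulr_ge0; [rewrite divr_ge0 // ltW | exact: sqr_ge0].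
have tBs : tau * (B * s) = 2 * (T * s) + 2 / ep * tau ^+ 2 * s + 3 * (tau * s) by rewrite mulrA tB; ring.
rewrite -/B.
have [y0|y0] := lerP 0 y.
  rewrite -(ler_pM2l tau0).
  have yy : 0 <= tau ^+ 2 * y by rewrite mulr_ge0 // sqr_ge0.
  rewrite tBs ger0_norm //; lra.
rewrite -(ler_pM2l tau0) tBs.
have yy : tau ^+ 2 * (- y) <= tau * (- y) by rewrite ler_wpM2r //; lra.
rewrite ltr0_norm //; (clear -yy tq tp2 t2e t2T ets es Ts k2 h2; lra).
Qed.

End Comparison.

Section DoublingTail.
Context {R : realType} {n : nat}.
Notation E := 'rV[R]_n.
Variables (O : set E) (F : op_type R n) (d1 d0 ga Ga nu : R).
Hypotheses (n0 : (0 < n)%N) (d10 : 0 <= d1) (d00 : 0 <= d0) (ga0 : 0 < ga) (gG : ga <= Ga).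
Hypotheses (nuh : 2^-1 < nu <= 1) (F2h : F2low O F d1 d0 ga Ga) (F1h : F1mod O F nu).

(** Ellipticity gains [ga * T], with [T] the trace of [Y - X] up to [eta], while (F1) costs
    [C1 * del * |Y|]. By [gap_bound], [|Y|] is at most a multiple of [T / tau] plus terms without
    [T]; the condition [4 * C1 * del <= ga * tau] lets the gain absorb the former. *)
Lemma doubling_tail (a b V w : E -> R) x1 y1 (p1 p2 q : E) (X Y B M : 'M[R]_n) xh
   (c C1 th rm ep eta tau LL del ka : R) :
  (forall M p z x y, Defs.symmetric M -> O x -> O y -> `|x - y| <= rm ->
  `|F M p z x - F M p z y| <= th * (1 + `|p| + `|z|) + C1 * (`|x - y| `^ nu * `|M|)) ->
  Fsub O F a V -> Fsup O F b w -> O x1 -> O y1 -> `|x1 - y1| <= rm ->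
  Defs.symmetric X -> Defs.symmetric Y -> Defs.symmetric M ->
  (forall A, ell ga Ga A -> c <= - \tr (A *m M)) ->
  ujet (fun x => V x - (0 + dot q (x - xh) + 2^-1 * qf (M + ka%:M) (x - xh))) x1 p1 X -> ljet w y1 p2 Y ->
  0 < ep -> 0 < eta -> 0 < tau -> tau <= 1 -> eta <= tau -> eta <= 1 -> 0 <= ka -> 0 <= C1 -> 0 <= th ->
  (forall a b, qf X a - qf Y b <= 2 / ep * sq (a - b) + eta * (sq a + sq b)) ->
  `|p1 - p2| <= 2 * eta -> `|p2| <= LL ->
  `|x1 - y1| `^ nu <= del -> 4 * C1 * del <= ga * tau ->
  c <= d1 * (`|q| + 2 * eta + n%:R * (`|x1 - xh| * `|M + ka%:M|)) + d0 * `|V x1 - w y1| + a x1 - b y1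
       + th * (1 + LL + `|w y1|) + n%:R * Ga * (2 * eta + ka)
       + C1 * del * (4 * tau / ep + 6).
Proof.
move=> F1m Fu Fv Ox1 Oy1 xyr sX sY sM cM jX jY ep0 eta0 tau0 tau1 etat eta1 ka0 C10 th0 H pp pL Hdel Ctau.
have Ga0 : 0 <= Ga by rewrite ltW // (lt_le_trans ga0).
have sM' : Defs.symmetric (M + ka%:M) by apply: symD => //; exact: sym_scalar.
have := ujet_add_quad sM' jX; set p1' := _ + _ + _; set X' := X + (M + ka%:M) => jX'.
have sX' : Defs.symmetric X' by exact: symD.
have hA := Fu _ _ _ Ox1 sX' jX'; have hB := Fv _ _ _ Oy1 sY jY.
have sD : Defs.symmetric (Y - X + (2 * eta)%:M) by apply: symD; [exact: symB | exact: sym_scalar].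
have Hd z : 0 <= qf (Y - X + (2 * eta)%:M) z.
  by rewrite qfDm qfBm qf_scalar; have := H z z; rewrite subrr sq0 mulr0; lra.
pose T := \tr (Y - X + (2 * eta)%:M).
have T0 : 0 <= T.
  have := tr_psd_ge0 (A := 1%:M) _ sD Hd; rewrite mul1mx; apply.
  by move=> z; rewrite qf_scalar mul1r sq_ge0.
have HT z : qf Y z - qf X z <= T * sq z.
  have [->|z0] := eqVneq z 0; first by rewrite !qf0 sq0 subrr mulr0.
  have zp : 0 < nrm2 z by exact: nrm2_gt0.
  have zE : z = nrm2 z *: ((nrm2 z)^-1 *: z) by rewrite scalerA divff ?scale1r // gt_eqF.
  have z1 : sq ((nrm2 z)^-1 *: z) = 1 by rewrite sqZ -nrm2K -exprMn mulVf ?gt_eqF // expr1n.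
  have := tr_psd_lb sD Hd z1; rewrite -/T qfDm qfBm qf_scalar z1 mulr1 => h.
  set e := _ *: z in zE z1 h.
  have qe N : qf N z = nrm2 z ^+ 2 * qf N e by rewrite -qfZ -zE.
  rewrite !qe -mulrBr -nrm2K mulrC ler_wpM2r ?sqr_ge0 //; (clear -h z1 tau1 tau0 eta0 ep0; lra).
have Yb := gap_bound ep0 eta0 tau0 tau1 etat T0 H HT.
set BY := 2 * T / tau + 2 * tau / ep + 3 in Yb.
have BY0 : 0 <= BY by rewrite !addr_ge0 // divr_ge0 ?mulr_ge0 // ltW.
have nY := qf_entry_bound BY0 sY Yb.
have Hc A : ell ga Ga A -> ga * T - n%:R * Ga * (2 * eta + ka) + c <= - \tr (A *m (X' - Y)).
  move=> hA'.
  have /andP[h1 _] := ell_tr_psd hA' sD Hd.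
  have /andP[_ h3] := ell_scalar_tr Ga0 hA'.
  have h4 := cM A hA'.
  have h5 : (2 * eta + ka) * \tr A <= (2 * eta + ka) * (n%:R * Ga) by rewrite ler_wpM2l //; (clear -pL pp ka0 eta1 etat tau1 tau0 eta0; lra).
  have -> : \tr (A *m (X' - Y)) = (2 * eta + ka) * \tr A + \tr (A *m M) - \tr (A *m (Y - X + (2 * eta)%:M)).
    by rewrite /X' !mulmxDr !mulmxN !mul_mx_scalar !mxtraceD !raddfN /= !mxtraceZ; ring.
  rewrite -/T in h1; (clear -h1 h5 h4 h3; lra).
have h1 := F2h p1' p2 (V x1) (w y1) sX' sY Ox1 Hc.
have h2 := F1m Y p2 (w y1) x1 y1 sY Ox1 Oy1 xyr.
have h3 : `|p1' - p2| <= `|q| + 2 * eta + n%:R * (`|x1 - xh| * `|M + ka%:M|).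
  have -> : p1' - p2 = q + (p1 - p2) + (x1 - xh) *m (M + ka%:M) by rewrite /p1'; apply/rowP => i; rewrite !mxE; ring.
  apply: le_trans (ler_normD _ _) _; apply: lerD; last exact: mulmx_norm_le.
  by apply: le_trans (ler_normD _ _) _; (clear -Ctau Hdel pp; lra).
have h4 : d1 * `|p1' - p2| <= d1 * (`|q| + 2 * eta + n%:R * (`|x1 - xh| * `|M + ka%:M|)) by rewrite ler_wpM2l.
have h5 : th * (1 + `|p2| + `|w y1|) <= th * (1 + LL + `|w y1|) by rewrite ler_wpM2l //; (clear -pL pp th0 C10 ka0; lra).
have del0 : 0 <= del by apply: le_trans Hdel; exact: powR_ge0.
have h6 : C1 * (`|x1 - y1| `^ nu * `|Y|) <= C1 * (del * (2 * BY)).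
  by rewrite ler_wpM2l // ler_pM ?powR_ge0.
have h7 : C1 * (del * (2 * BY)) = 4 * C1 * del * (T / tau) + C1 * del * (4 * tau / ep + 6).
  by rewrite /BY; field; rewrite !gt_eqF.
have h8 : 4 * C1 * del * (T / tau) <= ga * T.
  have -> : ga * T = ga * tau * (T / tau) by field; rewrite gt_eqF.
  by rewrite ler_wpM2r // divr_ge0 // ltW.
have h9 := ler_norm (- (F Y p2 (w y1) x1 - F Y p2 (w y1) y1)); rewrite normrN in h9.
clear -h1 h2 h4 h5 h6 h7 h8 h9 hA hB; lra.
Qed.

End DoublingTail.

Definition loc_lip (R : realType) (n : nat) (O : set 'rV[R]_n) (w : 'rV[R]_n -> R) := forall x, O x -> exists r L : R, [/\ 0 < r, 0 <= L &
  forall y z, `|y - x| <= r -> `|z - x| <= r -> w y - w z <= L * `|y - z|].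

(** Comparison with the pair [(a, a)] and the Lipschitz bound on [w] give [|a - b| = O(ep)], better
    than the [o(sqrt ep)] of merely continuous functions. This rate makes the exponent [nu > 1/2]
    sufficient. *)
Lemma doubling_max (R : realType) (n : nat) (V w : 'rV[R]_n -> R) xh (r L ka ep : R) : 0 < r -> 0 <= L -> 0 < ka -> 0 < ep ->
  (forall x, `|x - xh| <= r -> {for x, continuous V}) ->
  (forall x, `|x - xh| <= r -> {for x, continuous w}) ->
  (forall y z, `|y - xh| <= r -> `|z - xh| <= r -> w y - w z <= L * `|y - z|) ->
  (forall x, `|x - xh| <= r -> V x - w x <= V xh - w xh - ka * sq (x - xh)) ->
  2 * L * ep <= r / 4 -> 2 * L ^+ 2 * ep <= ka * (r / 4) ^+ 2 ->
  exists a b, [/\ `|a - xh| <= r / 4, `|a - b| <= 2 * L * ep &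
   forall x y, `|x - a| <= r / 4 -> `|y - b| <= r / 4 ->
     V x - w y <= V a - w b + dot (ep^-1 *: (a - b)) ((x - a) - (y - b)) + 2^-1 * qf (ep^-1)%:M ((x - a) - (y - b))].
Proof.
move=> r0 L0 ka0 ep0 Vc wc wL Vw h1 h2.
pose G (z : 'rV[R]_n) := (2 * ep)^-1 * sq z.
have Gc z : {for z, continuous G}.
  apply: continuousM; first exact: cst_continuous.
  have -> : sq = (fun y : 'rV[R]_n => sq (y - 0)) by apply/funext => y; rewrite subr0.
  exact: cont_sq.
have [a [b [ar br ab]]] := evt_pair r0 Vc wc Gc.
have xr : `|xh - xh| <= r by rewrite subrr normr0 ltW.
have e0 : 0 < (2 * ep)^-1 by rewrite invr_gt0 mulr_gt0.
have hab : `|a - b| <= 2 * L * ep.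
  have := ab a a ar ar; rewrite /G subrr sq0 mulr0 subr0 => h.
  have := wL a b ar br; have := normv_sq (a - b) => hn hl.
  have h3 : (2 * ep)^-1 * sq (a - b) <= L * `|a - b| by lra.
  have h4 : `|a - b| ^+ 2 <= 2 * ep * (L * `|a - b|).
    by apply: le_trans hn _; rewrite -ler_pdivrMl ?mulr_gt0.
  have [z|z] := eqVneq `|a - b| 0; first by rewrite z !mulr_ge0 // ltW.
  have zp : 0 < `|a - b| by rewrite lt_def z normr_ge0.
  rewrite -(ler_pM2r zp); apply: le_trans _ (le_trans h4 _); first by rewrite expr2.
  by rewrite le_eqVlt; apply/orP; left; apply/eqP; ring.
have har : `|a - xh| <= r / 4.
  have h3 := ab xh xh xr xr; have h4 := Vw a ar; have h5 := wL a b ar br.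
  rewrite /G subrr sq0 mulr0 subr0 in h3.
  have h6 : 0 <= (2 * ep)^-1 * sq (a - b) by rewrite mulr_ge0 ?sq_ge0 // ltW.
  have h7 : L * `|a - b| <= L * (2 * L * ep) by rewrite ler_wpM2l.
  rewrite -(@ler_pXn2r _ 2) ?nnegrE ?divr_ge0 ?(ltW r0) //.
  apply: le_trans (normv_sq _) _; rewrite -(ler_pM2l ka0); apply: le_trans h2.
  by rewrite expr2; lra.
exists a, b; split=> // x y xa yb.
have xr' : `|x - xh| <= r by have := ler_normD (x - a) (a - xh); rewrite subrKA; lra.
have yr' : `|y - xh| <= r.
  have -> : y - xh = y - b + (b - xh) by rewrite subrKA.
  apply: le_trans (ler_normD _ _) _; have : b - xh = (b - a) + (a - xh) by rewrite subrKA.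
  by move=> ->; have := ler_normD (b - a) (a - xh); rewrite (distrC b a); lra.
have := ab x y xr' yr'; rewrite /G.
have -> : x - y = (a - b) + ((x - a) - (y - b)) by apply/rowP => i; rewrite !mxE; ring.
rewrite sqD qf_scalar dotZl; move: (sq (a - b)) (dot _ _) (sq _) => s d q.
have -> : ep^-1 = 2 * (2 * ep)^-1 by field; rewrite gt_eqF.
lra.
Qed.

(** A quadratic touching [V - w] is subtracted from [V], with [e%:M] added to its Hessian to make
    the maximum strict, and the variables are doubled with penalty parameter [ep]. Lipschitz
    continuity is asked of [w] alone, so [V] may be a mere subsolution. The total error is a
    multiple of [e], which is arbitrary. *)
Lemma sub_super_diff (R : realType) (n : nat) (O : set 'rV[R]_n) (F : op_type R n)
  (d1 d0 ga Ga nu : R) (a b V w : 'rV[R]_n -> R) :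
  (0 < n)%N -> 0 <= d1 -> 0 <= d0 -> 0 < ga -> ga <= Ga -> 2^-1 < nu <= 1 ->
  F2low O F d1 d0 ga Ga -> F1mod O F nu -> open O -> (forall x, O x -> {for x, continuous a}) ->
  (forall x, O x -> {for x, continuous b}) -> (forall x, O x -> {for x, continuous V}) ->
  (forall x, O x -> {for x, continuous w}) -> loc_lip O w -> Fsub O F a V -> Fsup O F b w ->
  Psub ga Ga d1 O (fun x => d0 * `|V x - w x| + a x - b x) (fun x => V x - w x).
Proof.
move=> n0 d10 d00 ga0 gG nuh F2h F1h oO ac bc Vc wc wL Fa Fb xh p M c Ox sM [dJ dJ0 J] Hc.
have Ga0 : 0 <= Ga by rewrite ltW // (lt_le_trans ga0).
have [rL [L [rL0 L0 HL]]] := wL _ Ox.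
have [dO dO0 HO] := (openP_eps O).1 oO _ Ox.
have [Lam LamE] : {x | x = 2 * L + 2} by eexists.
have Lam0 : 0 < Lam by lra.
have [NM NME] : {x | x = `|M| + `|1%:M : 'M[R]_n|} by eexists.
have NM0 : 0 <= NM by rewrite NME addr_ge0.
have nG0 : 0 <= n%:R * Ga by rewrite mulr_ge0.
have [Kc KcE] : {x | x = d1 * (2 + n%:R * NM) + 2 * d0 + 3 + (2 + Lam + `|w xh|) + 3 * (n%:R * Ga)} by eexists.
have Kc0 : 0 < Kc.
  have h1 : 0 <= d1 * (2 + n%:R * NM) by rewrite mulr_ge0 // addr_ge0 // mulr_ge0.
  have h2 := normr_ge0 (w xh); rewrite KcE; clear -h1 h2 d00 Lam0 nG0; lra.
suff H e : 0 < e -> e <= 1 -> c <= d1 * `|p| + (d0 * `|V xh - w xh| + a xh - b xh) + e * Kc.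
  rewrite leNgt; apply/negP => lt.
  set g := c - (d1 * `|p| + (d0 * `|V xh - w xh| + a xh - b xh)).
  have g0 : 0 < g by rewrite /g subr_gt0.
  have e0 : 0 < Num.min 1 (g / (2 * Kc)) by rewrite lt_min ltr01 divr_gt0 // mulr_gt0.
  have [e1 e2] : Num.min 1 (g / (2 * Kc)) <= 1 /\ Num.min 1 (g / (2 * Kc)) <= g / (2 * Kc) by rewrite !ge_min !lexx orbT.
  have := H _ e0 e1; move: e2; rewrite -(ler_pM2r Kc0).
  have -> : g / (2 * Kc) * Kc = g / 2 by field; rewrite gt_eqF.
  by rewrite {2}/g; move: (_ * Kc) => k; rewrite /g; lra.
move=> e0 e1; move: e e0 e1 => e e0 e1.
have [rm [C1 [rm0 rm1 C10 F1m]]] := F1h _ e0.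
have [rc rc0 Hrc] : exists2 r : R, 0 < r & forall x, `|x - xh| < r ->
    [/\ `|V x - V xh| <= e, `|w x - w xh| <= e, `|a x - a xh| <= e & `|b x - b xh| <= e].
  have /contP_eps/(_ _ e0)[r1 r10 H1] := Vc _ Ox.
  have /contP_eps/(_ _ e0)[r2 r20 H2] := wc _ Ox.
  have /contP_eps/(_ _ e0)[r3 r30 H3] := ac _ Ox.
  have /contP_eps/(_ _ e0)[r4 r40 H4] := bc _ Ox.
  exists (Num.min (Num.min r1 r2) (Num.min r3 r4)); first by rewrite !lt_min r10 r20 r30 r40.
  move=> x; rewrite !lt_min => /andP[/andP[k1 k2] /andP[k3 k4]].
  by split; apply: ltW; [apply: H1|apply: H2|apply: H3|apply: H4].
pose r := Num.min (Num.min (dJ / 2) (dO / 2)) (Num.min rL (Num.min (rc / 2) e)).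
have r0 : 0 < r by rewrite !lt_min !divr_gt0 // rL0 e0.
have [rJ [rO [rrL [rrc re]]]] : r <= dJ / 2 /\ r <= dO / 2 /\ r <= rL /\ r <= rc / 2 /\ r <= e.
  by rewrite /r !ge_min !lexx !orbT.
have inO x : `|x - xh| <= r -> O x by move=> h; apply: HO; (clear -h rO r0; lra).
pose A := 4 * C1 / ga + 1.
have A0 : 0 < A by rewrite ltr_wpDl // divr_ge0 ?mulr_ge0 // ltW.
pose Q := C1 * (4 * A * Lam + 6) + 1.
have Q0 : 0 < Q by rewrite ltr_wpDl // mulr_ge0 // addr_ge0 // !mulr_ge0 // ltW.
have th0 : 0 < Num.min 1 (Num.min A^-1 (e / Q)) by rewrite !lt_min ltr01 invr_gt0 A0 divr_gt0.
have [t1 t10 Ht1] := powR_small nuh th0.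
have [ep [ep0 epc]] : exists ep, 0 < ep /\
   [/\ Lam * ep <= t1, Lam * ep <= 1, Lam * ep <= rm, Lam * ep <= r / 4 &
    2 * L ^+ 2 * ep <= e / 2 * (r / 4) ^+ 2].
  pose m1 := Num.min (Num.min t1 1) (Num.min rm (r / 4)).
  have m10 : 0 < m1 by rewrite !lt_min t10 ltr01 rm0 divr_gt0.
  pose m2 := e / 2 * (r / 4) ^+ 2 / (2 * L ^+ 2 + 1).
  have l0 : 0 <= 2 * L ^+ 2 by rewrite mulr_ge0 // sqr_ge0.
  have l1 : 0 < 2 * L ^+ 2 + 1 by rewrite ltr_wpDl.
  have m20 : 0 < m2 by rewrite divr_gt0 // mulr_gt0 ?exprn_gt0 ?divr_gt0.
  exists (Num.min (m1 / Lam) m2); split; first by rewrite lt_min m20 divr_gt0.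
  have k1 : Lam * Num.min (m1 / Lam) m2 <= m1 by rewrite mulrC -ler_pdivlMr // ge_min lexx.
  have k2 : 2 * L ^+ 2 * Num.min (m1 / Lam) m2 <= 2 * L ^+ 2 * m2 by rewrite ler_wpM2l // ge_min lexx orbT.
  split; try (by apply: le_trans k1 _; rewrite /m1 !ge_min !lexx ?orbT).
  apply: le_trans k2 _; have -> : e / 2 * (r / 4) ^+ 2 = (2 * L ^+ 2 + 1) * m2 by rewrite /m2 [RHS]mulrC divfK // gt_eqF.
  by rewrite [leRHS]mulrDl mul1r lerDl ltW.
have [ep1 ep2 ep3 ep4 ep5] := epc.
have Lep0 : 0 < Lam * ep by rewrite mulr_gt0.
pose M' := M + e%:M.
pose V1 x := V x - (0 + dot p (x - xh) + 2^-1 * qf M' (x - xh)).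
have V1c x : `|x - xh| <= r -> {for x, continuous V1}.
  move=> /inO /Vc vc; apply: continuousB => //.
  exact: (differentiable_continuous (quad_differentiable 0 p M' xh x)).
have V1h : V1 xh = V xh by rewrite /V1 subrr dot0r qf0; (clear; lra).
have Lep : 2 * L * ep <= Lam * ep by rewrite ler_pM2r // LamE; clear; lra.
have [|||||a1 [b1 [a1r ab1 Hab]]] := @doubling_max R n V1 w xh r L (e / 2) ep r0 L0 _ ep0 V1c _ _ _ _ ep5.
- by rewrite divr_gt0.
- by move=> x /inO /wc.
- by move=> y z yr zr; apply: HL; [apply: le_trans yr rrL | apply: le_trans zr rrL].
- move=> x xr; rewrite V1h; have := J x; rewrite /V1 /M' qfDm qf_scalar.
  have -> : `|x - xh| < dJ by (clear -xr rJ r0; lra).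
  by move=> /(_ isT); (clear; lra).
- (clear -Lep ep4; lra).
have Z'H (al be : 'rV[R]_n) : qf (ep^-1)%:M al <= qf (2 / ep)%:M be + 4 / ep / 2 * sq (al - be).
  rewrite !qf_scalar; have := sqD_le be (al - be); rewrite addrC subrK -(ler_pM2l (x := ep^-1)) ?invr_gt0 //.
  (clear; lra).
have r40 : 0 < r / 4 by rewrite divr_gt0.
have lam0 : 0 < 4 / ep by rewrite divr_gt0.
have b1r : `|b1 - xh| <= r / 2.
  have -> : b1 - xh = (a1 - xh) - (a1 - b1) by apply/rowP => i; rewrite !mxE; ring.
  by apply: le_trans (ler_normB _ _) _; (clear -ab1 a1r Lep ep4; lra).
pose del := (Lam * ep) `^ nu.
have del0 : 0 < del by exact: powR_gt0.
(* With [tau] proportional to [del = (Lam * ep) ^ nu], the leftover [del * tau / ep] is of order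
   [ep ^ (2 nu - 1)], hence small. *)
pose tau := A * del; have tau0 : 0 < tau by rewrite mulr_gt0.
have hh := Ht1 _ Lep0 ep1; set h := (Lam * ep) `^ (nu - 2^-1) in hh.
have [hh1 [hh2 hh3]] : h <= 1 /\ h <= A^-1 /\ h <= e / Q by move: hh; rewrite !le_min => /andP[-> /andP[-> ->]].
have h0 : 0 < h by exact: powR_gt0.
have delE : del = h * Num.sqrt (Lam * ep) by rewrite /del powR_split.
have s1 : Num.sqrt (Lam * ep) <= 1 by rewrite -sqrtr1 ler_wsqrtr.
have delh : del <= h by rewrite delE ler_piMr // ltW.
have tau1 : tau <= 1.
  by rewrite /tau mulrC -ler_pdivlMr // mul1r; apply: le_trans delh hh2.
have last : C1 * del * (4 * tau / ep + 6) <= e.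
  have k1 : del ^+ 2 / ep = h ^+ 2 * Lam.
    by rewrite delE exprMn sqr_sqrtr ?(ltW Lep0) // mulrA mulfK // gt_eqF.
  have -> : C1 * del * (4 * tau / ep + 6) = C1 * (4 * A * (del ^+ 2 / ep) + 6 * del) by rewrite /tau; field; rewrite gt_eqF.
  rewrite k1; have k2 : h ^+ 2 <= h by rewrite expr2 ler_piMr // ltW.
  apply: (@le_trans _ _ (Q * h)); last by rewrite mulrC -ler_pdivlMr.
  have k3 : 4 * A * (h ^+ 2 * Lam) <= 4 * A * (h * Lam).
    by rewrite ler_wpM2l ?mulr_ge0 ?(ltW A0) // ler_wpM2r // ltW.
  have k4 : 4 * A * (h ^+ 2 * Lam) + 6 * del <= (4 * A * Lam + 6) * h by clear -k3 delh; lra.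
  have k5 : C1 * (4 * A * (h ^+ 2 * Lam) + 6 * del) <= C1 * ((4 * A * Lam + 6) * h) by rewrite ler_wpM2l.
  rewrite /Q; clear -k4 k5 h0; lra.
pose eta := Num.min (Num.min tau ep) (Num.min e (r / 4)).
have eta0 : 0 < eta by rewrite !lt_min tau0 ep0 e0 r40.
have [et1 [et2 [et3 et4]]] : eta <= tau /\ eta <= ep /\ eta <= e /\ eta <= r / 4 by rewrite /eta !ge_min !lexx !orbT.
have near1 x : `|x - a1| <= r / 4 -> `|x - xh| <= r.
  move=> k; have h1 := ler_normD (x - a1) (a1 - xh); rewrite subrKA in h1; clear -k h1 a1r r0; lra.
have near2 x : `|x - b1| <= r / 4 -> `|x - xh| <= r.
  move=> k; have h1 := ler_normD (x - b1) (b1 - xh); rewrite subrKA in h1; clear -k h1 b1r r0; lra.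
have [||x1 [y1 [p1 [p2 [X [Y [[x1a y1b p1p p2p] [[sX sY jX jY] [Hs _ _]]]]]]]]] :=
  @theorem_on_sums R n V1 w a1 b1 (r / 4) (4 / ep) (ep^-1 *: (a1 - b1)) (ep^-1)%:M (2 / ep)%:M
  n0 r40 lam0 (sym_scalar _) _ _ Z'H Hab eta eta0.
- by move=> x /near1; exact: V1c.
- by move=> x /near2 /inO /wc.
have x1r : `|x1 - xh| <= r by apply: near1; apply: ltW; apply: lt_le_trans x1a et4.
have y1r : `|y1 - xh| <= r by apply: near2; apply: ltW; apply: lt_le_trans y1b et4.
have xy1 : `|x1 - y1| <= Lam * ep.
  have -> : x1 - y1 = (x1 - a1) + (a1 - b1) - (y1 - b1) by apply/rowP => i; rewrite !mxE; ring.
  apply: le_trans (ler_normB _ _) _; have k := ler_normD (x1 - a1) (a1 - b1); rewrite LamE; clear -k x1a y1b ab1 et2; lra.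
have Hs' al be : qf X al - qf Y be <= 2 / ep * sq (al - be) + eta * (sq al + sq be).
  by have := Hs al be; rewrite qf_scalar.
have pp : `|p1 - p2| <= 2 * eta.
  have -> : p1 - p2 = (p1 - ep^-1 *: (a1 - b1)) - (p2 - ep^-1 *: (a1 - b1)) by apply/rowP => i; rewrite !mxE; ring.
  apply: le_trans (ler_normB _ _) _; clear -p1p p2p; lra.
have pL : `|p2| <= Lam.
  have -> : p2 = (p2 - ep^-1 *: (a1 - b1)) + ep^-1 *: (a1 - b1) by rewrite subrK.
  apply: le_trans (ler_normD _ _) _; rewrite normrZ gtr0_norm ?invr_gt0 //.
  have k : ep^-1 * `|a1 - b1| <= 2 * L by rewrite ler_pdivrMl // mulrC.
  rewrite LamE; clear -k p2p et3 e1; lra.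
have hdel : `|x1 - y1| `^ nu <= del.
  apply: ge0_ler_powR; rewrite ?nnegrE ?(ltW Lep0) //.
  by have /andP[nu1 _] := nuh; apply: le_trans (ltW nu1); rewrite invr_ge0.
have C1d : 4 * C1 * del <= ga * tau.
  have -> : ga * tau = 4 * C1 * del + ga * del by rewrite /tau /A; field; rewrite gt_eqF.
  by rewrite lerDl mulr_ge0 // ltW.
have fin := @doubling_tail R n O F d1 d0 ga Ga nu d10 ga0 gG F2h a b V w x1 y1 p1 p2 p X Y 0 M xh
  c C1 e rm ep eta tau Lam del e F1m Fa Fb (inO _ x1r) (inO _ y1r) (le_trans xy1 ep3) sX sY sM Hc jX jY
  ep0 eta0 tau0 tau1 et1 (le_trans et3 e1) (ltW e0) C10 (ltW e0) Hs' pp pL hdel C1d.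
have rlt : r < rc by clear -rrc rc0; lra.
have [v1 _ a1' _] := Hrc x1 (le_lt_trans x1r rlt).
have [_ w1 _ b1'] := Hrc y1 (le_lt_trans y1r rlt).
have nM : `|M + e%:M| <= NM.
  apply: le_trans (ler_normD _ _) _; have -> : e%:M = e *: (1%:M : 'M[R]_n) by rewrite scalemx1.
  rewrite NME lerD2l normrZ gtr0_norm //.
  by rewrite ler_piMl.
have f1 : n%:R * (`|x1 - xh| * `|M + e%:M|) <= e * (n%:R * NM).
  have -> : e * (n%:R * NM) = n%:R * (e * NM) by ring.
  rewrite ler_wpM2l //. 
  by apply: ler_pM => //; apply: le_trans x1r re.
have f2 : d1 * (`|p| + 2 * eta + n%:R * (`|x1 - xh| * `|M + e%:M|)) <= d1 * (`|p| + 2 * e + e * (n%:R * NM)).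
  rewrite ler_wpM2l //; clear -et3 f1; lra.
have f3 : d0 * `|V x1 - w y1| <= d0 * (`|V xh - w xh| + 2 * e).
  rewrite ler_wpM2l //.
  have -> : V x1 - w y1 = (V xh - w xh) + (V x1 - V xh) - (w y1 - w xh) by ring.
  apply: le_trans (ler_normB _ _) _; have k := ler_normD (V xh - w xh) (V x1 - V xh); clear -k v1 w1; lra.
have f4 : e * (1 + Lam + `|w y1|) <= e * (2 + Lam + `|w xh|).
  rewrite ler_pM2l //; have -> : w y1 = w xh + (w y1 - w xh) by ring.
  have k := ler_normD (w xh) (w y1 - w xh); clear -k w1 e1; lra.
have f5 : n%:R * Ga * (2 * eta + e) <= n%:R * Ga * (3 * e).
  rewrite ler_wpM2l //; clear -et3; lra.
have [f6 f7] : a x1 - a xh <= e /\ b xh - b y1 <= e.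
  by split; [apply: le_trans a1'; exact: ler_norm | rewrite distrC in b1'; apply: le_trans b1'; exact: ler_norm].
rewrite KcE; clear -fin f1 f2 f3 f4 f5 f6 f7 last; lra.
Qed.

(** Division by [N] reduces to the normalised estimate, by homogeneity; points farther than [r'] are
    covered by the oscillation bound [2 * N]. *)
Lemma lipschitz_cube (R : realType) (n : nat) (O : set 'rV[R]_n) (F : op_type R n)
  (d1 d0 ga Ga nu : R) : (0 < n)%N -> 0 <= d1 -> 0 <= d0 -> 0 < ga -> ga <= Ga -> 2^-1 < nu <= 1 ->
  F2low O F d1 d0 ga Ga -> F1mod O F nu -> F3 O F ->
  forall r : R, 0 < r -> exists2 L : R, 0 < L & forall (u g : 'rV[R]_n -> R) (x0 : 'rV[R]_n) (N : R), 0 < N ->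
   (forall x : 'rV[R]_n, `|x - x0| <= r -> O x /\ {for x, continuous u}) ->
   Fsub O F g u -> Fsup O F g u ->
   (forall x : 'rV[R]_n, `|x - x0| <= r -> `|u x| <= N /\ `|g x| <= N) ->
   forall y : 'rV[R]_n, `|y - x0| <= r -> u x0 - u y <= L * N * `|x0 - y|.
Proof.
move=> n0 d10 d00 ga0 gG nuh F2h F1h F3h r r0.
have [r1 r10 H] := lipschitz_small n0 d10 d00 ga0 gG nuh F2h F1h.
pose r' := Num.min r r1; have r'0 : 0 < r' by rewrite lt_min r0.
have [r'r r'r1] : r' <= r /\ r' <= r1 by rewrite /r' !ge_min !lexx orbT.
have [L L0 HL] := H r' r'0 r'r1.
exists (2 * L * n%:R + 2 / r').
  by apply: ltr_wpDl; [rewrite !mulr_ge0 // ltW | rewrite divr_gt0].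
move=> u g x0 N N0 uO Fu Fv ug y yr.
have nn : 0 <= `|x0 - y| by [].
have [yr'|yr'] := leP `|y - x0| r'.
  have Ni : 0 < N^-1 by rewrite invr_gt0.
  have sc (a : R) : `|a| <= N -> `|N^-1 * a| <= 1.
    by move=> aN; rewrite normrM gtr0_norm // ler_pdivrMl // mulr1.
  have h1 x : `|x - x0| <= r' -> O x /\ {for x, continuous (fun x => N^-1 * u x)}.
    move=> xr; have [Ox uc] := uO x (le_trans xr r'r); split=> //.
    by apply: continuousM => //; exact: cst_continuous.
  have h2 x : `|x - x0| <= r' -> `|N^-1 * u x| <= 1 /\ `|N^-1 * g x| <= 1.
    by move=> xr; have [ux gx] := ug x (le_trans xr r'r); split; exact: sc.
  have := HL _ _ x0 h1 (Fsub_scale F3h Ni Fu) (Fsup_scale F3h Ni Fv) h2 y yr'.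
  set e := nrm2 _ => k.
    have e1 : e <= n%:R * `|x0 - y| by exact: nrm2_normv.
  have e0 : 0 <= e by exact: nrm2_ge0.
  have k1 : 0 <= L * (e * Num.sqrt e) by rewrite !mulr_ge0 ?sqrtr_ge0 // ltW.
  have k2 : N^-1 * u x0 - N^-1 * u y <= 2 * L * e by move: k; rewrite /radm; clear -k1; lra.
  move: k2; rewrite -mulrBr ler_pdivrMl // => /le_trans; apply.
  have k3 : N * (2 * L * e) <= N * (2 * L * (n%:R * `|x0 - y|)).
    by rewrite ler_pM2l // ler_pM2l // mulr_gt0.
  apply: le_trans k3 _.
  have k4 : 0 <= 2 / r' * N * `|x0 - y| by rewrite mulr_ge0 // mulr_ge0 ?divr_ge0 // ltW.
  by clear -k4; lra.
have [|ux _] := ug x0; first by rewrite subrr normr0 ltW.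
have [uy _] := ug y yr.
have k1 : u x0 - u y <= 2 * N.
  by move: ux uy; rewrite !ler_norml => /andP[a1 a2] /andP[a3 a4]; lra.
rewrite distrC in yr'; move: k1 => k1.
have k2 : 2 * N <= 2 / r' * N * `|x0 - y|.
  have -> : 2 / r' * N * `|x0 - y| = 2 * N * (`|x0 - y| / r') by ring.
  by rewrite ler_peMr ?mulr_ge0 ?(ltW N0) // ler_pdivlMr // mul1r ltW.
have k3 : 0 <= 2 * L * n%:R * N * `|x0 - y| by rewrite !mulr_ge0 // ltW.
clear -k1 k2 k3; lra.
Qed.

Lemma sol_loc_lip (R : realType) (n : nat) (O : set 'rV[R]_n) (F : op_type R n)
  (d1 d0 ga Ga nu : R) (u g : 'rV[R]_n -> R) : (0 < n)%N -> 0 <= d1 -> 0 <= d0 -> 0 < ga -> ga <= Ga -> 2^-1 < nu <= 1 ->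
  F2low O F d1 d0 ga Ga -> F1mod O F nu -> F3 O F -> open O ->
  (forall x, O x -> {for x, continuous u}) -> (forall x, O x -> {for x, continuous g}) ->
  Fsub O F g u -> Fsup O F g u -> loc_lip O u.
Proof.
move=> n0 d10 d00 ga0 gG nuh F2h F1h F3h oO uc gc Fu Fv x Ox.
have /contP_eps/(_ 1 ltr01)[e1 e10 H1] := uc _ Ox.
have /contP_eps/(_ 1 ltr01)[e2 e20 H2] := gc _ Ox.
have [e3 e30 H3] := (openP_eps O).1 oO _ Ox.
pose r := Num.min e1 (Num.min e2 e3) / 4.
have m0 : 0 < Num.min e1 (Num.min e2 e3) by rewrite !lt_min e10 e20.
have r0 : 0 < r by rewrite divr_gt0.
have [k1 [k2 k3]] : 4 * r <= e1 /\ 4 * r <= e2 /\ 4 * r <= e3.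
  by rewrite /r mulrC divfK // !ge_min !lexx ?orbT.
have [L L0 HL] := lipschitz_cube n0 d10 d00 ga0 gG nuh F2h F1h F3h r0.
pose N := `|u x| + `|g x| + 1; have N0 : 0 < N by rewrite ltr_wpDl // addr_ge0.
exists (r / 2), (L * N); split; [by rewrite divr_gt0 | by rewrite mulr_ge0 // ltW |].
move=> y z yx zx.
have close t : `|t - y| <= r -> `|t - x| < 4 * r.
  by move=> ty; have k := ler_normD (t - y) (y - x); rewrite subrKA in k; clear -k ty yx r0; lra.
apply: (HL u g y N N0) => //.
- move=> t /close tx; have Ot : O t by apply: H3; exact: lt_le_trans tx k3.
  by split=> //; exact: uc.
- move=> t /close tx; have h1 := H1 t (lt_le_trans tx k1); have h2 := H2 t (lt_le_trans tx k2).
  have a1 := ler_normD (u t - u x) (u x); have a2 := ler_normD (g t - g x) (g x).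
  rewrite !subrK in a1 a2; have b1 := normr_ge0 (u x); have b2 := normr_ge0 (g x).
  by rewrite /N; clear -h1 h2 a1 a2 b1 b2; split; lra.
have -> : z - y = (z - x) - (y - x) by apply/rowP => i; rewrite !mxE; ring.
apply: le_trans (ler_normB _ _) _; clear -yx zx; lra.
Qed.

(** * The Alexandrov-Bakelman-Pucci estimate *)

(** The integral of a nonnegative function is a supremum over the simple functions below it, so
    monotonicity holds without measurability. *)
Lemma ge0_integralT_mono (R : realType) (f g : R -> \bar R) :
  (forall t, (0 <= f t)%E) -> (forall t, (f t <= g t)%E) ->
  (\int[@lebesgue_measure R]_(t in [set: R]) f t <= \int[@lebesgue_measure R]_(t in [set: R]) g t)%E.
Proof.
move=> f0 fg; have g0 t : (0 <= g t)%E by exact: le_trans (fg t).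
rewrite !ge0_integralTE //; apply: ereal_sup_le => _ [h hf <-]; exists h => // t.
exact: le_trans (fg t).
Qed.

Lemma measurable_scaled_indic (R : realType) (c : R) (I : set R) : measurable I ->
  measurable_fun [set: R] (fun x => (c%:E * (\1_I x)%:E)%E).
Proof.
move=> mI; have -> : (fun x => (c%:E * (\1_I x)%:E)%E) = EFin \o (fun x => c * \1_I x) by [].
by apply/measurable_EFinP; apply: measurable_funM => //; exact: measurable_indic.
Qed.

Lemma integral_scaled_indic (R : realType) (c : R) (I : set R) : 0 <= c -> measurable I ->
  (\int[@lebesgue_measure R]_(x in [set: R]) (c%:E * (\1_I x)%:E) = c%:E * @lebesgue_measure R I)%E.
Proof.
move=> c0 mI; rewrite ge0_integralZl //.
- by rewrite integral_indic //; congr (_ * _)%E; congr (_ _); exact: setIT.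
- by apply/measurable_EFinP; exact: measurable_indic.
Qed.

Lemma integral_step_lb (R : realType) (M : nat) (a h : R) (c : 'I_M -> R) (g : R -> \bar R) : 0 < h ->
  (forall i, 0 <= c i) -> (forall t, (0 <= g t)%E) ->
  (forall (i : 'I_M) t, a + i%:R * h <= t < a + i.+1%:R * h -> ((c i)%:E <= g t)%E) ->
  ((\sum_(i < M) h * c i)%:E <= \int[@lebesgue_measure R]_(t in [set: R]) g t)%E.
Proof.
move=> h0 c0 g0 H.
pose I (i : 'I_M) : set R := [set` `[a + i%:R * h, a + i.+1%:R * h[ ].
have mI i : measurable (I i) by exact: measurable_itv.
pose S t : \bar R := (\sum_(i < M) ((c i)%:E * (\1_(I i) t)%:E))%E.
have t0 i t : (0 <= (c i)%:E * (\1_(I i) t)%:E)%E by rewrite mule_ge0 ?lee_fin ?c0.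
have S0 t : (0 <= S t)%E by apply: sume_ge0.
have -> : ((\sum_(i < M) h * c i)%:E = \int[@lebesgue_measure R]_(t in [set: R]) S t)%E.
  rewrite ge0_integral_sum //; last first.
    by move=> i; exact: measurable_scaled_indic.
  rewrite -sumEFin; apply: eq_bigr => i _.
  rewrite integral_scaled_indic // lebesgue_measure_itv /= lte_fin ltrD2l ltr_pM2r // ltr_nat ltnSn.
  by rewrite -EFinB -EFinM; congr (_%:E); rewrite -addn1 natrD; ring.
apply: ge0_integralT_mono => // t.
have [[i ti]|no] := pselect (exists i, I i t); last first.
  rewrite /S big1 // => i _; rewrite indicE memNset ?mule0 //.
  by move=> h1; apply: no; exists i.
have -> : S t = (c i)%:E.
  rewrite /S (bigD1 i) //= big1 ?adde0; first by rewrite indicE mem_set // mule1.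
  move=> j ji; rewrite indicE memNset ?mule0 //.
  move: ti; rewrite /I /= !in_itv /= => /andP[h1 h2] /andP[h3 h4].
  have := le_lt_trans h3 h2; have := le_lt_trans h1 h4.
  rewrite !ltrD2l !ltr_pM2r // !ltr_nat !ltnS => k1 k2.
  by case/eqP: ji; apply/val_inj/eqP; rewrite eqn_leq k1 k2.
by apply: (H i); move: ti; rewrite /I /= in_itv.
Qed.

(** * Lower Riemann sums for the iterated integral *)

Section Grid.
Context {R : realType}.

Definition ffcons (M n : nat) (p : 'I_M * {ffun 'I_n -> 'I_M}) : {ffun 'I_n.+1 -> 'I_M} :=
  [ffun i => if unlift ord0 i is Some j then p.2 j else p.1].

Lemma ffcons_bij M n : bijective (@ffcons M n).
Proof.
exists (fun k : {ffun 'I_n.+1 -> 'I_M} => (k ord0, [ffun j => k (lift ord0 j)])).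
  move=> [i k]; rewrite /ffcons ffunE unlift_none; congr (_, _).
  by apply/ffunP => j; rewrite !ffunE liftK.
move=> k; apply/ffunP => i; rewrite ffunE.
by case: unliftP => [j ->|->]; rewrite ?ffunE.
Qed.

Lemma lebint_ge0 n (g : 'rV[R]_n -> \bar R) : (forall x, (0 <= g x)%E) -> (0 <= lebint_n g)%E.
Proof.
elim: n g => [|n IH] g g0 //=; apply: integral_ge0 => t _; exact: IH.
Qed.

(** Induction on the dimension, with [integral_step_lb] in the first variable. Partial integrals are
    only bounded below by step functions, which are measurable. *)
Lemma lebint_grid n M (a : 'rV[R]_n) (h : R) (c : {ffun 'I_n -> 'I_M} -> R) (g : 'rV[R]_n -> \bar R) : (0 < h)%R ->
  (forall k, (0 <= c k)%R) -> (forall x, (0 <= g x)%E) ->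
  (forall (k : {ffun 'I_n -> 'I_M}) (x : 'rV[R]_n), (forall i : 'I_n, a 0 i + (k i)%:R * h <= x 0 i < a 0 i + (k i).+1%:R * h) -> ((c k)%:E <= g x)%E) ->
  ((\sum_k h ^+ n * c k)%:E <= lebint_n g)%E.
Proof.
elim: n a c g => [|n IH] a c g h0 c0 g0 H /=.
  have k0 : {ffun 'I_0 -> 'I_M} by exact: [ffun i : 'I_0 => False_rect _ (notF (ltn_ord i))].
  rewrite (big_pred1 k0); first by rewrite expr0 mul1r; apply: H; case.
  by move=> k /=; apply/esym/eqP/ffunP; case.
rewrite (reindex _ (onW_bij _ (ffcons_bij M n))) /=.
rewrite -(pair_bigA _ (fun i k => h ^+ n.+1 * c (ffcons (i, k)))) /=.
have -> : \sum_i \sum_j h ^+ n.+1 * c (ffcons (i, j)) = \sum_(i < M) h * (\sum_j h ^+ n * c (ffcons (i, j))).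
  by apply: eq_bigr => i _; rewrite big_distrr /=; apply: eq_bigr => j _; rewrite exprS mulrA.
apply: (@integral_step_lb R M (a 0 ord0) h) => //.
- by move=> i; apply: sumr_ge0 => j _; rewrite mulr_ge0 // exprn_ge0 // ltW.
- by move=> t; apply: lebint_ge0.
move=> i t it.
apply: (IH (\row_j a 0 (lift ord0 j)) (fun k => c (ffcons (i, k)))) => // k y yk.
apply: H => j; rewrite !mxE ffunE.
by case: unliftP => [l ->|->] //=; have := yk l; rewrite mxE.
Qed.

End Grid.

Lemma cont_dotB (R : realType) (n : nat) (e c x : 'rV[R]_n) : {for x, continuous (fun y : 'rV[R]_n => dot e (y - c))}.
Proof.
have -> : (fun y : 'rV[R]_n => dot e (y - c)) = (fun y => dot e y - dot e c) by apply/funext => y; rewrite dotBr.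
by apply: continuousB; [exact: cont_dot | exact: cst_continuous].
Qed.

Lemma cont_nrm2 (R : realType) (n : nat) (c x : 'rV[R]_n) : {for x, continuous (fun y : 'rV[R]_n => nrm2 (y - c))}.
Proof.
apply: (@continuous_comp _ _ _ (fun y : 'rV[R]_n => sq (y - c)) Num.sqrt); first exact: cont_sq.
exact: sqrt_continuous.
Qed.

Lemma cont_lt_near (R : realType) (n : nat) (f : 'rV[R]_n -> R) c x : {for x, continuous f} -> f x < c ->
  exists2 d : R, 0 < d & forall y, `|y - x| < d -> f y < c.
Proof.
move=> /contP_eps fc fx; have [|d dd H] := fc (c - f x); first by rewrite subr_gt0.
by exists d => // y /H k; have := le_lt_trans (ler_norm _) k; lra.
Qed.

(* If two planes of slopes [p1] and [p2] touch [W] from above at nearby points, the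
   difference of the slopes is controlled by the equation: the quadratic
   [- al s - be s^2 + de |x - y1|^2], with [s] the coordinate along [p1 - p2], touches. *)
Lemma slope_close (R : realType) (n : nat) (ga Ga d1 : R) (D : set 'rV[R]_n)
  (g W : 'rV[R]_n -> R) (y1 y2 p1 p2 : 'rV[R]_n) (h K : R) :
  (0 < n)%N -> 0 < ga -> ga <= Ga -> 0 <= d1 -> 0 < h -> p1 - p2 != 0 ->
  K = 10 * n%:R * Ga / ga + 1 ->
  Psub ga Ga d1 D g W -> `|y1 - y2| <= h ->
  (forall x : 'rV[R]_n, nrm2 (x - y1) <= K * (4 * n%:R * h) -> [/\ D x, {for x, continuous W},
      W x <= W y1 + dot p1 (x - y1) & W x <= W y2 + dot p2 (x - y2)]) ->
  W y2 <= W y1 + dot p1 (y2 - y1) ->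
  exists2 z : 'rV[R]_n, nrm2 (z - y1) <= K * (4 * n%:R * h) &
    nrm2 (p1 - p2) * ga <= 32 * n%:R * h * (d1 * (`|p1| + (1 + K) * nrm2 (p1 - p2)) + g z).
Proof.
move=> n0 ga0 gG d10 h0 q0 KE Ps yh Hb H2.
have np : 0 < n%:R :> R by rewrite ltr0n.
have Ga0 : 0 < Ga by exact: lt_le_trans gG.
have [S SE] : {S | S = 4 * n%:R * h} by eexists.
have S0 : 0 < S by rewrite SE !mulr_gt0.
have nG : 0 < n%:R * Ga by rewrite mulr_gt0.
have K1 : 1 <= K by rewrite KE lerDr divr_ge0 ?mulr_ge0 // ltW.
have gK : ga * K = 10 * (n%:R * Ga) + ga by rewrite KE; field; rewrite gt_eqF.
have y10 : nrm2 (y1 - y1) <= K * (4 * n%:R * h).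
  by rewrite subrr /nrm2 sq0 sqrtr0 -SE mulr_ge0 ?(ltW S0) //; lra.
rewrite -SE in Hb y10 *.
have rho0 : 0 < K * S by rewrite mulr_gt0 //; lra.
set Q := nrm2 (p1 - p2); have Q0 : 0 < Q by exact: nrm2_gt0.
have [e eE] : {e | e = Q^-1 *: (p1 - p2)} by eexists.
have se : sq e = 1 by rewrite eE sqZ -nrm2K -exprMn mulVf ?gt_eqF // expr1n.
have eQ : p1 - p2 = Q *: e by rewrite eE scalerA divff ?scale1r // gt_eqF.
(* [al] splits the slope gap [Q] evenly between the two planes, [be] gives concavity along [e], and
   [de] is so small that ellipticity retains [be * ga] of this concavity. *)
have [al alE] : {x | x = Q / 2} by eexists.
have [be beE] : {x | x = Q / (8 * S)} by eexists.
have [de deE] : {x | x = be * ga / (2 * (n%:R * Ga))} by eexists.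
have be0 : 0 < be by rewrite beE divr_gt0 // mulr_gt0.
have de0 : 0 < de by rewrite deE; apply: divr_gt0; apply: mulr_gt0.
have beS : be * S = Q / 8 by rewrite beE; field; rewrite gt_eqF.
have deG : de * (2 * (n%:R * Ga)) = be * ga by rewrite deE divfK // gt_eqF // mulr_gt0.
(* [K] is large enough for the term [de * sq] to exceed all the others at Euclidean distance
   [K * S], so the maximum is not attained there. *)
have deK : 5 * be * S < de * (K * K) * S.
  rewrite ltr_pM2r //.
  have k1 : de * K * (2 * (n%:R * Ga)) = be * (10 * (n%:R * Ga) + ga).
    rewrite -gK.
    have -> : be * (ga * K) = be * ga * K by rewrite mulrA.
    by rewrite -deG; ring.
  have k2 : 5 * be < de * K.
    rewrite -(@ltr_pM2r _ (2 * (n%:R * Ga))) ?mulr_gt0 // k1.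
    have : 0 < be * ga by rewrite mulr_gt0.
    lra.
  apply: lt_le_trans k2 _; rewrite mulrA ler_peMr // mulr_ge0 ?(ltW de0) //; lra.
have deKle : 2 * de * K <= Q * K / (8 * S).
  have -> : Q * K / (8 * S) = be * K by rewrite beE; ring.
  rewrite ler_wpM2r //; first by lra.
  have : de * (2 * (n%:R * Ga)) <= be * (n%:R * Ga).
    by rewrite deG ler_pM2l //; apply: le_trans gG _; rewrite ler_peMl ?(ltW Ga0) // ler1n.
  have -> : de * (2 * (n%:R * Ga)) = (2 * de) * (n%:R * Ga) by ring.
  by rewrite ler_pM2r.
pose B (x : 'rV[R]_n) := - al * dot e (x - y1) - be * dot e (x - y1) ^+ 2 + de * sq (x - y1).
pose A : set 'rV[R]_n := [set x | nrm2 (x - y1) <= K * S /\ `|dot e (x - y1)| <= S].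
have Bc x : {for x, continuous B}.
  have c1 := @cont_dotB R n e y1 x.
  apply: continuousD; last by apply: continuousM; [exact: cst_continuous | exact: cont_sq].
  apply: continuousB; apply: continuousM; try exact: cst_continuous; try exact: c1.
  by apply: continuousM; exact: c1.
have nc x := @cont_nrm2 R n y1 x.
have dc x : {for x, continuous (fun x : 'rV[R]_n => `|dot e (x - y1)|)}.
  apply: (@continuous_comp _ _ _ (fun y : 'rV[R]_n => dot e (y - y1)) Num.norm); last exact: norm_continuous.
  exact: cont_dotB.
have strict := @cont_lt_near R n.
have Acl : compact A.
  apply: (@subclosed_compact _ _ [set x | `|x - y1| <= K * S]).
  - apply: closedP_eps => x nA.
    have [hx|hx] := ltP (K * S) (nrm2 (x - y1)).
      have [||d dd H] := strict (fun x : 'rV[R]_n => - nrm2 (x - y1)) (- (K * S)) x; first by apply: continuousN; exact: nc.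
        by rewrite ltrN2.
      by exists d => // y /H; rewrite ltrN2 => k [k2 _]; move: k; rewrite ltNge k2.
    have [hx2|hx2] := ltP S `|dot e (x - y1)|.
      have [||d dd H] := strict (fun x : 'rV[R]_n => - `|dot e (x - y1)|) (- S) x; first by apply: continuousN; exact: dc.
        by rewrite ltrN2.
      by exists d => // y /H; rewrite ltrN2 => k [_ k2]; move: k; rewrite ltNge k2.
    by case: nA.
  - exact: compact_cube.
  - by move=> x [xx _]; apply: le_trans (normv_nrm2 _) xx.
have Ay : A y1 by split=> //; rewrite subrr dot0r normr0 ltW.
have [|z [z1 z2] Hz] := @evt_max R n (fun x : 'rV[R]_n => W x - dot p1 (x - y1) - B x) A (ex_intro _ _ Ay) Acl.
  move=> x [xx _]; have [_ Wc _ _] := Hb x xx; apply: continuousB; last exact: Bc.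
  apply: continuousB => //.
  exact: cont_dotB.
have Hz0 : 0 <= W z - W y1 - dot p1 (z - y1) - B z.
  by have := Hz y1 Ay; rewrite /B subrr sq0 !dot0r expr0n /= !mulr0; (clear; lra).
have [Dz Wz c1 c2] := Hb z z1.
set s := dot e (z - y1) in z2.
have s2 : s ^+ 2 <= S ^+ 2 by rewrite -(real_normK (num_real s)) ler_pXn2r ?nnegrE ?(ltW S0).
have BE : B z = - al * s - be * s ^+ 2 + de * sq (z - y1) by [].
have beS2 : be * S ^+ 2 = Q / 8 * S by rewrite expr2 mulrA beS.
have bes : be * s ^+ 2 <= Q / 8 * S by rewrite -beS2 ler_pM2l.
have dsq : 0 <= de * sq (z - y1) by rewrite mulr_ge0 ?sq_ge0 // ltW.
have [sl sr] : - S <= s /\ s <= S by move: z2; rewrite ler_norml => /andP[].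
have z1' : nrm2 (z - y1) < K * S.
  rewrite lt_neqAle z1 andbT; apply/eqP => zE.
  have k1 : sq (z - y1) = K * K * S * S by rewrite -nrm2K zE; ring.
  have k2 : al * s <= al * S by rewrite ler_pM2l // alE divr_gt0.
  have k3 : 5 * be * S * S < de * (K * K) * S * S by rewrite ltr_pM2r.
  have k4 : 5 * be * S * S = 5 * (Q / 8 * S) by rewrite -beS; ring.
  rewrite BE k1 in Hz0; rewrite alE in k2 Hz0.
  by clear -Hz0 c1 k2 k3 k4 bes; lra.
(* At [s = S] the plane of slope [p2], and at [s = - S] the plane of slope [p1], lies strictly below
   the comparison quadratic; the maximum avoids both faces of the slab. *)
have z2' : `|s| < S.
  rewrite lt_neqAle z2 andbT; apply/eqP => zE.
  have th : W y2 + dot p2 (z - y2) <= W y1 + dot p1 (z - y1) - Q * s + Q * (n%:R * h).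
    have k1 : dot p2 (z - y2) = dot p1 (z - y1) - Q * s + dot p2 (y1 - y2).
      rewrite /s -dotZl -eQ !dotBl !dotBr; ring.
    have k2 : dot (p1 - p2) (y2 - y1) <= Q * (n%:R * h).
      apply: le_trans (ler_norm _) _; apply: le_trans (dot_nrm2 _ _) _.
      rewrite ler_pM2l //; apply: le_trans (nrm2_normv _ n0) _; rewrite ler_pM2l // distrC //.
    rewrite dotBl in k2; have k3 : dot p2 (y1 - y2) = - dot p2 (y2 - y1) by rewrite -dotNr opprB.
    clear -H2 k1 k2 k3; lra.
  have nh : Q * (n%:R * h) = Q * S / 4 by rewrite SE; field.
  have QS : 0 < Q * S by rewrite mulr_gt0.
  have sE : s ^+ 2 = S ^+ 2 by rewrite -(real_normK (num_real s)) zE.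
  rewrite BE sE beS2 alE in Hz0.
  move: zE; have [s0|s0] := lerP 0 s => zE.
    rewrite ger0_norm // in zE; rewrite zE in Hz0 th; clear -Hz0 th nh QS c2 dsq; lra.
  have sE2 : s = - S by rewrite -zE ltr0_norm // opprK.
  rewrite sE2 in Hz0; clear -Hz0 c1 dsq QS; lra.
exists z => //.
pose M : 'M[R]_n := (- (2 * be)) *: outer e + (2 * de)%:M.
have sM : Defs.symmetric M by apply: symD; [apply: symZ; exact: outer_sym | exact: sym_scalar].
pose p := p1 + ((- al - 2 * be * s) *: e + (2 * de) *: (z - y1)).
have J : ujet W z p M.
  have [d dd Hd] := strict _ _ z (nc z) z1'.
  have [d' dd' Hd'] := strict _ _ z (dc z) z2'.
  exists (Num.min d d'); first by rewrite lt_min dd.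
  move=> y; rewrite lt_min => /andP[yd yd'].
  have Ay' : A y by split; apply: ltW; [exact: Hd | exact: Hd'].
  have := Hz y Ay'; rewrite /B /p /M qfDm qfZm qf_outer qf_scalar.
  have -> : y - y1 = (z - y1) + (y - z) by apply/rowP => i; rewrite !mxE; ring.
  move: (y - z) => t; rewrite (sqD (z - y1) t) !(dotDr (z - y1) t) -/s (dotDl p1) (dotDl (_ *: e)) !dotZl.
  clear; lra.
have Hc (A' : 'M[R]_n) : ell ga Ga A' -> be * ga <= - \tr (A' *m M).
  move=> hA; have [sA qA] := hA; have /andP[_ k1] := ell_scalar_tr (ltW Ga0) hA.
  have /andP[k2 _] := qA e; rewrite se mulr1 in k2.
  have k3 : de * \tr A' <= de * (n%:R * Ga) by rewrite ler_pM2l.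
  have k4 : be * ga <= be * qf A' e by rewrite ler_pM2l.
  have -> : \tr (A' *m M) = - (2 * be) * qf A' e + 2 * de * \tr A'.
    by rewrite mulmxDr mxtraceD mul_mx_scalar mxtraceZ -scalemxAr mxtraceZ tr_mul_outer.
  by clear -k3 k4 deG; lra.
have := Ps z p M _ Dz sM J Hc.
have pn : `|p| <= `|p1| + (1 + K) * Q.
  apply: le_trans (ler_normD _ _) _; rewrite lerD2l.
  apply: le_trans (ler_normD _ _) _; rewrite (normrZ _ e) (normrZ _ (z - y1)).
  have e1 : `|e| <= 1 by rewrite -(@expr_le1 _ 2) // -se normv_sq.
  have k1 : `|- al - 2 * be * s| <= Q * 3 / 4.
    have k2 : 2 * be * `|s| <= Q / 4 by have : be * `|s| <= be * S by [rewrite ler_pM2l]; (clear -beS; lra).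
    have k3 : `|al| = Q / 2 by rewrite alE gtr0_norm // divr_gt0.
    apply: le_trans (ler_normB _ _) _; rewrite normrN k3 !normrM (gtr0_norm be0) (gtr0_norm (x := 2)) //.
    clear -k2 Q0; lra.
  have k3 : `|2 * de| * `|z - y1| <= Q * K / 8.
    have d2 : 0 < 2 * de by rewrite mulr_gt0.
    rewrite (gtr0_norm d2); apply: (@le_trans _ _ (2 * de * (K * S))).
      by rewrite ler_pM2l ?mulr_gt0 //; apply: le_trans (normv_nrm2 _) z1.
    have := ler_wpM2r (ltW S0) deKle; have -> : Q * K / (8 * S) * S = Q * K / 8 by field; rewrite gt_eqF.
    (clear; lra).
  have k4 : `|- al - 2 * be * s| * `|e| <= Q * 3 / 4 * 1 by apply: ler_pM.
  have QK : 0 < Q * K by rewrite mulr_gt0 //; (clear -K1; lra).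
  by clear -k3 k4 QK Q0; lra.
move=> k1; have k2 : d1 * `|p| <= d1 * (`|p1| + (1 + K) * Q) by rewrite ler_wpM2l.
have -> : Q * ga = 32 * n%:R * h * (be * ga) by rewrite beE SE; field; rewrite !gt_eqF.
by rewrite ler_pM2l; [(clear -k2 k1; lra) | rewrite !mulr_gt0].
Qed.

(** * Counting of lattice slopes *)

Lemma count_close (R : realType) (n N : nat) (A : {set {ffun 'I_n -> 'I_N}}) (D : R) : 0 <= D ->
  (forall k k', k \in A -> k' \in A -> forall i : 'I_n, `|(k i)%:R - (k' i)%:R| <= D) ->
  #|A|%:R <= (2 * D + 1) ^+ n.
Proof.
move=> D0 H; have [->|[k0 k0A]] := set_0Vmem A.
  by rewrite cards0 exprn_ge0 // addr_ge0 // mulr_ge0.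
pose m := Num.truncn D.
have /andP[m1 m2] := truncn_itv D0; rewrite -/m in m1 m2.
have mD : (2 * m).+1%:R <= 2 * D + 1 by rewrite -addn1 natrD natrM; lra.
have Hm k i : k \in A -> (k0 i <= k i + m)%N /\ (k i <= k0 i + m)%N.
  move=> kA; have := H k k0 kA k0A i; rewrite ler_norml => /andP[h1 h2].
  have a1 : (k0 i)%:R < (k i + m.+1)%:R :> R by rewrite natrD; lra.
  have a2 : (k i)%:R < (k0 i + m.+1)%:R :> R by rewrite natrD; lra.
  by rewrite !ltr_nat !addnS !ltnS in a1 a2.
pose ph (k : {ffun 'I_n -> 'I_N}) : {ffun 'I_n -> 'I_(2 * m).+1} := [ffun i => inord (k i + m - k0 i)].
have inj : {in A &, injective ph}.
  move=> k k' kA k'A /ffunP e; apply/ffunP => i; apply/val_inj.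
  have := congr1 val (e i); rewrite !ffunE /=.
  have [h1 h2] := Hm k i kA; have [h3 h4] := Hm k' i k'A.
  rewrite !inordK; last 2 first.
  - by rewrite ltnS leq_subLR mul2n -addnn addnA leq_add2r.
  - by rewrite ltnS leq_subLR mul2n -addnn addnA leq_add2r.
  by move/(congr1 (addn (k0 i))); rewrite !subnKC // => /addIn.
have : (#|A| <= (2 * m).+1 ^ n)%N.
  rewrite -(card_in_imset inj) (leq_trans (max_card _)) //.
  by rewrite card_ffun !card_ord.
rewrite -(ler_nat R) natrX => /le_trans; apply.
by rewrite lerXn2r // nnegrE // addr_ge0 // mulr_ge0.
Qed.

(** This count stands for the area formula: of the [N ^ n] lattice slopes, those assigned to one
    cell [Q] differ by at most [w Q] in each coordinate, so there are at most
    [(3 * N * w Q / P) ^ n] of them. *)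
Lemma abp_cells (R : realType) (n N : nat) (T : finType) (cel : {ffun 'I_n -> 'I_N} -> T)
  (w : T -> R) (P : R) : (0 < N)%N -> 0 < P -> (forall Q, P <= N%:R * w Q) ->
  (forall k k', cel k = cel k' -> forall i : 'I_n, P * `|(k i)%:R - (k' i)%:R| <= N%:R * w (cel k)) ->
  P ^+ n <= \sum_Q (3 * w Q) ^+ n.
Proof.
move=> N0 P0 Hw H; have Np : 0 < N%:R :> R by rewrite ltr0n.
have w0 Q : 0 < w Q by have := lt_le_trans P0 (Hw Q); rewrite pmulr_rgt0.
have card : (N ^ n)%N = (\sum_Q #|[set k | cel k == Q]%SET|)%N.
  have -> : (N ^ n)%N = #|[set: {ffun 'I_n -> 'I_N}]%SET| by rewrite cardsT card_ffun !card_ord.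
  rewrite -sum1_card (partition_big cel xpredT) //=; apply: eq_bigr => Q _.
  by rewrite -sum1_card; apply: eq_bigl => k; rewrite !inE.
have k1 : N%:R ^+ n <= \sum_Q (3 * (N%:R * w Q / P)) ^+ n :> R.
  rewrite -natrX card natr_sum; apply: ler_sum => Q _.
  have D1 : 1 <= N%:R * w Q / P by rewrite ler_pdivlMr // mul1r.
  apply: (@le_trans _ _ ((2 * (N%:R * w Q / P) + 1) ^+ n)).
    apply: count_close; first by apply: le_trans D1.
    move=> k k'; rewrite !inE => /eqP e /eqP e' i.
    by rewrite ler_pdivlMr // mulrC -e; apply: H; rewrite e e'.
  by rewrite lerXn2r ?nnegrE //; lra.
rewrite -(@ler_pM2l _ (N%:R ^+ n)) ?exprn_gt0 //.
have -> : N%:R ^+ n * (\sum_Q (3 * w Q) ^+ n) = P ^+ n * \sum_Q (3 * (N%:R * w Q / P)) ^+ n.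
  rewrite !big_distrr /=; apply: eq_bigr => Q _; rewrite -!exprMn; congr (_ ^+ n).
  by field; rewrite gt_eqF.
by rewrite mulrC ler_pM2l ?exprn_gt0.
Qed.

Lemma expr_le_powR (R : realType) (n : nat) (p c s : R) : n%:R < p -> 0 <= c -> 0 < s ->
  c ^+ n <= s ^+ n + s ^+ n * (c `^ p / s `^ p).
Proof.
move=> np c0 s0; have sp : 0 < s `^ p by exact: powR_gt0.
have [cs|sc] := lerP c s.
  apply: (@le_trans _ _ (s ^+ n)); first by rewrite lerXn2r // nnegrE // ltW.
  by rewrite lerDl mulr_ge0 ?exprn_ge0 ?divr_ge0 ?powR_ge0 // ltW.
apply: (@le_trans _ _ (s ^+ n * (c `^ p / s `^ p))); last by rewrite lerDr exprn_ge0 // ltW.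
have cE : c = s * (c / s) by rewrite mulrC divfK // gt_eqF.
have r1 : 1 <= c / s by rewrite ler_pdivlMr // mul1r ltW.
have -> : c `^ p / s `^ p = (c / s) `^ p.
  rewrite {1}cE powRM ?(ltW s0) ?(le_trans ler01 r1) // mulrAC divff ?mul1r // gt_eqF //.
rewrite {1}cE exprMn ler_pM2l ?exprn_gt0 // -powR_mulrn ?(le_trans ler01 r1) //.
by apply: ler_powR => //; exact: ltW.
Qed.

Lemma expr_add_le (R : realType) (n : nat) (x y : R) : (0 < n)%N -> 0 <= x -> 0 <= y ->
  x ^+ n + y ^+ n <= (x + y) ^+ n.
Proof.
case: n => // n _ x0 y0; rewrite !exprS mulrDl lerD // ler_wpM2l // lerXn2r ?nnegrE ?addr_ge0 //.
  by rewrite lerDl.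
by rewrite lerDr.
Qed.

(** A substitute for the Holder inequality between [L^n] and [L^p]: where [c Q] exceeds the
    reference level [s], its [n]-th power is dominated by its [p]-th power normalised by [s]. *)
Lemma holder_sum (R : realType) (n : nat) (T : finType) (c : T -> R) (p v V s A a : R) :
  (0 < n)%N -> n%:R < p -> 0 < v -> 0 < s -> 0 <= A -> 0 <= a -> (forall Q, 0 <= c Q) ->
  \sum_(Q : T) v = V -> \sum_Q v * c Q `^ p <= s `^ p * V ->
  \sum_Q v * (A + a * c Q) ^+ n <= V * (2 * A + 4 * a * s) ^+ n.
Proof.
move=> n0 np v0 s0 A0 a0 c0 HV Hs; have sp : 0 < s `^ p by exact: powR_gt0.
have V0 : 0 <= V by rewrite -HV sumr_ge0 // => Q _; exact: ltW.
have k1 Q : (A + a * c Q) ^+ n <= (2 * A) ^+ n + (2 * a * s) ^+ n * (1 + c Q `^ p / s `^ p).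
  have ac : 0 <= a * c Q by exact: mulr_ge0.
  apply: (@le_trans _ _ ((2 * A) ^+ n + (2 * (a * c Q)) ^+ n)).
    have [h|h] := lerP A (a * c Q).
      apply: (@le_trans _ _ ((2 * (a * c Q)) ^+ n)); last by rewrite lerDr exprn_ge0 // mulr_ge0.
      by rewrite lerXn2r ?nnegrE ?addr_ge0 ?mulr_ge0 //; lra.
    apply: (@le_trans _ _ ((2 * A) ^+ n)); last by rewrite lerDl exprn_ge0 // !mulr_ge0.
    by rewrite lerXn2r ?nnegrE ?addr_ge0 ?mulr_ge0 //; lra.
  rewrite lerD2l mulrA exprMn [leRHS](_ : _ = (2 * a) ^+ n * (s ^+ n + s ^+ n * (c Q `^ p / s `^ p))).
    rewrite ler_wpM2l ?exprn_ge0 ?mulr_ge0 //; exact: expr_le_powR.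
  by rewrite (exprMn _ (2 * a)); ring.
apply: (@le_trans _ _ (\sum_Q (v * ((2 * A) ^+ n + (2 * a * s) ^+ n) + (2 * a * s) ^+ n / s `^ p * (v * c Q `^ p)))).
  apply: ler_sum => Q _; have k2 := k1 Q; rewrite -(ler_pM2l v0) in k2.
  by apply: le_trans k2 _; rewrite le_eqVlt; apply/orP; left; apply/eqP; ring.
have e1 X : \sum_(Q : T) v * X = V * X by rewrite -HV big_distrl.
rewrite big_split /= e1 -big_distrr /=.
have k2 : (2 * a * s) ^+ n / s `^ p * \sum_Q v * c Q `^ p <= (2 * a * s) ^+ n * V.
  have -> : (2 * a * s) ^+ n * V = (2 * a * s) ^+ n / s `^ p * (s `^ p * V) by field; rewrite gt_eqF.
  by rewrite ler_wpM2l // divr_ge0 ?exprn_ge0 ?mulr_ge0 // ltW.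
have k3 : (2 * A) ^+ n + ((2 * a * s) ^+ n + (2 * a * s) ^+ n) <= (2 * A + 4 * a * s) ^+ n.
  have as0 : 0 <= 2 * a * s by rewrite !mulr_ge0 // ltW.
  have -> : 4 * a * s = 2 * a * s + 2 * a * s by ring.
  have A2 : 0 <= 2 * A by rewrite mulr_ge0.
  by apply: le_trans (expr_add_le n0 A2 (addr_ge0 as0 as0)); rewrite lerD2l expr_add_le.
have k4 : V * ((2 * A) ^+ n + ((2 * a * s) ^+ n + (2 * a * s) ^+ n)) <= V * (2 * A + 4 * a * s) ^+ n by rewrite ler_wpM2l.
by clear -k2 k4; lra.
Qed.

(** Between [x0] and a point of the cube the linear function of slope [p] varies by at most
    [W x0 / 4], so contact occurs where [W] keeps three quarters of its central value. *)
Lemma contact_point (R : realType) (n : nat) (W : 'rV[R]_n -> R) (x0 p : 'rV[R]_n) (r : R) : 0 < r ->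
  (forall x : 'rV[R]_n, `|x - x0| <= r -> {for x, continuous W}) -> 
  4 * n%:R * r * `|p| <= W x0 ->
  exists y, [/\ `|y - x0| <= r, 3 / 4 * W x0 <= W y &
    forall x : 'rV[R]_n, `|x - x0| <= r -> W x <= W y + dot p (x - y)].
Proof.
move=> r0 Wc pm.
have x0r : `|x0 - x0| <= r by rewrite subrr normr0 ltW.
have [|||y yr Hy] := @evt_max R n (fun x => W x - dot p x) [set x | `|x - x0| <= r].
- by exists x0.
- exact: compact_cube.
- by move=> x xr; apply: continuousB; [exact: Wc | exact: cont_dot].
exists y; split=> //.
  have := Hy x0 x0r; have := ler_norm (- dot p (y - x0)); rewrite normrN.
  have := dot_normv p (y - x0); have : n%:R * (`|p| * `|y - x0|) <= n%:R * (`|p| * r).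
    by rewrite ler_wpM2l // ler_wpM2l.
  rewrite dotBr; lra.
by move=> x xr; have := Hy x xr; rewrite dotBr; lra.
Qed.

(** [W] is nonpositive on the faces, so uniform continuity keeps the points where it is large at a
    fixed distance from them. One mesh size thus serves all contact points. *)
Lemma deep_point (R : realType) (n : nat) (W : 'rV[R]_n -> R) (x0 : 'rV[R]_n) (r : R) : 0 < r ->
  (forall x : 'rV[R]_n, `|x - x0| <= r -> {for x, continuous W}) -> 0 < W x0 ->
  (forall x : 'rV[R]_n, `|x - x0| = r -> W x <= 0) ->
  exists2 d : R, 0 < d & forall y, `|y - x0| <= r -> 3 / 4 * W x0 <= W y ->
    forall x : 'rV[R]_n, `|x - y| < d -> `|x - x0| < r /\ 0 < W x.
Proof.
move=> r0 Wc mu0 Wb; have e0 : 0 < W x0 / 8 by rewrite divr_gt0.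
have [d d0 Hd] := @unif_cont R n W [set x | `|x - x0| <= r] (compact_cube r0) Wc _ e0.
exists (Num.min d r); first by rewrite lt_min d0.
move=> y yr Wy x; rewrite lt_min => /andP[xd xr].
have Wx : 0 < W x by have := Hd y x yr xd; rewrite ltr_norml => /andP[k _]; lra.
split=> //.
suff dist : d <= r - `|y - x0| \/ `|y - x0| = 0.
  have := ler_normD (x - y) (y - x0); rewrite subrKA; case: dist; lra.
have [->|z] := eqVneq `|y - x0| 0; [by right | left].
have zp : 0 < `|y - x0| by rewrite lt_def z normr_ge0.
rewrite leNgt; apply/negP => lt.
pose x' := x0 + (r / `|y - x0|) *: (y - x0).
have x'r : `|x' - x0| = r.
  rewrite /x' addrAC subrr add0r normrZ gtr0_norm ?divr_gt0 //; by rewrite divfK // gt_eqF.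
have x'y : `|x' - y| = r - `|y - x0|.
  have -> : x' - y = (r / `|y - x0| - 1) *: (y - x0) by rewrite /x'; apply/rowP => i; rewrite !mxE; ring.
  rewrite normrZ ger0_norm ?subr_ge0 ?ler_pdivlMr ?mul1r // mulrBl mul1r divfK // gt_eqF //.
have := Hd y x' yr; rewrite x'y => /(_ lt); rewrite ltr_norml => /andP[k _].
by have := Wb x' x'r; lra.
Qed.

Lemma grid_cell (R : realType) (n M : nat) (x0 x : 'rV[R]_n) (r h : R) : 0 < h -> h * M.+1%:R = 2 * r ->
  `|x - x0| < r -> exists k : {ffun 'I_n -> 'I_M.+1},
   forall i : 'I_n, (x0 - const_mx r) 0 i + (k i)%:R * h <= x 0 i < (x0 - const_mx r) 0 i + (k i).+1%:R * h.
Proof.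
move=> h0 hM xr.
exists [ffun i : 'I_n => inord (Num.truncn ((x 0 i - x0 0 i + r) / h))] => i.
have xi : `|x 0 i - x0 0 i| < r.
  by apply: le_lt_trans xr; have := normv_coord (x - x0) i; rewrite !mxE.
move: xi; rewrite ltr_norml => /andP[a1 a2].
set t := (x 0 i - x0 0 i + r) / h.
have t0 : 0 <= t by rewrite divr_ge0 ?(ltW h0) //; lra.
have tM : t < M.+1%:R by rewrite ltr_pdivrMr // mulrC hM; lra.
have /andP[b1 b2] := truncn_itv t0.
have tn : (Num.truncn t < M.+1)%N by rewrite -(ltr_nat R); exact: le_lt_trans b1 tM.
rewrite !mxE !ffunE inordK //; set m := Num.truncn t in b1 b2 *.
have th : t * h = x 0 i - x0 0 i + r by rewrite /t divfK // gt_eqF.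
have c1 : m%:R * h <= t * h by rewrite ler_pM2r.
have c2 : t * h < m.+1%:R * h by rewrite ltr_pM2r.
by apply/andP; split; lra.
Qed.

Lemma lt_truncn1 (R : realType) (x : R) : 0 <= x -> x < (Num.truncn x).+1%:R.
Proof. by move=> /truncn_itv/andP[]. Qed.

(** Each lattice slope in a cube of size [P] has a contact point, and contact points in one grid
    cell of mesh [h] have slopes differing by at most [K3 * h * (A + a * c Q)], by [slope_close].
    Counting then bounds [P ^+ n] by a sum over cells, which [holder_sum] and the integral of
    [f ^ p] control. *)
Lemma abp_core (R : realType) (n : nat) (ga Ga d1 p : R) (O : set 'rV[R]_n) (f W : 'rV[R]_n -> R)
  (a C0 s r K P : R) (x0 : 'rV[R]_n) :
  (0 < n)%N -> 0 < ga -> ga <= Ga -> 0 <= d1 -> n%:R < p -> 0 < r ->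
  (forall x : 'rV[R]_n, `|x - x0| <= r -> O x) ->
  (forall x : 'rV[R]_n, `|x - x0| <= r -> {for x, continuous f}) -> (forall x, O x -> 0 <= f x) ->
  (forall x : 'rV[R]_n, `|x - x0| <= r -> {for x, continuous W}) ->
  (forall x : 'rV[R]_n, `|x - x0| = r -> W x <= 0) ->
  Psub ga Ga d1 [set x | `|x - x0| < r /\ 0 < W x] (fun x => C0 + a * f x) W ->
  0 < C0 -> 0 <= a -> 0 < s ->
  (lebint_n (fun x => ((\1_O x) * (`|f x| `^ p))%:E) <= (s `^ p * (2 * r) ^+ n)%:E)%E ->
  K = 10 * n%:R * Ga / ga + 1 -> 0 < W x0 -> 4 * n%:R * r * P = W x0 ->
  P <= 3 * (32 * n%:R / ga) * (2 * r) * (2 * (4 * C0 + d1 * (P * (1 + (1 + K) * n%:R))) + 4 * a * s).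
Proof.
move=> n0 ga0 gG d10 np r0 rO fc f0 Wc Wb Ps C00 a0 s0 Hint KE mu0 PE.
have nn0 : 0 < n%:R :> R by rewrite ltr0n.
have Ga0 : 0 < Ga by exact: lt_le_trans gG.
have K1 : 1 <= K by rewrite KE lerDr divr_ge0 ?mulr_ge0 // ltW.
have P0 : 0 < P by move: mu0; rewrite -PE pmulr_rgt0 // !mulr_gt0.
have [dm dm0 Hdm] := deep_point r0 Wc mu0 Wb.
have [ef efE] : {x | x = C0 / (a + 1)} by eexists.
have ef0 : 0 < ef by rewrite efE divr_gt0 // ltr_wpDl.
have aef : a * ef <= C0.
  rewrite efE mulrCA ler_piMr ?(ltW C00) // ler_pdivrMr ?ltr_wpDl // mul1r lerDl //.
have [df df0 Hdf] := @unif_cont R n f [set x : 'rV[R]_n | `|x - x0| <= r] (compact_cube r0) fc _ ef0.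
pose dd := Num.min dm df; have dd0 : 0 < dd by rewrite lt_min dm0.
have [ddm ddf] : dd <= dm /\ dd <= df by rewrite /dd !ge_min !lexx orbT.
have B0 : 0 < K * (4 * n%:R) + 1.
  by apply: ltr_wpDl => //; apply: mulr_ge0; [apply: le_trans K1 | exact: mulr_ge0].
have [M HM] : exists M : nat, (K * (4 * n%:R) + 1) * (2 * r) < M.+1%:R * dd.
  exists (Num.truncn ((K * (4 * n%:R) + 1) * (2 * r) / dd)); rewrite -ltr_pdivrMr //.
  by apply: lt_truncn1; apply: divr_ge0; [apply: mulr_ge0; [|rewrite mulr_ge0 //]|]; exact: ltW.
have M0 : 0 < M.+1%:R :> R by rewrite ltr0n.
have [h hE] : {h | h = 2 * r / M.+1%:R} by eexists.
have h0 : 0 < h by rewrite hE divr_gt0 // mulr_gt0.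
have hM : h * M.+1%:R = 2 * r by rewrite hE divfK // gt_eqF.
have Kh : K * (4 * n%:R * h) + h < dd.
  have -> : K * (4 * n%:R * h) + h = (K * (4 * n%:R) + 1) * h by ring.
  by rewrite hE mulrA ltr_pdivrMr // (mulrC dd).
have Kn0 : 0 <= K * (4 * n%:R * h) by rewrite mulr_ge0 ?(le_trans ler01 K1) // !mulr_ge0 // ltW.
have hdd : h < dd by (clear -Kn0 Kh; lra).
have [K3 K3E] : {x | x = 32 * n%:R / ga} by eexists.
have K30 : 0 < K3 by rewrite K3E divr_gt0 // mulr_gt0.
have [A AE] : {x | x = 4 * C0 + d1 * (P * (1 + (1 + K) * n%:R))} by eexists.
have A0 : 4 * C0 <= A.
  rewrite AE lerDl mulr_ge0 // mulr_ge0 ?(ltW P0) // addr_ge0 // mulr_ge0 //; lra.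
have A00 : 0 < A by lra.
(* The lattice of slopes is finer than the width allotted to every cell, as [abp_cells] requires. *)
have [N HN] : exists N : nat, P < N.+1%:R * (K3 * h * A).
  exists (Num.truncn (P / (K3 * h * A))); rewrite -ltr_pdivrMr ?mulr_gt0 //.
  by apply: lt_truncn1; rewrite divr_ge0 ?mulr_ge0 // ltW.
have N0 : 0 < N.+1%:R :> R by rewrite ltr0n.
pose sl (k : {ffun 'I_n -> 'I_N.+1}) : 'rV[R]_n := \row_i (P * ((k i)%:R / N.+1%:R)).
have slP k : `|sl k| <= P.
  apply: normv_le; first exact: ltW.
  move=> i; rewrite mxE ger0_norm ?mulr_ge0 ?divr_ge0 ?(ltW P0) // ler_piMr ?(ltW P0) //.
  by rewrite ler_pdivrMr // mul1r ler_nat ltnW.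
have contact k : exists y, [/\ `|y - x0| <= r, 3 / 4 * W x0 <= W y &
    forall x : 'rV[R]_n, `|x - x0| <= r -> W x <= W y + dot (sl k) (x - y)].
  by apply: contact_point => //; rewrite -PE ler_pM2l // !mulr_gt0.
have [y Hy] := choice contact.
have near k (x : 'rV[R]_n) : `|x - y k| < dd -> [/\ `|x - x0| < r, 0 < W x & `|f x - f (y k)| < ef].
  move=> xk; have [h1 h2 _] := Hy k; have [|k1 k2] := Hdm (y k) h1 h2 x; first exact: lt_le_trans xk ddm.
  by split=> //; apply: Hdf => //; exact: lt_le_trans xk ddf.
have yr k : `|y k - x0| < r by have [] := near k (y k) _; rewrite // subrr normr0.
have [cel Hcel] := choice (fun k => grid_cell h0 hM (yr k)).
have same k k' : cel k = cel k' -> `|y k - y k'| <= h.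
  move=> e; apply: normv_le; first exact: ltW.
  move=> i; have := Hcel k i; have := Hcel k' i; rewrite e !mxE => /andP[a1 a2] /andP[a3 a4].
  by rewrite -!natr1 !mulrDl !mul1r in a1 a2 a3 a4; rewrite ler_norml; apply/andP; split; (clear -a4 a3 a2 a1; lra).
(* A contact value of [f] lowered by [ef] is a lower bound of [f] on the whole cell, so these
   numbers give a lower sum of the integral. Cells without contact point receive [0]. *)
pose c (Q : {ffun 'I_n -> 'I_M.+1}) := if [pick k | cel k == Q] is Some k then Num.max 0 (f (y k) - ef) else 0.
have c0 Q : 0 <= c Q by rewrite /c; case: pickP => // k _; rewrite le_max lexx.
have cf k : f (y k) <= c (cel k) + 2 * ef.
  rewrite /c; case: pickP => [k' /eqP e|]; last by move=> /(_ k); rewrite eqxx.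
  have [|_ _ k1] := near k' (y k); first by apply: le_lt_trans (same _ _ (esym e)) hdd.
  move: k1; rewrite ltr_norml => /andP[_ k1].
  have : f (y k') - ef <= Num.max 0 (f (y k') - ef) by rewrite le_max lexx orbT.
  by (clear -k1; lra).
have p0 : 0 < p by apply: lt_trans np.
have Hgrid : \sum_Q h ^+ n * c Q `^ p <= s `^ p * (2 * r) ^+ n.
  rewrite -lee_fin; apply: le_trans Hint.
  apply: (@lebint_grid R n M.+1 (x0 - const_mx r) h (fun Q => c Q `^ p)) => [//|||].
  - by move=> Q; exact: powR_ge0.
  - by move=> x; rewrite lee_fin mulr_ge0 ?powR_ge0.
  move=> Q x Hx; rewrite lee_fin /c; case: pickP => [k /eqP e|_]; last first.
    by rewrite powR0 ?gt_eqF // mulr_ge0 ?powR_ge0.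
  have xk : `|x - y k| <= h.
    apply: normv_le; first exact: ltW.
    move=> i; have := Hcel k i; have := Hx i; rewrite e !mxE => /andP[a1 a2] /andP[a3 a4].
    by rewrite -!natr1 !mulrDl !mul1r in a1 a2 a3 a4; rewrite ler_norml; apply/andP; split; (clear -a4 a3 a2 a1; lra).
  have [|xr _ k1] := near k x; first exact: le_lt_trans xk hdd.
  have Ox : O x by apply: rO; exact: ltW.
  rewrite indicE mem_set // mul1r ger0_norm ?f0 //.
  apply: ge0_ler_powR; rewrite ?nnegrE ?(ltW p0) ?f0 // ?le_max ?lexx //.
  rewrite ge_max f0 //=; move: k1; rewrite ltr_norml => /andP[k1 _]; (clear -k1; lra).
have slopes k k' : cel k = cel k' -> nrm2 (sl k - sl k') <= K3 * h * (A + a * c (cel k)).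
  move=> e; have [z|q0] := eqVneq (sl k - sl k') 0.
    by rewrite z /nrm2 sq0 sqrtr0 !mulr_ge0 ?(ltW K30) ?(ltW h0) // addr_ge0 ?mulr_ge0 // ltW.
  have yk := same _ _ e; have [y1 y2 y3] := Hy k; have [y4 y5 y6] := Hy k'.
  have nx (x : 'rV[R]_n) : nrm2 (x - y k) <= K * (4 * n%:R * h) -> `|x - y k| < dd.
    by move=> hx; apply: le_lt_trans (normv_nrm2 _) (le_lt_trans hx _); (clear -Kh h0; lra).
  have [||z z1 z2] := @slope_close R n ga Ga d1 _ _ W (y k) (y k') (sl k) (sl k') h K n0 ga0 gG d10 h0 q0 KE Ps yk.
  - move=> x /nx /near[xr Wx _]; split=> //; first by apply: Wc; exact: ltW.
    + by apply: y3; exact: ltW.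
    + by apply: y6; exact: ltW.
  - exact: y3.
  have [zr _ fz] := near k z (nx z z1).
  have Qn : nrm2 (sl k - sl k') <= n%:R * P.
    apply: le_trans (nrm2_normv _ n0) _; rewrite ler_pM2l //; apply: normv_le; first exact: ltW.
    move=> i; rewrite !mxE -mulrBr -mulrBl normrM (gtr0_norm P0) ler_piMr ?(ltW P0) //.
    rewrite normrM normfV (gtr0_norm N0) ler_pdivrMr // mul1r ler_norml.
    have b1 : (k i)%:R <= N.+1%:R :> R by rewrite ler_nat ltnW.
    have b2 : (k' i)%:R <= N.+1%:R :> R by rewrite ler_nat ltnW.
    have b3 : 0 <= (k i)%:R :> R by []. have b4 : 0 <= (k' i)%:R :> R by [].
    by apply/andP; split; clear -b1 b2 b3 b4; lra.
  have m1 : (1 + K) * nrm2 (sl k - sl k') <= (1 + K) * (n%:R * P) by rewrite ler_wpM2l //; (clear -K1; lra).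
  have m2 : d1 * (`|sl k| + (1 + K) * nrm2 (sl k - sl k')) <= d1 * (P * (1 + (1 + K) * n%:R)).
    by rewrite ler_wpM2l //; have := slP k; clear -m1; lra.
  have m3 : a * f z <= a * (c (cel k) + 3 * ef).
    rewrite ler_wpM2l //; have := cf k; move: fz; rewrite ltr_norml => /andP[_ fz]; clear -fz; lra.
  have m4 : d1 * (`|sl k| + (1 + K) * nrm2 (sl k - sl k')) + (C0 + a * f z) <= A + a * c (cel k).
    by rewrite AE; clear -m2 m3 aef; lra.
  have m5 : 32 * n%:R * h * (d1 * (`|sl k| + (1 + K) * nrm2 (sl k - sl k')) + (C0 + a * f z)) <=
    32 * n%:R * h * (A + a * c (cel k)) by rewrite ler_pM2l // !mulr_gt0.
  have := le_trans z2 m5; rewrite -ler_pdivlMr // => /le_trans; apply.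
  by rewrite K3E le_eqVlt; apply/orP; left; apply/eqP; ring.
have Hcells : P ^+ n <= \sum_Q (3 * (K3 * h * (A + a * c Q))) ^+ n.
  apply: (@abp_cells R n N.+1 _ cel (fun Q => K3 * h * (A + a * c Q)) P) => //.
    move=> Q; apply: le_trans (ltW HN) _; rewrite ler_pM2l // ler_pM2l ?mulr_gt0 // lerDl mulr_ge0 //.
  move=> k k' e i; have := slopes k k' e.
  have : `|(sl k - sl k') 0 i| <= nrm2 (sl k - sl k').
    by apply: le_trans (normv_nrm2 _); exact: normv_coord.
  move=> k1 k2; have := le_trans k1 k2; rewrite !mxE -mulrBr -mulrBl !normrM normfV (gtr0_norm P0) (gtr0_norm N0).
  by rewrite mulrA ler_pdivrMr // (mulrC _ N.+1%:R).
have V : \sum_(Q : {ffun 'I_n -> 'I_M.+1}) h ^+ n = (2 * r) ^+ n.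
  by rewrite sumr_const card_ffun !card_ord -hM exprMn -natrX mulr_natr.
have hn0 : 0 < h ^+ n by rewrite exprn_gt0.
have Hh := holder_sum n0 np hn0 s0 (ltW A00) a0 c0 V Hgrid.
have X0 : 0 <= 3 * K3 * (2 * r) * (2 * A + 4 * a * s).
  have as0 : 0 <= 4 * a * s by rewrite !mulr_ge0 // ltW.
  by rewrite mulr_ge0 //; [rewrite !mulr_ge0 // ltW | rewrite addr_ge0 // mulr_ge0 // ltW].
rewrite -K3E -AE -(@ler_pXn2r _ n) ?nnegrE ?(ltW P0) //.
apply: le_trans Hcells _.
have -> : \sum_Q (3 * (K3 * h * (A + a * c Q))) ^+ n = (3 * K3) ^+ n * \sum_Q h ^+ n * (A + a * c Q) ^+ n.
  by rewrite big_distrr /=; apply: eq_bigr => Q _; rewrite -!exprMn; congr (_ ^+ n); ring.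
rewrite -(mulrA (3 * K3)) (exprMn _ (3 * K3)) ler_pM2l ?exprn_gt0 ?mulr_gt0 //.
by rewrite exprMn.
Qed.

(** [s] bounds the mean of order [p] of [f] at the scale of the cube. For radii up to [R0] the
    first-order term, of order [d1 * r * P], is absorbed by [P] itself. *)
Lemma abp (R : realType) (n : nat) (ga Ga d1 p : R) : (0 < n)%N -> 0 < ga -> ga <= Ga -> 0 <= d1 -> n%:R < p ->
  exists C R0 : R, [/\ 0 < C, 0 < R0 & forall (O : set 'rV[R]_n) (f W : 'rV[R]_n -> R) (a C0 s r : R) (x0 : 'rV[R]_n),
  0 < r -> r <= R0 ->
  (forall x : 'rV[R]_n, `|x - x0| <= r -> O x) ->
  (forall x : 'rV[R]_n, `|x - x0| <= r -> {for x, continuous f}) -> (forall x, O x -> 0 <= f x) ->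
  (forall x : 'rV[R]_n, `|x - x0| <= r -> {for x, continuous W}) ->
  (forall x : 'rV[R]_n, `|x - x0| = r -> W x <= 0) ->
  Psub ga Ga d1 [set x | `|x - x0| < r /\ 0 < W x] (fun x => C0 + a * f x) W ->
  0 < C0 -> 0 <= a -> 0 < s ->
  (lebint_n (fun x => ((\1_O x) * (`|f x| `^ p))%:E) <= (s `^ p * (2 * r) ^+ n)%:E)%E ->
  W x0 <= C * r ^+ 2 * (C0 + a * s)].
Proof.
move=> n0 ga0 gG d10 np.
have nn0 : 0 < n%:R :> R by rewrite ltr0n.
have Ga0 : 0 < Ga by exact: lt_le_trans gG.
have [K KE] : {K | K = 10 * n%:R * Ga / ga + 1} by eexists.
have K1 : 1 <= K by rewrite KE lerDr divr_ge0 ?mulr_ge0 // ltW.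
have [K3 K3E] : {x | x = 32 * n%:R / ga} by eexists.
have K30 : 0 < K3 by rewrite K3E divr_gt0 // mulr_gt0.
have [K2 K2E] : {x | x = 1 + (1 + K) * n%:R} by eexists.
have K20 : 0 < K2 by rewrite K2E addr_gt0 // mulr_gt0 //; lra.
have [B BE] : {x | x = 24 * (K3 * K2 * d1) + 1} by eexists.
have kk : 0 <= K3 * K2 * d1 by rewrite mulr_ge0 // mulr_ge0 // ltW.
have B0 : 0 < B by lra.
exists ((4 * n%:R) * (96 * K3)), B^-1; split; [|by rewrite invr_gt0 |].
  by apply: mulr_gt0; apply: mulr_gt0.
move=> O f W a C0 s r x0 r0 rB rO fc f0 Wc Wb Ps C00 a0 s0 Hint.
have RHS0 : 0 <= (4 * n%:R) * (96 * K3) * r ^+ 2 * (C0 + a * s).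
  apply: mulr_ge0; last by rewrite addr_ge0 ?mulr_ge0 // ltW.
  by apply: mulr_ge0; [apply: mulr_ge0; apply: mulr_ge0 => //; exact: ltW | exact: sqr_ge0].
have [W0|W0] := lerP (W x0) 0; first exact: le_trans RHS0.
have n4 : 0 < 4 * n%:R * r by rewrite !mulr_gt0.
have PE : 4 * n%:R * r * (W x0 / (4 * n%:R * r)) = W x0 by rewrite mulrC divfK // gt_eqF.
have P0 : 0 < W x0 / (4 * n%:R * r) by rewrite divr_gt0.
have := abp_core n0 ga0 gG d10 np r0 rO fc f0 Wc Wb Ps C00 a0 s0 Hint KE W0 PE.
move: PE P0; generalize (W x0 / (4 * n%:R * r)) => P PE P0; rewrite -K3E -K2E => k1.
have rB' : r * B <= 1 by rewrite -ler_pdivlMr // div1r.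
have k2 : 24 * (K3 * K2 * d1) * r <= 1 by rewrite BE in rB'; lra.
have k3 : 24 * (K3 * K2 * d1) * r * P <= P by rewrite -[leRHS]mul1r ler_pM2r.
have k4 : P <= 96 * (K3 * r * (C0 + a * s)).
  have q1 : 0 <= K3 * r * (a * s) by rewrite mulr_ge0 // ?mulr_ge0 // ltW.
  by clear -k1 k3 q1; lra.
have := ler_wpM2l (ltW n4) k4; rewrite PE => /le_trans; apply.
by rewrite le_eqVlt; apply/orP; left; apply/eqP; ring.
Qed.

(** * Defining functions of smooth domains *)

Lemma derive_grad (R : realType) (n : nat) (f : 'rV[R]_n -> R) (z h : 'rV[R]_n) :
  differentiable f z -> 'D_h f z = dot (grad f z) h.
Proof.
move=> df; rewrite deriveE // {1}(row_sum_delta h) linear_sum /dot; apply: eq_bigr => i _.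
by rewrite linearZ /= -deriveE // mxE mulrC.
Qed.

Lemma mvt_line (R : realType) (n : nat) (f : 'rV[R]_n -> R) (x h : 'rV[R]_n) :
  (forall t : R, 0 <= t <= 1 -> differentiable f (x + t *: h)) ->
  exists2 c : R, 0 <= c <= 1 & f (x + h) - f x = dot (grad f (x + c *: h)) h.
Proof.
move=> df; pose phi (t : R) := f (x + t *: h).
have q t : (fun k : R => k^-1 *: ((phi \o shift t) (k *: 1) - phi t)) =
    (fun k : R => k^-1 *: ((f \o shift (x + t *: h)) (k *: h) - f (x + t *: h))).
  apply/funext => k; rewrite /phi /=; congr (_ *: (f _ - _)).
  by apply/rowP => i; rewrite !mxE [k *: 1]mulr1; ring.
have dphi (t : R) : 0 <= t <= 1 -> is_derive t 1 phi (dot (grad f (x + t *: h)) h).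
  move=> ht; have dv : derivable f (x + t *: h) h by apply: diff_derivable; exact: df.
  apply: DeriveDef; first by rewrite /derivable q.
  by rewrite -derive_grad; [rewrite /derive q | exact: df].
have [||c cI] := @MVT R phi (fun t => dot (grad f (x + t *: h)) h) 0 1 ltr01.
- by move=> t; rewrite in_itv /= => /andP[t0 t1]; apply: dphi; rewrite !ltW.
- apply: continuous_in_subspaceT => t; rewrite inE /= in_itv /= => ht.
  by apply: differentiable_continuous; apply/derivable1_diffP; case: (dphi t ht).
rewrite /phi scale1r scale0r addr0 subr0 mulr1 => ->; exists c => //.
by move: cI; rewrite in_itv /= => /andP[a b]; rewrite !ltW.
Qed.

Lemma cont_bounded_cube (R : realType) (n : nat) (f : 'rV[R]_n -> R) (r : R) : 0 < r ->
  (forall x, {for x, continuous f}) -> exists2 B : R, 0 <= B & forall x, `|x| <= r -> `|f x| <= B.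
Proof.
move=> r0 fc.
have [|||c _ Hc] := @evt_max R n (fun x => `|f x|) [set x | `|x - 0| <= r].
- by exists 0; rewrite /= subrr normr0 ltW.
- exact: compact_cube.
- by move=> x _; apply: (@continuous_comp _ _ _ f Num.norm); [exact: fc | exact: norm_continuous].
by exists `|f c| => // x xr; apply: Hc; rewrite /= subr0.
Qed.

Lemma Cinf_bounds (R : realType) (n : nat) (f : 'rV[R]_n -> R) (r : R) : Cinf f -> 0 < r ->
  exists2 B : R, 0 <= B & forall x h : 'rV[R]_n, `|x| <= r -> `|h| <= 1 ->
  [/\ `|f (x + h) - f x| <= B * `|h|, `|f (x + h) - f x - dot (grad f x) h| <= B * sq h & `|grad f x| <= B].
Proof.
move=> Cf r0.
have [f1 [f2 f3]] := Cf 2; have r10 : 0 < r + 1 by rewrite addr_gt0.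
have ub (I : finType) (g : I -> 'rV[R]_n -> R) : (forall i x, {for x, continuous (g i)}) ->
    exists2 B : R, 0 <= B & forall i (x : 'rV[R]_n), `|x| <= r + 1 -> `|g i x| <= B.
  move=> gc.
  have H i : exists B : R, 0 <= B /\ forall x : 'rV[R]_n, `|x| <= r + 1 -> `|g i x| <= B.
    by have [B B0 HB] := cont_bounded_cube r10 (gc i); exists B.
  have [B HB] := choice H; exists (\sum_i B i); first by apply: sumr_ge0 => i _; case: (HB i).
  move=> i x /(HB i).2 k; apply: le_trans k _.
  by rewrite (bigD1 i) //= lerDl; apply: sumr_ge0 => j _; case: (HB j).
have [B1 B10 HB1] := ub 'I_n (fun i => pd i f) (fun i x => (f3 i).1 x I).
have [B2 B20 HB2] := ub ('I_n * 'I_n)%type (fun ij => pd ij.1 (pd ij.2 f)) (fun ij x => (f3 ij.2).2.2 ij.1 x I).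
have gB (x : 'rV[R]_n) : `|x| <= r + 1 -> `|grad f x| <= B1.
  by move=> xr; apply: normv_le => // i; rewrite mxE HB1.
have nn : 0 <= n%:R :> R by [].
exists (n%:R * B1 + n%:R * (n%:R * B2) + B1); first by rewrite !addr_ge0 ?mulr_ge0.
move=> x h xr h1.
have xt (t : R) (k : 'rV[R]_n) : `|k| <= 1 -> 0 <= t <= 1 -> `|x + t *: k| <= r + 1.
  move=> k1 /andP[t0 t1]; apply: le_trans (ler_normD _ _) _; apply: lerD => //.
  by rewrite normrZ ger0_norm // mulr_ile1.
have [c c01 fE] := mvt_line (f := f) (x := x) (h := h) (fun t _ => f2 _ I).
have nB : n%:R * (`|grad f (x + c *: h)| * `|h|) <= n%:R * B1 * `|h|.
  by rewrite -mulrA ler_wpM2l // ler_wpM2r // gB // xt.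
have e1 : 0 <= n%:R * (n%:R * B2) * `|h| by rewrite !mulr_ge0.
have e2 : 0 <= B1 * `|h| by rewrite mulr_ge0.
have hs : `|h| ^+ 2 <= sq h by exact: normv_sq.
split.
- rewrite fE; apply: le_trans (dot_normv _ _) _; apply: le_trans nB _; lra.
- rewrite fE -dotBl; apply: le_trans (dot_normv _ _) _.
  have k1 : `|grad f (x + c *: h) - grad f x| <= n%:R * B2 * `|h|.
    apply: normv_le; first by rewrite !mulr_ge0.
    move=> j; rewrite !mxE.
    have ch : `|c *: h| <= `|h|.
      by case/andP: c01 => c0 c1; rewrite normrZ ger0_norm // ler_piMl.
    have [c' c'01 ->] := mvt_line (f := pd j f) (x := x) (h := c *: h) (fun t _ => (f3 j).2.1 _ I).
    apply: le_trans (dot_normv _ _) _; rewrite -mulrA ler_wpM2l // ler_pM //.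
    apply: normv_le => // i; rewrite mxE; apply: (HB2 (i, j)); apply: xt => //.
    exact: le_trans h1.
  have k2 : n%:R * (`|grad f (x + c *: h) - grad f x| * `|h|) <= n%:R * (n%:R * B2 * `|h| * `|h|).
    by rewrite ler_wpM2l // ler_wpM2r.
  apply: le_trans k2 _.
  have -> : n%:R * (n%:R * B2 * `|h| * `|h|) = n%:R * (n%:R * B2) * `|h| ^+ 2 by ring.
  apply: (@le_trans _ _ (n%:R * (n%:R * B2) * sq h)); first by rewrite ler_wpM2l ?mulr_ge0.
  rewrite ler_wpM2r ?sq_ge0 //; have : 0 <= n%:R * B1 by rewrite mulr_ge0.
  lra.
- apply: le_trans (gB _ _) _; first by lra.
  rewrite lerDr addr_ge0 ?mulr_ge0 //.
Qed.

Lemma cont_pos_near (R : realType) (n : nat) (f : 'rV[R]_n -> R) (x : 'rV[R]_n) : {for x, continuous f} -> 0 < f x ->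
  exists2 e : R, 0 < e & forall y, `|y - x| < e -> f x / 2 < f y.
Proof.
move=> /contP_eps fc fx; have [|e e0 H] := fc (f x / 2); first by rewrite divr_gt0.
by exists e => // y /H; rewrite ltr_norml => /andP[k _]; lra.
Qed.

(* [d] is a defining function of the domain, [G] its gradient. *)
Definition regdom (R : realType) (n : nat) (Om : set 'rV[R]_n) (d : 'rV[R]_n -> R) (G : 'rV[R]_n -> 'rV[R]_n)
    (L c s0 : R) := [/\ Om = [set x | 0 < d x], forall x, {for x, continuous d},
  0 < L /\ 0 < c /\ 0 < s0,
  forall x h : 'rV[R]_n, Om x -> `|h| <= 1 ->
    [/\ `|d (x + h) - d x| <= L * `|h|, `|d (x + h) - d x - dot (G x) h| <= L * sq h & `|G x| <= L] &
  forall x, Om x -> d x < s0 -> c <= sq (G x)].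

Lemma compact_closure (R : realType) (n : nat) (Om : set 'rV[R]_n) : bounded_set Om -> compact (closure Om) /\
  exists2 B : R, 0 < B & forall x, Om x -> `|x| <= B.
Proof.
move=> [M [Mr HM]].
have M0 : 0 < Num.max M 0 + 1 by rewrite ltr_wpDl // le_max lexx orbT.
have MM : M < Num.max M 0 + 1 by rewrite (@le_lt_trans _ _ (Num.max M 0)) ?le_max ?lexx // ltrDl.
have HB x : Om x -> `|x| <= Num.max M 0 + 1 by move=> Ox; exact: (HM _ MM).
split; last by exists (Num.max M 0 + 1).
apply: (@subclosed_compact _ _ [set x | `|x - 0| <= Num.max M 0 + 1]).
- exact: closed_closure.
- exact: compact_cube.
have cl : closed [set x : 'rV[R]_n | `|x - 0| <= Num.max M 0 + 1].
  by rewrite cubeE //; exact: closed_ball_closed.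
by rewrite closureE => x; apply; split=> // y /HB; rewrite /= subr0.
Qed.

(** On the compact closure either [d] is positive or, on the boundary, the gradient does not vanish.
    Compactness gives a single threshold for both alternatives, used for [c] and for [s0]. *)
Lemma smooth_regdom (R : realType) (n : nat) (Om : set 'rV[R]_n) : smooth_domain Om ->
  exists d G L c s0, regdom Om d G L c s0.
Proof.
move=> [_ [_ [_ [bO [rho [Cr [OE Hg]]]]]]].
have [cO [B B0 HB]] := compact_closure bO.
have [B1 B10 H1] := Cinf_bounds Cr B0.
have rc x : {for x, continuous rho} by exact: (Cr 0).
pose d x := - rho x; pose G x := - grad rho x.
have dc x : {for x, continuous d} by apply: continuousN; exact: rc.
have OE' : Om = [set x | 0 < d x] by rewrite OE; apply/seteqP; split=> x /=; rewrite /d oppr_gt0.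
have sqc x : {for x, continuous (fun y => sq (G y))}.
  have [_ [_ f3]] := Cr 2.
  have -> : (fun y => sq (G y)) = (fun y => \sum_i (pd i rho y * pd i rho y)).
    by apply/funext => y; rewrite /sq /dot; apply: eq_bigr => i _; rewrite !mxE mulrNN.
  apply: cont_sum => i; apply: continuousM; exact: (f3 i).1.
have cl0 x : closure Om x -> 0 <= d x.
  move=> cx; rewrite leNgt; apply/negP => dx; have [e e0 He] := cont_lt_near (dc x) dx.
  have nb : nbhs x [set y | `|y - x| < e] by apply/nearP_eps; exists e.
  have [y [Oy /= ye]] := cx _ nb; have := He y ye; move: Oy; rewrite OE' /= => h1 h2.
  by have := lt_trans h1 h2; rewrite ltxx.
have [|x Cx|c c0 Hc] := @compact_unif R n (closure Om) (fun x r => r <= d x \/ r <= sq (G x)) cO.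
- by move=> x r r' _ [h|h] _ rr; [left|right]; apply: le_trans h.
- have [dx|dx] := ltP 0 (d x).
    have [e e0 He] := cont_pos_near (dc x) dx.
    exists (Num.min e (d x / 2)); first by rewrite lt_min e0 divr_gt0.
    move=> y _; rewrite lt_min => /andP[/He k _]; left; rewrite ge_min; apply/orP; right; lra.
  have d0 : d x = 0 by apply/eqP; rewrite eq_le dx cl0.
  have gx : 0 < sq (G x).
    rewrite sqN; apply: sq_gt0; have r0 : rho x = 0 by rewrite -[rho x]opprK -/(d x) d0 oppr0.
    have [i Hi] := Hg x r0; apply/eqP => e; case/eqP: Hi.
    by have := congr1 (fun v : 'rV[R]_n => v 0 i) e; rewrite !mxE.
  have [e e0 He] := cont_pos_near (sqc x) gx.
  exists (Num.min e (sq (G x) / 2)); first by rewrite lt_min e0 divr_gt0.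
  move=> y _; rewrite lt_min => /andP[/He k _]; right; rewrite ge_min; apply/orP; right; lra.
exists d, G, (B1 + 1), c, c; split=> //.
- by split=> //; lra.
- move=> x h Ox h1; have [k1 k2 k3] := H1 x h (HB x Ox) h1; split.
  + have -> : d (x + h) - d x = - (rho (x + h) - rho x) by rewrite /d; ring.
    by rewrite normrN; apply: le_trans k1 _; rewrite ler_wpM2r // lerDl.
  + have -> : d (x + h) - d x - dot (G x) h = - (rho (x + h) - rho x - dot (grad rho x) h).
      by rewrite /d /G dotNl; ring.
    by rewrite normrN; apply: le_trans k2 _; rewrite ler_wpM2r ?sq_ge0 // lerDl.
  + by rewrite normrN; apply: le_trans k3 _; rewrite lerDl.
- move=> x Ox dx; have [|h|//] := Hc x; first exact: subset_closure.
  by have := lt_le_trans dx h; rewrite ltxx.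
Qed.

(** * Boundary estimate *)

Lemma ujet_upper (R : realType) (n : nat) (w be : 'rV[R]_n -> R) (x p q : 'rV[R]_n) (M B : 'M[R]_n) :
  ujet (fun y => w y - be y) x p M ->
  (exists2 e : R, 0 < e & forall h : 'rV[R]_n, `|h| < e -> be (x + h) <= be x + dot q h + 2^-1 * qf B h) ->
  ujet w x (p + q) (M + B).
Proof.
move=> [d d0 H] [e e0 He]; exists (Num.min d e); first by rewrite lt_min d0.
move=> y; rewrite lt_min => /andP[/H k1 /He]; rewrite addrC subrK => k2.
rewrite qfDm dotDl; lra.
Qed.

(** [d] is known only through a first-order expansion with quadratic error. The product of [dot g h]
    with this error is cubic, and the additional [1] in the coefficient of [sq h] absorbs it for
    small [h]. *)
Lemma comp_upper (R : realType) (n : nat) (d : 'rV[R]_n -> R) (x g : 'rV[R]_n) (L m ka : R) :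
  0 <= L -> 0 <= ka ->
  (forall h : 'rV[R]_n, `|h| <= 1 -> `|d (x + h) - d x - dot g h| <= L * sq h) ->
  exists2 e : R, 0 < e & forall h : 'rV[R]_n, `|h| < e ->
    m * (d (x + h) - d x) - ka * (d (x + h) - d x) ^+ 2 <=
    m * dot g h + (`|m| * L + 1) * sq h - ka * dot g h ^+ 2.
Proof.
move=> L0 ka0 H.
pose Q := 2 * ka * (n%:R * `|g| * L) + 1.
have q0 : 0 <= 2 * ka * (n%:R * `|g| * L) by rewrite !mulr_ge0.
have Q0 : 0 < Q by rewrite ltr_wpDl.
exists (Num.min 1 Q^-1); first by rewrite lt_min ltr01 invr_gt0.
move=> h; rewrite lt_min => /andP[h1 h2]; have := H h (ltW h1).
move: (d (x + h) - d x) => D HD; have [e eE] : {e | e = D - dot g h} by eexists.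
have DE : D = dot g h + e by rewrite eE addrC subrK.
rewrite -eE in HD; rewrite DE; have s0 := sq_ge0 h.
have k1 : m * e <= `|m| * L * sq h.
  apply: le_trans (ler_norm _) _; rewrite normrM -mulrA ler_wpM2l //.
have k2 : - (2 * ka * (dot g h * e)) <= sq h.
  apply: le_trans (ler_norm _) _; rewrite normrN normrM ger0_norm ?mulr_ge0 // normrM.
  have k3 : `|dot g h| <= n%:R * (`|g| * `|h|) by exact: dot_normv.
  have k4 : `|dot g h| * `|e| <= n%:R * (`|g| * `|h|) * (L * sq h) by apply: ler_pM.
  apply: (@le_trans _ _ (2 * ka * (n%:R * (`|g| * `|h|) * (L * sq h)))).
    by rewrite ler_wpM2l // mulr_ge0.
  have -> : 2 * ka * (n%:R * (`|g| * `|h|) * (L * sq h)) = (Q - 1) * `|h| * sq h by rewrite /Q; ring.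
  rewrite ler_piMl //; apply: (@le_trans _ _ (Q * `|h|)); first by rewrite ler_wpM2r // gerBl.
  by rewrite mulrC -ler_pdivlMr // div1r ltW.
have k5 : 0 <= ka * e ^+ 2 by rewrite mulr_ge0 // sqr_ge0.
by clear -k1 k2 k5; lra.
Qed.

(* [m a^(m+1) - (m+1) b a^m + b^(m+1) = (a - b)^2 sum_j (j+1) a^j b^(m-1-j)] *)
Lemma power_convex (R : realType) (a b : R) (m : nat) : 0 <= a -> 0 < b -> a <= 2 * b ->
  b ^+ m * (a - b) ^+ 2 <= m.+1%:R * a ^+ m.+2 - m.+2%:R * b * a ^+ m.+1 + b ^+ m.+2 /\
  (a ^+ m.+1 - b ^+ m.+1) ^+ 2 <= 4 ^+ m.+1 * b ^+ (2 * m) * (a - b) ^+ 2.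
Proof.
move=> a0 b0 ab; split.
  elim: m => [|m IH]; first by rewrite expr0 !expr1; nra.
  have k1 := ler_wpM2l (ltW b0) IH; have am : 0 <= a ^+ m.+1 by exact: exprn_ge0.
  have k2 : 0 <= m.+2%:R * a ^+ m.+1 * (a - b) ^+ 2 by rewrite mulr_ge0 ?sqr_ge0 // mulr_ge0.
  rewrite mulrA -exprS in k1; apply: le_trans k1 _.
  rewrite -subr_ge0; have -> // : m.+2%:R * a ^+ m.+3 - m.+3%:R * b * a ^+ m.+2 + b ^+ m.+3 -
     b * (m.+1%:R * a ^+ m.+2 - m.+2%:R * b * a ^+ m.+1 + b ^+ m.+2) = m.+2%:R * a ^+ m.+1 * (a - b) ^+ 2.
  by rewrite !(exprS _ m.+2) !(exprS _ m.+1) -!natr1; ring.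
have ab1 : `|a - b| ^+ 2 = (a - b) ^+ 2 by rewrite real_normK ?num_real.
have H : `|a ^+ m.+1 - b ^+ m.+1| <= (2 ^+ m.+1 - 1) * b ^+ m * `|a - b|.
  elim: m => [|m IH]; first by rewrite !expr1 expr0 mulr1; lra.
  have -> : a ^+ m.+2 - b ^+ m.+2 = a * (a ^+ m.+1 - b ^+ m.+1) + b ^+ m.+1 * (a - b) by rewrite !(exprS _ m.+1); ring.
  apply: le_trans (ler_normD _ _) _; rewrite !normrM (ger0_norm a0) (ger0_norm (exprn_ge0 _ (ltW b0))).
  have k1 : a * `|a ^+ m.+1 - b ^+ m.+1| <= 2 * b * ((2 ^+ m.+1 - 1) * b ^+ m * `|a - b|) by apply: ler_pM.
  have -> : (2 ^+ m.+2 - 1) * b ^+ m.+1 * `|a - b| = 2 * b * ((2 ^+ m.+1 - 1) * b ^+ m * `|a - b|) + b ^+ m.+1 * `|a - b|.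
    by rewrite (exprS 2) (exprS b); ring.
  by rewrite lerD2r.
rewrite -(real_normK (num_real (a ^+ m.+1 - _))) -ab1.
have k1 : 0 <= (2 ^+ m.+1 - 1) * b ^+ m * `|a - b|.
  by rewrite mulr_ge0 // mulr_ge0 ?exprn_ge0 ?(ltW b0) // subr_ge0 exprn_ege1 // ler1n.
have k2 : `|a ^+ m.+1 - b ^+ m.+1| <= 2 ^+ m.+1 * b ^+ m * `|a - b|.
  by apply: le_trans H _; rewrite ler_wpM2r // ler_wpM2r ?exprn_ge0 ?(ltW b0) // gerBl.
apply: (@le_trans _ _ ((2 ^+ m.+1 * b ^+ m * `|a - b|) ^+ 2)).
  by rewrite lerXn2r // nnegrE ?mulr_ge0 ?exprn_ge0 // ltW.
rewrite !exprMn ler_wpM2r ?sqr_ge0 // -!exprM [(m * 2)%N]mulnC ler_wpM2r ?exprn_ge0 ?(ltW b0) //.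
by rewrite mulnC exprM -[2 ^+ 2]/(2 * 2) -natrM.
Qed.

(** The exponent is the inverse of an integer so that inequalities about [t * rt m t] become
    polynomial in the root; a large [m] makes the exponent as small as desired. *)
Definition rt (R : realType) (m : nat) (t : R) : R := t `^ (m.+2%:R)^-1.

Lemma rt_gt0 (R : realType) (m : nat) (t : R) : 0 < t -> 0 < rt m t.
Proof. by move=> t0; exact: powR_gt0. Qed.

Lemma rt_ge0 (R : realType) (m : nat) (t : R) : 0 <= rt m t.
Proof. exact: powR_ge0. Qed.

Lemma rtK (R : realType) (m : nat) (t : R) : 0 <= t -> rt m t ^+ m.+2 = t.
Proof.
by move=> t0; rewrite -powR_mulrn ?powR_ge0 // -powRrM mulVf ?pnatr_eq0 // powRr1.
Qed.

Lemma rt_le (R : realType) (m : nat) (t e : R) : 0 <= t -> 0 <= e -> t <= e ^+ m.+2 -> rt m t <= e.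
Proof.
by move=> t0 e0 te; rewrite -(@ler_pXn2r _ m.+2) ?nnegrE ?rt_ge0 // rtK.
Qed.

Lemma rt_dist (R : realType) (m : nat) (t t0 : R) : 0 <= t -> 0 < t0 ->
  rt m t0 ^+ m.+1 * `|rt m t - rt m t0| <= `|t - t0|.
Proof.
move=> t1 t00.
suff key (a b : R) : 0 <= a -> 0 < b -> b ^+ m.+1 * `|a - b| <= `|a ^+ m.+2 - b ^+ m.+2|.
  by have := key _ _ (rt_ge0 m t) (rt_gt0 m t00); rewrite !rtK ?(ltW t00).
move=> a0 b0.
have [ab|ab] := lerP b a.
  rewrite !ger0_norm ?subr_ge0 // ?lerXn2r ?nnegrE ?(ltW b0) //.
  have : a * b ^+ m.+1 <= a * a ^+ m.+1 by rewrite ler_wpM2l // lerXn2r ?nnegrE ?(ltW b0).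
  by rewrite (exprS a m.+1) (exprS b m.+1); lra.
have k : a ^+ m.+1 <= b ^+ m.+1 by rewrite lerXn2r ?nnegrE ?(ltW b0) // ltW.
have k2 : a * a ^+ m.+1 <= a * b ^+ m.+1 by rewrite ler_wpM2l.
have k3 : a * b ^+ m.+1 <= b * b ^+ m.+1 by rewrite ler_wpM2r ?exprn_ge0 ?(ltW b0) // ltW.
have k4 := ler_norm (- (a ^+ m.+2 - b ^+ m.+2)); rewrite normrN in k4.
apply: le_trans k4; rewrite (exprS a m.+1) (exprS b m.+1); lra.
Qed.

Lemma cont_rt_comp (R : realType) (n m : nat) (d : 'rV[R]_n -> R) (x : 'rV[R]_n) :
  {for x, continuous d} -> 0 < d x -> {for x, continuous (fun y => rt m (d y))}.
Proof.
move=> dc dx; apply/contP_eps => e e0; have B0 : 0 < rt m (d x) ^+ m.+1 by rewrite exprn_gt0 // rt_gt0.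
have [r r0 Hr] := cont_pos_near dc dx.
have /contP_eps/(_ (e * rt m (d x) ^+ m.+1))[|r' r'0 Hr'] := dc; first by rewrite mulr_gt0.
exists (Num.min r r'); first by rewrite lt_min r0.
move=> y; rewrite lt_min => /andP[/Hr k1 /Hr' k2].
have dy : 0 <= d y by lra.
by rewrite -(ltr_pM2l B0); apply: le_lt_trans (rt_dist m dy dx) _; rewrite mulrC.
Qed.

(** In terms of the roots of [t] and [t0] this is [power_convex]: [t * rt m t] is uniformly convex
    at scale [t0]. Consequently a concave parabola touches the profile [t * (1 - rt m t)] from above
    at [t0]. *)
Lemma barrier1d (R : realType) (m : nat) : exists2 ka : R, 0 < ka & ka <= 1 /\ forall t0 t : R, 0 < t0 -> 0 <= t -> t <= 2 * t0 ->
  t0 * rt m t0 + (1 + (m.+2%:R)^-1) * rt m t0 * (t - t0) + ka * (rt m t0 / t0) * (t - t0) ^+ 2 <= t * rt m t.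
Proof.
have M0 : 0 < m.+2%:R :> R by rewrite ltr0n.
have F0 : 0 < 4 ^+ m.+2 :> R by rewrite exprn_gt0.
exists (m.+2%:R * 4 ^+ m.+2)^-1; first by rewrite invr_gt0 (mulr_gt0 M0 F0).
split.
  have F1 : 1 <= 4 ^+ m.+2 :> R by rewrite exprn_ege1 // ler1n.
  have M1 : 1 <= m.+2%:R :> R by rewrite ler1n.
  by rewrite (invf_le1 (mulr_gt0 M0 F0)); apply: le_trans M1 _; rewrite ler_peMr // ltW.
move=> t0 t t00 t1 t2; set b := rt m t0; set a := rt m t.
have b0 : 0 < b by exact: rt_gt0.
have a0 : 0 <= a by exact: rt_ge0.
have tE : t = a ^+ m.+2 by rewrite rtK.
have t0E : t0 = b ^+ m.+2 by rewrite rtK // ltW.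
have ab : a <= 2 * b.
  rewrite -(@ler_pXn2r _ m.+2) ?nnegrE ?mulr_ge0 ?(ltW b0) // -tE exprMn -t0E; apply: le_trans t2 _.
  rewrite ler_pM2r // (exprS 2) ler_peMr // exprn_ege1 // ler1n //.
have [k1 k2] := power_convex m.+1 a0 b0 ab.
have k3 : (m.+2%:R * 4 ^+ m.+2)^-1 * (b / t0) * (t - t0) ^+ 2 <= (m.+2%:R)^-1 * (b ^+ m.+1 * (a - b) ^+ 2).
  have k4 : (m.+2%:R * 4 ^+ m.+2)^-1 * (b / t0) * (t - t0) ^+ 2 <=
    (m.+2%:R * 4 ^+ m.+2)^-1 * (b / t0) * (4 ^+ m.+2 * b ^+ (2 * m.+1) * (a - b) ^+ 2).
    rewrite -tE -t0E in k2; apply: ler_wpM2l k2; apply: mulr_ge0; last by rewrite divr_ge0 // ltW.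
    by rewrite invr_ge0 ltW // (mulr_gt0 M0 F0).
  apply: le_trans k4 _; rewrite le_eqVlt; apply/orP; left; apply/eqP.
  have aux (F M B X : R) : 0 < F -> 0 < M -> 0 < B ->
    (M * F)^-1 * (b / (b * B)) * (F * B ^+ 2 * X) = M^-1 * (B * X).
    by move=> *; field; rewrite !gt_eqF.
  rewrite t0E (exprS b m.+1) mulnC exprM; apply: aux => //; exact: exprn_gt0.
apply: (@le_trans _ _ (t0 * b + (1 + (m.+2%:R)^-1) * b * (t - t0) + (m.+2%:R)^-1 * (b ^+ m.+1 * (a - b) ^+ 2))).
  by rewrite lerD2l.
have k5 : (m.+2%:R)^-1 * (b ^+ m.+1 * (a - b) ^+ 2) <=
   (m.+2%:R)^-1 * (m.+2%:R * a ^+ m.+3 - m.+3%:R * b * a ^+ m.+2 + b ^+ m.+3) by rewrite ler_pM2l // invr_gt0.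
have k6 : (m.+2%:R)^-1 * (m.+2%:R * a ^+ m.+3 - m.+3%:R * b * a ^+ m.+2 + b ^+ m.+3) =
   t * a - (1 + (m.+2%:R)^-1) * b * t + (m.+2%:R)^-1 * (t0 * b).
  have aux (M : R) : 0 < M -> M^-1 * (M * (a * t) - (M + 1) * b * t + b * t0) =
    t * a - (1 + M^-1) * b * t + M^-1 * (t0 * b) by move=> M1; field; rewrite gt_eqF.
  by rewrite (exprS a m.+2) (exprS b m.+2) -tE -t0E (_ : m.+3%:R = m.+2%:R + 1) ?aux // -natr1.
have aux (Y I : R) : Y <= t * a - (1 + I) * b * t + I * (t0 * b) ->
  t0 * b + (1 + I) * b * (t - t0) + Y <= t * a by clear; lra.
by rewrite k6 in k5; exact: aux k5.
Qed.

(* The local barrier: [w - tau theta(d) - nu |x - x0|^2 + nu r^2] with [theta] a strictly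
   concave parabola is a subsolution near [x0]. *)
Lemma barrier_Psub (R : realType) (n : nat) (Om : set 'rV[R]_n) (d : 'rV[R]_n -> R) (G : 'rV[R]_n -> 'rV[R]_n)
    (L c s0 ga Ga d1 : R) (g w : 'rV[R]_n -> R) (x0 : 'rV[R]_n) (r e0 tau nu mu kap t0 b1 b0 : R) :
  regdom Om d G L c s0 -> (0 < n)%N -> 0 < ga -> ga <= Ga -> 0 <= d1 ->
  Psub ga Ga d1 [set x | Om x /\ 0 < w x] g w ->
  0 < tau -> 0 < nu -> 0 < kap -> r <= 1 -> 0 <= r ->
  (forall x : 'rV[R]_n, `|x - x0| < r -> Om x /\ `|b1 - 2 * kap * (d x - t0)| <= 2) ->
  (forall x : 'rV[R]_n, `|x - x0| < r ->
     0 < w x - e0 - tau * (b0 + b1 * (d x - t0) - kap * (d x - t0) ^+ 2) - nu * sq (x - x0) + mu -> 0 < w x /\ d x < s0) ->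
  2 * nu * (n%:R * Ga + d1) <= tau * kap * ga * c ->
  2 * (2 * L + 1) * (n%:R * Ga) + 2 * L * d1 <= kap * ga * c ->
  Psub ga Ga d1 [set x | `|x - x0| < r /\
     0 < w x - e0 - tau * (b0 + b1 * (d x - t0) - kap * (d x - t0) ^+ 2) - nu * sq (x - x0) + mu] g
    (fun x => w x - e0 - tau * (b0 + b1 * (d x - t0) - kap * (d x - t0) ^+ 2) - nu * sq (x - x0) + mu).
Proof.
move=> [OE dc [L0 [c0 s00]] dH dG] n0 ga0 gG d10 Ps tau0 nu0 kap0 r1 r0 Hin Hpos Hnu Hkap x p M cc [xr Wx] sM J Hc.
have Ga0 : 0 < Ga by exact: lt_le_trans gG.
have [Ox mx] := Hin x xr; have [wx dx] := Hpos x xr Wx.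
have Gx := dG x Ox dx.
set m := b1 - 2 * kap * (d x - t0) in mx.
pose be y := tau * (b0 + b1 * (d y - t0) - kap * (d y - t0) ^+ 2) + nu * sq (y - x0) + e0 - mu.
have J' : ujet (fun y => w y - be y) x p M.
  have -> // : (fun y => w y - be y) = (fun x => w x - e0 - tau * (b0 + b1 * (d x - t0) - kap * (d x - t0) ^+ 2) - nu * sq (x - x0) + mu).
  by apply/funext => y; rewrite /be; ring.
have dd h : `|h| <= 1 -> `|d (x + h) - d x - dot (G x) h| <= L * sq h by move=> h1; have [] := dH x h Ox h1.
have [e ee He] := @comp_upper R n d x (G x) L m kap (ltW L0) (ltW kap0) dd.
pose B : 'M[R]_n := (2 * tau * (2 * L + 1) + 2 * nu)%:M - (2 * tau * kap) *: outer (G x).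
pose q := (tau * m) *: G x + (2 * nu) *: (x - x0).
have sB : Defs.symmetric B by apply: symB; [exact: sym_scalar | apply: symZ; exact: outer_sym].
have Jw : ujet w x (p + q) (M + B).
  apply: (ujet_upper J'); exists e => // h /He k1.
  have k2 : (`|m| * L + 1) * sq h <= (2 * L + 1) * sq h by rewrite ler_wpM2r ?sq_ge0 // lerD2r ler_pM2r.
  have hx : x + h - x0 = (x - x0) + h by rewrite addrAC.
  rewrite /be hx (sqD (x - x0) h) /q /B qfBm qf_scalar qfZm qf_outer (dotDl (_ *: G x)) !dotZl.
  have k3 : tau * (m * (d (x + h) - d x) - kap * (d (x + h) - d x) ^+ 2) <=
    tau * (m * dot (G x) h + (2 * L + 1) * sq h - kap * dot (G x) h ^+ 2).
    by rewrite ler_pM2l //; clear -k1 k2; lra.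
  have k4 : tau * (b0 + b1 * (d (x + h) - t0) - kap * (d (x + h) - t0) ^+ 2) =
     tau * (b0 + b1 * (d x - t0) - kap * (d x - t0) ^+ 2) + tau * (m * (d (x + h) - d x) - kap * (d (x + h) - d x) ^+ 2).
    by rewrite /m; ring.
  rewrite k4; clear -k3; lra.
have sMB : Defs.symmetric (M + B) by exact: symD.
pose c' := cc - (2 * tau * (2 * L + 1) + 2 * nu) * (n%:R * Ga) + 2 * tau * kap * (ga * sq (G x)).
have Hc' A : ell ga Ga A -> c' <= - \tr (A *m (M + B)).
  move=> hA; have k1 := Hc A hA; have [sA qA] := hA; have /andP[_ k2] := ell_scalar_tr (ltW Ga0) hA.
  have /andP[k3 _] := qA (G x).
  have -> : \tr (A *m (M + B)) = \tr (A *m M) + (2 * tau * (2 * L + 1) + 2 * nu) * \tr A - 2 * tau * kap * qf A (G x).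
    by rewrite /B !mulmxDr mulmxN mul_mx_scalar -scalemxAr !mxtraceD raddfN /= !mxtraceZ tr_mul_outer addrA.
  have k4 : (2 * tau * (2 * L + 1) + 2 * nu) * \tr A <= (2 * tau * (2 * L + 1) + 2 * nu) * (n%:R * Ga).
    by apply: ler_wpM2l => //; apply: addr_ge0; rewrite !mulr_ge0 ?addr_ge0 ?mulr_ge0 ?(ltW tau0) ?(ltW nu0) ?(ltW L0).
  have k5 : 2 * tau * kap * (ga * sq (G x)) <= 2 * tau * kap * qf A (G x).
    by rewrite ler_pM2l // !mulr_gt0.
  rewrite /c'; clear -k1 k4 k5; lra.
have := Ps x (p + q) (M + B) c' _ sMB Jw Hc'.
move=> /(_ (conj Ox wx)) k1.
have GL : `|G x| <= L by have [] := dH x 0 Ox _; rewrite ?normr0.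
have pq : `|p + q| <= `|p| + (2 * tau * L + 2 * nu).
  apply: le_trans (ler_normD _ _) _; rewrite lerD2l; apply: le_trans (ler_normD _ _) _.
  rewrite (normrZ _ (G x)) (normrZ _ (x - x0)) normrM (gtr0_norm tau0) (gtr0_norm (mulr_gt0 _ nu0)) //.
  have a1 : `|m| * `|G x| <= 2 * L by apply: ler_pM.
  have a2 : tau * (`|m| * `|G x|) <= tau * (2 * L) by rewrite ler_pM2l.
  have a3 : 2 * nu * `|x - x0| <= 2 * nu * 1.
    by rewrite ler_pM2l ?mulr_gt0 //; apply: le_trans (ltW xr) r1.
  clear -a2 a3; lra.
have k2 : d1 * `|p + q| <= d1 * (`|p| + (2 * tau * L + 2 * nu)) by rewrite ler_wpM2l.
have k3 : 2 * tau * kap * (ga * c) <= 2 * tau * kap * (ga * sq (G x)).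
  by rewrite ler_pM2l ?mulr_gt0 // ler_pM2l.
have k4 := ler_wpM2l (ltW tau0) Hkap.
rewrite /c' in k1; clear -k1 k2 k3 k4 Hnu; lra.
Qed.

Lemma scale_int (R : realType) (n : nat) (p J r : R) : 0 < p -> 0 < J -> 0 < r ->
  (J * (2 * r) `^ (- (n%:R / p))) `^ p * (2 * r) ^+ n = J `^ p.
Proof.
move=> p0 J0 r0; have r20 : 0 < 2 * r by rewrite mulr_gt0.
rewrite powRM ?powR_ge0 ?(ltW J0) // -powRrM mulNr divfK ?gt_eqF // -mulrA -powR_mulrn ?(ltW r20) //.
by rewrite -powRD ?addNr ?powRr0 ?mulr1 // (gt_eqF r20) implybT.
Qed.

(** The total power of [t] is [1 - 1/(m+2) - n/p], nonnegative by hypothesis. This is how [p > n]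
    leads to a bound linear in the depth. *)
Lemma scale_rt (R : realType) (n m : nat) (p t c : R) : 0 < p -> 0 < c -> 0 < t -> t <= 1 ->
  (m.+2%:R)^-1 + n%:R / p <= 1 ->
  t / rt m t * (2 * (t * c)) `^ (- (n%:R / p)) <= (2 * c) `^ (- (n%:R / p)).
Proof.
move=> p0 c0 t0 t1 H; have -> : 2 * (t * c) = t * (2 * c) by ring.
rewrite powRM ?mulr_ge0 ?(ltW t0) ?(ltW c0) // mulrA ler_piMl ?powR_ge0 //.
have -> : t / rt m t = t `^ (1 - (m.+2%:R)^-1).
  rewrite /rt -powRN -{1}(powRr1 (ltW t0)) -powRD //; by rewrite (gt_eqF t0) implybT.
rewrite -powRD; last by rewrite (gt_eqF t0) implybT.
apply: (@le_trans _ _ (1 `^ (1 - m.+2%:R^-1 - n%:R / p))); last by rewrite powR1.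
by apply: ge0_ler_powR; rewrite ?nnegrE ?(ltW t0) // -addrA -opprD subr_ge0.
Qed.

Lemma compact_shell (R : realType) (n : nat) (d : 'rV[R]_n -> R) (B a b : R) : 0 < B ->
  (forall x, {for x, continuous d}) -> (forall x, a <= d x -> `|x| <= B) ->
  compact [set x | a <= d x /\ d x <= b].
Proof.
move=> B0 dc HB; apply: (@subclosed_compact _ _ [set x : 'rV[R]_n | `|x - 0| <= B]).
- apply: closedP_eps => x nx.
  have [hx|hx] := ltP (d x) a.
    have [e e0 He] := cont_lt_near (dc x) hx; exists e => // y /He k [k2 _].
    by move: k; rewrite ltNge k2.
  have [hx2|hx2] := ltP b (d x).
    have [e e0 He] := @cont_lt_near R n (fun y => - d y) (- b) x (continuousN (dc x)) ltac:(by rewrite /= ltrN2).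
    by exists e => // y /He; rewrite ltrN2 => k [_ k2]; move: k; rewrite ltNge k2.
  by case: nx.
- exact: compact_cube.
- by move=> x [h _]; rewrite /= subr0; exact: HB.
Qed.

(** Let [tau] be the largest ratio of [w] to the profile [d * (1 - rt m d)], attained at depth [t0].
    On a cube of size comparable to [t0], subtract from [w] the parabola above the profile and
    [nu * sq (x - x0)], and add [nu * r ^+ 2]: the result is a subsolution, nonpositive on the
    faces. The estimate [abp] at the centre bounds [nu], and [nu] is proportional to [tau * kap]. *)
Lemma boundary_bound (R : realType) (n : nat) (Om : set 'rV[R]_n) (d : 'rV[R]_n -> R) (G : 'rV[R]_n -> 'rV[R]_n)
    (L c s0 ga Ga d1 p J : R) (f : 'rV[R]_n -> R) :
  regdom Om d G L c s0 -> bounded_set Om -> (0 < n)%N -> 0 < ga -> ga <= Ga -> 0 <= d1 -> n%:R < p ->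
  (forall x, Om x -> {for x, continuous f}) -> (forall x, Om x -> 0 <= f x) -> 0 < J ->
  (lebint_n (fun x => ((\1_Om x) * (`|f x| `^ p))%:E) <= (J `^ p)%:E)%E ->
  exists C s1 : R, [/\ 0 < C, 0 < s1 & forall (s C0 a : R) (w : 'rV[R]_n -> R), 0 < s -> s <= s1 ->
    (forall x, Om x -> {for x, continuous w}) ->
    (forall e : R, 0 < e -> exists2 de : R, 0 < de & forall x, Om x -> d x < de -> w x < e) ->
    (forall x, s <= d x -> w x <= 0) ->
    Psub ga Ga d1 [set x | Om x /\ 0 < w x] (fun x => C0 + a * f x) w -> 0 < C0 -> 0 <= a ->
    forall x, Om x -> w x <= C * (C0 + a * J) * d x].
Proof.
move=> rd bO n0 ga0 gG d10 np fc f0 J0 Hint.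
have [OE dc [L0 [c0 s00]] dH dG] := rd.
have [_ [B B0 HB]] := compact_closure bO.
have np0 : 0 < n%:R :> R by rewrite ltr0n.
have p0 : 0 < p by exact: lt_trans np.
have Ga0 : 0 < Ga by exact: lt_le_trans gG.
have nG0 : 0 < n%:R * Ga by rewrite mulr_gt0.
have npp : n%:R / p < 1 by rewrite ltr_pdivrMr // mul1r.
have [m Hm] : exists m : nat, (m.+2%:R)^-1 + n%:R / p <= 1.
  have g0 : 0 < 1 - n%:R / p by rewrite subr_gt0.
  exists (Num.truncn (1 - n%:R / p)^-1); have h0 : 0 <= (1 - n%:R / p)^-1 by rewrite invr_ge0 ltW.
  have := lt_truncn1 h0; set N := Num.truncn _ => k.
  have k2 : (1 - n%:R / p)^-1 <= N.+2%:R by apply: ltW; apply: lt_trans k _; rewrite ltr_nat.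
  by rewrite -lerBrDr -[leRHS]invrK lef_pV2 ?posrE ?invr_gt0 ?ltr0n.
have [CA [R0 [CA0 R00 Habp]]] := abp n0 ga0 gG d10 np.
have [ka ka0 [ka1 Hka]] := barrier1d R m.
have [iv ivE] : {x : R | x = (m.+2%:R)^-1} by eexists.
have iv1 : 0 < iv <= 1 by rewrite ivE invr_gt0 ltr0n /= invf_le1 ?ltr0n // ler1n.
rewrite -ivE in Hka.
have [co coE] : {x | x = Num.min 1 (2 * L)^-1} by eexists.
have co0 : 0 < co by rewrite coE lt_min ltr01 invr_gt0 mulr_gt0.
have [co1 coL] : co <= 1 /\ co * L <= 1 / 2.
  rewrite coE ge_min lexx; split=> //.
  have : Num.min 1 (2 * L)^-1 * L <= (2 * L)^-1 * L by rewrite ler_pM2r // ge_min lexx orbT.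
  by have -> : (2 * L)^-1 * L = 1 / 2 by field; rewrite gt_eqF.
have [c1 c1E] : {x | x = ga * c / (2 * (n%:R * Ga + d1) + 1)} by eexists.
have den0 : 0 < 2 * (n%:R * Ga + d1) + 1 by (clear -nG0 d10; lra).
have c10 : 0 < c1 by rewrite c1E divr_gt0 // mulr_gt0.
have c1H : 2 * c1 * (n%:R * Ga + d1) <= ga * c.
  have : c1 * (2 * (n%:R * Ga + d1) + 1) = ga * c by rewrite c1E divfK // gt_eqF.
  by clear -c10; lra.
have [A0 A0E] : {x | x = 2 * (2 * L + 1) * (n%:R * Ga) + 2 * L * d1} by eexists.
have A00 : 0 <= A0 by rewrite A0E addr_ge0 ?mulr_ge0 ?addr_ge0 ?mulr_ge0 ?(ltW L0) ?(ltW nG0) // ltW.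
have kgc : 0 < ka * ga * c by rewrite !mulr_gt0.
(* [e] bounds the root [rt m] in the strip. Its smallness makes the profile comparable to [d], lets
   the concavity [kap] beat the curvature and first-order terms, and keeps [nu * r ^+ 2] below the
   profile. *)
have [e eE] : {x | x = Num.min (8%:R)^-1 (Num.min (ka * ga * c / (A0 + 1)) (4 * (c1 + 1))^-1)} by eexists.
have e0 : 0 < e by rewrite eE !lt_min invr_gt0 ltr0n divr_gt0 ?ltr_wpDl // invr_gt0 mulr_gt0 // addr_gt0.
have [e8 [eA ec1]] : e <= 8%:R^-1 /\ e <= ka * ga * c / (A0 + 1) /\ e <= (4 * (c1 + 1))^-1.
  by rewrite eE !ge_min !lexx ?orbT.
have eA' : e * A0 <= ka * ga * c.
  have : e * (A0 + 1) <= ka * ga * c by rewrite -ler_pdivlMr // ltr_wpDl.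
  by clear -e0; lra.
have ec1' : c1 * e <= 1 / 4.
  have : e * (4 * (c1 + 1)) <= 1 by rewrite -ler_pdivlMr ?div1r // mulr_gt0 // addr_gt0.
  by clear -e0; lra.
have [s1 s1E] : {x | x = Num.min (Num.min (e ^+ m.+2 / 2) R0) (Num.min (1 / 2) s0)} by eexists.
have em0 : 0 < e ^+ m.+2 by rewrite exprn_gt0.
have s10 : 0 < s1 by rewrite s1E !lt_min R00 s00 !divr_gt0.
have [s1e [s1R [s11 s1s]]] : s1 <= e ^+ m.+2 / 2 /\ s1 <= R0 /\ s1 <= 1 / 2 /\ s1 <= s0.
  by rewrite s1E !ge_min !lexx ?orbT.
have C20 : 0 <= (2 * co) `^ (- (n%:R / p)) by exact: powR_ge0.
have CC0 : 0 < CA / (ka * c1) * (1 + (2 * co) `^ (- (n%:R / p))).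
  by apply: mulr_gt0; [rewrite divr_gt0 // mulr_gt0 | rewrite ltr_wpDr].
exists (CA / (ka * c1) * (1 + (2 * co) `^ (- (n%:R / p)))), s1; split=> //.
move=> s C0 a w ss0 ss1 wc wb ws Ps C00 a0 xb Oxb.
have aJ : 0 <= a * J by rewrite mulr_ge0 // ltW.
have dxb : 0 < d xb by move: Oxb; rewrite OE.
have RHS0 : 0 <= CA / (ka * c1) * (1 + (2 * co) `^ (- (n%:R / p))) * (C0 + a * J) * d xb.
  by apply: mulr_ge0 (ltW dxb); apply: mulr_ge0 (ltW CC0) _; rewrite addr_ge0 // ltW.
(* Lowering [w] by [ep] makes it negative near the boundary, so the ratio to the profile attains its
   maximum on a compact shell. *)
apply/ler_addgt0Pr => ep ep0.
have [wxe|wxe] := lerP (w xb) ep; first by apply: le_trans wxe _; rewrite lerDr.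
have [de de0 Hde] := wb _ ep0.
have dexb : de <= d xb by rewrite leNgt; apply/negP => /(Hde _ Oxb) k; have := lt_trans k wxe; rewrite ltxx.
have dsxb : d xb <= s by rewrite leNgt; apply/negP => /ltW /ws k; have := lt_le_trans wxe k; rewrite ltNge (ltW ep0).
have OmP x : 0 < d x -> Om x by rewrite OE.
have rte t : 0 <= t -> t <= 2 * s1 -> rt m t <= e by move=> t0 t2; apply: rt_le => //; [exact: ltW | (clear -t2 s1e; lra)].
have bpos t : 0 < t -> t <= 2 * s1 -> t * (1 / 2) <= t * (1 - rt m t).
  move=> t0 t2; rewrite ler_pM2l //; have := rte t (ltW t0) t2; (clear -e8; lra).
have cK : compact [set x | de <= d x /\ d x <= s].
  by apply: (@compact_shell R n d B) => // x k; apply: HB; apply: OmP; exact: lt_le_trans k.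
have [||x0 [t1 t2] Hx0] := @evt_max R n (fun y => (w y - ep) / (d y * (1 - rt m (d y)))) _ _ cK.
- by exists xb.
- move=> x [h1 h2]; have dx : 0 < d x by exact: lt_le_trans h1.
  apply: continuousM; first by apply: continuousB; [apply: wc; exact: OmP | exact: cst_continuous].
  apply: continuousV; last first.
    apply: continuousM; first exact: dc.
    by apply: continuousB; [exact: cst_continuous | exact: cont_rt_comp].
  by rewrite gt_eqF //; apply: lt_le_trans (bpos _ dx _); [rewrite mulr_gt0 ?divr_gt0 | (clear -dx h2 ss1; lra)].
have [tau tauE] : {x | x = (w x0 - ep) / (d x0 * (1 - rt m (d x0)))} by eexists.
rewrite -tauE in Hx0; have [t0 t0E] : {x | x = d x0} by eexists.
rewrite -t0E in t1 t2 tauE; have t00 : 0 < t0 by exact: lt_le_trans t1.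
have bd t : 0 < t -> t <= 2 * s1 -> 0 < t * (1 - rt m t).
  by move=> k1 k2; apply: lt_le_trans (bpos t k1 k2); rewrite mulr_gt0 // divr_gt0.
have tau0 : 0 < tau.
  apply: lt_le_trans (Hx0 xb (conj dexb dsxb)); rewrite divr_gt0 ?subr_gt0 // bd //; (clear -dsxb dexb de0 ss1; lra).
have Hw x : Om x -> d x <= s -> w x - ep <= tau * (d x * (1 - rt m (d x))).
  move=> Ox dxs; have dx : 0 < d x by move: Ox; rewrite OE.
  have bdx : 0 < d x * (1 - rt m (d x)) by apply: bd => //; (clear -dx dxs ss1; lra).
  have [h|h] := ltP (d x) de.
    have := Hde x Ox h; have : 0 < tau * (d x * (1 - rt m (d x))) by rewrite mulr_gt0.
    (clear; lra).
  by rewrite -ler_pdivrMr //; apply: Hx0.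
have wx0 : w x0 - ep = tau * (t0 * (1 - rt m t0)) by rewrite tauE divfK // gt_eqF // bd //; (clear -t2 ss1 ss0; lra).
have [r rE] : {x | x = t0 * co} by eexists.
have r0 : 0 < r by rewrite rE mulr_gt0.
have rt1 : r <= t0 by rewrite rE ler_piMr // ltW.
have rt0 : 0 < rt m t0 by exact: rt_gt0.
have rt0e : rt m t0 <= e by apply: rte; [exact: ltW | clear -t2 ss1 s10; lra].
have [kap kapE] : {x | x = ka * (rt m t0 / t0)} by eexists.
have kap0 : 0 < kap by rewrite kapE mulr_gt0 // divr_gt0.
have [nu nuE] : {x | x = tau * kap * c1} by eexists.
have nu0 : 0 < nu by rewrite nuE !mulr_gt0.
have [b1 b1E] : {x | x = 1 - (1 + iv) * rt m t0} by eexists.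
have cube x : `|x - x0| <= r -> [/\ Om x, t0 / 2 <= d x & d x <= 3 / 2 * t0].
  move=> xr; have h1 : `|x - x0| <= 1 by (clear -xr rt1 t2 ss1 s11; lra).
  have Ox0 : Om x0 by apply: OmP; rewrite -t0E.
  have [k1 _ _] := dH x0 (x - x0) Ox0 h1; have xE : x0 + (x - x0) = x by rewrite addrC subrK.
  rewrite xE -t0E in k1.
  have k2 : L * `|x - x0| <= L * r by rewrite ler_pM2l.
  have k3 : L * r <= t0 / 2.
    have -> : L * r = t0 * (co * L) by rewrite rE; ring.
    by have := ler_wpM2l (ltW t00) coL; (clear; lra).
  move: k1; rewrite ler_norml => /andP[k1 k4].
  have dx : t0 / 2 <= d x by clear -k1 k2 k3; lra.
  by split=> //; [apply: OmP; clear -dx t00; lra | clear -k4 k2 k3; lra].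
pose th t := t0 * (1 - rt m t0) + b1 * (t - t0) - kap * (t - t0) ^+ 2.
have thb t : 0 <= t -> t <= 2 * t0 -> t * (1 - rt m t) <= th t.
  move=> k1 k2; have := Hka t0 t t00 k1 k2; rewrite /th b1E kapE; clear; lra.
have thw x : `|x - x0| <= r -> w x - ep <= tau * th (d x) /\ t0 / 4 <= th (d x).
  move=> /cube[Ox k1 k2].
  have k3 : d x * (1 - rt m (d x)) <= th (d x) by apply: thb; [clear -k1 t00 | clear -k2 t00]; lra.
  have k4 : d x * (1 / 2) <= d x * (1 - rt m (d x)) by apply: bpos; [clear -k1 t00 | clear -k2 t2 ss1 s10]; lra.
  have k5 : t0 / 4 <= th (d x) by clear -k1 k3 k4; lra.
  split=> //; have [k6|k6] := lerP (d x) s.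
    by apply: le_trans (Hw x Ox k6) _; rewrite ler_pM2l.
  have := ws x (ltW k6); have : 0 <= tau * th (d x) by rewrite mulr_ge0 ?(ltW tau0) //; clear -k5 t00; lra.
  clear -ep0; lra.
have rn x : `|x - x0| < r -> `|x - x0| <= r by exact: ltW.
have mu4 : nu * r ^+ 2 <= tau * (t0 / 4).
  have -> : nu * r ^+ 2 = tau * (t0 * (ka * (co ^+ 2 * (c1 * rt m t0)))) by rewrite nuE kapE rE; field; rewrite gt_eqF.
  rewrite ler_pM2l // ler_pM2l //.
  have k1 : c1 * rt m t0 <= 1 / 4 by apply: le_trans ec1'; rewrite ler_pM2l.
  have k2 : 0 <= c1 * rt m t0 by rewrite mulr_ge0 // ltW.
  have k3 : co ^+ 2 * (c1 * rt m t0) <= 1 / 4 by apply: le_trans k1; rewrite ler_piMl // expr_le1 // ltW.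
  have k4 : ka * (co ^+ 2 * (c1 * rt m t0)) <= co ^+ 2 * (c1 * rt m t0) by rewrite ler_piMl // mulr_ge0 // sqr_ge0.
  clear -k3 k4; lra.
have Hpos x : `|x - x0| < r -> 0 < w x - ep - tau * (t0 * (1 - rt m t0) + b1 * (d x - t0) - kap * (d x - t0) ^+ 2)
     - nu * sq (x - x0) + nu * r ^+ 2 -> 0 < w x /\ d x < s0.
  move=> xr; rewrite -/(th (d x)) => Wx; have [_ k1] := thw x (rn x xr).
  have k2 : tau * (t0 / 4) <= tau * th (d x) by rewrite ler_pM2l.
  have k3 : 0 <= nu * sq (x - x0) by rewrite mulr_ge0 ?sq_ge0 // ltW.
  have wx : 0 < w x by clear -Wx k2 k3 mu4 ep0; lra.
  split=> //; rewrite ltNge; apply/negP => k4; have k5 : s <= d x by apply: le_trans k4; (clear -ss1 s1s; lra).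
  by have := lt_le_trans wx (ws x k5); rewrite ltxx.
have Hin x : `|x - x0| < r -> Om x /\ `|b1 - 2 * kap * (d x - t0)| <= 2.
  move=> /rn /cube[Ox k1 k2]; split=> //.
  have k3 : kap * (t0 / 2) <= 1 / 2.
    have -> : kap * (t0 / 2) = ka * rt m t0 / 2 by rewrite kapE; field; rewrite gt_eqF.
    have : ka * rt m t0 <= 1 * 1 by apply: ler_pM; rewrite ?(ltW ka0) ?(ltW rt0) //; clear -rt0e e8; lra.
    by move=> k3; clear -k3; lra.
  have k4 : kap * (d x - t0) <= kap * (t0 / 2) by rewrite ler_pM2l //; clear -k2; lra.
  have k5 : - (kap * (t0 / 2)) <= kap * (d x - t0) by rewrite -mulrN ler_pM2l //; clear -k1; lra.
  have k6 : 0 <= iv * rt m t0 <= rt m t0.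
    by case/andP: iv1 => i1 i2; rewrite mulr_ge0 ?(ltW i1) ?(ltW rt0) //= ler_piMl // ltW.
  case/andP: k6 => k6 k7; rewrite ler_norml b1E; clear -k3 k4 k5 k6 k7 rt0 rt0e e8; apply/andP; split; lra.
have Hnu : 2 * nu * (n%:R * Ga + d1) <= tau * kap * ga * c.
  have -> : 2 * nu * (n%:R * Ga + d1) = tau * kap * (2 * c1 * (n%:R * Ga + d1)) by rewrite nuE; ring.
  have -> : tau * kap * ga * c = tau * kap * (ga * c) by ring.
  by rewrite ler_pM2l // mulr_gt0.
have rtt : t0 <= rt m t0 ^+ 2.
  rewrite -{1}(rtK m (ltW t00)) -addn2 exprD ler_piMl ?sqr_ge0 // exprn_ile1 //; first exact: ltW.
  by clear -rt0e e8; lra.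
have Hkap : 2 * (2 * L + 1) * (n%:R * Ga) + 2 * L * d1 <= kap * ga * c.
  rewrite -A0E -(ler_pM2l t00).
  have -> : t0 * (kap * ga * c) = rt m t0 * (ka * ga * c) by rewrite kapE; field; rewrite gt_eqF.
  apply: (@le_trans _ _ (rt m t0 * (e * A0))); last by rewrite ler_pM2l.
  rewrite mulrA ler_wpM2r //; apply: le_trans rtt _; by rewrite expr2 ler_pM2l.
have rr1 : r <= 1 by (clear -rt1 t2 ss1 s11; lra).
have PsW := barrier_Psub (r := r) (e0 := ep) (mu := nu * r ^+ 2) rd n0 ga0 gG d10 Ps tau0 nu0 kap0 rr1 (ltW r0) Hin Hpos Hnu Hkap.
have sc0 : 0 < J * (2 * r) `^ (- (n%:R / p)) by rewrite mulr_gt0 // powR_gt0 // mulr_gt0.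
set W := (fun x => w x - _ - _ - _ + _) in PsW.
have Wc x : `|x - x0| <= r -> {for x, continuous W}.
  move=> /cube[Ox _ _]; have cd : {for x, continuous (fun y => d y - t0)}.
    by apply: continuousB; [exact: dc | exact: cst_continuous].
  apply: continuousD; last exact: cst_continuous.
  apply: continuousB; last by apply: continuousM; [exact: cst_continuous | exact: cont_sq].
  apply: continuousB; first by apply: continuousB; [exact: wc | exact: cst_continuous].
  apply: continuousM; first exact: cst_continuous.
  apply: continuousB; last first.
    by apply: continuousM; [exact: cst_continuous | apply: continuousM; exact: cd].
  apply: continuousD; first exact: cst_continuous.
  by apply: continuousM; [exact: cst_continuous | exact: cd].
have Wbd x : `|x - x0| = r -> W x <= 0.
  move=> xr; have [|k1 _] := thw x; first by rewrite xr.
  have k2 : nu * r ^+ 2 <= nu * sq (x - x0) by rewrite ler_pM2l // -xr normv_sq.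
  by rewrite /W -/(th (d x)); clear -k1 k2; lra.
have rR : r <= R0 by (clear -rt1 t2 ss1 s1R; lra).
have Hint' : (lebint_n (fun x => ((\1_Om x) * (`|f x| `^ p))%:E) <=
    ((J * (2 * r) `^ (- (n%:R / p))) `^ p * (2 * r) ^+ n)%:E)%E by rewrite scale_int.
have cubeO x : `|x - x0| <= r -> Om x by move=> /cube[].
have := Habp Om f W a C0 _ r x0 r0 rR cubeO (fun x xr => fc x (cubeO x xr)) f0 Wc Wbd PsW C00 a0 sc0 Hint'.
(* At the centre [w - ep] equals [tau] times the profile, so only the added constant remains. *)
have -> : W x0 = nu * r ^+ 2 by rewrite /W -t0E !subrr sq0 wx0; ring.
have r2 : 0 < r ^+ 2 by rewrite exprn_gt0.
move=> k1; have {}k1 : nu <= CA * (C0 + a * (J * (2 * r) `^ (- (n%:R / p)))).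
  by rewrite -(ler_pM2r r2); apply: le_trans k1 _; rewrite le_eqVlt; apply/orP; left; apply/eqP; ring.
have k2 : tau <= CA / (ka * c1) * (t0 / rt m t0 * (C0 + a * (J * (2 * r) `^ (- (n%:R / p))))).
  have kc : 0 < ka * c1 * (rt m t0 / t0) by rewrite mulr_gt0 ?divr_gt0 // mulr_gt0.
  rewrite -(ler_pM2l kc).
  have -> : ka * c1 * (rt m t0 / t0) * tau = nu by rewrite nuE kapE; ring.
  apply: le_trans k1 _; rewrite le_eqVlt; apply/orP; left; apply/eqP.
  by move: (_ + _ * (_ * _)) => Z; field; rewrite !gt_eqF.
have k3 : t0 / rt m t0 <= 1.
  rewrite ler_pdivrMr // mul1r; apply: le_trans rtt _; rewrite expr2 ler_piMl ?(ltW rt0) //; (clear -rt0e e8; lra).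
have t01 : t0 <= 1 by (clear -t2 ss1 s11; lra).
have k4 := scale_rt p0 co0 t00 t01 Hm; rewrite -rE in k4.
have k5 : t0 / rt m t0 * (C0 + a * (J * (2 * r) `^ (- (n%:R / p)))) <= (1 + (2 * co) `^ (- (n%:R / p))) * (C0 + a * J).
  have k6 : a * J * (t0 / rt m t0 * (2 * r) `^ (- (n%:R / p))) <= a * J * (2 * co) `^ (- (n%:R / p)) by rewrite ler_wpM2l.
  have k7 : t0 / rt m t0 * C0 <= 1 * C0 by rewrite ler_pM2r.
  have k8 : 0 <= (2 * co) `^ (- (n%:R / p)) * C0 by rewrite mulr_ge0 // ltW.
  clear -k6 k7 k8 aJ; lra.
have k6 : tau <= CA / (ka * c1) * ((1 + (2 * co) `^ (- (n%:R / p))) * (C0 + a * J)).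
  by apply: le_trans k2 _; rewrite ler_pM2l // divr_gt0 // mulr_gt0.
have k7 : tau * (d xb * (1 - rt m (d xb))) <= tau * d xb.
  by rewrite ler_pM2l // ler_piMr ?(ltW dxb) // gerBl rt_ge0.
have k8 : tau * d xb <= CA / (ka * c1) * ((1 + (2 * co) `^ (- (n%:R / p))) * (C0 + a * J)) * d xb by rewrite ler_pM2r.
have k9 := Hw xb Oxb dsxb; rewrite mulrA in k8.
rewrite -lerBlDr; apply: le_trans k9 (le_trans k7 k8).
Qed.

(** * Propagation of positivity *)

Lemma sq_normv_mul (R : realType) (n : nat) (x : 'rV[R]_n) (r : R) : 0 <= r -> n%:R * `|x| <= r -> (0 < n)%N -> sq x <= r ^+ 2.
Proof.
move=> r0 xr n0; apply: le_trans (sq_normv x) _; apply: (@le_trans _ _ ((n%:R * `|x|) ^+ 2)).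
  rewrite exprMn ler_wpM2r ?sqr_ge0 // expr2 ler_peMl // ler1n //.
by rewrite ler_sqr ?nnegrE // mulr_ge0.
Qed.

Definition nonneg_super (R : realType) (n : nat) (ga Ga d1 C1 e : R) (Om : set 'rV[R]_n) (z : 'rV[R]_n -> R) :=
  [/\ 0 <= e, forall x, Om x -> {for x, continuous z}, forall x, Om x -> 0 <= z x &
   Psub ga Ga d1 Om (fun x => C1 * z x + e) (fun x => - z x)].

(** Hopf-type barrier [c * (exp (- al |x - y|^2) - E0)], null on the sphere of radius [r]. For large
    [al] it is a strict subsolution outside the ball of radius [rho], and [z] minus the barrier
    cannot have a minimum below [- e] there. *)
Lemma local_spread (R : realType) (n : nat) (ga Ga d1 C1 rho r : R) :
  (0 < n)%N -> 0 < ga -> ga <= Ga -> 0 <= d1 -> 0 <= C1 -> 0 < rho -> 0 < r ->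
  exists th : R, [/\ 0 < th, th <= 1 & forall (Om : set 'rV[R]_n) (y : 'rV[R]_n) (z : 'rV[R]_n -> R) (e c : R),
    (forall x, sq (x - y) <= r ^+ 2 -> Om x) -> nonneg_super ga Ga d1 C1 e Om z -> 0 <= c ->
    (forall x, sq (x - y) <= rho ^+ 2 -> c <= z x) ->
    forall x, sq (x - y) <= r ^+ 2 / 4 -> th * c - e <= z x].
Proof.
move=> n0 ga0 gG d10 C10 rho0 r0; have Ga0 : 0 < Ga by exact: lt_le_trans gG.
have gr0 : 0 < 2 * ga * rho ^+ 2 by rewrite mulr_gt0 ?mulr_gt0 // exprn_gt0.
have [X XE] : {x | x = 4 * (n%:R * Ga) + 2 * d1 * r + C1 + 1} by eexists.
have nG : 0 <= n%:R * Ga by rewrite mulr_ge0 // ltW.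
have dr : 0 <= d1 * r by rewrite mulr_ge0 // ltW.
have X0 : 0 <= X by rewrite XE; clear -nG dr C10; lra.
have [al alE] : {x | x = 1 + X / (2 * ga * rho ^+ 2)} by eexists.
have al1 : 1 <= al by rewrite alE lerDl divr_ge0 // ltW.
have al0 : 0 < al by exact: lt_le_trans al1.
have alX : X <= 2 * ga * rho ^+ 2 * al.
  by rewrite alE mulrDr mulr1 (mulrC _ (X / _)) divfK ?gt_eqF // lerDr ltW.
pose E0 := expR (- (al * r ^+ 2)).
have r2 : 0 < r ^+ 2 by rewrite exprn_gt0.
have th0 : 0 < expR (- (al * (r ^+ 2 / 4))) - E0.
  by rewrite subr_gt0 ltr_expR ltrN2 ltr_pM2l // ltr_pdivrMr // ltr_pMr // ltr1n.
exists (expR (- (al * (r ^+ 2 / 4))) - E0); split=> //.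
  rewrite lerBlDr; apply: (@le_trans _ _ 1); last by rewrite lerDl expR_ge0.
  by rewrite expR_le1 oppr_le0 mulr_ge0 ?divr_ge0 // ltW.
move=> Om y z e c HOm [e0 zc z0 Pz] c0 Hc.
pose h (x : 'rV[R]_n) := expR (- (al * sq (x - y))).
have h1 x : 0 < h x <= 1 by rewrite expR_gt0 /= expR_le1 oppr_le0 mulr_ge0 ?sq_ge0 // ltW.
have hc x : {for x, continuous h}.
  have k1 : {for x, continuous (fun y' : 'rV[R]_n => - (al * sq (y' - y)))}.
    apply: continuousN; apply: continuousM; [exact: cst_continuous | exact: cont_sq].
  exact: (continuous_comp k1 (@continuous_expR R _)).
have cK : compact [set x | 0 <= r ^+ 2 - sq (x - y) /\ r ^+ 2 - sq (x - y) <= r ^+ 2].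
  apply: (@compact_shell _ _ _ (r + `|y|)); first by rewrite ltr_pwDl.
    by move=> x; apply: continuousB; [exact: cst_continuous | exact: cont_sq].
  move=> x; rewrite subr_ge0 => k1; have k2 : `|x - y| <= r.
    by rewrite -ler_sqr ?nnegrE ?(ltW r0) //; apply: le_trans k1; exact: normv_sq.
  have := ler_normD (x - y) y; rewrite subrK => k3; apply: le_trans k3 _; by rewrite lerD2r.
set K := [set x | _] in cK.
have KP x : sq (x - y) <= r ^+ 2 -> K x by move=> k1; split; rewrite ?subr_ge0 // gerBl sq_ge0.
have PK x : K x -> sq (x - y) <= r ^+ 2 by case; rewrite subr_ge0.
have [|||xm Kxm Hm] := @evt_min R n (fun x => z x - c * (h x - E0)) K.
- by exists y; apply: KP; rewrite subrr sq0 ltW.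
- by [].
- move=> x /PK /HOm Ox; apply: continuousB; first exact: zc.
  apply: continuousM; first exact: cst_continuous.
  by apply: continuousB; [exact: hc | exact: cst_continuous].
suff Hs : - e <= z xm - c * (h xm - E0).
  move=> x k1; have Kx : K x by apply: KP; apply: le_trans k1 _; rewrite ler_pdivrMr // ler_peMr ?(ltW r2) // ler1n.
  have k2 := Hm x Kx; have k3 : expR (- (al * (r ^+ 2 / 4))) <= h x by rewrite ler_expR lerN2 ler_pM2l.
  have k4 : c * (expR (- (al * (r ^+ 2 / 4))) - E0) <= c * (h x - E0) by rewrite ler_wpM2l // lerD2r.
  clear -k2 k4 Hs; rewrite mulrC; lra.
rewrite leNgt; apply/negP => neg.
have sm := PK _ Kxm; have Oxm := HOm _ sm.
have E00 : 0 < E0 by exact: expR_gt0.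
have zlt : z xm < c * (h xm - E0) by clear -neg e0; lra.
have cpos : 0 < c.
  rewrite lt_neqAle c0 andbT eq_sym; apply/eqP => cE; move: zlt; rewrite cE mul0r ltNge z0 //.
have hE : E0 < h xm by rewrite -subr_gt0 -(pmulr_rgt0 _ cpos); apply: le_lt_trans zlt; exact: z0.
have smr : sq (xm - y) < r ^+ 2 by move: hE; rewrite ltr_expR ltrN2 ltr_pM2l.
have smrho : rho ^+ 2 < sq (xm - y).
  rewrite ltNge; apply/negP => /Hc k1; have /andP[_ k2] := h1 xm.
  have k3 : c * (h xm - E0) <= c * 1 by rewrite ler_wpM2l //; clear -k2 E00; lra.
  by clear -k1 k3 zlt; lra.
have [g gE] : {x | x = 2 *: (xm - y)} by eexists.
have Hd k : `|k| <= 1 -> `|sq (xm + k - y) - sq (xm - y) - dot g k| <= 1 * sq k.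
  move=> _; have -> : xm + k - y = (xm - y) + k by rewrite addrAC.
  rewrite (sqD (xm - y) k) gE dotZl.
  have -> : sq (xm - y) + 2 * dot (xm - y) k + sq k - sq (xm - y) - 2 * dot (xm - y) k = sq k by ring.
  by rewrite ger0_norm ?sq_ge0 // mul1r.
have al24 : 0 <= al ^+ 2 / 4 by rewrite divr_ge0 // sqr_ge0.
have [e1 e10 He1] := @comp_upper R n (fun x => sq (x - y)) xm g 1 al _ ler01 al24 Hd.
have [e2 e20 He2] : exists2 e2 : R, 0 < e2 & forall k, `|k| < e2 -> `|al * (sq (xm + k - y) - sq (xm - y))| <= 2.
  have k0 : 0 < 2 / al by rewrite divr_gt0.
  have /contP_eps/(_ _ k0)[e2 e20 He2] := @cont_sq R n y xm.
  exists e2 => // k ke; have := He2 (xm + k); rewrite (_ : xm + k - xm = k); last by rewrite addrAC subrr add0r.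
  by move=> /(_ ke) k1; rewrite normrM gtr0_norm // mulrC -ler_pdivlMr // ltW.
pose B : 'M[R]_n := (c * h xm) *: ((2 * (al + 1))%:M - (al ^+ 2 / 2) *: outer g).
have J : ujet (fun x => - z x) xm (0 + (c * h xm * al) *: g) (0 + B).
  apply: (@ujet_upper _ _ _ (fun x => - c * h x)).
    have [e3 e30 He3] := cont_lt_near (@cont_sq R n y xm) smr.
    exists e3 => // x /He3 /ltW/KP/Hm; rewrite dot0l qf0m; clear; lra.
  exists (Num.min e1 e2); first by rewrite lt_min e10.
  move=> k; rewrite lt_min => /andP[/He1 k1 /He2 k2].
  have [t tE] : {t | t = sq (xm + k - y) - sq (xm - y)} by eexists.
  have -> : h (xm + k) = h xm * expR (- (al * t)) by rewrite /h -expRD tE; congr expR; ring.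
  rewrite -tE in k1 k2.
  (* Squaring [1 - s / 2 <= exp (- s / 2)] keeps the quadratic term [s ^ 2 / 4], from which the
     barrier draws its convexity. *)
  have k3 : 1 - al * t + al ^+ 2 / 4 * t ^+ 2 <= expR (- (al * t)).
    have -> : - (al * t) = - (al * t) / 2 + - (al * t) / 2 by field.
    have k4 := @expR_ge1Dx R (- (al * t) / 2); rewrite expRD -expr2.
    have k5 : 0 <= 1 + - (al * t) / 2 by move: k2; rewrite ler_norml => /andP[_]; clear; lra.
    have : (1 + - (al * t) / 2) ^+ 2 <= expR (- (al * t) / 2) ^+ 2 by rewrite ler_sqr ?nnegrE ?expR_ge0.
    by apply: le_trans; rewrite le_eqVlt; apply/orP; left; apply/eqP; field.
  have ch : 0 <= c * h xm by rewrite mulr_ge0 // expR_ge0.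
  have k4 := ler_wpM2l ch k3.
  rewrite (gtr0_norm al0) mulr1 in k1; have k5 := ler_wpM2l ch k1.
  rewrite /B qfZm qfBm qf_scalar qfZm qf_outer dotZl; clear -k4 k5; lra.
have sB : Defs.symmetric B by apply: symZ; apply: symB; [exact: sym_scalar | apply: symZ; exact: outer_sym].
rewrite !add0r in J.
have gsq : sq g = 4 * sq (xm - y) by rewrite gE sqZ; ring.
have gr : `|g| <= 2 * r.
  rewrite -ler_sqr ?nnegrE ?mulr_ge0 ?(ltW r0) //; apply: le_trans (normv_sq _) _.
  by rewrite gsq exprMn; clear -sm; lra.
have ch : 0 < c * h xm by rewrite mulr_gt0 // expR_gt0.
have := Pz xm _ _ (c * h xm * (2 * al ^+ 2 * ga * rho ^+ 2 - 2 * (al + 1) * (n%:R * Ga))) Oxm sB J.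
have HA A : ell ga Ga A -> c * h xm * (2 * al ^+ 2 * ga * rho ^+ 2 - 2 * (al + 1) * (n%:R * Ga)) <= - \tr (A *m B).
  move=> hA; have [sA qA] := hA; have /andP[_ k2] := ell_scalar_tr (ltW Ga0) hA.
  have /andP[k3 _] := qA g.
  have -> : \tr (A *m B) = c * h xm * (2 * (al + 1) * \tr A - al ^+ 2 / 2 * qf A g).
    by rewrite /B -scalemxAr mulmxDr mulmxN mul_mx_scalar -scalemxAr mxtraceZ mxtraceD raddfN /= !mxtraceZ tr_mul_outer.
  rewrite -[leRHS]mulrN ler_pM2l //.
  have k4 : 2 * (al + 1) * \tr A <= 2 * (al + 1) * (n%:R * Ga) by rewrite ler_wpM2l // mulr_ge0 // addr_ge0 // ltW.
  have k5 : al ^+ 2 / 2 * (ga * (4 * rho ^+ 2)) <= al ^+ 2 / 2 * qf A g.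
    rewrite ler_wpM2l ?divr_ge0 ?sqr_ge0 //; apply: le_trans k3; rewrite gsq ler_pM2l // ler_pM2l // ltW //.
  clear -k4 k5; lra.
move=> /(_ HA); rewrite normrZ (gtr0_norm (mulr_gt0 ch al0)) => k1.
have k2 : d1 * (c * h xm * al * `|g|) <= c * h xm * (al * (2 * d1 * r)).
  have : c * h xm * al * (d1 * `|g|) <= c * h xm * al * (d1 * (2 * r)).
    by rewrite ler_wpM2l ?mulr_ge0 ?(ltW c0) ?expR_ge0 ?(ltW al0) // ler_wpM2l.
  clear; lra.
have k3 : C1 * z xm <= c * h xm * C1.
  have : C1 * z xm <= C1 * (c * h xm) by rewrite ler_wpM2l // ltW //; apply: lt_le_trans zlt _; rewrite ler_wpM2l // gerBl ltW.
  clear; lra.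
have k4 : 2 * al ^+ 2 * ga * rho ^+ 2 >= al * X by have := ler_wpM2l (ltW al0) alX; clear; lra.
have k5 : 1 <= 2 * al ^+ 2 * ga * rho ^+ 2 - 2 * (al + 1) * (n%:R * Ga) - al * (2 * d1 * r) - C1.
  have k6 : n%:R * Ga * 1 <= n%:R * Ga * al by rewrite ler_wpM2l.
  have k7 : C1 * 1 <= C1 * al by rewrite ler_wpM2l.
  by move: k4; rewrite XE; clear -k6 k7 al1; lra.
have k6 := ler_wpM2l (ltW ch) k5.
have k7 : c * (h xm - E0) <= c * h xm by rewrite ler_wpM2l // gerBl ltW.
have z0m := z0 xm Oxm.
clear -k1 k2 k3 k6 k7 neg z0m; lra.
Qed.

(** One link of a chain of balls: the previous constant and that of [local_spread] merge into a
    single [s], which multiplies [c] and, inverted, the error. *)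
Lemma spread_chain (R : realType) (d t c e v : R) : 0 < d -> 0 < t -> t <= 1 -> 0 <= e -> 0 <= v ->
  (0 <= d * c - e / d -> t * (d * c - e / d) - e <= v) -> 
  forall s, 0 < s -> s <= t * d -> s <= (d^-1 + 1)^-1 -> 0 <= c -> s * c - e / s <= v.
Proof.
move=> d0 t0 t1 e0 v0 H s s0 s1 s2 c0.
have k0 : d^-1 + 1 <= s^-1 by rewrite -[leLHS]invrK lef_pV2 ?posrE ?invr_gt0 ?addr_gt0 ?invr_gt0.
have k1 : (d^-1 + 1) * e <= s^-1 * e by rewrite ler_wpM2r.
have k2 : s * c <= t * d * c by rewrite ler_wpM2r.
have ed : 0 <= e / d by rewrite divr_ge0 // ltW.
have k3 : t * (e / d) <= e / d by rewrite ler_piMl.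
have [k4|k4] := lerP 0 (d * c - e / d).
  by move: (H k4); clear -k1 k2 k3; lra.
have k5 : t * (d * c - e / d) <= 0 by rewrite pmulr_rle0 // ltW.
by clear -k1 k2 k3 k5 v0 e0; lra.
Qed.

(** The points reached by positivity form a nonempty, open and relatively closed subset of the
    connected set [Om]; [local_spread] gives the closedness. *)
Lemma spread_point (R : realType) (n : nat) (ga Ga d1 C1 r0 : R) (Om : set 'rV[R]_n) (x0 : 'rV[R]_n) :
  (0 < n)%N -> 0 < ga -> ga <= Ga -> 0 <= d1 -> 0 <= C1 -> open Om -> connected Om -> Om x0 -> 0 < r0 ->
  forall x, Om x -> exists2 d : R, 0 < d & forall (z : 'rV[R]_n -> R) (e c : R), nonneg_super ga Ga d1 C1 e Om z ->
   0 <= c -> (forall y : 'rV[R]_n, `|y - x0| <= r0 -> Om y -> c <= z y) ->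
   forall y : 'rV[R]_n, `|y - x| < d -> d * c - e / d <= z y.
Proof.
move=> n0 ga0 gG d10 C10 oO cO Ox0 r00.
pose S (x : 'rV[R]_n) := exists2 d : R, 0 < d & forall (z : 'rV[R]_n -> R) (e c : R), nonneg_super ga Ga d1 C1 e Om z ->
   0 <= c -> (forall y : 'rV[R]_n, `|y - x0| <= r0 -> Om y -> c <= z y) ->
   forall y : 'rV[R]_n, `|y - x| < d -> d * c - e / d <= z y.
suff HA : [set x | Om x /\ S x] = Om.
  by move=> x Ox; have [] : [set x | Om x /\ S x] x by rewrite HA.
have oP := (openP_eps Om).1 oO.
have near x : Om x -> exists2 et : R, 0 < et & forall y, S y -> `|y - x| < et -> S x.
  move=> Ox; have [D D0 HD] := oP x Ox.
  have n1 : 1 <= n%:R :> R by rewrite ler1n.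
  have n4 : 0 < 4 * n%:R :> R by rewrite mulr_gt0 // ltr0n.
  have [rr rrE] : {a | a = D / 4} by eexists.
  have rr0 : 0 < rr by rewrite rrE divr_gt0.
  have [et etE] : {a | a = rr / (4 * n%:R)} by eexists.
  have et0 : 0 < et by rewrite etE divr_gt0.
  have etr : 4 * n%:R * et = rr by rewrite etE; field; rewrite gt_eqF // ltr0n.
  have etr1 : et <= rr by rewrite -etr ler_peMl ?(ltW et0) //; clear -n1; lra.
  exists et => // y [d dd Hd] yx.
  have [t [t0 t1 Ht]] := @local_spread R n ga Ga d1 C1 (d / 2) rr n0 ga0 gG d10 C10 (divr_gt0 dd (ltr0Sn _ _)) rr0.
  have [s sE] : {a | a = Num.min et (Num.min (t * d) (d^-1 + 1)^-1)} by eexists.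
  have s0 : 0 < s by rewrite sE !lt_min et0 mulr_gt0 // invr_gt0 addr_gt0 // invr_gt0.
  have : s <= s by [].
  rewrite {2}sE !le_min => /and3P[s1 s2 s3].
  exists s => // z e c Nz c0 Hc y' y's.
  have [e0 zc z0 Pz] := Nz.
  have sub x' : sq (x' - y) <= rr ^+ 2 -> Om x'.
    move=> k1; apply: HD; have k2 : `|x' - y| <= rr.
      by rewrite -ler_sqr ?nnegrE ?(ltW rr0) //; apply: le_trans k1; exact: normv_sq.
    have k3 : `|x' - x| <= `|x' - y| + `|y - x| by rewrite -[x' - x](subrKA y) ler_normD.
    by clear -k2 k3 yx etr1 rrE D0; lra.
  have y'y : sq (y' - y) <= rr ^+ 2 / 4.
    have -> : rr ^+ 2 / 4 = (rr / 2) ^+ 2 by field.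
    apply: sq_normv_mul => //; first by rewrite divr_ge0 // ltW.
    have k3 : `|y' - y| <= `|y' - x| + `|x - y| by rewrite -[y' - y](subrKA x) ler_normD.
    have k4 : `|y' - y| <= 2 * et by rewrite (distrC x y) in k3; clear -k3 yx y's s1; lra.
    have k5 : n%:R * `|y' - y| <= n%:R * (2 * et) by rewrite ler_wpM2l.
    by apply: le_trans k5 _; rewrite -etr; clear; lra.
  have Oy' : Om y'.
    by apply: sub; apply: le_trans y'y _; rewrite ler_pdivrMr // ler_peMr ?sqr_ge0 // ler1n.
  apply: (@spread_chain R d t c e (z y')) => //; first exact: z0.
  move=> k1; apply: (Ht Om y z e (d * c - e / d)) => // x' k2.
  apply: (Hd z e c) => //; apply: (@le_lt_trans _ _ (d / 2)); last by rewrite ltr_pdivrMr // ltr_pMr // ltr1n.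
  rewrite -ler_sqr ?nnegrE ?divr_ge0 ?(ltW dd) //; apply: le_trans k2; exact: normv_sq.
apply: cO.
- exists x0; split=> //; have [D D0 HD] := oP x0 Ox0.
  have [d dE] : {d | d = Num.min (Num.min r0 1) D} by eexists.
  have d0 : 0 < d by rewrite dE !lt_min r00 ltr01.
  have : d <= d by []; rewrite {2}dE !le_min => /andP[/andP[k1 k2] k3].
  exists d => // z e c [e0 _ _ _] c0 Hc y yd.
  have k4 : c <= z y by apply: Hc; [apply: ltW; apply: lt_le_trans k1 | apply: HD; apply: lt_le_trans k3].
  have k5 : 0 <= e / d by rewrite divr_ge0 // ltW.
  have k6 : d * c <= c by rewrite ler_piMl.
  by clear -k4 k5 k6; lra.
- exists [set x | Om x /\ S x]; last by rewrite setIidr // => x [].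
  apply/openP_eps => x [Ox [d d0 Hd]]; have [D D0 HD] := oP x Ox.
  exists (Num.min D (d / 2)); first by rewrite lt_min D0 divr_gt0.
  move=> y; rewrite lt_min => /andP[/HD Oy yx]; split=> //.
  exists (d / 2); first by rewrite divr_gt0.
  move=> z e c Nz c0 Hc y' k1; have [e0 _ _ _] := Nz.
  have k2 : `|y' - x| < d.
    have k3 : `|y' - x| <= `|y' - y| + `|y - x| by rewrite -[y' - x](subrKA y) ler_normD.
    by clear -k1 k3 yx; lra.
  have k3 := Hd z e c Nz c0 Hc y' k2.
  have k4 : 0 <= e / d by rewrite divr_ge0 // ltW.
  have k5 : 0 <= d * c by rewrite mulr_ge0 // ltW.
  have -> : e / (d / 2) = 2 * (e / d) by field; rewrite gt_eqF.
  by clear -k3 k4 k5; lra.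
- exists [set x | Om x -> S x]; last first.
    by apply/seteqP; split=> x [k1 k2]; split=> //; apply: k2.
  apply: closedP_eps => x /not_implyP[Ox nS]; have [et et0 Het] := near x Ox.
  have [D D0 HD] := oP x Ox.
  exists (Num.min et D); first by rewrite lt_min et0.
  by move=> y; rewrite lt_min => /andP[k1 /HD Oy] k2; apply: nS; apply: Het (k2 Oy) k1.
Qed.

(** Compactness is used twice, for the target [x] and then for the source [x0]; halving the radius
    lets nearby sources share one constant. *)
Lemma harnack_spread (R : realType) (n : nat) (ga Ga d1 C1 r0 : R) (Om K : set 'rV[R]_n) :
  (0 < n)%N -> 0 < ga -> ga <= Ga -> 0 <= d1 -> 0 <= C1 -> open Om -> connected Om -> 0 < r0 ->
  compact K -> K `<=` Om ->
  exists2 d : R, 0 < d & forall (x0 x : 'rV[R]_n) (z : 'rV[R]_n -> R) (e c : R), K x0 -> K x ->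
    nonneg_super ga Ga d1 C1 e Om z -> 0 <= c ->
    (forall y : 'rV[R]_n, `|y - x0| <= r0 -> Om y -> c <= z y) -> d * c - e / d <= z x.
Proof.
move=> n0 ga0 gG d10 C10 oO cO r00 cK KO.
have mono (d d' c e v : R) : 0 <= c -> 0 <= e -> d * c - e / d <= v -> 0 < d' -> d' <= d -> d' * c - e / d' <= v.
  move=> c0 e0 k1 d'0 k2; have k3 : d' * c <= d * c by rewrite ler_wpM2r.
  have k4 : e / d <= e / d' by rewrite ler_wpM2l // lef_pV2 ?posrE // (lt_le_trans d'0).
  by clear -k1 k3 k4; lra.
have [|x0 d d' K0 H d'0 dd|x0 K0|d d0 Hd] := @compact_unif R n K (fun x0 d => forall (x : 'rV[R]_n) (z : 'rV[R]_n -> R) (e c : R), K x ->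
    nonneg_super ga Ga d1 C1 e Om z -> 0 <= c ->
    (forall y : 'rV[R]_n, `|y - x0| <= r0 -> Om y -> c <= z y) -> d * c - e / d <= z x).
- by [].
- move=> x z e c Kx Nz c0 Hc; have [e0 _ _ _] := Nz.
  exact: (mono d d' c e (z x) c0 e0 (H x z e c Kx Nz c0 Hc) d'0 dd).
- have r2 : 0 < r0 / 2 by rewrite divr_gt0.
  have [|x d d' Kx H d'0 dd|x Kx|d d0 Hd] := @compact_unif R n K (fun x d => forall (z : 'rV[R]_n -> R) (e c : R), 
    nonneg_super ga Ga d1 C1 e Om z -> 0 <= c ->
    (forall y : 'rV[R]_n, `|y - x0| <= r0 / 2 -> Om y -> c <= z y) -> d * c - e / d <= z x).
  + by [].
  + move=> z e c Nz c0 Hc; have [e0 _ _ _] := Nz.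
    exact: (mono d d' c e (z x) c0 e0 (H z e c Nz c0 Hc) d'0 dd).
  + have [d d0 Hd] := spread_point n0 ga0 gG d10 C10 oO cO (KO x0 K0) r2 (KO x Kx).
    exists d => // y Ky yx z e c Nz c0 Hc; exact: (Hd z e c Nz c0 Hc y yx).
  exists (Num.min d (r0 / 2)); first by rewrite lt_min d0.
  move=> y Ky; rewrite lt_min => /andP[k1 k2] x z e c Kx Nz c0 Hc; have [e0 _ _ _] := Nz.
  have m0 : 0 < Num.min d (r0 / 2) by rewrite lt_min d0.
  apply: (mono d _ c e (z x) c0 e0 _ m0 _); last by rewrite ge_min lexx.
  apply: (Hd x Kx z e c Nz c0) => y' k3; apply: Hc.
  have k4 : `|y' - y| <= `|y' - x0| + `|x0 - y| by rewrite -[y' - y](subrKA x0) ler_normD.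
  by rewrite (distrC x0 y) in k4; clear -k2 k3 k4; lra.
by exists d => // x0 x z e c K0 Kx Nz c0 Hc; apply: (Hd x0 K0 x z e c).
Qed.

(** * Thin strips *)

Lemma Psub_mono (R : realType) (n : nat) (ga Ga d1 : R) (D D' : set 'rV[R]_n) (g g' w : 'rV[R]_n -> R) :
  Psub ga Ga d1 D g w -> (forall x, D' x -> D x /\ g x <= g' x) -> Psub ga Ga d1 D' g' w.
Proof.
move=> P H x p M c D'x sM J Hc; have [Dx gx] := H x D'x.
by apply: le_trans (P x p M c Dx sM J Hc) _; rewrite lerD2l.
Qed.

Lemma Psub_shift (R : realType) (n : nat) (ga Ga d1 k : R) (D : set 'rV[R]_n) (g w w' : 'rV[R]_n -> R) :
  Psub ga Ga d1 D g w -> (forall x, w' x = w x + k) -> Psub ga Ga d1 D g w'.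
Proof.
move=> P H x p M c Dx sM [e e0 He] Hc; apply: (P x p M c Dx sM _ Hc).
by exists e => // y /He; rewrite !H; clear; lra.
Qed.

Lemma F3_zero (R : realType) (n : nat) (O : set 'rV[R]_n) (F : op_type R n) (x : 'rV[R]_n) : F3 O F -> O x -> F 0 0 0 x = 0.
Proof. by move=> F3h Ox; have := F3h 0 0 0 0 x (lexx _) (@sym0 _ _) Ox; rewrite !scale0r !mul0r. Qed.

Lemma Fsub_Psub (R : realType) (n : nat) (O : set 'rV[R]_n) (F : op_type R n) (d1 d0 ga Ga : R) (a V : 'rV[R]_n -> R) :
  F2low O F d1 d0 ga Ga -> F3 O F -> Fsub O F a V -> Psub ga Ga d1 O (fun x => d0 * `|V x| + a x) V.
Proof.
move=> F2h F3h Vs x p M c Ox sM J Hc; have k1 := Vs x p M Ox sM J.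
have := F2h M 0 p 0 (V x) 0 x c sM (@sym0 _ _) Ox; rewrite (F3_zero F3h Ox) !subr0 => /(_ Hc).
clear -k1; lra.
Qed.

Lemma Fsup_Psub (R : realType) (n : nat) (O : set 'rV[R]_n) (F : op_type R n) (d1 d0 ga Ga : R) (b w : 'rV[R]_n -> R) :
  F2low O F d1 d0 ga Ga -> F3 O F -> Fsup O F b w -> Psub ga Ga d1 O (fun x => d0 * `|w x| - b x) (fun x => - w x).
Proof.
move=> F2h F3h ws x p M c Ox sM /ujetN J Hc; have sN := symN sM; have k1 := ws x _ _ Ox sN J.
have := F2h 0 (- M) 0 (- p) 0 (w x) x c (@sym0 _ _) sN Ox; rewrite (F3_zero F3h Ox) !sub0r !opprK !normrN => /(_ Hc).
clear -k1; lra.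
Qed.

Lemma shell_compact (R : realType) (n : nat) (Om : set 'rV[R]_n) (d : 'rV[R]_n -> R) (G : 'rV[R]_n -> 'rV[R]_n)
    (L c s0 : R) : regdom Om d G L c s0 -> bounded_set Om ->
  (exists2 Dm : R, 0 < Dm & forall x, Om x -> d x <= Dm) /\ (forall a : R, 0 < a -> compact [set x | a <= d x]).
Proof.
move=> [OE dc _ _ _] bO; have [_ [B B0 HB]] := compact_closure bO.
have OmP x : 0 < d x -> Om x by rewrite OE.
have [D D0 HD] := cont_bounded_cube B0 dc.
have HDm x : Om x -> d x <= D by move=> /HB/HD; apply: le_trans; exact: ler_norm.
split=> [|a a0].
  by exists (D + 1) => [|x /HDm k]; [exact: ltr_wpDl | apply: le_trans k _; rewrite lerDl].
have -> : [set x | a <= d x] = [set x | a <= d x /\ d x <= D].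
  apply/seteqP; split=> x /= => [k|[]] //; split=> //; apply: HDm; apply: OmP; exact: lt_le_trans k.
by apply: (@compact_shell _ _ _ B) => // x k; apply: HB; apply: OmP; exact: lt_le_trans k.
Qed.

Definition bdry_small (R : realType) (n : nat) (Om : set 'rV[R]_n) (d w : 'rV[R]_n -> R) :=
  forall e : R, 0 < e -> exists2 de : R, 0 < de & forall x, Om x -> d x < de -> w x < e.

Lemma max_attained (R : realType) (n : nat) (Om : set 'rV[R]_n) (d : 'rV[R]_n -> R) (G : 'rV[R]_n -> 'rV[R]_n)
    (L c s0 : R) (w : 'rV[R]_n -> R) (y : 'rV[R]_n) : regdom Om d G L c s0 -> bounded_set Om ->
  (forall x, Om x -> {for x, continuous w}) -> bdry_small Om d w -> Om y -> 0 < w y ->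
  exists2 xT, Om xT & forall x, Om x -> w x <= w xT.
Proof.
move=> rd bO wc ws Oy wy; have [_ cK] := shell_compact rd bO; have [OE _ _ _ _] := rd.
have OmP x : 0 < d x -> Om x by rewrite OE.
have [de de0 Hde] := ws _ wy.
have yK : de <= d y by rewrite leNgt; apply/negP => /(Hde y Oy); rewrite ltxx.
have [||xT xTK HT] := @evt_max R n w _ _ (cK de de0).
- by exists y.
- by move=> x xK; apply: wc; apply: OmP; exact: lt_le_trans xK.
exists xT => [|x Ox]; first by apply: OmP; exact: lt_le_trans xTK.
have [k|k] := ltP (d x) de; last exact: HT.
by apply: le_trans (ltW (Hde x Ox k)) _; exact: HT.
Qed.

(* The zeroth-order term [C1 * w] is absorbed because [w] is at most a multiple of the strip width [s]. *)
Lemma strip_bound (R : realType) (n : nat) (Om : set 'rV[R]_n) (d : 'rV[R]_n -> R) (G : 'rV[R]_n -> 'rV[R]_n)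
    (L c s0 ga Ga d1 p J C1 : R) (f : 'rV[R]_n -> R) :
  regdom Om d G L c s0 -> bounded_set Om -> (0 < n)%N -> 0 < ga -> ga <= Ga -> 0 <= d1 -> n%:R < p ->
  (forall x, Om x -> {for x, continuous f}) -> (forall x, Om x -> 0 <= f x) -> 0 < J -> 0 < C1 ->
  (lebint_n (fun x => ((\1_Om x) * (`|f x| `^ p))%:E) <= (J `^ p)%:E)%E ->
  exists C s1 : R, [/\ 0 < C, 0 < s1 & forall (s e a : R) (w : 'rV[R]_n -> R), 0 < s -> s <= s1 ->
    (forall x, Om x -> {for x, continuous w}) -> bdry_small Om d w ->
    (forall x, s <= d x -> w x <= 0) ->
    Psub ga Ga d1 [set x | Om x /\ 0 < w x] (fun x => C1 * w x + e + a * f x) w -> 0 <= e -> 0 <= a ->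
    forall x, Om x -> w x <= C * (e + a * J) * d x].
Proof.
move=> rd bO n0 ga0 gG d10 np fc f0 J0 C10 Hint.
have [C [s1 [C0 s10 H]]] := boundary_bound rd bO n0 ga0 gG d10 np fc f0 J0 Hint.
have CC1 : 0 < 2 * C * C1 by rewrite (mulr_gt0 (mulr_gt0 (ltr0Sn _ _) C0) C10).
have C2 : 0 < 2 * C by rewrite mulr_gt0.
exists (2 * C), (Num.min s1 (2 * C * C1)^-1); split=> //; first by rewrite lt_min s10 invr_gt0.
move=> s e a w s0'; rewrite le_min => /andP[ss1 ss2] wc ws wK Pw e0 a0 y Oy.
have [OE _ _ _ _] := rd; have dP x : Om x -> 0 < d x by rewrite OE.
have aJ : 0 <= e + a * J by rewrite addr_ge0 // mulr_ge0 // ltW.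
have [k|wy] := lerP (w y) 0.
  by apply: le_trans k _; rewrite mulr_ge0 ?(ltW (dP y Oy)) // mulr_ge0 // ltW.
have [xT OxT HT] := max_attained rd bO wc ws Oy wy.
have T0 : 0 < w xT by apply: lt_le_trans wy _; exact: HT.
have C00 : 0 < C1 * w xT + e by rewrite ltr_pwDl // mulr_gt0.
have Pw' : Psub ga Ga d1 [set x | Om x /\ 0 < w x] (fun x => C1 * w xT + e + a * f x) w.
  apply: Psub_mono Pw _ => x [Ox wx]; split=> //.
  by rewrite lerD2r lerD2r ler_pM2l //; exact: HT.
have Hb := H s _ a w s0' ss1 wc ws wK Pw' C00 a0.
have dT : d xT < s by rewrite ltNge; apply/negP => /wK; rewrite leNgt T0.
have k1 := Hb xT OxT.
have k2 : C * (C1 * w xT + e + a * J) * d xT <= C * (C1 * w xT + e + a * J) * s.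
  rewrite ler_wpM2l ?(ltW dT) // mulr_ge0 ?(ltW C0) // -addrA addr_ge0 // mulr_ge0 // ltW //.
have k3 : 2 * C * C1 * s <= 1 by rewrite mulrC -ler_pdivlMr // div1r.
have k4 : 2 * C * C1 * s * w xT <= 1 * w xT by rewrite ler_wpM2r // ltW.
have k5 : 2 * C * C1 * s * (e + a * J) <= 1 * (e + a * J) by rewrite ler_wpM2r.
have k6 : w xT <= 2 * C * s * (e + a * J) by clear -k1 k2 k4; lra.
have k7 : C1 * w xT <= e + a * J by have := ler_wpM2l (ltW C10) k6; clear -k5; lra.
apply: le_trans (Hb y Oy) _; rewrite ler_pM2r ?dP //.
have k8 : C * (C1 * w xT) <= C * (e + a * J) by rewrite ler_pM2l.
clear -k8; lra.
Qed.

(** With [ka] small against [cf], an interior negative minimum of [z - ka * (r ^+ 2 - sq (x - y))]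
    would violate the inequality, so [z] stays above the paraboloid. *)
Lemma source_bump (R : realType) (n : nat) (ga Ga d1 C1 r cf : R) : (0 < n)%N -> 0 < ga -> ga <= Ga -> 0 <= d1 -> 0 <= C1 ->
  0 < r -> 0 < cf -> exists2 k : R, 0 < k & forall (z : 'rV[R]_n -> R) (y : 'rV[R]_n),
  (forall x : 'rV[R]_n, `|x - y| <= r -> {for x, continuous z} /\ 0 <= z x) ->
  Psub ga Ga d1 [set x : 'rV[R]_n | `|x - y| <= r] (fun x => C1 * z x - cf) (fun x => - z x) ->
  forall x : 'rV[R]_n, n%:R * `|x - y| <= r / 2 -> k <= z x.
Proof.
move=> n0 ga0 gG d10 C10 r0 cf0; have Ga0 : 0 < Ga by exact: lt_le_trans gG.
have r2 : 0 < r ^+ 2 by exact: exprn_gt0.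
have [X XE] : {x | x = 2 * (n%:R * Ga) + d1 * (2 * r) + C1 * r ^+ 2} by eexists.
have X0 : 0 <= X by rewrite XE !addr_ge0 ?mulr_ge0 ?(ltW Ga0) ?(ltW r0) ?(ltW r2).
have X1 : 0 < X + 1 by rewrite ltr_wpDl.
have [ka kaE] : {x | x = cf / (X + 1)} by eexists.
have ka0 : 0 < ka by rewrite kaE divr_gt0.
have kaX : ka * (X + 1) = cf by rewrite kaE divfK ?gt_eqF.
exists (ka * (r ^+ 2 / 2)); first by rewrite mulr_gt0 // divr_gt0.
move=> z y Hz Pz x xr.
have [||xm Kxm Hm] := @evt_min R n (fun x => z x - ka * (r ^+ 2 - sq (x - y))) _ _ (@compact_cube R n y r r0).
- by exists y; rewrite /= subrr normr0 ltW.
- move=> x' /Hz[zc _]; apply: continuousB; first exact: zc.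
  apply: continuousM; first exact: cst_continuous.
  by apply: continuousB; [exact: cst_continuous | exact: cont_sq].
have sx : sq (x - y) <= (r / 2) ^+ 2 by apply: sq_normv_mul => //; rewrite divr_ge0 // ltW.
have xrr : `|x - y| <= r.
  apply: (@le_trans _ _ (r / 2)); last by rewrite ler_pdivrMr // ler_peMr ?(ltW r0) // ler1n.
  by rewrite -ler_sqr ?nnegrE ?divr_ge0 ?(ltW r0) //; apply: le_trans sx; exact: normv_sq.
have k1 := Hm x xrr.
have k2 : ka * sq (x - y) <= ka * (r / 2) ^+ 2 by rewrite ler_pM2l.
have [k3|k3] := lerP 0 (z xm - ka * (r ^+ 2 - sq (xm - y))).
  have k4 : 0 < ka * r ^+ 2 by rewrite mulr_gt0.
  by clear -k1 k2 k3 k4; lra.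
have [zc z0] := Hz _ Kxm.
have sm : sq (xm - y) < r ^+ 2.
  rewrite ltNge; apply/negP => k4; have : ka * (r ^+ 2 - sq (xm - y)) <= 0 by rewrite pmulr_rle0 // subr_le0.
  by clear -k3 z0; lra.
have xmr : `|xm - y| < r.
  by rewrite -ltr_sqr ?nnegrE ?(ltW r0) //; apply: le_lt_trans sm; exact: normv_sq.
have J : ujet (fun x => - z x) xm ((2 * ka) *: (xm - y)) ((2 * ka)%:M).
  exists (r - `|xm - y|); first by rewrite subr_gt0.
  move=> x' k4; have k5 : `|x' - y| <= r.
    have k6 : `|x' - y| <= `|x' - xm| + `|xm - y| by rewrite -[x' - y](subrKA xm) ler_normD.
    by clear -k4 k6; lra.
  have := Hm x' k5; have -> : x' - y = (xm - y) + (x' - xm) by rewrite [RHS]addrC subrKA.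
  rewrite (sqD (xm - y) (x' - xm)) qf_scalar dotZl; clear; lra.
have := Pz xm _ _ (- (2 * ka * (n%:R * Ga))) (ltW xmr) (sym_scalar _) J.
have HA (A : 'M[R]_n) : ell ga Ga A -> - (2 * ka * (n%:R * Ga)) <= - \tr (A *m (2 * ka)%:M).
  move=> hA; have /andP[_ k4] := ell_scalar_tr (ltW Ga0) hA.
  by rewrite mul_mx_scalar mxtraceZ lerN2 ler_pM2l // mulr_gt0.
move=> /(_ HA); rewrite normrZ gtr0_norm ?mulr_gt0 // => k4.
have k5 : d1 * (2 * ka * `|xm - y|) <= ka * (d1 * (2 * r)).
  have : d1 * (2 * ka) * `|xm - y| <= d1 * (2 * ka) * r by rewrite ler_wpM2l ?(ltW xmr) // !mulr_ge0 // ltW.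
  by clear; lra.
have k6 : C1 * z xm <= ka * (C1 * r ^+ 2).
  have k7 : z xm <= ka * r ^+ 2.
    have k8 : 0 <= ka * sq (xm - y) by rewrite mulr_ge0 ?sq_ge0 // ltW.
    by clear -k3 k8; lra.
  by have := ler_wpM2l C10 k7; clear; lra.
move: kaX; rewrite XE => kaX; clear -k4 k5 k6 kaX ka0; lra.
Qed.

(** The gradient of [d] is bounded below in the strip, so the convexity of [d + k * d ^+ 2] along it
    contributes [2 * al * k * ga * c]. [k] is large enough to cover the other derivatives of the
    barrier and to leave [2 * al * C1], which later pays for the zeroth-order term. *)
Lemma strip_Psub (R : realType) (n : nat) (Om : set 'rV[R]_n) (d : 'rV[R]_n -> R) (G : 'rV[R]_n -> 'rV[R]_n)
    (L c s0 ga Ga d1 C1 : R) : regdom Om d G L c s0 -> (0 < n)%N -> 0 < ga -> ga <= Ga -> 0 <= d1 -> 0 <= C1 ->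
  exists2 k : R, 0 < k & forall (s al : R) (g u : 'rV[R]_n -> R), s <= s0 -> k * s <= 1 -> 0 < al ->
    Psub ga Ga d1 [set x | Om x /\ d x < s] g u ->
    Psub ga Ga d1 [set x | Om x /\ d x < s] (fun x => g x - 2 * al * C1) (fun x => u x + al * (d x + k * d x ^+ 2)).
Proof.
move=> [OE dc [L0 [c0 s00]] dH dG] n0 ga0 gG d10 C10; have Ga0 : 0 < Ga by exact: lt_le_trans gG.
have gc : 0 < 2 * ga * c by rewrite (mulr_gt0 (mulr_gt0 (ltr0Sn _ _) ga0) c0).
have [X XE] : {x | x = 3 * d1 * L + 2 * (3 * L + 1) * (n%:R * Ga) + 2 * C1} by eexists.
have nG : 0 <= n%:R * Ga by rewrite mulr_ge0 // ltW.
have L3 : 0 <= 3 * L + 1 by clear -L0; lra.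
have dL : 0 <= d1 * L by rewrite mulr_ge0 // ltW.
have X0 : 0 <= X.
  have k1 : 0 <= (3 * L + 1) * (n%:R * Ga) by rewrite mulr_ge0.
  by rewrite XE; clear -k1 dL C10; lra.
have [k kE] : {x | x = X / (2 * ga * c) + 1} by eexists.
have k0 : 0 < k by rewrite kE ltr_wpDl // divr_ge0 // ltW.
have kX : X <= 2 * ga * c * k by rewrite kE mulrDr mulr1 (mulrC _ (X / _)) divfK ?gt_eqF // lerDl ltW.
exists k => // s al g u ss0 ks al0 Pu x p M cc [Ox dxs] sM J Hc.
have dx0 : 0 < d x by move: Ox; rewrite OE.
have kd : 0 <= k * d x <= 1.
  by rewrite mulr_ge0 ?(ltW k0) ?(ltW dx0) //=; apply: le_trans ks; rewrite ler_pM2l // ltW.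
case/andP: kd => kd0 kd1.
have [m mE] : {x' | x' = - (1 + 2 * (k * d x))} by eexists.
have m3 : `|m| <= 3 by rewrite mE normrN ger0_norm; clear -kd0 kd1; lra.
have dd (h : 'rV[R]_n) : `|h| <= 1 -> `|d (x + h) - d x - dot (G x) h| <= L * sq h by move=> /(dH x h Ox)[].
have Gx : `|G x| <= L by have [|_ _] := dH x 0 Ox; rewrite ?normr0.
have [e ee He] := @comp_upper R n d x (G x) L m k (ltW L0) (ltW k0) dd.
pose B : 'M[R]_n := al *: ((2 * (3 * L + 1))%:M - (2 * k) *: outer (G x)).
have sB : Defs.symmetric B by apply: symZ; apply: symB; [exact: sym_scalar | apply: symZ; exact: outer_sym].
have Ju : ujet u x (p + (al * m) *: G x) (M + B).
  apply: (@ujet_upper _ _ _ (fun y => - (al * (d y + k * d y ^+ 2)))).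
    by case: J => r r0 Hr; exists r => // y /Hr; clear; lra.
  exists e => // h /He k1.
  have k2 : `|m| * L * sq h <= 3 * L * sq h by rewrite ler_wpM2r ?sq_ge0 // ler_pM2r.
  have k3 : m * (d (x + h) - d x) - k * (d (x + h) - d x) ^+ 2 <= m * dot (G x) h + (3 * L + 1) * sq h - k * dot (G x) h ^+ 2.
    by clear -k1 k2; lra.
  have k4 := ler_wpM2l (ltW al0) k3.
  have k5 : - (al * (d (x + h) + k * d (x + h) ^+ 2)) = - (al * (d x + k * d x ^+ 2)) +
     al * (m * (d (x + h) - d x) - k * (d (x + h) - d x) ^+ 2) by rewrite mE; ring.
  rewrite k5 /B qfZm qfBm qf_scalar qfZm qf_outer dotZl; clear -k4; lra.
have := Pu x _ _ (cc - al * (2 * (3 * L + 1) * (n%:R * Ga)) + al * (2 * k * (ga * c))) (conj Ox dxs) (symD sM sB) Ju.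
have HA A : ell ga Ga A -> cc - al * (2 * (3 * L + 1) * (n%:R * Ga)) + al * (2 * k * (ga * c)) <= - \tr (A *m (M + B)).
  move=> hA; have k1 := Hc A hA; have [sA qA] := hA; have /andP[_ k2] := ell_scalar_tr (ltW Ga0) hA.
  have /andP[k3 _] := qA (G x).
  have -> : \tr (A *m (M + B)) = \tr (A *m M) + al * (2 * (3 * L + 1) * \tr A - 2 * k * qf A (G x)).
    by rewrite /B mulmxDr -scalemxAr mulmxDr mulmxN mul_mx_scalar -scalemxAr mxtraceD mxtraceZ mxtraceD raddfN /= !mxtraceZ tr_mul_outer.
  have k4 : 2 * (3 * L + 1) * \tr A <= 2 * (3 * L + 1) * (n%:R * Ga) by rewrite ler_wpM2l // mulr_ge0.
  have k5 : 2 * k * (ga * c) <= 2 * k * qf A (G x).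
    rewrite ler_pM2l ?mulr_gt0 //; apply: le_trans k3; rewrite ler_pM2l //; apply: dG => //; exact: lt_le_trans ss0.
  have k6 : al * (2 * (3 * L + 1) * \tr A - 2 * k * qf A (G x)) <= al * (2 * (3 * L + 1) * (n%:R * Ga) - 2 * k * (ga * c)).
    by rewrite ler_pM2l //; clear -k4 k5; lra.
  clear -k1 k6; lra.
move=> /(_ HA) k1.
have k2 : `|p + (al * m) *: G x| <= `|p| + al * (3 * L).
  apply: le_trans (ler_normD _ _) _; rewrite lerD2l normrZ normrM (gtr0_norm al0) -mulrA ler_pM2l //.
  by apply: ler_pM.
have k3 := ler_wpM2l d10 k2.
have k4 : al * X <= al * (2 * ga * c * k) by rewrite ler_pM2l.
rewrite XE in k4; clear -k1 k3 k4; lra.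
Qed.

(** * Sign of the solutions *)

(** Positivity anywhere would propagate to [y] without error term. Hence a zero of [u] makes it
    vanish identically, and the zero jet at [xf] contradicts [f xf > 0]. *)
Lemma strong_maximum_principle (R : realType) (n : nat) (Om : set 'rV[R]_n) (F : op_type R n) (d1 d0 ga Ga Lm lam : R) (f u : 'rV[R]_n -> R) (y xf : 'rV[R]_n) :
  (0 < n)%N -> 0 <= d1 -> 0 <= d0 -> 0 < ga -> ga <= Ga -> F2low Om F d1 d0 ga Ga -> F3 Om F -> open Om -> connected Om ->
  `|lam| <= Lm -> (forall x, Om x -> 0 <= f x) -> Om xf -> 0 < f xf -> (forall x, Om x -> {for x, continuous u}) ->
  Fsup Om F (fun x => lam * u x + f x) u -> (forall x, Om x -> 0 <= u x) -> Om y -> 0 < u y.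
Proof.
move=> n0 d10 d00 ga0 gG F2h F3h oO cO lamL f0 Oxf fxf uc us u0 Oy.
have Lm0 : 0 <= Lm by apply: le_trans lamL.
have Pu := Fsup_Psub F2h F3h us.
rewrite lt_neqAle u0 // andbT; apply/negP => /eqP uy.
have [[x1 [Ox1 ux1]]|nx] := pselect (exists x1, Om x1 /\ 0 < u x1).
  have /contP_eps/(_ _ (divr_gt0 ux1 (ltr0Sn R 1)))[e e0 He] := uc x1 Ox1.
  have C10 : 0 <= d0 + Lm by rewrite addr_ge0.
  have e20 : 0 < e / 2 by rewrite divr_gt0.
  have [d d0' Hd] := spread_point n0 ga0 gG d10 C10 oO cO Ox1 e20 Oy.
  have Nu : nonneg_super ga Ga d1 (d0 + Lm) 0 Om u.
    split=> //; apply: Psub_mono Pu _ => x Ox; split=> //; have fx := f0 x Ox; have ux := u0 x Ox.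
    have k1 : - lam * u x <= Lm * u x by rewrite ler_wpM2r // (le_trans (ler_norm _)) // normrN.
    by rewrite ger0_norm //; clear -k1 fx; lra.
  have := Hd u 0 (u x1 / 2) Nu (ltW (divr_gt0 ux1 (ltr0Sn R 1))) _ y.
  rewrite subrr normr0 mul0r subr0 -uy => /(_ _ d0'); rewrite leNgt mulr_gt0 ?divr_gt0 // => H; have : false; last by [].
  apply: H => x xe Ox; have := He x; rewrite ltr_norml => /(_ _)/andP[|k _].
    by apply: le_lt_trans xe _; rewrite ltr_pdivrMr // ltr_pMr // ltr1n.
  by clear -k; lra.
have uz x : Om x -> u x = 0.
  move=> Ox; apply/eqP; rewrite eq_le u0 // andbT leNgt; apply/negP => k; apply: nx; by exists x.
have [D D0 HD] := (openP_eps Om).1 oO xf Oxf.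
have J : ujet (fun x => - u x) xf 0 0.
  by exists D => // x /HD Ox; rewrite !uz // dot0l qf0m; clear; lra.
have := Pu xf 0 0 0 Oxf (@sym0 _ _) J; rewrite uz // !normr0 !mulr0 add0r sub0r add0r => /(_ _); rewrite leNgt oppr_lt0 fxf => H.
have : false; last by [].
by apply: H => A _; rewrite mulmx0 mxtrace0 oppr0.
Qed.

(** [u] is a full solution and hence locally Lipschitz, as [sub_super_diff] asks of the function
    subtracted. The gap between the two parameters acts on [- u <= m] and leaves the error
    [(lam - r) * m]. *)
Lemma diff_Psub (R : realType) (n : nat) (Om : set 'rV[R]_n) (F : op_type R n) (d1 d0 ga Ga nu Lm lam r t m : R) (f u v : 'rV[R]_n -> R) :
  (0 < n)%N -> 0 <= d1 -> 0 <= d0 -> 0 < ga -> ga <= Ga -> 2^-1 < nu <= 1 ->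
  F2low Om F d1 d0 ga Ga -> F1mod Om F nu -> F3 Om F -> open Om ->
  `|r| <= Lm -> r < lam -> 0 < t -> (forall x, Om x -> {for x, continuous f}) ->
  (forall x, Om x -> {for x, continuous u}) -> (forall x, Om x -> {for x, continuous v}) ->
  Fsub Om F (fun x => r * v x) v ->
  Fsub Om F (fun x => lam * u x + f x) u -> Fsup Om F (fun x => lam * u x + f x) u ->
  (forall x, Om x -> - m <= u x) ->
  Psub ga Ga d1 Om (fun x => (d0 + Lm) * `|u x - t * v x| + (lam - r) * m - f x) (fun x => t * v x - u x).
Proof.
move=> n0 d10 d00 ga0 gG nuh F2h F1h F3h oO rL rl t0 fc uc vc vs usb usp um.
have gc x : Om x -> {for x, continuous (fun x => lam * u x + f x)}.
  move=> Ox; apply: continuousD; last exact: fc.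
  by apply: continuousM; [exact: cst_continuous | exact: uc].
have ul := sol_loc_lip n0 d10 d00 ga0 gG nuh F2h F1h F3h oO uc gc usb usp.
have vs' := Fsub_scale F3h t0 vs.
have tvc x : Om x -> {for x, continuous (fun x => t * v x)}.
  by move=> Ox; apply: continuousM; [exact: cst_continuous | exact: vc].
have ac x : Om x -> {for x, continuous (fun x => t * (r * v x))}.
  by move=> Ox; apply: continuousM; [exact: cst_continuous | apply: continuousM; [exact: cst_continuous | exact: vc]].
have P := sub_super_diff n0 d10 d00 ga0 gG nuh F2h F1h oO ac gc tvc uc ul vs' usp.
apply: Psub_mono P _ => x Ox; split=> //; rewrite (distrC (t * v x) (u x)).
have k1 : - (r * (u x - t * v x)) <= Lm * `|u x - t * v x|.
  by apply: le_trans (ler_norm _) _; rewrite normrN normrM ler_wpM2r.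
have k2 : (lam - r) * (- u x) <= (lam - r) * m.
  by rewrite ler_pM2l ?subr_gt0 // lerNl um.
by clear -k1 k2; lra.
Qed.

Lemma small_width (R : realType) (s1 s0 k C C1 e : R) : 0 < s1 -> 0 < s0 -> 0 < k -> 0 < C -> 0 < C1 -> 0 < e ->
  exists s : R, [/\ 0 < s /\ s <= s1, s <= s0, k * s <= 1, C * s <= 1 & C * C1 * s <= 1 /\ s <= e].
Proof.
move=> s10 s00 k0 C0 C10 e0; have CC : 0 < C * C1 by exact: mulr_gt0.
pose s := Num.min s1 (Num.min s0 (Num.min k^-1 (Num.min C^-1 (Num.min (C * C1)^-1 e)))).
have : s <= s by []; rewrite {2}/s !le_min => /andP[k1 /andP[k2 /andP[k3 /andP[k4 /andP[k5 k6]]]]].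
exists s; split=> //.
- by split=> //; rewrite /s !lt_min s10 s00 e0 !invr_gt0 k0 C0 CC.
- by rewrite mulrC -ler_pdivlMr // div1r.
- by rewrite mulrC -ler_pdivlMr // div1r.
- by split=> //; rewrite mulrC -ler_pdivlMr // div1r.
Qed.

(** All constants are fixed before [lam], [u] and [v]. Once [m] is at least 1, the bounds on [u] and
    [v] are proportional to [m]; in the final strip argument the contribution of [f] is not, and it
    becomes negligible for [m >= m0]. The lower bound [c3] on [eps * m] forces this when [eps] is
    small. *)
Lemma antimaximum_jets (R : realType) (n : nat) (Om : set 'rV[R]_n) (F : op_type R n)
    (d : 'rV[R]_n -> R) (G : 'rV[R]_n -> 'rV[R]_n) (L c s0 d1 d0 ga Ga nu p J Lm : R) (f : 'rV[R]_n -> R) (xf : 'rV[R]_n) :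
  (0 < n)%N -> 0 <= d1 -> 0 <= d0 -> 0 < ga -> ga <= Ga -> 2^-1 < nu <= 1 ->
  F2low Om F d1 d0 ga Ga -> F1mod Om F nu -> F3 Om F -> open Om -> connected Om -> bounded_set Om ->
  regdom Om d G L c s0 -> n%:R < p ->
  (forall x, Om x -> {for x, continuous f}) -> (forall x, Om x -> 0 <= f x) -> Om xf -> 0 < f xf -> 0 < J ->
  (lebint_n (fun x => ((\1_Om x) * (`|f x| `^ p))%:E) <= (J `^ p)%:E)%E -> 0 <= Lm ->
  exists2 eta : R, 0 < eta & forall (lam r : R) (v u : 'rV[R]_n -> R), `|lam| <= Lm -> `|r| <= Lm -> r < lam -> lam - r <= eta ->
    (forall x, Om x -> {for x, continuous v}) -> (forall x, Om x -> v x < 0) -> Fsub Om F (fun x => r * v x) v ->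
    (forall x, Om x -> {for x, continuous u}) -> bdry_small Om d (fun x => `|u x|) ->
    Fsub Om F (fun x => lam * u x + f x) u -> Fsup Om F (fun x => lam * u x + f x) u ->
    (exists2 y, Om y & u y <= 0) -> forall x, Om x -> u x < 0.
Proof.
move=> n0 d10 d00 ga0 gG nuh F2h F1h F3h oO cO bO rd np fc f0 Oxf fxf J0 Hint Lm0.
have [OE dc [L0 [c0 s00]] dH _] := rd.
have dP x : Om x -> 0 < d x by rewrite OE.
have OmP x : 0 < d x -> Om x by rewrite OE.
have [C1 C1E] : {x | x = d0 + Lm + 1} by eexists.
have C10 : 0 < C1 by rewrite C1E ltr_wpDl // addr_ge0.
have [C [s1 [C0 s10 HS]]] := strip_bound rd bO n0 ga0 gG d10 np fc f0 J0 C10 Hint.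
have [k k0 HK] := strip_Psub rd n0 ga0 gG d10 (ltW C10).
have e10 : 0 < Num.min 1 (d xf) by rewrite lt_min ltr01 dP.
have [s [[s_0 ss1] ss0 ks Cs [CCs]]] := small_width s10 s00 k0 C0 C10 e10.
rewrite le_min => /andP[s_1 sxf].
have [[Dm Dm0 HDm] cKa] := shell_compact rd bO.
have s20 : 0 < s / 2 by rewrite divr_gt0.
have s2s : s / 2 <= s by rewrite ler_pdivrMr // ler_peMr ?(ltW s_0) // ler1n.
have cK := cKa s s_0; have cK' := cKa _ s20.
have KO x : s <= d x -> Om x by move=> k1; apply: OmP; exact: lt_le_trans k1.
have KO' x : s / 2 <= d x -> Om x by move=> k1; apply: OmP; exact: lt_le_trans k1.
have K'O : [set x | s / 2 <= d x] `<=` Om by exact: KO'.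
have KK' x : s <= d x -> s / 2 <= d x by exact: le_trans.
(* A cube of radius [rr] loses at most [s / 4] of depth, so two in succession, started where
   [d >= s], stay where [d >= s / 2]. *)
have [rr [rr0 rr1 rrL]] : exists rr : R, [/\ 0 < rr, rr <= 1 & L * rr <= s / 4].
  exists (Num.min 1 (s / 4 / L)); split; first by rewrite lt_min ltr01 !divr_gt0.
    by rewrite ge_min lexx.
  by rewrite mulrC -ler_pdivlMr // ge_min lexx orbT.
have Hd x y : Om x -> `|y - x| <= rr -> d x - s / 4 <= d y.
  move=> Ox yx; have [|k1 _ _] := dH x (y - x) Ox; first exact: le_trans rr1.
  have xE : x + (y - x) = y by rewrite addrC subrK.
  rewrite xE in k1; have k2 : L * `|y - x| <= L * rr by rewrite ler_pM2l.
  by move: k1; rewrite ler_norml => /andP[k1 _]; clear -k1 k2 rrL; lra.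
have [xB xBK HB] := @evt_max R n f _ (ex_intro _ xf (KK' _ sxf)) cK' (fun x xK => fc x (KO' x xK)).
have [Bf BfE] : {x | x = f xB} by eexists.
rewrite -BfE in HB; have Bf0 : 0 <= Bf by rewrite BfE; exact/f0/KO'.
have [Lu Lu0 Hlip] := lipschitz_cube n0 d10 d00 ga0 gG nuh F2h F1h F3h rr0.
have [cf cfE] : {x | x = f xf / 4} by eexists.
have cf0 : 0 < cf by rewrite cfE divr_gt0.
have [rf rf0 Hrf] : exists2 rf : R, 0 < rf & forall x : 'rV[R]_n, `|x - xf| <= rf -> Om x /\ 2 * cf <= f x.
  have [e e0 He] := cont_pos_near (fc xf Oxf) fxf; have [D D0 HD] := (openP_eps Om).1 oO xf Oxf.
  have m0 : 0 < Num.min e D by rewrite lt_min e0.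
  exists (Num.min e D / 2) => [|x k1]; first by rewrite divr_gt0.
  have : `|x - xf| < Num.min e D by apply: le_lt_trans k1 _; rewrite ltr_pdivrMr // ltr_pMr // ltr1n.
  by rewrite lt_min => /andP[/He k2 /HD Ox]; split=> //; rewrite cfE; clear -k2; lra.
have [kb kb0 Hkb] := source_bump n0 ga0 gG d10 (ltW C10) rf0 cf0.
have n0R : 0 < n%:R :> R by rewrite ltr0n.
have rb0 : 0 < rf / 2 / n%:R by rewrite !divr_gt0.
have HS' r0 (r00 : 0 < r0) := harnack_spread n0 ga0 gG d10 (ltW C10) oO cO r00 cK' K'O.
have [de1 de10 Hde1] := HS' _ rb0.
have [E1 E1E] : {x | x = C1 + 1} by eexists.
have E10 : 0 < E1 by rewrite E1E ltr_wpDl // ltW.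
(* The first bound covers the case where the error [E1 * (eps * m)] already exceeds [cf]; the second
   is the outcome of propagating the bump [kb] to [x1]. *)
have [c3 [c30 c3a c3b]] : exists c3 : R, [/\ 0 < c3, E1 * c3 <= cf & c3 * (1 + E1 / de1) <= de1 * kb].
  have q0 : 0 < 1 + E1 / de1 by rewrite ltr_pwDl // divr_ge0 // ltW.
  exists (Num.min (cf / E1) (de1 * kb / (1 + E1 / de1))); split.
  - by rewrite lt_min !divr_gt0 // mulr_gt0.
  - by rewrite mulrC -ler_pdivlMr // ge_min lexx.
  - by rewrite -ler_pdivlMr // ge_min lexx orbT.
have [N1 N1E] : {x | x = (2 + J) * (1 + Lm) + Bf} by eexists.
have J2 : 0 < 2 + J by rewrite addr_gt0.
have Lm1 : 0 < 1 + Lm by rewrite ltr_pwDl.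
have N10 : 0 < N1 by rewrite N1E ltr_pwDl // mulr_gt0.
have ball N al : 0 < N -> 0 < al -> exists rho : R, [/\ 0 < rho, rho <= rr & Lu * N * rho <= al].
  move=> N0 al0; have LN : 0 < Lu * N by rewrite mulr_gt0.
  exists (Num.min rr (al / (Lu * N))); split; first by rewrite lt_min rr0 divr_gt0.
    by rewrite ge_min lexx.
  by rewrite mulrC -ler_pdivlMr // ge_min lexx orbT.
have [r1 [r10 r1r Hr1]] := ball N1 (1 / 2) N10 (divr_gt0 ltr01 (ltr0Sn _ _)).
have [de2 de20 Hde2] := HS' _ r10.
have [ka kaE] : {x | x = 2 * (1 + (1 + E1 / de2) * 2 / de2) + J} by eexists.
have k20 : 0 < (1 + E1 / de2) * 2 / de2 by rewrite divr_gt0 // mulr_gt0 // ltr_pwDl // divr_ge0 // ltW.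
have ka0 : 0 < ka by rewrite kaE addr_gt0 // mulr_gt0 // addr_gt0.
have [N2 N2E] : {x | x = (ka + 1) * (1 + Lm) + Bf} by eexists.
have N20 : 0 < N2 by rewrite N2E ltr_pwDl // mulr_gt0 // addr_gt0.
have [r2 [r20 r2r Hr2]] := ball N2 (1 / 4) N20 (divr_gt0 ltr01 (ltr0Sn _ _)).
have [de3 de30 Hde3] := HS' _ r20.
have [th thE] : {x | x = de3 / 16} by eexists.
have th0 : 0 < th by rewrite thE divr_gt0.
have [r3 [r30 r3r Hr3]] := ball N2 (th / 2) N20 (divr_gt0 th0 (ltr0Sn _ _)).
have [de4 de40 Hde4] := HS' _ r30.
have [A AE] : {x | x = Dm + k * Dm ^+ 2} by eexists.
have A0 : 0 < A by rewrite AE addr_gt0 // mulr_gt0 // exprn_gt0.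
(* For [m >= m0] the slope [th * m / A] of the final barrier exceeds [C * J], the slope that [f] can
   produce in the strip. *)
have [m0 m0E] : {x | x = 1 + C * J * A / th} by eexists.
have CJA : 0 < C * J * A / th by rewrite divr_gt0 // mulr_gt0 // mulr_gt0.
have m00 : 1 <= m0 by rewrite m0E lerDl ltW.
have m0p : 0 < m0 by exact: lt_le_trans m00.
(* The bound with [m0] combines with [c3 <= eps * m] to give [m >= m0]; the last one yields the
   contradiction behind [u <= - (th * m)]. *)
have [eta [eta0 eta8 etam etaE]] : exists eta : R, [/\ 0 < eta, eta <= 1 / 8, eta * m0 <= c3 & eta * (1 + E1 / de4) <= de4 * th / 4].
  have q0 : 0 < 1 + E1 / de4 by rewrite ltr_pwDl // divr_ge0 // ltW.
  exists (Num.min (1 / 8) (Num.min (c3 / m0) (de4 * th / 4 / (1 + E1 / de4)))); split.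
  - by rewrite !lt_min !divr_gt0 // mulr_gt0.
  - by rewrite ge_min lexx.
  - by rewrite -ler_pdivlMr // !ge_min lexx orbT.
  - by rewrite -ler_pdivlMr // !ge_min lexx !orbT.
exists eta => // lam r v u lamL rL rlam leta vc v0 vs uc ub usb usp [y0 Oy0 uy0].
have [eps epsE] : {x | x = lam - r} by eexists.
rewrite -epsE in leta; have eps0 : 0 < eps by rewrite epsE subr_gt0.
have [y [Oy uy]] : exists y, Om y /\ u y < 0.
  have [//|nn] := pselect (exists y, Om y /\ u y < 0).
  have u0 x : Om x -> 0 <= u x by move=> Ox; rewrite leNgt; apply/negP => k1; apply: nn; exists x.
  have := strong_maximum_principle n0 d10 d00 ga0 gG F2h F3h oO cO lamL f0 Oxf fxf uc usp u0 Oy0.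
  by rewrite ltNge uy0.
have nuc x : Om x -> {for x, continuous (fun x => - u x)} by move=> /uc; exact: continuousN.
have nub : bdry_small Om d (fun x => - u x).
  move=> e /ub[de de0 Hde]; exists de => // x Ox /(Hde x Ox); apply: le_lt_trans.
  by rewrite -normrN ler_norm.
have nuy : 0 < - u y by rewrite oppr_gt0.
have [xm Oxm Hxm] := max_attained rd bO nuc nub Oy nuy.
have [m mE] : {x | x = - u xm} by eexists.
rewrite -mE in Hxm; have m_0 : 0 < m by apply: lt_le_trans nuy _; exact: Hxm.
have um x : Om x -> - m <= u x by move=> /Hxm; rewrite lerNl.
have abs_le a x : `|a| <= Lm -> a * x <= Lm * `|x| by move=> aL; apply: le_trans (ler_norm _) _; rewrite normrM ler_wpM2r.
have absN_le a x : `|a| <= Lm -> - (a * x) <= Lm * `|x| by move=> aL; apply: le_trans (ler_norm _) _; rewrite normrN normrM ler_wpM2r.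
have Pnu := Fsup_Psub F2h F3h usp; have Pu := Fsub_Psub F2h F3h usb.
(* [strip_bound] limits the excess of [- u] over its bound on the inner set, and [C * C1 * s <= 1]
   makes this excess at most [mu]. The sign of [f] is favourable here; for the upper bound [Hmax] it
   costs [J]. *)
have Hmin mu : 0 <= mu -> (forall x, s <= d x -> - u x <= mu) -> forall x, Om x -> - u x <= 2 * mu.
  move=> mu0 Hmu x Ox.
  have [k1|k1] := leP s (d x); first by apply: le_trans (Hmu x k1) _; clear -mu0; lra.
  have := HS s (C1 * mu) 0 (fun x => - u x - mu) s_0 ss1 _ _ _ _ _ (lexx 0) x Ox.
  rewrite mul0r addr0 => k2; have {k2} : - u x - mu <= C * (C1 * mu) * d x.
    apply: k2.
    - by move=> x' Ox'; apply: continuousB; [exact: nuc | exact: cst_continuous].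
    - by move=> e /nub[de de0 Hde]; exists de => // x' Ox' /(Hde x' Ox'); apply: le_lt_trans; rewrite gerBl.
    - by move=> x' /Hmu; rewrite subr_le0.
    - apply: (Psub_shift (k := - mu) _ (fun _ => erefl)); apply: Psub_mono Pnu _ => x' [Ox' wx']; split=> //.
      have := absN_le lam (u x') lamL; have := f0 x' Ox'; have wx : u x' < 0 by clear -wx' mu0; lra.
      rewrite ltr0_norm // C1E => k3 k4; clear -k3 k4 wx; lra.
    - by rewrite mulr_ge0 // ltW.
  have k3 : C * C1 * d x <= 1 by apply: le_trans CCs; rewrite ler_pM2l ?mulr_gt0 // ltW.
  have k4 : C * C1 * d x * mu <= 1 * mu by rewrite ler_wpM2r.
  by clear -k4; lra.
have Hmax mu : 0 <= mu -> (forall x, s <= d x -> u x <= mu) -> forall x, Om x -> u x <= 2 * mu + J.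
  move=> mu0 Hmu x Ox.
  have [k1|k1] := leP s (d x); first by apply: le_trans (Hmu x k1) _; clear -mu0 J0; lra.
  have := HS s (C1 * mu) 1 (fun x => u x - mu) s_0 ss1 _ _ _ _ _ ler01 x Ox.
  rewrite mul1r => k2; have {k2} : u x - mu <= C * (C1 * mu + J) * d x.
    apply: k2.
    - by move=> x' Ox'; apply: continuousB; [exact: uc | exact: cst_continuous].
    - move=> e /ub[de de0 Hde]; exists de => // x' Ox' /(Hde x' Ox'); apply: le_lt_trans.
      by apply: le_trans (ler_norm (u x')); rewrite gerBl.
    - by move=> x' /Hmu; rewrite subr_le0.
    - apply: (Psub_shift (k := - mu) _ (fun _ => erefl)); apply: Psub_mono Pu _ => x' [Ox' wx']; split=> //.
      have := abs_le lam (u x') lamL; have wx : 0 < u x' by clear -wx' mu0; lra.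
      rewrite gtr0_norm // C1E => k3; clear -k3 wx; lra.
    - by rewrite mulr_ge0 // ltW.
  have k3 : C * C1 * d x <= 1 by apply: le_trans CCs; rewrite ler_pM2l ?mulr_gt0 // ltW.
  have k4 : C * C1 * d x * mu <= 1 * mu by rewrite ler_wpM2r.
  have k5 : C * d x <= 1 by apply: le_trans Cs; rewrite ler_pM2l // ltW.
  have k6 : C * d x * J <= 1 * J by rewrite ler_pM2r.
  by clear -k4 k6; lra.
(* If [u] were nonnegative on the inner set, [Hmin] with [mu = 0] would make it nonnegative
   everywhere. *)
have [yk sk uyk] : exists2 yk, s <= d yk & u yk < 0.
  have [[yk [? ?]]|nn] := pselect (exists yk, s <= d yk /\ u yk < 0); first by exists yk.
  have k1 := Hmin 0 (lexx 0) _ xm Oxm; move: k1; rewrite mulr0 -mE leNgt m_0 => k1.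
  have : false; last by [].
  by apply: k1 => x sx; rewrite oppr_le0 leNgt; apply/negP => k2; apply: nn; exists x.
have KNE : [set x | s <= d x] !=set0 by exists yk.
have [x1 x1K Hx1] := @evt_max R n (fun x => u x / v x) _ KNE cK
   (fun x sx => continuousM (uc x (KO x sx)) (continuousV (ltr0_neq0 (v0 x (KO x sx))) (vc x (KO x sx)))).
have [t tE] : {t | t = u x1 / v x1} by eexists.
rewrite -tE in Hx1; have t0 : 0 < t.
  by apply: lt_le_trans (Hx1 yk sk); rewrite nmulr_rgt0 // invr_lt0 v0 //; exact: KO.
have z1 : u x1 - t * v x1 = 0 by rewrite tE divfK ?subrr // ltr0_neq0 // v0 //; exact: KO.
have zK x : s <= d x -> 0 <= u x - t * v x.
  by move=> sx; rewrite subr_ge0 -ler_ndivrMr ?v0 //; [exact: Hx1 | exact: KO].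
have Pz := diff_Psub n0 d10 d00 ga0 gG nuh F2h F1h F3h oO rL rlam t0 fc uc vc vs usb usp um.
rewrite -epsE in Pz.
have zc x : Om x -> {for x, continuous (fun x => u x - t * v x)}.
  by move=> Ox; apply: continuousB; [exact: uc | apply: continuousM; [exact: cst_continuous | exact: vc]].
have tv0 x : Om x -> t * v x < 0 by move=> Ox; rewrite nmulr_llt0 // v0.
have em0 : 0 < eps * m by rewrite mulr_gt0.
have zlb x : Om x -> - (eps * m) <= u x - t * v x.
  move=> Ox; have [k1|k1] := leP s (d x).
    by apply: le_trans (zK x k1); rewrite oppr_le0 ltW.
  have := HS s (eps * m) 0 (fun x => t * v x - u x) s_0 ss1 _ _ _ _ (ltW em0) (lexx 0) x Ox.
  rewrite mul0r addr0 => k2; have {k2} : t * v x - u x <= C * (eps * m) * d x.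
    apply: k2.
    - by move=> x' Ox'; apply: continuousB; [apply: continuousM; [exact: cst_continuous | exact: vc] | exact: uc].
    - move=> e /nub[de de0 Hde]; exists de => // x' Ox' /(Hde x' Ox'); apply: le_lt_trans.
      by rewrite gerDr ltW // tv0.
    - by move=> x' /zK k3; clear -k3; lra.
    - apply: Psub_mono Pz _ => x' [Ox' wx']; split=> //.
      have fx := f0 x' Ox'; rewrite C1E ltr0_norm; last by clear -wx'; lra.
      by clear -fx wx'; lra.
  have k5 : C * d x <= 1 by apply: le_trans Cs; rewrite ler_pM2l // ltW.
  have k6 : C * d x * (eps * m) <= 1 * (eps * m) by rewrite ler_pM2r.
  by clear -k6; lra.
have eps1 : eps <= 1 by clear -leta eta8; lra.
(* Raised by [eps * m], the difference is nonnegative and positivity propagates. Its value at [x1]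
   is exactly [eps * m], which caps every lower bound carried to [x1]. *)
pose Z x := u x - t * v x + eps * m.
have PZ : Psub ga Ga d1 Om (fun x => C1 * Z x + E1 * (eps * m) - f x) (fun x => - Z x).
  apply: (Psub_shift (k := - (eps * m)) (w := fun x => t * v x - u x)); last by move=> x; rewrite /Z; ring.
  apply: Psub_mono Pz _ => x Ox; split=> //; rewrite lerD2r E1E /Z.
  have k1 : `|u x - t * v x| <= u x - t * v x + 2 * (eps * m).
    by rewrite ler_norml; have := zlb x Ox; clear -em0; move=> k1; apply/andP; split; lra.
  have k2 : (d0 + Lm) * `|u x - t * v x| <= C1 * `|u x - t * v x| by rewrite ler_wpM2r // C1E lerDl.
  have k3 : C1 * `|u x - t * v x| <= C1 * (u x - t * v x + 2 * (eps * m)) by rewrite ler_pM2l.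
  by clear -k2 k3; lra.
have Z0 x : Om x -> 0 <= Z x by move=> /zlb; rewrite /Z; clear; lra.
have Zc x : Om x -> {for x, continuous Z}.
  by move=> Ox; apply: continuousD; [exact: zc | exact: cst_continuous].
have NZ : nonneg_super ga Ga d1 C1 (E1 * (eps * m)) Om Z.
  split=> //; first by rewrite mulr_ge0 // ltW.
  by apply: Psub_mono PZ _ => x Ox; split=> //; rewrite gerBl f0.
have Zx1 : Z x1 = eps * m by rewrite /Z z1 add0r.
have HZ de c' : 0 < de -> de * c' - E1 * (eps * m) / de <= Z x1 -> de * c' <= eps * m * (1 + E1 / de).
  by move=> de0; rewrite Zx1; clear; lra.
(* [f > 0] near [xf] keeps [Z] away from [0], whereas [Z x1 = eps * m]. *)
have S1 : c3 <= eps * m.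
  have [k1|k1] := lerP (E1 * (eps * m)) cf; last first.
    by rewrite -(ler_pM2l E10); apply: le_trans c3a (ltW k1).
  have Hk : forall x : 'rV[R]_n, n%:R * `|x - xf| <= rf / 2 -> kb <= Z x.
    apply: Hkb.
      by move=> x /Hrf[Ox _]; split; [exact: Zc | exact: Z0].
    apply: Psub_mono PZ _ => x /Hrf[Ox fx]; split=> //; clear -k1 fx; lra.
  have := Hde1 xf x1 Z _ kb (KK' _ sxf) (KK' _ x1K) NZ (ltW kb0) _.
  move=> k2; have q0 : 0 < 1 + E1 / de1 by rewrite ltr_pwDl // divr_ge0 // ltW.
  rewrite -(ler_pM2r q0); apply: le_trans c3b _; apply: HZ => //; apply: k2 => x k3 Ox; apply: Hk.
  by rewrite mulrC -ler_pdivlMr.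
have mm0 : m0 <= m.
  rewrite -(ler_pM2l eps0); apply: le_trans S1; apply: le_trans etam; by rewrite ler_pM2r.
have m1 : 1 <= m by exact: le_trans mm0.
have Lip N : 0 < N -> (forall x, Om x -> `|u x| <= N) -> (forall x, s / 2 <= d x -> `|lam * u x + f x| <= N) ->
    forall x x', s <= d x -> `|x' - x| <= rr -> `|u x' - u x| <= Lu * N * `|x' - x|.
  move=> N0 uN gN x x' sx xx'; have Ox := KO x sx; have k1 := Hd x x' Ox xx'.
  have k1' : s * (3 / 4) <= d x' by clear -k1 sx; lra.
  have Ox' : Om x' by apply: OmP; clear -k1' s_0; lra.
  have cube a : Om a -> s * (3 / 4) <= d a -> forall b, `|b - a| <= rr -> s / 2 <= d b.
    by move=> Oa sa b /(Hd a b Oa) k2; clear -k2 sa; lra.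
  have H a b : Om a -> s * (3 / 4) <= d a -> `|b - a| <= rr -> u a - u b <= Lu * N * `|a - b|.
    move=> Oa sa ba; apply: (Hlip u (fun x => lam * u x + f x)) => //.
      by move=> x2 /(cube a Oa sa)/KO' O2; split=> //; exact: uc.
    by move=> x2 /(cube a Oa sa) k2; split; [apply: uN; exact: KO' | exact: gN].
  rewrite ler_norml; have k2 := H x' x Ox' k1' _; rewrite (distrC x x') in k2; have k3 := H x x' Ox _ xx'.
  rewrite (distrC x x') in k3; have {}k2 := k2 xx'; have {}k3 : u x - u x' <= Lu * N * `|x' - x| by apply: k3; clear -sx s_0; lra.
  by apply/andP; split; clear -k2 k3; lra.
have gN N x : s / 2 <= d x -> 0 <= N -> (forall x, Om x -> `|u x| <= N) -> `|lam * u x + f x| <= Lm * N + Bf.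
  move=> sx N0 uN; apply: le_trans (ler_normD _ _) _; apply: lerD.
    by rewrite normrM; apply: ler_pM => //; exact/uN/KO'.
  by rewrite ger0_norm ?f0 //; [exact: HB | exact: KO'].
have [xk xkK Hxk] := @evt_max R n u _ KNE cK (fun x sx => uc x (KO x sx)).
have ErP (de : R) : 0 < de -> 0 < 1 + E1 / de by move=> de0; rewrite ltr_pwDl // divr_ge0 // ltW.
(* By the Lipschitz estimate a maximum [mu > m] of [u] on the inner set persists, up to a factor 2,
   on a cube of fixed radius. There [Z >= u >= mu / 2], and propagation to [x1] bounds [mu] by a
   multiple of [m]. *)
have S2 x : Om x -> u x <= ka * m.
  move=> Ox; suff k1 : u xk <= (1 + (1 + E1 / de2) * 2 / de2) * m.
    have k2 : 0 <= (1 + (1 + E1 / de2) * 2 / de2) * m by rewrite mulr_ge0 ?(ltW m_0) // addr_ge0 // ltW.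
    apply: le_trans (Hmax _ k2 (fun x' sx => le_trans (Hxk x' sx) k1) x Ox) _.
    have k3 : J * 1 <= J * m by rewrite ler_pM2l.
    by rewrite kaE; clear -k3; lra.
  have [k1|k1] := lerP (u xk) m.
    by apply: le_trans k1 _; rewrite ler_peMl ?(ltW m_0) // lerDl ltW.
  have [mu muE] : {x | x = u xk} by eexists.
  rewrite -muE in k1 Hxk *; have mu1 : 1 <= mu by exact: le_trans (ltW k1).
  have mu0 : 0 < mu by exact: lt_le_trans mu1.
  have uN x' : Om x' -> `|u x'| <= (2 + J) * mu.
    move=> Ox'; have k2 := Hmax mu (ltW mu0) Hxk x' Ox'; have k3 := um x' Ox'.
    have k4 : J * 1 <= J * mu by rewrite ler_pM2l.
    have k5 : 0 < J * mu by rewrite mulr_gt0.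
    by rewrite ler_norml; apply/andP; split; [clear -k3 k1 k5 mu0 | clear -k2 k4]; lra.
  have N0 : 0 < N1 * mu by rewrite mulr_gt0.
  have kB : Bf * 1 <= Bf * mu by rewrite ler_wpM2l.
  have kL : 0 <= Lm * ((2 + J) * mu) by rewrite mulr_ge0 // mulr_ge0 // ltW.
  have kL' : 0 <= (2 + J) * mu by rewrite mulr_ge0 // ltW.
  have uN1 x' : Om x' -> `|u x'| <= N1 * mu.
    move=> /uN k2; rewrite N1E; clear -k2 kB kL Bf0; lra.
  have gN1 x' : s / 2 <= d x' -> `|lam * u x' + f x'| <= N1 * mu.
    move=> sx'; have := gN _ x' sx' kL' uN; rewrite N1E => k2; clear -k2 kB kL'; lra.
  have HL := Lip _ N0 uN1 gN1.
  have := Hde2 xk x1 Z _ (mu / 2) (KK' _ xkK) (KK' _ x1K) NZ (ltW (divr_gt0 mu0 (ltr0Sn _ _))) _.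
  move=> k2; have {k2} : de2 * (mu / 2) <= eps * m * (1 + E1 / de2).
    apply: HZ => //; apply: k2 => x' x'r Ox'; have := HL xk x' xkK (le_trans x'r r1r).
    rewrite ler_norml => /andP[k3 _]; rewrite -muE in k3.
    have k4 : Lu * (N1 * mu) * `|x' - xk| <= Lu * (N1 * mu) * r1 by rewrite ler_pM2l // mulr_gt0.
    have k5 : Lu * N1 * r1 * mu <= 1 / 2 * mu by rewrite ler_pM2r.
    have k6 := tv0 x' Ox'; rewrite /Z; clear -k3 k4 k5 k6 em0; lra.
  have k3 : eps * m * (1 + E1 / de2) <= 1 * m * (1 + E1 / de2) by rewrite ler_pM2r ?ErP // ler_pM2r.
  rewrite mulrDl mul1r => k4; apply: ler_wpDl; first exact: ltW.
  have k5 : de2 * mu <= de2 * ((1 + E1 / de2) * 2 / de2 * m).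
    have -> : de2 * ((1 + E1 / de2) * 2 / de2 * m) = m * (1 + E1 / de2) * 2 by field; rewrite gt_eqF.
    by clear -k3 k4; lra.
  by move: k5; rewrite ler_pM2l.
have N2m0 : 0 < N2 * m by rewrite mulr_gt0.
have uN x : Om x -> `|u x| <= (ka + 1) * m.
  move=> Ox; have k1 := S2 x Ox; have k2 := um x Ox; have k3 : 0 < ka * m by rewrite mulr_gt0.
  by rewrite ler_norml; apply/andP; split; [clear -k2 k3 | clear -k1 m_0]; lra.
have kB : Bf * 1 <= Bf * m by rewrite ler_wpM2l.
have kL' : 0 <= (ka + 1) * m by rewrite mulr_ge0 ?(ltW m_0) // addr_ge0 // ltW.
have kL : 0 <= Lm * ((ka + 1) * m) by rewrite mulr_ge0.
have HL : forall x x', s <= d x -> `|x' - x| <= rr -> `|u x' - u x| <= Lu * (N2 * m) * `|x' - x|.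
  apply: Lip => // x.
    by move=> /uN k2; rewrite N2E; clear -k2 kB kL Bf0; lra.
  by move=> sx; have := gN _ x sx kL' uN; rewrite N2E => k2; clear -k2 kB kL'; lra.
have LN2 : 0 < Lu * (N2 * m) by rewrite mulr_gt0.
have [xn xnK Hxn] := @evt_max R n (fun x => - u x) _ KNE cK (fun x sx => nuc x (KO x sx)).
have un : u xn <= - (m / 2).
  have k0' : 0 <= - u xn by apply: le_trans (Hxn yk sk); rewrite oppr_ge0 ltW.
  by have := Hmin _ k0' Hxn xm Oxm; rewrite -mE; clear; lra.
have tvc x : Om x -> {for x, continuous (fun x => - (t * v x))}.
  by move=> Ox; apply: continuousN; apply: continuousM; [exact: cst_continuous | exact: vc].
have PV := Fsub_Psub F2h F3h (Fsub_scale F3h t0 vs).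
have NV : nonneg_super ga Ga d1 C1 0 Om (fun x => - (t * v x)).
  split=> //; first by move=> x /tv0 k1; rewrite oppr_ge0 ltW.
  apply: (Psub_shift (k := 0) (w := fun x => t * v x)); last by move=> x; rewrite opprK addr0.
  apply: Psub_mono PV _ => x Ox; split=> //; have := abs_le r (t * v x) rL; have k1 := tv0 x Ox.
  by rewrite ltr0_norm // C1E => k2; clear -k1 k2; lra.
have m8 : 0 < m / 8 by rewrite divr_gt0.
(* Near the minimum point [xn] one has [- t v >= - u - eps * m >= m / 8], and [- t v] is a
   nonnegative supersolution without error, so this bound spreads. *)
have V8 x : s / 2 <= d x -> 2 * th * m <= - (t * v x).
  move=> sx; have := Hde3 xn x _ 0 (m / 8) (KK' _ xnK) sx NV (ltW m8) _.
  rewrite mul0r subr0 => k1; have {k1} : de3 * (m / 8) <= - (t * v x).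
    apply: k1 => x' x'r Ox'; have := HL xn x' xnK (le_trans x'r r2r).
    rewrite ler_norml => /andP[_ k3].
    have k4 : Lu * (N2 * m) * `|x' - xn| <= Lu * (N2 * m) * r2 by rewrite ler_pM2l.
    have k5 : Lu * N2 * r2 * m <= 1 / 4 * m by rewrite ler_pM2r.
    have k6 := zlb x' Ox'; have k7 : eps * m <= 1 / 8 * m by rewrite ler_pM2r //; apply: le_trans eta8.
    by clear -un k3 k4 k5 k6 k7; lra.
  by rewrite thE; clear; lra.
have thm : 0 < th * m by rewrite mulr_gt0.
(* If [u] were not very negative at [x], then [Z = u - t v + eps m] would be of order [m] around [x]. *)
have S3 x : s <= d x -> u x <= - (th * m).
  move=> sx; rewrite leNgt; apply/negP => k1.
  have := Hde4 x x1 Z _ (th * m / 2) (KK' _ sx) (KK' _ x1K) NZ (ltW (divr_gt0 thm (ltr0Sn _ _))) _.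
  move=> k2; have {k2} : de4 * (th * m / 2) <= eps * m * (1 + E1 / de4).
    apply: HZ => //; apply: k2 => x' x'r Ox'; have := HL x x' sx (le_trans x'r r3r).
    rewrite ler_norml => /andP[k3 _].
    have k4 : Lu * (N2 * m) * `|x' - x| <= Lu * (N2 * m) * r3 by rewrite ler_pM2l.
    have k5 : Lu * N2 * r3 * m <= th / 2 * m by rewrite ler_pM2r.
    have k6 : 2 * th * m <= - (t * v x').
      by apply: V8; have := Hd x x' (KO x sx) (le_trans x'r r3r); clear -sx s_0; lra.
    by rewrite /Z; clear -k1 k3 k4 k5 k6 em0; lra.
  have k3 : eps * (1 + E1 / de4) <= eta * (1 + E1 / de4) by rewrite ler_pM2r // ErP.
  have k4 : eps * (1 + E1 / de4) * m <= de4 * th / 4 * m by rewrite ler_pM2r //; apply: le_trans k3 etaE.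
  have k5 : 0 < de4 * th * m by rewrite mulr_gt0 // mulr_gt0.
  by clear -k4 k5; lra.
(* As [A] bounds [d + k * d ^+ 2], this slope makes the barrier at most [th * m], so that [w <= 0]
   on the inner set. *)
have [al alE] : {x | x = th * m / A} by eexists.
have al0 : 0 < al by rewrite alE divr_gt0.
have alA : al * A = th * m by rewrite alE divfK // gt_eqF.
have alC : C * J < al.
  have E : C * J * A = th * (C * J * A / th) by field; rewrite gt_eqF.
  by rewrite alE ltr_pdivlMr // E ltr_pM2l //; apply: lt_le_trans mm0; rewrite m0E ltrDr ltr01.
pose w x := u x + al * (d x + k * d x ^+ 2).
have dd x : Om x -> 0 < d x + k * d x ^+ 2.
  by move=> /dP dx; rewrite addr_gt0 // mulr_gt0 // exprn_gt0.
have wK x : s <= d x -> w x <= 0.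
  move=> sx; have dx := dP x (KO x sx); have k1 := HDm x (KO x sx); have k2 := S3 x sx.
  have k3 : d x ^+ 2 <= Dm ^+ 2 by rewrite ler_sqr ?nnegrE ?(ltW dx) ?(ltW Dm0).
  have k4 : al * (d x + k * d x ^+ 2) <= al * A by rewrite ler_pM2l // AE lerD // ler_pM2l.
  by rewrite /w; clear -k2 k4 alA; lra.
have ds2 x : Om x -> d x < s -> d x + k * d x ^+ 2 <= 2 * d x.
  move=> /dP dx dxs; have k1 : k * d x <= 1 by apply: le_trans ks; rewrite ler_pM2l // ltW.
  have k2 : k * d x * d x <= 1 * d x by rewrite ler_pM2r.
  by clear -k2; lra.
have Pw := HK s al _ u ss0 ks al0 (Psub_mono Pu (D' := [set x | Om x /\ d x < s]) (fun x h => conj h.1 (lexx _))).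
have wc x : Om x -> {for x, continuous w}.
  move=> Ox; apply: continuousD; first exact: uc.
  apply: continuousM; first exact: cst_continuous.
  apply: continuousD; first exact: dc.
  by apply: continuousM; [exact: cst_continuous | apply: continuousM; exact: dc].
have wb : bdry_small Om d w.
  move=> e e0; have e2 : 0 < e / 2 by rewrite divr_gt0.
  have [de de0 Hde] := ub _ e2; have a4 : 0 < 4 * al by rewrite mulr_gt0.
  exists (Num.min de (Num.min s (e / (4 * al)))); first by rewrite !lt_min de0 s_0 divr_gt0.
  move=> x Ox; rewrite !lt_min => /and3P[/(Hde x Ox) k1 k2 k3].
  have k4 : al * (d x + k * d x ^+ 2) <= al * (2 * d x) by rewrite ler_pM2l //; exact: ds2.
  have k5 : d x * (4 * al) < e by rewrite -ltr_pdivlMr.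
  have k6 := ler_norm (u x); rewrite /w; clear -k1 k4 k5 k6; lra.
(* The gain [- 2 * al * C1] of [strip_Psub] offsets the replacement of [|u|] by [w + 2 * al], so
   [strip_bound] applies with [e = 0] and only [f] contributes. *)
have Hw x : Om x -> w x <= C * J * d x.
  move=> Ox; have := HS s 0 1 w s_0 ss1 wc wb wK _ (lexx 0) ler01 x Ox.
  rewrite add0r mul1r; apply; apply: Psub_mono Pw _ => x' [Ox' wx'].
  have dxs : d x' < s by rewrite ltNge; apply/negP => /wK; rewrite leNgt wx'.
  split=> //; rewrite mul1r addr0 lerBlDr.
  have k1 : al * (d x' + k * d x' ^+ 2) <= al * (2 * d x') by rewrite ler_pM2l //; exact: ds2.
  have k2 : al * (2 * d x') <= al * 2 by rewrite ler_pM2l // ler_piMr //; apply: le_trans (ltW dxs) s_1.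
  have k3 : 0 < al * (d x' + k * d x' ^+ 2) by rewrite mulr_gt0 // dd.
  have k4 : `|u x'| <= w x' + 2 * al.
    by rewrite ler_norml; move: wx'; rewrite /w => wx'; apply/andP; split; [clear -wx' k1 k2 k3 al0 | clear -k3 al0]; lra.
  have k5 := abs_le lam (u x') lamL.
  have k6 : C1 * `|u x'| <= C1 * (w x' + 2 * al) by rewrite ler_pM2l.
  have k7 : (d0 + Lm) * `|u x'| <= C1 * `|u x'| by rewrite ler_wpM2r // C1E lerDl.
  by clear -k5 k6 k7; lra.
move=> x Ox; have k1 := Hw x Ox; have dx := dP x Ox.
have k2 : C * J * d x < al * d x by rewrite ltr_pM2r.
have k3 : 0 < al * (k * d x ^+ 2) by rewrite mulr_gt0 // mulr_gt0 // exprn_gt0.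
by move: k1; rewrite /w; clear -k2 k3; lra.
Qed.

(** Near a boundary point [|u|] is small, near an interior point [d] is bounded below; compactness
    of the closure gives one threshold for [d]. *)
Lemma boundary_smallness (R : realType) (n : nat) (Om : set 'rV[R]_n) (d : 'rV[R]_n -> R) (G : 'rV[R]_n -> 'rV[R]_n)
    (L c s0 : R) (u : 'rV[R]_n -> R) : regdom Om d G L c s0 -> bounded_set Om -> {within closure Om, continuous u} ->
  (forall x, (closure Om `\` Om) x -> u x = 0) -> bdry_small Om d (fun x => `|u x|).
Proof.
move=> [OE dc _ _ _] bO uc u0 e e0; have [cC _] := compact_closure bO.
have dP x : Om x -> 0 < d x by rewrite OE.
have [|x r r' Cx H r'0 rr Ox|x Cx|r r0 Hr] := @compact_unif R n (closure Om) (fun x r => Om x -> r <= d x \/ `|u x| < e).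
- by [].
- by have [k|k] := H Ox; [left; exact: le_trans k | right].
- have [Ox|nOx] := pselect (Om x).
    have [h h0 Hh] := cont_pos_near (dc x) (dP x Ox); have d2 : 0 < d x / 2 by rewrite divr_gt0 // dP.
    exists (Num.min h (d x / 2)); first by rewrite lt_min h0.
    move=> y _; rewrite lt_min => /andP[/Hh k1 _] Oy; left; apply: le_trans (ltW k1); by rewrite ge_min lexx orbT.
  have /subspace_continuousP/(_ x Cx)/cvgrPdist_lt/(_ e e0) := uc.
  rewrite near_withinE => /nearP_eps[h h0 Hh].
  exists h => // y Cy yx _; right; have k : `|u x - u y| < e := Hh y yx Cy.
  by move: k; rewrite u0 // sub0r normrN.
by exists r => // x Ox dx; have [|//] := Hr x (subset_closure Ox) Ox; rewrite leNgt dx.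
Qed.

Lemma Lp_bound (R : realType) (n : nat) (p : R) (Om : set 'rV[R]_n) (f : 'rV[R]_n -> R) : 0 < p -> Lp_on p Om f ->
  exists2 J : R, 0 < J & (lebint_n (fun x => ((\1_Om x) * (`|f x| `^ p))%:E) <= (J `^ p)%:E)%E.
Proof.
move=> p0; rewrite /Lp_on; case: (lebint_n _) => [a _| |_]; last by exists 1; rewrite ?leNye.
  exists ((`|a| + 1) `^ p^-1); first by rewrite powR_gt0 // ltr_wpDl.
  rewrite -powRrM mulVf ?gt_eqF // powRr1 ?addr_ge0 // lee_fin.
  by apply: le_trans (ler_norm a) _; rewrite lerDl.
by rewrite ltxx.
Qed.

Lemma antimaximum_negative (R : realType) (n : nat) (Om : set 'rV[R]_n) (F : op_type R n) (d1 d0 ga Ga nu p l : R) (f : 'rV[R]_n -> R) :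
  (0 < n)%N -> smooth_domain Om -> 0 <= d1 -> 0 <= d0 -> 0 < ga -> ga <= Ga -> 2^-1 < nu <= 1 ->
  F2low Om F d1 d0 ga Ga -> F1mod Om F nu -> F3 Om F -> n%:R < p -> cont_on Om f -> Lp_on p Om f ->
  (exists x, Om x /\ f x != 0) -> (forall x, Om x -> 0 <= f x) ->
  exists2 eta : R, 0 < eta & forall (lam r : R) (v u : 'rV[R]_n -> R), l < lam -> lam <= l + eta -> r <= l -> l - eta < r ->
    cont_on Om v -> (forall x, Om x -> v x < 0) -> Fsub Om F (fun x => r * v x) v ->
    cont_on Om u -> {within closure Om, continuous u} -> (forall x, (closure Om `\` Om) x -> u x = 0) ->
    Fsub Om F (fun x => lam * u x + f x) u -> Fsup Om F (fun x => lam * u x + f x) u ->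
    (exists2 y, Om y & u y <= 0) -> forall x, Om x -> u x < 0.
Proof.
move=> n0 sO d10 d00 ga0 gG nuh F2h F1h F3h np fc fL [xf [Oxf fxf]] f0.
have [oO [cO [_ [bO _]]]] := sO.
have p0 : 0 < p by apply: le_lt_trans np.
have [J J0 Hint] := Lp_bound p0 fL.
have [d [G [L [c [s0 rd]]]]] := smooth_regdom sO.
have fxf0 : 0 < f xf by rewrite lt_neqAle eq_sym fxf f0.
have l10 : 0 <= `|l| + 1 by rewrite addr_ge0.
have [eta eta0 H] := antimaximum_jets n0 d10 d00 ga0 gG nuh F2h F1h F3h oO cO bO rd np fc f0 Oxf fxf0 J0 Hint l10.
(* Half of [eta] goes to [lam - l] and half to [l - r]; the cap at 1 keeps both parameters within
   [|l| + 1], the bound with which the constants were fixed. *)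
exists (Num.min 1 (eta / 2)); first by rewrite lt_min ltr01 divr_gt0.
have m1 : Num.min 1 (eta / 2) <= 1 by rewrite ge_min lexx.
have m2 : Num.min 1 (eta / 2) <= eta / 2 by rewrite ge_min lexx orbT.
move: (Num.min _ _) m1 m2 => e e1 e2 lam r v u k1 k2 k3 k4 vc v0 vs uc ucl ub usb usp y0.
have bound a : l - 1 <= a -> a <= l + 1 -> `|a| <= `|l| + 1.
  move=> h1 h2; have h3 := ler_norm l; have h4 := ler_norm (- l); rewrite normrN in h4.
  by rewrite ler_norml; apply/andP; split; [clear -h1 h4 | clear -h2 h3]; lra.
apply: (H lam r v u) => //.
- by apply: bound; [clear -k1 | clear -k2 e1]; lra.
- by apply: bound; [clear -k4 e1 | clear -k3]; lra.
- exact: le_lt_trans k1.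
- by clear -k2 k4 e2; lra.
- exact: (boundary_smallness rd bO ucl ub).
Qed.

(** * Odd conjugation and the second case *)

Definition odd_conj (R : realType) (n : nat) (F : op_type R n) : op_type R n := fun M p z x => - F (- M) (- p) (- z) x.

Lemma odd_conj_F2low (R : realType) (n : nat) (O : set 'rV[R]_n) (F : op_type R n) (d1 d0 ga Ga : R) :
  F2low O F d1 d0 ga Ga -> F2low O (odd_conj F) d1 d0 ga Ga.
Proof.
move=> H M N p q z w x c sM sN Ox Hc.
have := H (- N) (- M) (- q) (- p) (- w) (- z) x c (symN sN) (symN sM) Ox.
have -> : - N - - M = M - N by rewrite opprK addrC.
have -> : - q - - p = p - q by rewrite opprK addrC.
have -> : - w - - z = z - w by rewrite opprK addrC.
by move=> /(_ Hc) k; rewrite /odd_conj opprK [leRHS]addrC.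
Qed.

Lemma odd_conj_F1mod (R : realType) (n : nat) (O : set 'rV[R]_n) (F : op_type R n) (nu : R) :
  F1mod O F nu -> F1mod O (odd_conj F) nu.
Proof.
move=> H th th0; have [r [C [r0 r1 C0 Hr]]] := H th th0; exists r, C; split=> // M p z x y sM Ox Oy xy.
have := Hr (- M) (- p) (- z) x y (symN sM) Ox Oy xy; rewrite !normrN /odd_conj.
by rewrite -opprD normrN.
Qed.

Lemma odd_conj_F3 (R : realType) (n : nat) (O : set 'rV[R]_n) (F : op_type R n) : F3 O F -> F3 O (odd_conj F).
Proof. by move=> H t M p z x t0 sM Ox; rewrite /odd_conj -(scalerN t M) -(scalerN t p) -(mulrN t z) H ?mulrN //; exact: symN. Qed.

(** A change of sign exchanges superjets and subjets. Competitors for [lambda1_plus] thereby become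
    negative subsolutions for the conjugate operator. *)
Lemma odd_conj_Fsub (R : realType) (n : nat) (O : set 'rV[R]_n) (F : op_type R n) (g u : 'rV[R]_n -> R) :
  Fsup O F g u -> Fsub O (odd_conj F) (fun x => - g x) (fun x => - u x).
Proof.
move=> H x p M Ox sM /ujetN J; have := H x _ _ Ox (symN sM) J.
by rewrite /odd_conj opprK lerN2.
Qed.

Lemma odd_conj_Fsup (R : realType) (n : nat) (O : set 'rV[R]_n) (F : op_type R n) (g u : 'rV[R]_n -> R) :
  Fsub O F g u -> Fsup O (odd_conj F) (fun x => - g x) (fun x => - u x).
Proof.
move=> H x p M Ox sM /ljetN J; have := H x _ _ Ox (symN sM) J.
by rewrite /odd_conj opprK lerN2.
Qed.

Theorem theorem2p5 (R : realType) (n : nat) (Om : set 'rV[R]_n)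
  (F : op_type R n) (p : R) (f : 'rV[R]_n -> R) :
  (0 < n)%N ->
  smooth_domain Om ->
  F1 Om F -> F2 Om F -> F3 Om F ->
  n%:R < p ->
  cont_on Om f -> Lp_on p Om f ->
  (exists x, Om x /\ f x != 0) ->
  ((forall x, Om x -> 0 <= f x) ->
     exists eta : R, 0 < eta /\
       forall lambda : R,
         (lambda1_plus Om F <= lambda1_minus Om F)%E ->
         (lambda1_minus Om F < lambda%:E)%E ->
         (lambda%:E <= lambda1_minus Om F + eta%:E)%E ->
         forall u : 'rV[R]_n -> R,
           {within closure Om, continuous u} ->
           visc_sol Om F (fun x => lambda * u x + f x) u ->
           (forall x, (closure Om `\` Om) x -> u x = 0) ->
           forall x, Om x -> u x < 0)
  /\
  ((forall x, Om x -> f x <= 0) ->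
     exists eta : R, 0 < eta /\
       forall lambda : R,
         (lambda1_minus Om F <= lambda1_plus Om F)%E ->
         (lambda1_plus Om F < lambda%:E)%E ->
         (lambda%:E <= lambda1_plus Om F + eta%:E)%E ->
         forall u : 'rV[R]_n -> R,
           {within closure Om, continuous u} ->
           visc_sol Om F (fun x => lambda * u x + f x) u ->
           (forall x, (closure Om `\` Om) x -> u x = 0) ->
           forall x, Om x -> 0 < u x).
Proof.
move=> n0 sO F1h F2h F3h np fc fL fn0.
have [nu nuh F1m] := F1_modulus F1h F3h.
have [d1 [d0 [ga [Ga [d10 d00 ga0 gG F2l]]]]] := F2_F2low n0 F2h.
split=> f0.
- case lE : (lambda1_minus Om F) => [l| |].
  + have [eta eta0 H] := antimaximum_negative l n0 sO d10 d00 ga0 gG nuh F2l F1m F3h np fc fL fn0 f0.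
    exists eta; split=> // lam lpm; rewrite lte_fin -EFinD lee_fin => k1 k2 u ucl [us1 us2] ub.
    have : ((l - eta)%:E < lambda1_minus Om F)%E by rewrite lE lte_fin gtrBl.
    move=> /ereal_sup_gt[_ [r [v [vc [v0 vs]]] <-]]; rewrite lte_fin => k3.
    have k4 : r <= l.
      by rewrite -lee_fin -lE; apply: ereal_sup_ubound; exists r => //; exists v.
    apply: (H lam r v u k1 k2 k4 k3 vc v0 (visc_sub_Fsub vs) us1.1 ucl ub (visc_sub_Fsub us1) (visc_super_Fsup us2)).
    (* As [f >= 0], a positive [u] would be admissible for [lambda1_plus] with parameter [lam], so
       [lam] would not exceed [lambda1_minus]. *)
    apply: contrapT => nex; have up x : Om x -> 0 < u x.
      by move=> Ox; rewrite ltNge; apply/negP => k5; apply: nex; exists x.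
    have : (lam%:E <= lambda1_plus Om F)%E.
      apply: ereal_sup_ubound; exists lam => //; exists u; split; first exact: us1.1.
      split=> //; split; first exact: us1.1.
      move=> phi x0 cphi Ox0 mphi; apply: le_trans (us2.2 phi x0 cphi Ox0 mphi).
      by rewrite lerDl f0.
    by move=> /le_trans/(_ lpm); rewrite lee_fin leNgt k1.
  (* An infinite eigenvalue leaves no [lam] to consider: [+oo] is below no real number, and [-oo]
     plus a constant is above none. *)
  + by exists 1; split=> // lam _; rewrite ltNge leey.
  + by exists 1; split=> // lam _ _; rewrite addNye leNgt ltNyr.
- case lE : (lambda1_plus Om F) => [l| |].
  + have fc' : cont_on Om (fun x => - f x) by move=> x /fc; exact: continuousN.
    have fL' : Lp_on p Om (fun x => - f x).
      by move: fL; rewrite /Lp_on; under [X in _ -> (lebint_n X < _)%E]funext do rewrite normrN.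
    have fn0' : exists x, Om x /\ - f x != 0.
      by have [x [Ox fx]] := fn0; exists x; rewrite oppr_eq0.
    have f0' x : Om x -> 0 <= - f x by move=> /f0; rewrite oppr_ge0.
    have [eta eta0 H] := antimaximum_negative l n0 sO d10 d00 ga0 gG nuh (odd_conj_F2low F2l) (odd_conj_F1mod F1m)
      (odd_conj_F3 F3h) np fc' fL' fn0' f0'.
    exists eta; split=> // lam lpm; rewrite lte_fin -EFinD lee_fin => k1 k2 u ucl [us1 us2] ub x Ox.
    have : ((l - eta)%:E < lambda1_plus Om F)%E by rewrite lE lte_fin gtrBl.
    move=> /ereal_sup_gt[_ [r [v [vc [v0 vs]]] <-]]; rewrite lte_fin => k3.
    have k4 : r <= l.
      by rewrite -lee_fin -lE; apply: ereal_sup_ubound; exists r => //; exists v.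
    have neg (g w : 'rV[R]_n -> R) a : (fun x => - (a * w x + g x)) = (fun x => a * - w x + - g x).
      by apply: funext => y; rewrite opprD mulrN.
    have vs' : Fsub Om (odd_conj F) (fun x => r * - v x) (fun x => - v x).
      by have := odd_conj_Fsub (visc_super_Fsup vs); congr Fsub; apply: funext => y; rewrite mulrN.
    have usb := odd_conj_Fsub (visc_super_Fsup us2); have usp := odd_conj_Fsup (visc_sub_Fsub us1).
    rewrite neg in usb; rewrite neg in usp.
    have vc' : cont_on Om (fun x => - v x) by move=> y /vc; exact: continuousN.
    have uc' : cont_on Om (fun x => - u x) by move=> y /us1.1; exact: continuousN.
    have ucl' : {within closure Om, continuous (fun x => - u x)} by move=> y; apply: continuousN; exact: ucl.
    have ub' y : (closure Om `\` Om) y -> - u y = 0 by move=> /ub ->; rewrite oppr0.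
    have v0' y : Om y -> - v y < 0 by move=> /v0; rewrite oppr_lt0.
    rewrite -oppr_lt0; apply: (H lam r _ _ k1 k2 k4 k3 vc' v0' vs' uc' ucl' ub' usb usp) => //.
    (* The mirror image: as [f <= 0], a negative [u] would be admissible for [lambda1_minus]. *)
    apply: contrapT => nex; have un y : Om y -> u y < 0.
      by move=> Oy; rewrite ltNge; apply/negP => k5; apply: nex; exists y; rewrite ?oppr_le0.
    have : (lam%:E <= lambda1_minus Om F)%E.
      apply: ereal_sup_ubound; exists lam => //; exists u; split; first exact: us1.1.
      split=> //; split; first exact: us1.1.
      move=> phi x0 cphi Ox0 mphi; apply: le_trans (us1.2 phi x0 cphi Ox0 mphi) _.
      by rewrite gerDl f0.
    by move=> /le_trans/(_ lpm); rewrite lee_fin leNgt k1.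
  + by exists 1; split=> // lam _; rewrite ltNge leey.
  + by exists 1; split=> // lam _ _; rewrite addNye leNgt ltNyr.
Qed.
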